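(* Let $\mathbb G=(A,\Delta_A)$ be a $C^*$-quantum group with reduced bicharacter $W\in\mathcal U(\hat A\otimes A)$, let $\widehat{\mathfrak D(\mathbb G)}$ be its quantum codouble, and let $R=(\theta\otimes\rho)W\in\mathcal U(\mathcal D\otimes\mathcal D)$ be the canonical $R$-matrix, where $\mathcal D$ is the $C^*$-algebra of the Drinfeld double. Let $C_1$ and $C_2$ be $\widehat{\mathfrak D(\mathbb G)}$-$C^*$-algebras, and view them also as $\mathbb G$-Yetter–Drinfeld $C^*$-algebras. There is an equivariant isomorphism of crossed products $C_1\boxtimes_R C_2\cong C_1\boxtimes_W C_2$, that is, an isomorphism intertwining the canonical embeddings of $C_1$ and $C_2$.
   Context: Conventions: $\otimes$ is the minimal $C^*$-tensor product, $\mathcal U(A)$ the unitary group of the multiplier algebra, $\sigma$ the flip; a morphism $A\to B$ is a nondegenerate $*$-homomorphism $A\to\mathcal M(B)$; $X\cdot Y$ is the closed linear span of products; leg numbering notation is used. A $C^*$-quantum group is a pair $(A,\Delta_A)$ obtained from a manageable (in Woronowicz's sense) multiplicative unitary $\mathbb W\in\mathcal U(\mathcal L\otimes\mathcal L)$, $\mathbb W_{23}\mathbb W_{12}=\mathbb W_{12}\mathbb W_{13}\mathbb W_{23}$, $\mathcal L$ separable: $A$ and $\hat A$ are the closed linear spans of the slices $(\omega\otimes\mathrm{id})\mathbb W$ and $(\mathrm{id}\otimes\omega)\mathbb W$, $\omega\in\mathbb B(\mathcal L)_*$; $W\in\mathcal U(\hat A\otimes A)$ is $\mathbb W$ viewed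 as a multiplier (reduced bicharacter); $(\mathrm{id}\otimes\Delta_A)W=W_{12}W_{13}$, $(\hat\Delta_A\otimes\mathrm{id})W=W_{23}W_{13}$. The dual is $\hat{\mathbb G}=(\hat A,\hat\Delta_A)$ with reduced bicharacter $\hat W=\sigma(W^* )\in\mathcal U(A\otimes\hat A)$; the dual of $\hat{\mathbb G}$ is $\mathbb G$. Corepresentation of $(A,\Delta_A)$ on $\mathcal H$: $U\in\mathcal U(\mathbb K(\mathcal H)\otimes A)$ with $(\mathrm{id}\otimes\Delta_A)U=U_{12}U_{13}$. Continuous coaction on $C$: injective morphism $\gamma\colon C\to C\otimes A$ with $(\mathrm{id}\otimes\Delta_A)\gamma=(\gamma\otimes\mathrm{id})\gamma$ and $\gamma(C)\cdot(1\otimes A)=C\otimes A$. A morphism $f$ is equivariant if $\delta f=(f\otimes\mathrm{id})\gamma$. Covariant representation: $(\varphi,U)$ with $(\varphi\otimes\mathrm{id})\gamma(c)=U(\varphi(c)\otimes1)U^*$; faithful ones always exist. Universal dual: $\hat A^{u}$ comes with $\tilde{\mathcal V}\in\mathcal U(\hat A^{u}\otimes A)$ whose slices span $\hat A^{u}$, such that each corepresentation $U$ on $\mathcal H$ is $(\rho^{\mathcal H}\otimes\mathrm{id})\tilde{\mathcal V}$ for a unique representation $\rho^{\mathcal H}$ of $\hat A^{u}$ on $\mathcal H$; $(\hat\Delta^{u}\otimes\mathrm{id})\tilde{\mathcal V}=\tilde{\mathcal V}_{23}\tilde{\mathcal V}_{13}$; the reducing map satisfies $(\hat\Lambda\otimes\mathrm{id})\tilde{\mathcal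 V}=W$. Applied to $\hat{\mathbb G}$ this gives $A^{u}$. Twisted tensor product: let $\mathbb G=(A,\Delta_A)$, $\mathbb H=(B,\Delta_B)$ be $C^*$-quantum groups and $\chi\in\mathcal U(\hat A\otimes\hat B)$ a bicharacter ($(\hat\Delta_A\otimes\mathrm{id})\chi=\chi_{23}\chi_{13}$, $(\mathrm{id}\otimes\hat\Delta_B)\chi=\chi_{12}\chi_{13}$). It lifts uniquely to a bicharacter $\chi^{u}\in\mathcal U(\hat A^{u}\otimes\hat B^{u})$. For a $\mathbb G$-$C^*$-algebra $C$ and an $\mathbb H$-$C^*$-algebra $D$ with faithful covariant representations $(\varphi,U^{\mathcal H})$, $(\psi,U^{\mathcal K})$, put $Z:=(\rho^{\mathcal H}\otimes\rho^{\mathcal K})(\chi^{u})^*$, $\iota_C(c)=\varphi(c)\otimes1$, $\iota_D(d)=Z(1\otimes\psi(d))Z^*$ and $C\boxtimes_\chi D:=\iota_C(C)\cdot\iota_D(D)\subseteq\mathbb B(\mathcal H\otimes\mathcal K)$. This is a $C^*$-algebra independent of the choices up to isomorphism intertwining $\iota_C,\iota_D$. Codouble: $\widehat{\mathfrak D(\mathbb G)}=(\hat{\mathcal D},\Delta_{\hat{\mathcal D}})$ with $\hat{\mathcal D}=A\otimes\hat A$ and $\Delta_{\hat{\mathcal D}}(a\otimes\hat a)=\sigma^W_{23}(\Delta_A(a)\otimes\hat\Delta_A(\hat a))$, where $\sigma^W\colon A\otimes\hat A\to\hat A\otimes A$, $a\otimes\hat a\mapsto W(\hat a\otimes a)W^*$.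 It is a $C^*$-quantum group; its dual is the Drinfeld double $\mathfrak D(\mathbb G)=(\mathcal D,\Delta_{\mathcal D})$. There are morphisms $\rho\colon A\to\mathcal D$ and $\theta\colon\hat A\to\mathcal D$ compatible with comultiplications, with $\mathcal D=\rho(A)\cdot\theta(\hat A)$, such that the reduced bicharacter of the codouble in $\mathcal U(\mathcal D\otimes A\otimes\hat A)$ is $((\theta\otimes\mathrm{id}_A)W)_{12}\,((\rho\otimes\mathrm{id}_{\hat A})\hat W)_{13}$. The unitary $R=(\theta\otimes\rho)W$ is a bicharacter with $R(\sigma\circ\Delta_{\mathcal D}(x))R^*=\Delta_{\mathcal D}(x)$, so the codouble is quasitriangular, and $\boxtimes_R$ is the twisted tensor product for two coactions of the codouble and $\chi=R$. Corepresentations $X$ of the codouble on $\mathcal K$ correspond bijectively, via $X=U_{12}V_{13}$, to pairs of corepresentations $U$ of $\mathbb G$ and $V$ of $\hat{\mathbb G}$ on $\mathcal K$ with $\sigma^W_{23}(U_{12}V_{13})=V_{12}U_{13}$. A $\mathbb G$-Yetter–Drinfeld $C^*$-algebra is a $C^*$-algebra $C$ with continuous coactions $\gamma\colon C\to C\otimes A$ of $\mathbb G$ and $\delta\colon C\to C\otimes\hat A$ of $\hat{\mathbb G}$ with $\sigma^W_{23}((\gamma\otimes\mathrm{id}_{\hat A})\delta)=(\delta\otimes\mathrm{id}_A)\gamma$. Continuous coactions $\xi$ of the codouble on $C$ correspond bijectively to such pairs via $\xi=(\gamma\otimes\mathrm{id}_{\hat A})\delta$. For Yetter–Drinfeld algebras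 $C_1,C_2$, $C_1\boxtimes_W C_2$ is the twisted tensor product for $\chi=W$, using the $\mathbb G$-coaction on $C_1$ and the $\hat{\mathbb G}$-coaction on $C_2$. Equivariance: $C_1\boxtimes_R C_2$ carries the unique continuous coaction of the codouble making the embeddings of $C_1,C_2$ equivariant; equivariance of the isomorphism refers to the structure on $C_1\boxtimes_W C_2$ for which the embeddings of $C_1$ and $C_2$ are equivariant. *)

(* Defs.v *)
From HB Require Import structures.
From mathcomp Require Import all_boot all_order all_algebra.
From mathcomp Require Import complex.
From mathcomp Require Import all_classical all_reals all_analysis.
Set Implicit Arguments.
Unset Strict Implicit.
Unset Printing Implicit Defensive.
Import Order.TTheory GRing.Theory Num.Theory numFieldNormedType.Exports.
Local Open Scope classical_set_scope.
Local Open Scope ring_scope.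

(* C*-algebras are concrete: norm-closed nondegenerate *-algebras of operators
   on a Hilbert space.  Multiplier algebras and minimal (spatial) tensor
   products are then computed inside the bounded operators.  Objects that are
   determined by a universal property (adjoints, tensor products of operators
   and of morphisms, extensions of morphisms to multipliers) are picked by
   [xget]; the property characterises them uniquely, and whenever the object
   does not exist the value is junk.  Equalities of operators are equalities
   of functions, but equality of maps between C*-algebras is always stated
   pointwise on the algebra. *)

(* The inner product is conjugate-linear in the first variable. *)
Record hilbert (R : realType) := Hilbert {
  hsp :> completeNormedModType R[i];
  ip : hsp -> hsp -> R[i];
  ip_linear : forall x : hsp, scalar (ip x);
  ip_conj : forall x y : hsp, ip y x = (ip x y)^*;
  ip_norm : forall x : hsp, ip x x = `|x| ^+ 2 }.

Notation op H K := (hsp H -> hsp K).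

Definition lspan (K : pzRingType) (V : lmodType K) (S : set V) : set V :=
  [set v | exists n (c : 'I_n -> K) (s : 'I_n -> V),
     (forall i, S (s i)) /\ v = \sum_(i < n) c i *: s i].

(* A choice of the Hilbert space tensor product of any two Hilbert spaces; it
   is unique up to a unique unitary compatible with elementary tensors. *)
Record hilbert_tensor (R : realType) := HilbertTensor {
  ht : hilbert R -> hilbert R -> hilbert R;
  pt : forall H K : hilbert R, H -> K -> ht H K;
  pt_linearl : forall (H K : hilbert R) (k : K),
    linear (fun h : H => pt h k : ht H K);
  pt_linearr : forall (H K : hilbert R) (h : H),
    linear (fun k : K => pt h k : ht H K);
  pt_ip : forall (H K : hilbert R) (h h' : H) (k k' : K),
    ip (pt h k) (pt h' k') = ip h h' * ip k k';
  pt_total : forall H K : hilbert R,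
    closure (lspan [set pt h k | h in [set: H] & k in [set: K]])
      = [set: ht H K] }.

Section Operators.
Variable R : realType.
Implicit Types H K : hilbert R.

Definition bounded_op H K (t : op H K) := linear t /\ continuous t.

Definition unitary H K (u : op H K) :=
  [/\ linear u, (forall x y, ip (u x) (u y) = ip x y)
    & forall y, exists x, u x = y].

Definition adj H K (t : op H K) : op K H :=
  xget (fun=> 0) [set s : op K H | forall x y, ip (t x) y = ip x (s y)].

Definition Ad H K (u : op H K) (t : op H H) : op K K := u \o t \o adj u.

(* Closure in operator norm; limits of bounded operators in this sense are
   automatically linear and bounded. *)
Definition nclosure H K (S : set (op H K)) : set (op H K) :=
  [set t | forall e : R[i], 0 < e ->
     exists2 s, S s & forall x, `|t x - s x| <= e * `|x|].

Definition cspan H K (S : set (op H K)) : set (op H K) := nclosure (lspan S).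

Definition prodset H (X Y : set (op H H)) : set (op H H) :=
  cspan [set x \o y | x in X & y in Y].

Definition separable_hilbert H :=
  exists2 S : set H, countable S & closure S = [set: H].

Record opalg := OpAlg { sp : hilbert R; els :> op sp sp -> Prop }.
Arguments els : clear implicits.

Definition is_cstar (A : opalg) :=
  [/\ els A `<=` @bounded_op (sp A) (sp A),
      cspan (els A) `<=` els A,
      (forall a b, A a -> A b -> A (a \o b)),
      (forall a, A a -> A (adj a)) &
      closure (lspan [set a x | a in els A & x in [set: sp A]]) = [set: sp A]].

(* The operators |x><y|; their closed linear span is the algebra of compact
   operators.  Its multiplier algebra is the algebra of all bounded operators,
   so that representations are morphisms to [Kop K]. *)
Definition rank1 H (x y : H) : op H H := fun z => ip y z *: x.
Definition Kop H : opalg := OpAlg (cspan [set rank1 x y | x in [set: H] & y in [set: H]]).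

Definition mult (A : opalg) : set (op (sp A) (sp A)) :=
  [set t | bounded_op t /\ forall a, A a -> A (t \o a) /\ A (a \o t)].
Arguments mult : clear implicits.

Definition umult (A : opalg) : set (op (sp A) (sp A)) :=
  [set u | mult A u /\ unitary u].
Arguments umult : clear implicits.

Record premor (A B : opalg) := PreMor { mfun :> op (sp A) (sp A) -> op (sp B) (sp B) }.
Arguments PreMor : clear implicits.

(* nondegenerate *-homomorphism from A to the multiplier algebra of B *)
Definition morphism (A B : opalg) (f : premor A B) :=
  [/\ (forall a, A a -> mult B (f a)),
      (forall (c : R[i]) a b, A a -> A b -> f (c *: a + b) = c *: f a + f b),
      (forall a b, A a -> A b -> f (a \o b) = f a \o f b),
      (forall a, A a -> f (adj a) = adj (f a)) &
      prodset (f @` els A) (els B) = els B].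

Definition faithful (A B : opalg) (f : premor A B) :=
  forall a b, A a -> A b -> f a = f b -> a = b.

Definition isomorphism (A B : opalg) (f : premor A B) :=
  [/\ morphism f, faithful f & f @` els A = els B].

Definition idm (A : opalg) : premor A A := PreMor A A id.

(* The extension of f to multipliers; unique because f is nondegenerate. *)
Definition mext (A B : opalg) (f : premor A B)
    (t : op (sp A) (sp A)) : op (sp B) (sp B) :=
  xget (fun=> 0)
    [set s | mult B s /\ forall a, A a -> s \o f a = f (t \o a)].

End Operators.

Arguments els {R} o.
Arguments mult {R} A.
Arguments umult {R} A.
Arguments PreMor {R} A B mfun.

Section Tensor.
Variables (R : realType) (T : hilbert_tensor R).
Implicit Types H K L M : hilbert R.
Implicit Types A B C : opalg R.
Local Notation "H *t K" := (ht T H K) (at level 40, left associativity).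

Definition otens H K H' K' (s : op H H') (t : op K K') : op (H *t K) (H' *t K') :=
  xget (fun=> 0) [set r : op (H *t K) (H' *t K') |
    bounded_op r /\ forall h k, r (pt T h k) = pt T (s h) (t k)].

Definition flip H K : op (H *t K) (K *t H) :=
  xget (fun=> 0) [set r : op (H *t K) (K *t H) |
    bounded_op r /\ forall h k, r (pt T h k) = pt T k h].
Arguments flip : clear implicits.

Definition assoc H K L : op ((H *t K) *t L) (H *t (K *t L)) :=
  xget (fun=> 0) [set r : op ((H *t K) *t L) (H *t (K *t L)) |
    bounded_op r /\
    forall h k l, r (pt T (pt T h k) l) = pt T h (pt T k l)].
Arguments assoc : clear implicits.

(* Triple tensor products are bracketed to the right. *)
Definition leg12 H K L (t : op (H *t K) (H *t K)) :
    op (H *t (K *t L)) (H *t (K *t L)) :=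
  Ad (assoc H K L) (otens t (@id L)).
Arguments leg12 {H K} L t.
Definition leg23 H K L (t : op (K *t L) (K *t L)) :
    op (H *t (K *t L)) (H *t (K *t L)) :=
  otens (@id H) t.
Arguments leg23 H {K L} t.
Definition leg13 H K L (t : op (H *t L) (H *t L)) :
    op (H *t (K *t L)) (H *t (K *t L)) :=
  Ad (otens (@id H) (flip L K)) (leg12 K t).
Arguments leg13 {H} K {L} t.

(* t acting on the second and third of four legs *)
Definition mid H K L M K' L' (t : op (K *t L) (L' *t K')) :
    op ((H *t K) *t (L *t M)) ((H *t L') *t (K' *t M)) :=
  adj (assoc H L' (K' *t M))
  \o otens (@id H) (assoc L' K' M \o otens t (@id M) \o adj (assoc K L M))
  \o assoc H K (L *t M).
Arguments mid H {K L} M {K' L'} t.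

Definition tens A B : opalg R :=
  OpAlg (cspan [set otens a b | a in els A & b in els B]).

(* [tmor f g] is only specified on [tens A B]; [tapp f g] is its extension to
   multipliers, which depends on that restriction alone. *)
Definition tmor A B A' B' (f : premor A A') (g : premor B B') :
    premor (tens A B) (tens A' B') :=
  PreMor (tens A B) (tens A' B') (xget (fun=> fun=> 0) [set h |
    morphism (PreMor (tens A B) (tens A' B') h) /\
    forall a b, A a -> B b -> h (otens a b) = otens (f a) (g b)]).
Definition tapp A B A' B' (f : premor A A') (g : premor B B') :=
  mext (tmor f g).

(* Slices by the vector functionals w = <x, . y>, which span a dense subspace
   of the predual of B(H). *)
Definition lslices H K (t : op (H *t K) (H *t K)) : set (op K K) :=
  [set s | bounded_op s /\ exists x y : H, forall k k' : K,
     ip k (s k') = ip (pt T x k) (t (pt T y k'))].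
Definition rslices H K (t : op (H *t K) (H *t K)) : set (op H H) :=
  [set s | bounded_op s /\ exists x y : K, forall h h' : H,
     ip h (s h') = ip (pt T h x) (t (pt T h' y))].

Definition multiplicative_unitary H (W : op (H *t H) (H *t H)) :=
  unitary W /\
  leg23 H W \o leg12 H W = leg12 H W \o leg13 H W \o leg23 H W.

(* Possibly unbounded operators are given by their graphs. *)
Definition pos_selfadjoint H (Q : set (H * H)) :=
  [/\ closure [set x | exists y, Q (x, y)] = [set: H],
      (forall x y, Q (x, y) <-> forall u v, Q (u, v) -> ip v x = ip u y) &
      forall x y, Q (x, y) -> 0 <= ip x y].

Definition graph_tens H (Q : set (H * H)) : set ((H *t H) * (H *t H)) :=
  closure (lspan [set z | exists x y x' y', [/\ Q (x, x'), Q (y, y')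
                            & z = (pt T x y, pt T x' y')]]).

(* c exhibits Hc as the complex conjugate of H *)
Definition is_conjugate H (Hc : hilbert R) (c : H -> Hc) :=
  [/\ (forall (a : R[i]) x y, c (a *: x + y) = a^* *: c x + c y),
      (forall x y, ip (c x) (c y) = ip y x) & forall z, exists x, c x = z].

(* Woronowicz's definition; u' = Q u and y' = Q^-1 y. *)
Definition manageable H (W : op (H *t H) (H *t H)) :=
  exists (Q : set (H * H)) (Hc : hilbert R) (c : H -> Hc)
         (Wt : op (Hc *t H) (Hc *t H)),
    [/\ pos_selfadjoint Q /\ (forall x, Q (x, 0) -> x = 0),
        is_conjugate c, unitary Wt,
        (forall s t, graph_tens Q (s, t) <-> graph_tens Q (W s, W t)) &
        forall x z u u' y y', Q (u, u') -> Q (y', y) ->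
          ip (pt T x u) (W (pt T z y))
            = ip (pt T (c z) u') (Wt (pt T (c x) y'))].

(* (qA, qDelta) and its dual (qAd, qDeltad), with reduced bicharacter qW,
   obtained from the multiplicative unitary qU on qL, the algebras qA and qAd
   being identified through qpi and qpid with the slices of qU. *)
Record qgroup := QGroup {
  qA : opalg R;
  qAd : opalg R;
  qDelta : premor qA (tens qA qA);
  qDeltad : premor qAd (tens qAd qAd);
  qW : op (sp (tens qAd qA)) (sp (tens qAd qA));
  qL : hilbert R;
  qU : op (qL *t qL) (qL *t qL);
  qpi : premor qA (Kop qL);
  qpid : premor qAd (Kop qL) }.
Arguments qW : clear implicits.
Arguments qU : clear implicits.

Record is_qgroup (G : qgroup) : Prop := {
  qg_sep : separable_hilbert (qL G);
  qg_U : multiplicative_unitary (qU G) /\ manageable (qU G);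
  qg_A : is_cstar (qA G);
  qg_Ad : is_cstar (qAd G);
  qg_pi : morphism (qpi G) /\ faithful (qpi G);
  qg_pid : morphism (qpid G) /\ faithful (qpid G);
  qg_slA : qpi G @` els (qA G) = cspan (lslices (qU G));
  qg_slAd : qpid G @` els (qAd G) = cspan (rslices (qU G));
  qg_W : umult (tens (qAd G) (qA G)) (qW G);
  qg_WU : tapp (qpid G) (qpi G) (qW G) = qU G;
  qg_Delta : morphism (qDelta G);
  qg_Deltad : morphism (qDeltad G);
  qg_DeltaW : tapp (idm (qAd G)) (qDelta G) (qW G)
    = leg12 (sp (qA G)) (qW G) \o leg13 (sp (qA G)) (qW G);
  qg_DeltadW : Ad (assoc _ _ _) (tapp (qDeltad G) (idm (qA G)) (qW G))
    = leg23 (sp (qAd G)) (qW G) \o leg13 (sp (qAd G)) (qW G) }.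

Definition dualW (G : qgroup) :
    op (sp (tens (qA G) (qAd G))) (sp (tens (qA G) (qAd G))) :=
  Ad (flip (sp (qAd G)) (sp (qA G))) (adj (qW G)).
Arguments dualW : clear implicits.

Definition dual (G : qgroup) : qgroup :=
  @QGroup (qAd G) (qA G) (qDeltad G) (qDelta G) (dualW G)
    (qL G) (Ad (flip (qL G) (qL G)) (adj (qU G))) (qpid G) (qpi G).

Definition corepresentation (G : qgroup) H
    (U : op (sp (tens (Kop H) (qA G))) (sp (tens (Kop H) (qA G)))) :=
  umult (tens (Kop H) (qA G)) U /\
  tapp (idm (Kop H)) (qDelta G) U
    = leg12 (sp (qA G)) U \o leg13 (sp (qA G)) U.

Definition bicharacter A B (dA : premor A (tens A A)) (dB : premor B (tens B B))
    (chi : op (sp (tens A B)) (sp (tens A B))) :=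
  [/\ umult (tens A B) chi,
      Ad (assoc _ _ _) (tapp dA (idm B) chi)
        = leg23 (sp A) chi \o leg13 (sp A) chi &
      tapp (idm A) dB chi = leg12 (sp B) chi \o leg13 (sp B) chi].

(* Slices of uV are taken with normal functionals on the Hilbert space qL of
   the multiplicative unitary: an arbitrary faithful representation of qA
   could have a different predual. *)
Record udual (G : qgroup) := UDual {
  uA : opalg R;
  uV : op (sp (tens uA (qA G))) (sp (tens uA (qA G)));
  uDelta : premor uA (tens uA uA);
  uLambda : premor uA (qAd G) }.
Arguments uV {G} u.

Record is_udual (G : qgroup) (u : udual G) : Prop := {
  ud_A : is_cstar (uA u);
  ud_V : umult (tens (uA u) (qA G)) (uV u);
  ud_DV : tapp (idm (uA u)) (qDelta G) (uV u)
    = leg12 (sp (qA G)) (uV u) \o leg13 (sp (qA G)) (uV u);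
  ud_sl : els (uA u) = cspan (rslices (tapp (idm (uA u)) (qpi G) (uV u)));
  ud_univ : forall H U, @corepresentation G H U ->
    (exists r : premor (uA u) (Kop H),
       morphism r /\ tapp r (idm (qA G)) (uV u) = U) /\
    (forall r r' : premor (uA u) (Kop H),
       morphism r -> tapp r (idm (qA G)) (uV u) = U ->
       morphism r' -> tapp r' (idm (qA G)) (uV u) = U ->
       forall x, uA u x -> r x = r' x);
  ud_Delta : morphism (uDelta u);
  ud_DeltaV : Ad (assoc _ _ _) (tapp (uDelta u) (idm (qA G)) (uV u))
    = leg23 (sp (uA u)) (uV u) \o leg13 (sp (uA u)) (uV u);
  ud_Lambda : morphism (uLambda u);
  ud_LambdaV : tapp (uLambda u) (idm (qA G)) (uV u) = qW G }.

Definition universal_lift (G G' : qgroup) (u : udual G) (u' : udual G')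
    (chi : op (sp (tens (qAd G) (qAd G'))) (sp (tens (qAd G) (qAd G'))))
    (chiu : op (sp (tens (uA u) (uA u'))) (sp (tens (uA u) (uA u')))) :=
  bicharacter (uDelta u) (uDelta u') chiu /\
  tapp (uLambda u) (uLambda u') chiu = chi.

Record coaction (G : qgroup) C (g : premor C (tens C (qA G))) : Prop := {
  co_mor : morphism g;
  co_inj : faithful g;
  co_assoc : forall c, C c ->
    tapp (idm C) (qDelta G) (g c) = Ad (assoc _ _ _) (tapp g (idm (qA G)) (g c));
  co_cont : prodset (g @` els C) [set otens (@id (sp C)) a | a in els (qA G)]
    = els (tens C (qA G)) }.

Definition equivariant A C D (g : premor C (tens C A)) (d : premor D (tens D A))
    (f : premor C D) :=
  forall c, C c -> mext d (f c) = tapp f (idm A) (g c).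

(* A covariant representation (cphi, cU) on cK together with the
   representation crho of the universal dual corresponding to cU. *)
Record covrep (G : qgroup) (u : udual G) C := CovRep {
  cK : hilbert R;
  cphi : premor C (Kop cK);
  cU : op (sp (tens (Kop cK) (qA G))) (sp (tens (Kop cK) (qA G)));
  crho : premor (uA u) (Kop cK) }.
Arguments cU {G u C} c.

Record is_faithful_covrep (G : qgroup) (u : udual G) C
    (g : premor C (tens C (qA G))) (r : covrep u C) : Prop := {
  cr_phi : morphism (cphi r);
  cr_inj : faithful (cphi r);
  cr_U : corepresentation (cU r);
  cr_cov : forall c, C c ->
    tapp (cphi r) (idm (qA G)) (g c) = Ad (cU r) (otens (cphi r c) id);
  cr_rho : morphism (crho r);
  cr_rhoV : tapp (crho r) (idm (qA G)) (uV u) = cU r }.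

Section Twisted.
Variables (G G' : qgroup) (u : udual G) (u' : udual G').
Variable chiu : op (sp (tens (uA u) (uA u'))) (sp (tens (uA u) (uA u'))).
Variables (C D : opalg R) (r : covrep u C) (r' : covrep u' D).

Definition twZ : op (cK r *t cK r') (cK r *t cK r') :=
  adj (tapp (crho r) (crho r') chiu).
Definition twi1 c : op (cK r *t cK r') (cK r *t cK r') :=
  otens (cphi r c) (@id (cK r')).
Definition twi2 d : op (cK r *t cK r') (cK r *t cK r') :=
  Ad twZ (otens (@id (cK r)) (cphi r' d)).
Definition twisted : opalg R := OpAlg (prodset (twi1 @` els C) (twi2 @` els D)).
Definition iota1 : premor C twisted := PreMor C twisted twi1.
Definition iota2 : premor D twisted := PreMor D twisted twi2.

End Twisted.

Section Codouble.
Variable G : qgroup.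
Local Notation A := (qA G).
Local Notation Ad_ := (qAd G).

(* sigma^W is conjugation by this unitary *)
Definition Wflip : op (sp (tens A Ad_)) (sp (tens Ad_ A)) :=
  qW G \o flip (sp A) (sp Ad_).
Arguments Wflip : clear implicits.

(* X in A (x) Ad in the last two legs is mapped to Ad (x) A by sigma^W *)
Definition sigmaW23 H (X : op (H *t (sp A *t sp Ad_)) (H *t (sp A *t sp Ad_))) :
    op (H *t (sp Ad_ *t sp A)) (H *t (sp Ad_ *t sp A)) :=
  Ad (otens (@id H) Wflip) X.

Definition codouble_Delta : premor (tens A Ad_) (tens (tens A Ad_) (tens A Ad_)) :=
  PreMor (tens A Ad_) (tens (tens A Ad_) (tens A Ad_))
    (fun x => Ad (mid (sp A) (sp Ad_) Wflip) (tmor (qDelta G) (qDeltad G) x)).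

Record double_data := DoubleData {
  dD : opalg R;
  dDelta : premor dD (tens dD dD);
  drho : premor A dD;
  dtheta : premor Ad_ dD;
  dL : hilbert R;
  dU : op (dL *t dL) (dL *t dL);
  dpi : premor (tens A Ad_) (Kop dL);
  dpid : premor dD (Kop dL) }.
Arguments dU : clear implicits.

Variable d : double_data.

Definition codouble_W : op (sp (tens (dD d) (tens A Ad_))) (sp (tens (dD d) (tens A Ad_))) :=
  leg12 (sp Ad_) (tapp (dtheta d) (idm A) (qW G))
  \o leg13 (sp A) (tapp (drho d) (idm Ad_) (dualW G)).
Arguments codouble_W : clear implicits.

Definition codouble : qgroup :=
  @QGroup (tens A Ad_) (dD d) codouble_Delta (dDelta d) codouble_W
    (dL d) (dU d) (dpi d) (dpid d).

Record is_double : Prop := {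
  db_qgroup : is_qgroup codouble;
  db_rho : morphism (drho d);
  db_theta : morphism (dtheta d);
  db_rhoDelta : forall a, A a ->
    mext (dDelta d) (drho d a) = tapp (drho d) (drho d) (qDelta G a);
  db_thetaDelta : forall a, Ad_ a ->
    mext (dDelta d) (dtheta d a) = tapp (dtheta d) (dtheta d) (qDeltad G a);
  db_prod : els (dD d) = prodset (drho d @` els A) (dtheta d @` els Ad_) }.

Definition Rmatrix : op (sp (tens (dD d) (dD d))) (sp (tens (dD d) (dD d))) :=
  tapp (dtheta d) (drho d) (qW G).
Arguments Rmatrix : clear implicits.

(* (gamma (x) id) delta, on the legs C, A, Ad *)
Definition yd_composite C (g : premor C (tens C A)) (e : premor C (tens C Ad_)) :
    premor C (tens C (tens A Ad_)) :=
  PreMor C (tens C (tens A Ad_))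
    (fun c => Ad (assoc (sp C) (sp A) (sp Ad_)) (tapp g (idm Ad_) (e c))).

Record yetter_drinfeld C (g : premor C (tens C (qA G)))
    (e : premor C (tens C (qA (dual G)))) : Prop := {
  yd_g : coaction (G := G) g;
  yd_e : coaction (G := dual G) e;
  yd_comm : forall c, C c ->
    sigmaW23 (yd_composite g e c)
      = Ad (assoc (sp C) (sp Ad_) (sp A)) (tapp e (idm A) (g c)) }.

(* (g, e) is the Yetter-Drinfeld structure on C corresponding to the codouble
   coaction x *)
Definition yd_of_coaction C (x : premor C (tens C (qA codouble)))
    (g : premor C (tens C (qA G))) (e : premor C (tens C (qA (dual G)))) :=
  yetter_drinfeld g e /\ forall c, C c -> x c = yd_composite g e c.

End Codouble.

End Tensor.

Arguments qW {R T} q.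
Arguments qU {R T} q.
Arguments uV {R T G} u.
Arguments cU {R T G u C} c.
Arguments dU {R T G} d.
Arguments leg12 {R T H K} L t.
Arguments leg23 {R T} H {K L} t.
Arguments leg13 {R T H} K {L} t.
Arguments mid {R T} H {K L} M {K' L'} t.
Arguments dualW {R T} G.
Arguments Wflip {R T} G.
Arguments codouble {R T G} d.
Arguments codouble_W {R T G} d.
Arguments Rmatrix {R T G} d.
Arguments twisted {R T G G' u u'} chiu {C D} r r'.
Arguments iota1 {R T G G' u u'} chiu {C D} r r'.
Arguments iota2 {R T G G' u u'} chiu {C D} r r'.
Arguments udual {R T} G.
Arguments coaction {R T} G {C} g.
Arguments yd_of_coaction {R T G} d {C} x g e.

(* Main.v *)
(** A covariant representation [phi] of [C_i] is stabilised to [(phi (x) p) xi] by the regular representation of the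
codouble. By pentagon-type identities for the images of [W] under [theta] and [rho], the stabilised representations
are covariant for [theta] and [rho] and realise an amplification of both [C_1 x_R C_2] and [C_1 x_W C_2]. Conjugating by
[U_12] and [V_32] moves the latter into legs 12 and 32 of multipliers of [C_1 (x) K (x) C_2], hence it does not depend
on the faithful covariant representations; that the products span a C*-algebra follows by slicing. *)
From HB Require Import structures.
From mathcomp Require Import all_boot all_order all_algebra.
From mathcomp Require Import complex.
From mathcomp Require Import all_classical all_reals all_analysis.
From mathcomp Require Import ring lra.
Require Import Defs.
Set Implicit Arguments.
Unset Strict Implicit.
Unset Printing Implicit Defensive.
Import Order.TTheory GRing.Theory Num.Theory numFieldNormedType.Exports.
Local Open Scope classical_set_scope.
Local Open Scope ring_scope.

(** The two products are built from unrelated data: one from representations of the universal dual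
    of the codouble and the lift [Ru], the other from the universal duals of [G] and of its dual and
    the lift [Wu]. Instead of lifting theta and rho to the universal level, the proof works where
    the universal duals act through the reduced ones. There [Ru] and [Wu] both become W with its
    legs in theta and rho, so the twisting unitaries coincide; this is what stabilisation buys. Leg
    numbering is replaced by joint representations: [lg f g W] is W with its legs sent by f and g to
    one Hilbert space, and [namp], [ind2], [ind3] describe legs in general position without
    reassociating tensor products. Two representations of a quantum group algebra are proved equal
    by comparing the images of W ([separation]). For the C*-property the coaction legs of the two
    stabilised algebras must commute. Theta alone does not serve on the second algebra; the
    corrected representation [thL'], which forms an anti-Heisenberg pair with rho, does. *)

Local Notation bop := bounded_op.
Local Notation bo H := (op H H).
Local Notation cstar := is_cstar.
Local Notation "H ~> K" := (op H H -> op K K) (at level 41, no associativity).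

(** * Linear maps, real-valued norms and limits *)

Section Linear.
Variables (K : pzRingType) (V W : lmodType K) (t : V -> W) (lt : linear t).
Lemma lin0 : t 0 = 0.
by have := lt (-1) 0 0; rewrite !scaleN1r oppr0 addr0 addNr. Qed.
Lemma linD x y : t (x + y) = t x + t y.
by have := lt 1 x y; rewrite !scale1r. Qed.
Lemma linZ a x : t (a *: x) = a *: t x.
by have := lt a x 0; rewrite lin0 !addr0. Qed.
Lemma linN x : t (- x) = - t x.
by rewrite -scaleN1r linZ scaleN1r. Qed.
Lemma linB x y : t (x - y) = t x - t y.
by rewrite linD linN. Qed.
Lemma lin_sum I (r : seq I) (P : pred I) (F : I -> V) : t (\sum_(i <- r | P i) F i) = \sum_(i <- r | P i) t (F i).
exact: (big_morph t linD lin0). Qed.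
End Linear.

Section ComplexNorm.
Variable R : realType.
Implicit Types c d : R[i].
Definition cn c : R := complex.Re `|c|.
Lemma cnE c : `|c| = (cn c)%:C%C.
by rewrite /cn RRe_real // normr_real. Qed.
Lemma cn_ge0 c : 0 <= cn c.
by rewrite -ler0c -cnE. Qed.
Lemma cnM c d : cn (c * d) = cn c * cn d.
by apply: complexI; rewrite rmorphM /= -!cnE normrM. Qed.
Lemma cn_real (r : R) : 0 <= r -> cn r%:C%C = r.
by move=> r0; rewrite /cn ger0_norm // ler0c. Qed.
Lemma cn0 : cn 0 = 0.
by rewrite /cn normr0. Qed.
Lemma cn_eq0 c : cn c = 0 -> c = 0.
by move=> c0; apply/eqP; rewrite -normr_eq0 cnE c0. Qed.
Lemma cnN c : cn (- c) = cn c.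
by rewrite /cn normrN. Qed.
Lemma cnD c d : cn (c + d) <= cn c + cn d.
by rewrite -lecR rmorphD /= -!cnE ler_normD. Qed.
Lemma cnJ c : cn (c^*) = cn c.
by rewrite /cn norm_conjC. Qed.
Lemma Re_le_cn c : complex.Re c <= cn c.
by rewrite -lecR -cnE; apply: le_trans (normc_ge_Re c); rewrite lecR ler_norm.
Qed.
Lemma Re_cnj c : complex.Re (c^*) = complex.Re c.
by case: c. Qed.
Lemma ReM_cst (r : R) c : complex.Re (r%:C%C * c) = r * complex.Re c.
by case: c => a b; rewrite /= mul0r subr0. Qed.
Lemma Re_add c d : complex.Re (c + d) = complex.Re c + complex.Re d.
by case: c; case: d. Qed.
Lemma Re_opp c : complex.Re (- c) = - complex.Re c.
by case: c. Qed.
Lemma cnj_cst (r : R) : (r%:C%C : R[i])^* = r%:C%C.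
exact: conjc_real. Qed.
Lemma mulC_conj c : c * c^* = ((cn c) ^+ 2)%:C%C.
by rewrite -normCK cnE rmorphXn. Qed.
Lemma inv_small (e : R) : 0 < e -> exists N : nat, forall n, (N <= n)%N -> n.+1%:R^-1 <= e.
move=> e0; exists (Num.truncn e^-1) => n Nn.
rewrite -[leRHS]invrK lef_pV2 ?posrE ?invr_gt0 ?ltr0n //.
by apply/ltW/(lt_le_trans (truncnS_gt _)); rewrite ler_nat.
Qed.
Lemma small_le0 (x M : R) : (forall e : R, 0 < e -> x <= M * e) -> x <= 0.
move=> h; rewrite leNgt; apply/negP => x0.
have M0 : 0 < `|M| + 1 by rewrite ltr_wpDl.
(* For this e the hypothesis gives at most x / 2 on the right, which contradicts x > 0. *)
have := h (x / (2 * (`|M| + 1))).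
rewrite divr_gt0 ?mulr_gt0 // => /(_ isT); apply/negP; rewrite -ltNge.
have -> : M * (x / (2 * (`|M| + 1))) = (M / (`|M| + 1)) * (x / 2) by field; rewrite gt_eqF.
apply: (@le_lt_trans _ _ (1 * (x / 2))); last by lra.
rewrite ler_wpM2r //; first by lra.
by rewrite ler_pdivrMr // mul1r; have := ler_norm M; lra.
Qed.
Lemma small_eq0 (x M : R) : 0 <= x -> (forall e : R, 0 < e -> x <= M * e) -> x = 0.
by move=> x0 /small_le0 ?; apply/eqP; rewrite eq_le x0 andbT. Qed.
End ComplexNorm.

Section Norm.
Variables (R : realType) (V : normedModType R[i]).
Implicit Types x y : V.
Definition nm x : R := complex.Re `|x|.
Lemma nmE x : `|x| = (nm x)%:C%C.
by rewrite /nm RRe_real // normr_real. Qed.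
Lemma nm_ge0 x : 0 <= nm x.
by rewrite -ler0c -nmE. Qed.
Lemma nm0 : nm 0 = 0.
by rewrite /nm normr0. Qed.
Lemma nm_eq0 x : nm x = 0 -> x = 0.
by move=> x0; apply/eqP; rewrite -normr_eq0 nmE x0. Qed.
Lemma nmN x : nm (- x) = nm x.
by rewrite /nm normrN. Qed.
Lemma nmD x y : nm (x + y) <= nm x + nm y.
by rewrite -lecR rmorphD /= -!nmE ler_normD. Qed.
Lemma nmB x y : nm (x - y) <= nm x + nm y.
by rewrite -[nm y]nmN nmD. Qed.
Lemma nm_sub x y : nm (x - y) = nm (y - x).
by rewrite -nmN opprB. Qed.
Lemma nmZ c x : nm (c *: x) = cn c * nm x.
by apply: complexI; rewrite rmorphM /= -nmE normrZ nmE cnE. Qed.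
Lemma nm_ler x y : nm x <= nm y + nm (x - y).
by have := nmD y (x - y); rewrite addrC subrK. Qed.
Lemma nm_tri x y z : nm (x - z) <= nm (x - y) + nm (y - z).
by apply: le_trans (nmD _ _); rewrite addrA subrK. Qed.
Lemma nm_small_eq0 x (M : R) : (forall e : R, 0 < e -> nm x <= M * e) -> x = 0.
by move=> h; apply/nm_eq0/(small_eq0 (nm_ge0 x) h). Qed.
Lemma gt0_complexE (e : R[i]) : 0 < e -> exists2 r : R, 0 < r & e = r%:C%C.
move=> e0; exists (complex.Re e); last by rewrite RRe_real // gtr0_real.
by move: e0; rewrite ltcE /= => /andP[].
Qed.
Lemma closureP (S : set V) x : closure S x <-> forall e : R, 0 < e -> exists2 s, S s & nm (x - s) <= e.
split=> [cl e e0|h B /nbhs_ballP[e e0 sB]].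
- have /cl[s [Ss]] : nbhs x (ball x (e%:C%C : R[i])).
  by apply: nbhsx_ballx; rewrite ltcR.
 rewrite -ball_normE /ball_ /= nmE ltcR => hs; exists s => //.
 exact: ltW.
- have [r r0 er] := gt0_complexE e0.
 have r2 : 0 < r / 2 by rewrite divr_gt0.
 have [s Ss hs] := h _ r2; exists s; split => //; apply: sB.
 rewrite -ball_normE /ball_ /= nmE er ltcR; lra.
Qed.
End Norm.

Section Complete.
Variables (R : realType) (V : completeNormedModType R[i]).
Lemma cauchy_lim (u : nat -> V) : (forall e : R, 0 < e -> exists N, forall n m, (N <= n)%N -> (N <= m)%N ->
   nm (u n - u m) <= e) -> exists l, forall e : R, 0 < e -> exists N, forall n, (N <= n)%N -> nm (u n - l) <= e.
move=> hc.
have : cauchy (u @ \oo).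
 apply: cauchy_exP => e e0.
 have [r r0 er] := gt0_complexE e0.
 have r2 : 0 < r / 2 by rewrite divr_gt0.
 have [N hN] := hc _ r2.
 exists (u N); exists N => // n /= Nn.
 rewrite -ball_normE /ball_ /= nmE er ltcR.
 have := hN _ _ (leqnn N) Nn; lra.
move=> /cauchy_cvg cu; exists (lim (u @ \oo)) => e e0.
have := cu; move=> /cvgrPdist_lt /(_ e%:C%C).
rewrite ltcR e0 => /(_ isT)[N _ hN]; exists N => n Nn.
have := hN n Nn; rewrite /= nmE ltcR => /ltW.
by rewrite nm_sub.
Qed.
End Complete.

Section BoundedOps.
Variable R : realType.
Implicit Types V W : normedModType R[i].
Definition bnd V W (M : R) (t : V -> W) := forall x, nm (t x) <= M * nm x.
Lemma continuous_bnd V W (t : V -> W) : linear t -> continuous t <-> exists M : R, 0 <= M /\ bnd M t.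
move=> lt.
pose f : {linear V -> W} := HB.pack t (GRing.isLinear.Build R[i] V W *:%R t lt).
split=> [ct|[M [M0 hM]]].
- have /(linear_bounded_continuous f) /linear_boundedP/pinfty_ex_gt0[r r0 hr] : continuous f by exact: ct.
 have [M M0 rM] := gt0_complexE r0.
 exists M; split=> [|x]; first exact: ltW.
 by have := hr x; rewrite !nmE rM -rmorphM /= lecR.
- apply/(linear_bounded_continuous f)/linear_boundedP.
 exists M%:C%C; split; first by rewrite ger0_real // ler0c.
 move=> r Mr x; apply: (@le_trans _ _ (M%:C%C * `|x|)).
  by rewrite !nmE -rmorphM /= lecR; exact: hM.
 by rewrite ler_wpM2r // ltW.
Qed.
End BoundedOps.

(** * Inner products and the Riesz representation theorem *)

Section InnerProduct.
Variables (R : realType) (H : hilbert R).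
Implicit Types x y z : H.
Lemma ipC x y : ip y x = (ip x y)^*. exact: ip_conj. Qed.
Lemma ipDr x y z : ip x (y + z) = ip x y + ip x z.
exact: (linD (@ip_linear _ H x)). Qed.
Lemma ipZr x c y : ip x (c *: y) = c * ip x y.
exact: (linZ (@ip_linear _ H x)). Qed.
Lemma ip0r x : ip x 0 = 0.
exact: (lin0 (@ip_linear _ H x)). Qed.
Lemma ipNr x y : ip x (- y) = - ip x y.
exact: (linN (@ip_linear _ H x)). Qed.
Lemma ipBr x y z : ip x (y - z) = ip x y - ip x z.
exact: (linB (@ip_linear _ H x)). Qed.
Lemma ip_sumr x I (r : seq I) (P : pred I) (F : I -> H) :
 ip x (\sum_(i <- r | P i) F i) = \sum_(i <- r | P i) ip x (F i).
exact: (lin_sum (@ip_linear _ H x)). Qed.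
Lemma ipDl x y z : ip (x + y) z = ip x z + ip y z.
by rewrite ipC ipDr rmorphD /= -!ipC. Qed.
Lemma ipZl c x y : ip (c *: x) y = c^* * ip x y.
by rewrite ipC ipZr rmorphM /= -ipC. Qed.
Lemma ip0l x : ip 0 x = 0.
by rewrite ipC ip0r rmorph0. Qed.
Lemma ipNl x y : ip (- x) y = - ip x y.
by rewrite ipC ipNr rmorphN /= -ipC. Qed.
Lemma ipBl x y z : ip (x - y) z = ip x z - ip y z.
by rewrite ipDl ipNl. Qed.
Lemma ip_suml x I (r : seq I) (P : pred I) (F : I -> H) :
 ip (\sum_(i <- r | P i) F i) x = \sum_(i <- r | P i) ip (F i) x.
by rewrite ipC ip_sumr rmorph_sum; apply: eq_bigr => i _; rewrite [RHS]ipC.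
Qed.
Lemma ipxx x : ip x x = (nm x ^+ 2)%:C%C.
by rewrite ip_norm nmE rmorphXn. Qed.
Definition rip x y : R := complex.Re (ip x y).
Lemma ripC x y : rip x y = rip y x.
by rewrite /rip ipC Re_cnj. Qed.
Lemma ripxx x : rip x x = nm x ^+ 2.
by rewrite /rip ipxx. Qed.
Lemma ripDr x y z : rip x (y + z) = rip x y + rip x z.
by rewrite /rip ipDr Re_add. Qed.
Lemma ripNr x y : rip x (- y) = - rip x y.
by rewrite /rip ipNr Re_opp. Qed.
Lemma ripBr x y z : rip x (y - z) = rip x y - rip x z.
by rewrite ripDr ripNr. Qed.
Lemma ripDl x y z : rip (x + y) z = rip x z + rip y z.
by rewrite /rip ipDl Re_add. Qed.
Lemma ripNl x y : rip (- x) y = - rip x y.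
by rewrite /rip ipNl Re_opp. Qed.
Lemma ripBl x y z : rip (x - y) z = rip x z - rip y z.
by rewrite ripDl ripNl. Qed.
Lemma ripZr (t : R) x y : rip x (t%:C%C *: y) = t * rip x y.
by rewrite /rip ipZr ReM_cst. Qed.
Lemma nmD2 x y : nm (x + y) ^+ 2 = nm x ^+ 2 + 2 * rip x y + nm y ^+ 2.
by rewrite -!ripxx ripDl !ripDr (ripC y x); ring. Qed.
Lemma nmB2 x y : nm (x - y) ^+ 2 = nm x ^+ 2 - 2 * rip x y + nm y ^+ 2.
by rewrite nmD2 ripNr nmN; ring. Qed.
Lemma rip_le x y : rip x y <= nm x * nm y.
have : nm (x + y) ^+ 2 <= (nm x + nm y) ^+ 2 by rewrite ler_pXn2r ?nmD // nnegrE ?nm_ge0 // addr_ge0 ?nm_ge0.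
rewrite nmD2; lra.
Qed.
Lemma cauchy_schwarz x y : cn (ip x y) <= nm x * nm y.
have [i0|i0] := eqVneq (ip x y) 0.
 by rewrite i0 cn0 mulr_ge0 ?nm_ge0.
have c0 : cn (ip x y) != 0 by apply: contra i0 => /eqP/cn_eq0/eqP.
have cp : 0 < cn (ip x y) by rewrite lt_neqAle eq_sym c0 cn_ge0.
pose c := (ip x y)^* * ((cn (ip x y))^-1)%:C%C.
have cc : cn c = 1 by rewrite /c cnM cnJ cn_real ?invr_ge0 ?cn_ge0 // divff.
have := rip_le x (c *: y).
rewrite nmZ cc mul1r /rip ipZr /c mulrAC [_^* * _]mulrC mulC_conj -rmorphM /=.
by rewrite expr2 -mulrA divff // mulr1.
Qed.
Lemma ip_ext x y : (forall z, ip x z = ip y z) -> x = y.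
move=> h; apply/eqP; rewrite -subr_eq0; apply/eqP/nm_eq0/eqP.
by have := ripxx (x - y); rewrite /rip ipBl h subrr => /esym/eqP; rewrite sqrf_eq0.
Qed.
Lemma ip_extr x y : (forall z, ip z x = ip z y) -> x = y.
by move=> h; apply: ip_ext => z; rewrite ipC h -ipC. Qed.
Lemma parallelogram x y : nm (x - y) ^+ 2 = 2 * nm x ^+ 2 + 2 * nm y ^+ 2 - nm (x + y) ^+ 2.
by rewrite nmB2 nmD2; ring. Qed.
Lemma riesz (l : H -> R[i]) : scalar l -> (exists M, forall x, cn (l x) <= M * nm x) ->
 exists y, forall x, l x = ip y x.
move=> ll [M hM].
pose J z : R := nm z ^+ 2 - 2 * complex.Re (l z).
pose E : set R := [set J z | z in [set: H]].
have J_ge z : - (M ^+ 2) <= J z.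
 have := Re_le_cn (l z); have := hM z; rewrite /J => h1 h2.
 have : 0 <= (M - nm z) ^+ 2 by exact: sqr_ge0.
 rewrite sqrrB; nra.
have hE : has_inf E.
 split; first by exists (J 0), 0.
 by exists (- (M ^+ 2)) => _ [z _ <-].
pose m := inf E.
have mJ z : m <= J z by apply: ge_inf; [case: hE | exists z].
(* Compare with the value of [J] at the midpoint of z and w. *)
have Jsub z w : nm (z - w) ^+ 2 <= 2 * (J z + J w - 2 * m).
 have := mJ ((2^-1)%:C%C *: (z + w)); rewrite /J nmZ cn_real ?invr_ge0 //.
 rewrite (linZ ll) ReM_cst (linD ll) Re_add parallelogram exprMn.
 have -> : (2^-1 : R) ^+ 2 = 4^-1 by field.
 lra.
have /boolp.choice[u hu] (n : nat) : exists z : H, J z < m + n.+1%:R^-1.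
 have n0 : 0 < n.+1%:R^-1 :> R by rewrite invr_gt0 ltr0n.
 have [_ [z _ <-] hz] := inf_adherent n0 hE.
 by exists z.
have [y hy] : exists y, forall e : R, 0 < e -> exists N, forall n, (N <= n)%N -> nm (u n - y) <= e.
 apply: cauchy_lim => e e0.
 have [N hN] := inv_small (divr_gt0 (exprn_gt0 2 e0) (ltr0n _ 4)).
 exists N => n k Nn Nk.
 rewrite -(ler_pXn2r (n := 2)) ?nnegrE ?nm_ge0 ?(ltW e0) //.
 have := Jsub (u n) (u k); have := hu n; have := hu k.
 have := hN _ Nn; have := hN _ Nk.
 move: (J (u n)) (J (u k)) (n.+1%:R^-1) (k.+1%:R^-1) => jn jk i1 i2.
 move: (nm _ ^+ 2) (e ^+ 2) => a b *; lra.
(* Minimality of y, stated as a quadratic inequality in t. It is obtained as a limit of m <= J (u n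
   + t x), so that [J] is never evaluated at y. *)
have key x (t : R) : 0 <= t ^+ 2 * nm x ^+ 2 + 2 * t * (rip y x - complex.Re (l x)).
 rewrite -oppr_le0; apply: (@small_le0 _ _ (1 + 2 * `|t| * nm x)) => e e0.
 have [N1 h1] := inv_small e0; have [N2 h2] := hy _ e0.
 pose n := maxn N1 N2.
 have {h1} h1 := h1 n (leq_maxl _ _); have {h2} h2 := h2 n (leq_maxr _ _).
 have := mJ (u n + t%:C%C *: x); have := hu n; rewrite /J nmD2 nmZ.
 rewrite (linD ll) (linZ ll) Re_add ReM_cst ripZr exprMn.
 have -> : cn (t%:C%C) ^+ 2 = t ^+ 2.
  apply: complexI; rewrite rmorphXn /= -cnE normCK cnj_cst -rmorphM /=.
  by rewrite expr2.
 have hr : `|rip (u n) x - rip y x| <= e * nm x.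
  rewrite -ripBl ler_norml; apply/andP; split.
   rewrite lerNl -ripNl opprB; apply: le_trans (rip_le _ _) _.
   by rewrite ler_wpM2r ?nm_ge0 // nm_sub.
  by apply: le_trans (rip_le _ _) _; rewrite ler_wpM2r ?nm_ge0.
 have hr2 : t * (rip (u n) x - rip y x) <= `|t| * (e * nm x).
  apply: le_trans (ler_norm _) _; rewrite normrM.
  by rewrite ler_wpM2l.
 move: h1 hr2; clear.
 move: (nm (u n) ^+ 2) (complex.Re (l (u n))) (rip (u n) x) (rip y x) => A B C D.
 move: (complex.Re (l x)) (n.+1%:R^-1) (`|t|) (nm x) => F i T a *; lra.
have Rekey x : rip y x = complex.Re (l x).
 set d := rip y x - complex.Re (l x) in key *.
 apply: subr0_eq.
 (* The minimiser of the quadratic is - d / nm x ^+ 2. The added 1 avoids a division by zero and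
    still makes the value negative unless d = 0. *)
 have /= := key x (- d / (1 + nm x ^+ 2)); set a := nm x ^+ 2.
 have a0 : 0 <= a by exact: sqr_ge0.
 have -> : (- d / (1 + a)) ^+ 2 * a + 2 * (- d / (1 + a)) * d = - (d ^+ 2 * ((2 + a) / (1 + a) ^+ 2)).
  by field; rewrite gt_eqF // ltr_wpDr.
 rewrite oppr_ge0 => h.
 have : d ^+ 2 <= 0.
  rewrite -(pmulr_lle0 _ (_ : 0 < (2 + a) / (1 + a) ^+ 2)) //.
  by rewrite divr_gt0 ?exprn_gt0 //; lra.
 by rewrite real_exprn_even_le0 //= ?num_real // => /eqP.
exists y => x; apply/eqP; rewrite eq_complex; apply/andP; split; apply/eqP.
 by rewrite -Rekey.
have := Rekey ('i%C *: x); rewrite (linZ ll) /rip ipZr mulrC.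
have -> : 'i%C *: l x = l x * 'i%C by rewrite mulrC.
by rewrite !ReiNIm => /oppr_inj.
Qed.
End InnerProduct.

(** * Extension of densely defined bounded graphs *)

Section Extend.
Variables (R : realType) (H K : hilbert R).
(** [G] is a densely defined linear graph. Its closure [G1] is single-valued because of the bound
    and total because K is complete, so no function on the dense domain has to be chosen
    beforehand. *)
Lemma extend_graph (G : H -> K -> Prop) (M : R) : 0 <= M -> G 0 0 ->
 (forall a x y x' y', G x y -> G x' y' -> G (a *: x + x') (a *: y + y')) ->
 (forall x y, G x y -> nm y <= M * nm x) -> (forall x (e : R), 0 < e -> exists x' y', G x' y' /\ nm (x - x') <= e) ->
 exists t : H -> K, [/\ linear t, bnd M t & forall x y, G x y -> t x = y].
move=> M0 G0 Glin Gb Gd.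
have Gsub x y x' y' : G x y -> G x' y' -> G (x - x') (y - y').
 move=> g g'; have := Glin (-1) x' y' x y g' g.
 by rewrite !scaleN1r ![- _ + _]addrC.
pose G1 x y := forall e : R, 0 < e -> exists x' y', [/\ G x' y', nm (x - x') <= e & nm (y - y') <= e].
have GG1 x y : G x y -> G1 x y by move=> g e e0; exists x, y; rewrite !subrr !nm0 ltW.
have G1lin a x y x' y' : G1 x y -> G1 x' y' -> G1 (a *: x + x') (a *: y + y').
 move=> h h' e e0.
 have c0 : 0 < cn a + 1 by rewrite ltr_wpDl // cn_ge0.
 have d0 : 0 < e / (cn a + 1) by rewrite divr_gt0.
 have [x1 [y1 [g1 hx1 hy1]]] := h _ d0.
 have [x2 [y2 [g2 hx2 hy2]]] := h' _ d0.
 have est (V : normedModType R[i]) (u u1 v v1 : V) : nm (u - u1) <= e / (cn a + 1) ->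
   nm (v - v1) <= e / (cn a + 1) -> nm (a *: u + v - (a *: u1 + v1)) <= e.
  move=> hu hv; rewrite opprD addrACA -scalerBr.
  apply: le_trans (nmD _ _) _; rewrite nmZ.
  apply: (@le_trans _ _ (cn a * (e / (cn a + 1)) + e / (cn a + 1))).
   by rewrite lerD // ler_wpM2l ?cn_ge0.
  by rewrite -[X in _ + X]mul1r -mulrDl mulrC divfK // gt_eqF.
 exists (a *: x1 + x2), (a *: y1 + y2); split; [exact: Glin| exact: est..].
have G1b x y : G1 x y -> nm y <= M * nm x.
 move=> h; rewrite -subr_le0; apply: (@small_le0 _ _ (1 + M)) => e e0.
 have [x' [y' [g hx hy]]] := h e e0.
 have h4 := Gb _ _ g; have h2 := nm_ler y y'.
 have h1 := nm_ler x' x; rewrite nm_sub in h1.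
 have : M * nm x' <= M * (nm x + e) by rewrite ler_wpM2l //; lra.
 lra.
have G1uniq x y y' : G1 x y -> G1 x y' -> y = y'.
 move=> h h'; apply/eqP; rewrite -subr_eq0; apply/eqP/nm_eq0/eqP.
 rewrite eq_le nm_ge0 andbT.
 have := G1lin (-1) x y' x y h' h; rewrite !scaleN1r addNr => /G1b.
 by rewrite nm0 mulr0 addrC.
have G1tot x : exists y, G1 x y.
 have n0 (n : nat) : 0 < n.+1%:R^-1 :> R by rewrite invr_gt0 ltr0n.
 have /boolp.choice[u hu] (n : nat) : exists p : H * K, G p.1 p.2 /\ nm (x - p.1) <= n.+1%:R^-1.
  by have [x' [y' ?]] := Gd x _ (n0 n); exists (x', y').
  have [y hy] : exists y, forall e : R, 0 < e -> exists N, forall n, (N <= n)%N -> nm ((u n).2 - y) <= e.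
  apply: cauchy_lim => e e0.
  have d0 : 0 < e / (2 * (M + 1)) by rewrite divr_gt0 // mulr_gt0 // ltr_wpDl.
  have [N hN] := inv_small d0; exists N => n k Nn Nk.
  have [gn hn] := hu n; have [gk hk] := hu k.
  apply: le_trans (Gb _ _ (Gsub _ _ _ _ gn gk)) _.
  have : nm ((u n).1 - (u k).1) <= 2 * (e / (2 * (M + 1))).
   apply: le_trans (nm_tri _ x _) _; rewrite nm_sub.
   by rewrite mulr_natl mulr2n lerD // ?(le_trans hn) ?(le_trans hk) // hN.
  move=> h; apply: (@le_trans _ _ ((M + 1) * (2 * (e / (2 * (M + 1)))))).
   apply: ler_pM => //; [exact: nm_ge0 | by rewrite lerDl].
  by rewrite le_eqVlt; apply/orP; left; apply/eqP; field; rewrite gt_eqF // ltr_wpDl.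
 exists y => e e0; have [N1 h1] := inv_small e0; have [N2 h2] := hy _ e0.
 have [gn hn] := hu (maxn N1 N2).
 exists (u (maxn N1 N2)).1, (u (maxn N1 N2)).2; split => //.
  by apply: le_trans hn _; rewrite h1 // leq_maxl.
 by rewrite nm_sub h2 // leq_maxr.
have [t ht] := boolp.choice G1tot.
exists t; split=> [a x y|x|x y g].
- by apply: (G1uniq (a *: x + y)) => //; apply: G1lin.
- exact: G1b.
- by apply: (G1uniq x) => //; apply: GG1.
Qed.
End Extend.

(** * Bounded operators, adjoints, unitaries and conjugation *)

Section Adjoint.
Variable R : realType.
Implicit Types H K L : hilbert R.
Lemma opDE H K (s t : op H K) x : (s + t) x = s x + t x. by []. Qed.
Lemma opNE H K (t : op H K) x : (- t) x = - t x. by []. Qed.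
Lemma opBE H K (s t : op H K) x : (s - t) x = s x - t x. by []. Qed.
Lemma opZE H K a (t : op H K) x : (a *: t) x = a *: t x. by []. Qed.
Lemma op0E H K x : (0 : op H K) x = 0. by []. Qed.
Lemma op_sumE H K I (r : seq I) (P : pred I) (F : I -> op H K) x :
 (\sum_(i <- r | P i) F i) x = \sum_(i <- r | P i) F i x.
exact: (big_morph (fun t : op H K => t x)). Qed.
Lemma bopP H K (t : op H K) : bop t <-> linear t /\ exists M : R, 0 <= M /\ bnd M t.
split=> [[lt ct]|[lt ht]]; split=> //; first exact/continuous_bnd.
exact/(continuous_bnd lt).
Qed.
Lemma bop_lin H K (t : op H K) : bop t -> linear t.
by case. Qed.
Lemma bop_bnd H K (t : op H K) : bop t -> exists M : R, 0 <= M /\ bnd M t.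
by move=> /bopP[]. Qed.
Lemma mk_bop H K (t : op H K) (M : R) : linear t -> 0 <= M -> bnd M t -> bop t.
by move=> *; apply/bopP; split=> //; exists M. Qed.
Lemma bop_id H : bop (@id H).
by apply: (@mk_bop _ _ _ 1) => // x; rewrite mul1r. Qed.
Lemma bop_comp H K L (s : op K L) (t : op H K) : bop s -> bop t -> bop (s \o t).
move=> /bopP[ls [M [M0 hM]]] /bopP[lt [N [N0 hN]]].
apply: (@mk_bop _ _ _ (M * N)); first by move=> a x y; rewrite /= lt ls.
 by rewrite mulr_ge0.
by move=> x; apply: le_trans (hM _) _; rewrite -mulrA ler_wpM2l.
Qed.
Lemma bop0 H K : bop (0 : op H K).
apply: (@mk_bop _ _ _ 0) => // [a x y|x]; first by rewrite /= scaler0 addr0.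
by rewrite nm0 mul0r.
Qed.
Lemma bop_lincomb H K a (s t : op H K) : bop s -> bop t -> bop (a *: s + t).
move=> /bopP[ls [M [M0 hM]]] /bopP[lt [N [N0 hN]]].
apply: (@mk_bop _ _ _ (cn a * M + N)).
- move=> b x y; rewrite !opDE !opZE.
 by rewrite ls lt !scalerDr [LHS]addrACA !scalerA mulrC.
- by rewrite addr_ge0 // mulr_ge0 // cn_ge0.
- move=> x; apply: le_trans (nmD _ _) _; rewrite nmZ mulrDl -mulrA lerD //.
 by rewrite ler_wpM2l ?cn_ge0.
Qed.
Lemma bopD H K (s t : op H K) : bop s -> bop t -> bop (s + t).
by move=> hs ht; rewrite -[s]scale1r; apply: bop_lincomb. Qed.
Lemma bopZ H K a (t : op H K) : bop t -> bop (a *: t).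
by move=> ht; rewrite -[_ *: _]addr0; apply: bop_lincomb => //; apply: bop0. Qed.
Lemma bopN H K (t : op H K) : bop t -> bop (- t).
by rewrite -scaleN1r; apply: bopZ. Qed.
Lemma bopB H K (s t : op H K) : bop s -> bop t -> bop (s - t).
by move=> hs ht; apply: bopD => //; apply: bopN. Qed.
Lemma bop_sum H K I (r : seq I) (P : pred I) (F : I -> op H K) :
 (forall i, P i -> bop (F i)) -> bop (\sum_(i <- r | P i) F i).
by move=> h; elim/big_ind: _ => //; [exact: bop0|exact: bopD]. Qed.
Definition is_adj H K (t : op H K) (s : op K H) := forall x y, ip (t x) y = ip x (s y).
Lemma adj_eq H K (t : op H K) (s : op K H) : is_adj t s -> adj t = s.
move=> h; apply/funext => y; apply: ip_extr => x.
rewrite /adj -h; symmetry.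
by have := @xgetPex _ (fun=> 0) [set s : op K H | forall x y, ip (t x) y = ip x (s y)] (ex_intro _ s h); apply.
Qed.
Lemma is_adj_ex H K (t : op H K) : bop t -> exists s, is_adj t s.
move=> /bopP[lt [M [M0 hM]]].
suff /boolp.choice[s hs] : forall y, exists z, forall x, ip (t x) y = ip x z.
 by exists s.
move=> y; have [||z hz] := @riesz R H (fun x => ip y (t x)).
- by move=> a u v; rewrite lt ipDr ipZr.
- exists (nm y * M) => x; apply: le_trans (cauchy_schwarz _ _) _.
 by rewrite -mulrA ler_wpM2l ?nm_ge0.
- by exists z => x; rewrite ipC hz -ipC.
Qed.
Lemma adjP H K (t : op H K) : bop t -> is_adj t (adj t).
by move=> /is_adj_ex[s hs]; rewrite (adj_eq hs). Qed.
Lemma adjPr H K (t : op H K) : bop t -> is_adj (adj t) t.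
by move=> ht x y; rewrite ipC -adjP // -ipC. Qed.
Lemma adjK H K (t : op H K) : bop t -> adj (adj t) = t.
by move=> /adjPr/adj_eq. Qed.
Lemma adj_bnd H K (t : op H K) (M : R) : 0 <= M -> bop t -> bnd M t -> bnd M (adj t).
move=> M0 ht hM y.
have := rip_le (t (adj t y)) y; rewrite {1}/rip (adjP ht) -/(rip _ _) ripxx => h.
have [->|n0] := eqVneq (nm (adj t y)) 0; first by rewrite mulr_ge0 ?nm_ge0.
have n1 : 0 < nm (adj t y) by rewrite lt_neqAle eq_sym n0 nm_ge0.
rewrite -(ler_pM2l n1) -expr2; apply: le_trans h _.
by rewrite mulrA [_ * M]mulrC ler_wpM2r ?nm_ge0.
Qed.
Lemma bop_adj H K (t : op H K) : bop t -> bop (adj t).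
move=> ht; have [M [M0 hM]] := bop_bnd ht.
apply: (mk_bop _ M0); last exact: adj_bnd.
move=> a x y; apply: ip_extr => z.
by rewrite -adjP // !ipDr !ipZr -!adjP.
Qed.
Lemma adj_id H : adj (@id H) = id.
exact: adj_eq. Qed.
Lemma adj_comp H K L (s : op K L) (t : op H K) : bop s -> bop t -> adj (s \o t) = adj t \o adj s.
by move=> hs ht; apply: adj_eq => x y /=; rewrite !adjP. Qed.
Lemma adj_lincomb H K a (s t : op H K) : bop s -> bop t -> adj (a *: s + t) = a^* *: adj s + adj t.
move=> hs ht; apply: adj_eq => x y.
by rewrite [(_ + t) x]/= ipDl ipZl !adjP // -ipZr -ipDr.
Qed.
Lemma adj0 H K : adj (0 : op H K) = 0.
by apply: adj_eq => x y; rewrite ip0l ip0r. Qed.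
Lemma adjD H K (s t : op H K) : bop s -> bop t -> adj (s + t) = adj s + adj t.
by move=> hs ht; rewrite -[s]scale1r adj_lincomb // rmorph1 !scale1r. Qed.
Lemma adjZ H K a (t : op H K) : bop t -> adj (a *: t) = a^* *: adj t.
by move=> ht; rewrite -[_ *: t]addr0 adj_lincomb // ?adj0 ?addr0 //; apply: bop0.
Qed.
Lemma adjN H K (t : op H K) : bop t -> adj (- t) = - adj t.
by move=> ht; rewrite -scaleN1r adjZ // rmorphN1 scaleN1r. Qed.
Lemma adjB H K (s t : op H K) : bop s -> bop t -> adj (s - t) = adj s - adj t.
by move=> hs ht; rewrite adjD ?adjN //; apply: bopN. Qed.
Lemma adj_sum H K I (r : seq I) (P : pred I) (F : I -> op H K) : (forall i, bop (F i)) ->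
 adj (\sum_(i <- r | P i) F i) = \sum_(i <- r | P i) adj (F i).
move=> h; elim: r => [|i r IH]; first by rewrite !big_nil adj0.
by rewrite !big_cons; case: (P i) => //; rewrite adjD ?IH //; apply: bop_sum.
Qed.
Definition iso_op H K (u : op H K) := [/\ bop u, adj u \o u = id & u \o adj u = id].
Lemma unP H K (u : op H K) : unitary u <-> iso_op u.
split=> [[lu iu su]|[bu hu hu']].
- have bu : bop u.
  apply: (@mk_bop _ _ _ 1) => // x; rewrite mul1r -(ler_pXn2r (n := 2)) ?nnegrE ?nm_ge0 //.
  by rewrite -!ripxx /rip iu.
 have hu : adj u \o u = id by apply/funext => x; apply: ip_extr => y /=; rewrite -adjP.
 split=> //; apply/funext => y; have [x <-] := su y.
 by rewrite /= -[adj u (u x)]/((adj u \o u) x) hu.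
- split=> [|x y|y]; first exact: bop_lin.
  by rewrite adjP // -[adj u (u y)]/((adj u \o u) y) hu.
 by exists (adj u y); rewrite -[LHS]/((u \o adj u) y) hu'.
Qed.
Lemma un_bop H K (u : op H K) : unitary u -> bop u.
by move=> /unP[]. Qed.
Lemma unK H K (u : op H K) x : unitary u -> adj u (u x) = x.
by move=> /unP[_ h _]; rewrite -[LHS]/((adj u \o u) x) h. Qed.
Lemma unVK H K (u : op H K) x : unitary u -> u (adj u x) = x.
by move=> /unP[_ _ h]; rewrite -[LHS]/((u \o adj u) x) h. Qed.
Lemma un_adj H K (u : op H K) : unitary u -> unitary (adj u).
move=> /unP[bu h h']; apply/unP; split; rewrite ?adjK //.
exact: bop_adj.
Qed.
Lemma un_comp H K L (s : op K L) (t : op H K) : unitary s -> unitary t -> unitary (s \o t).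
move=> us ut; apply/unP; have bs := un_bop us; have bt := un_bop ut.
rewrite /iso_op adj_comp //; split; first exact: bop_comp.
 by apply/funext => x /=; rewrite !unK.
by apply/funext => x /=; rewrite !unVK.
Qed.
Lemma un_id H : unitary (@id H).
by apply/unP; split; rewrite ?adj_id //; apply: bop_id. Qed.
Lemma un_nm H K (u : op H K) x : unitary u -> nm (u x) = nm x.
case=> _ iu _; apply/eqP; rewrite -(eqrXn2 (n := 2)) ?nm_ge0 //.
by rewrite -!ripxx /rip iu.
Qed.
Lemma AdE H K (u : op H K) t x : Ad u t x = u (t (adj u x)). by []. Qed.
Lemma bop_Ad H K (u : op H K) t : unitary u -> bop t -> bop (Ad u t).
move=> uu bt; have bu := un_bop uu.
by apply: bop_comp; [apply: bop_comp | apply: bop_adj].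
Qed.
Lemma Ad_comp H K (u : op H K) s t : unitary u -> Ad u (s \o t) = Ad u s \o Ad u t.
by move=> uu; apply/funext => x; rewrite /Ad /= unK. Qed.
Lemma Ad_adj H K (u : op H K) t : unitary u -> bop t -> adj (Ad u t) = Ad u (adj t).
move=> uu bt; have bu := un_bop uu; have bu' := bop_adj bu.
rewrite /Ad (adj_comp (bop_comp bu bt) bu') (adj_comp bu bt) (adjK bu).
by [].
Qed.
Lemma Ad_lincomb H K (u : op H K) a s t : bop u -> Ad u (a *: s + t) = a *: Ad u s + Ad u t.
by move=> bu; apply/funext => x; rewrite AdE /= [(a *: s + t) _]/= (bop_lin bu).
Qed.
Lemma Ad_id H K (u : op H K) : unitary u -> Ad u id = id.
by move=> uu; apply/funext => x; rewrite AdE unVK. Qed.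
Lemma AdK H K (u : op H K) t : unitary u -> Ad (adj u) (Ad u t) = t.
move=> uu; have bu := un_bop uu; apply/funext => x.
by rewrite !AdE adjK // !unK.
Qed.
Lemma AdVK H K (u : op H K) t : unitary u -> Ad u (Ad (adj u) t) = t.
move=> uu; have bu := un_bop uu; apply/funext => x.
by rewrite !AdE adjK // !unVK.
Qed.
Lemma Ad_Ad H K L (u : op K L) (v : op H K) t : bop u -> bop v -> Ad u (Ad v t) = Ad (u \o v) t.
by move=> bu bv; rewrite /Ad adj_comp. Qed.
Lemma un_Ad H K (u : op H K) t : unitary u -> unitary t -> unitary (Ad u t).
by move=> uu ut; exact: un_comp (un_comp uu ut) (un_adj uu). Qed.
End Adjoint.

(** * Linear spans and norm-closed subspaces of operators *)

Section Spans.
Variables (K : pzRingType) (V : lmodType K) (S : set V).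
Lemma lspan0 : lspan S 0.
by exists 0%N, (fun=> 0), (fun=> 0); split=> [[]//|]; rewrite big_ord0. Qed.
Lemma lspan_cons a x v : S x -> lspan S v -> lspan S (a *: x + v).
move=> Sx [n [c [s [hs ->]]]].
exists n.+1, (fun i => if unlift ord0 i is Some j then c j else a),
 (fun i => if unlift ord0 i is Some j then s j else x); split.
 by move=> i; case: unliftP.
rewrite big_ord_recl unlift_none; congr (_ + _); apply: eq_bigr => i _.
by rewrite liftK.
Qed.
Lemma lspan_ind (P : V -> Prop) : P 0 -> (forall a x v, S x -> P v -> P (a *: x + v)) -> forall v, lspan S v -> P v.
move=> P0 Ps v [n [c [s [hs ->]]]].
elim: n c s hs => [|n IH] c s hs; first by rewrite big_ord0.
rewrite big_ord_recl; apply: Ps => //.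
by apply: (IH (fun i => c (lift ord0 i)) (fun i => s (lift ord0 i))) => i.
Qed.
Lemma sub_lspan : S `<=` lspan S.
by move=> x Sx; rewrite -[x]addr0 -[x]scale1r; apply: lspan_cons lspan0. Qed.
Lemma lspan_lincomb a x y : lspan S x -> lspan S y -> lspan S (a *: x + y).
move=> hx hy; elim/lspan_ind: x / hx => [|b x v Sx IH].
 by rewrite scaler0 add0r.
by rewrite scalerDr -addrA scalerA; apply: lspan_cons.
Qed.
End Spans.

Section NormClosure.
Variable R : realType.
Implicit Types H K : hilbert R.
Lemma nclP H K (S : set (op H K)) t : nclosure S t <-> forall e : R, 0 < e -> exists2 s, S s & bnd e (t - s).
split=> h e e0.
- have /h[s Ss hs] : 0 < e%:C%C :> R[i] by rewrite ltcR.
 by exists s => // x; move: (hs x); rewrite !nmE -rmorphM /= lecR.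
- have [r r0 ->] := gt0_complexE e0; have [s Ss hs] := h _ r0.
 by exists s => // x; rewrite !nmE -rmorphM /= lecR; exact: hs.
Qed.
(** Norm-closed linear subspaces. A density argument takes the form: the operators with a given
    property form a [csub] that contains the generators, then [cspan_min]. *)
Definition csub H K (X : set (op H K)) := [/\ X 0, (forall a s t, X s -> X t -> X (a *: s + t)) & nclosure X `<=` X].

Section Csub.
Variables (H K : hilbert R) (X : set (op H K)) (cX : csub X).
Lemma csub0 : X 0. by case: cX. Qed.
Lemma csub_lincomb a s t : X s -> X t -> X (a *: s + t).
by case: cX => _ h _; exact: h. Qed.
Lemma csubD s t : X s -> X t -> X (s + t).
by move=> hs ht; rewrite -[s]scale1r; exact: csub_lincomb. Qed.
Lemma csubZ a s : X s -> X (a *: s).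
by move=> hs; rewrite -[_ *: _]addr0; apply: csub_lincomb => //; exact: csub0. Qed.
Lemma csubN s : X s -> X (- s).
by rewrite -scaleN1r; exact: csubZ. Qed.
Lemma csubB s t : X s -> X t -> X (s - t).
by move=> hs ht; apply: csubD => //; exact: csubN. Qed.
Lemma csub_sum I (r : seq I) (P : pred I) F : (forall i, P i -> X (F i)) -> X (\sum_(i <- r | P i) F i).
by move=> h; elim/big_ind: _ => //; [exact: csub0|exact: csubD]. Qed.
Lemma csub_lim t : (forall e : R, 0 < e -> exists2 s, X s & bnd e (t - s)) -> X t.
by case: cX => _ _ h /nclP /h. Qed.
End Csub.
Lemma bnd_lin H K (M : R) (t : op H K) : bnd M t -> bnd M (- t).
by move=> h x; rewrite opNE nmN; exact: h. Qed.
Lemma bndD H K (M N : R) (s t : op H K) : bnd M s -> bnd N t -> bnd (M + N) (s + t).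
by move=> h h' x; apply: le_trans (nmD _ _) _; rewrite mulrDl lerD. Qed.
Lemma bndZ H K (M : R) a (t : op H K) : bnd M t -> bnd (cn a * M) (a *: t).
by move=> h x; rewrite opZE nmZ -mulrA ler_wpM2l ?cn_ge0. Qed.
Lemma bnd_sub H K (M : R) (s t : op H K) : bnd M (s - t) -> bnd M (t - s).
by move=> /bnd_lin; rewrite opprB. Qed.
Lemma bnd_le H K (M N : R) (t : op H K) : M <= N -> bnd M t -> bnd N t.
by move=> MN h x; apply: le_trans (h x) _; rewrite ler_wpM2r ?nm_ge0. Qed.
Lemma bnd_comp H K L (M N : R) (s : op K L) (t : op H K) : 0 <= M -> bnd M s -> bnd N t -> bnd (M * N) (s \o t).
by move=> M0 h h' x; apply: le_trans (h _) _; rewrite -mulrA ler_wpM2l. Qed.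
Lemma bnd_eq0 H K (t : op H K) : (forall e : R, 0 < e -> bnd e t) -> t = 0.
move=> h; apply/funext => x; apply: (@nm_small_eq0 _ _ _ (nm x)) => e e0.
by rewrite mulrC; exact: h.
Qed.
Lemma bnd_approx H K (C : R) (t : op H K) : (forall e : R, 0 < e -> bnd (C + e) t) -> bnd C t.
move=> h x; rewrite -subr_le0; apply: (@small_le0 _ _ (nm x)) => e e0.
by have := h _ e0 x; rewrite mulrDl [e * _]mulrC; lra.
Qed.
Lemma csub_cspan H K (S : set (op H K)) : csub (cspan S).
split.
- by apply/nclP => e e0; exists 0; [exact: lspan0|rewrite subr0 => x; rewrite nm0 mulr_ge0 ?nm_ge0 // ltW].
- move=> a s t /nclP hs /nclP ht; apply/nclP => e e0.
 have c0 : 0 < cn a + 1 by rewrite ltr_wpDl // cn_ge0.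
 have d0 : 0 < e / (cn a + 1) by rewrite divr_gt0.
 have [s' Ss' bs] := hs _ d0; have [t' St' bt] := ht _ d0.
 exists (a *: s' + t'); first exact: lspan_lincomb.
 have -> : a *: s + t - (a *: s' + t') = a *: (s - s') + (t - t') by rewrite opprD addrACA -scalerBr.
 have := bndD (bndZ a bs) bt.
 by rewrite -[X in _ + X]mul1r -mulrDl mulrC divfK // gt_eqF.
- move=> t /nclP h; apply/nclP => e e0.
 have e2 : 0 < e / 2 by rewrite divr_gt0.
 have [s /nclP hs bs] := h _ e2; have [s' Ss' bs'] := hs _ e2.
 exists s' => //; have := bndD bs bs'; rewrite addrA subrK => /bnd_le; apply.
 by rewrite -splitr.
Qed.
Lemma sub_cspan H K (S : set (op H K)) : S `<=` cspan S.
move=> s Ss; apply/nclP => e e0; exists s; first exact: sub_lspan.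
by rewrite subrr => x; rewrite nm0 mulr_ge0 ?nm_ge0 // ltW.
Qed.
Lemma cspan_min H K (S X : set (op H K)) : csub X -> S `<=` X -> cspan S `<=` X.
move=> cX SX t /nclP h; apply: (csub_lim cX) => e /h[s Ls bs]; exists s => //.
by elim/lspan_ind: s / Ls {bs} => [|a x v Sx]; [exact: csub0|apply: csub_lincomb => //; exact: SX].
Qed.
(** General source of closed subspaces: the preimage of one under a bounded additive map with closed
    domain [D]. The scalar [a'] may differ from a, which covers the adjoint, a conjugate-linear
    map. *)
Lemma csub_pre H K H' K' (D : set (op H K)) (X : set (op H' K')) (F : op H K -> op H' K') (C : R) :
 csub D -> csub X -> 0 <= C -> (forall a s t, D s -> D t -> exists a', F (a *: s + t) = a' *: F s + F t) ->
 (forall s t, D s -> D t -> F (s - t) = F s - F t) -> (forall M t, 0 <= M -> D t -> bnd M t -> bnd (C * M) (F t)) ->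
 csub [set t | D t /\ X (F t)].
move=> cD cX C0 Fl FB Fb.
split=> /=.
- split; first exact: csub0.
 by rewrite -(subr0 0) FB ?subrr ?(csub0 cX) //; exact: csub0.
- move=> a s t [Ds Xs] [Dt Xt]; split; first exact: csub_lincomb.
 by have [a' ->] := Fl a s t Ds Dt; exact: csub_lincomb.
- move=> t /nclP h; have Dt : D t.
  by apply: (csub_lim cD) => e /h[s [Ds _] bs]; exists s.
 split=> //; apply: (csub_lim cX) => e e0.
 have d0 : 0 < e / (C + 1) by rewrite divr_gt0 // ltr_wpDl.
 have [s [Ds Xs] bs] := h _ d0; exists (F s) => //.
 rewrite -FB //; have := Fb _ _ (ltW d0) (csubB cD Dt Ds) bs.
 apply: bnd_le; rewrite mulrCA ler_piMr ?(ltW e0) //.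
 by rewrite ler_pdivrMr ?mul1r ?lerDl // ltr_wpDl.
Qed.
Lemma csub_bop H K : csub (@bop R H K).
split=> [|a s t|t /nclP h]; [exact: bop0|exact: bop_lincomb|].
have [s /bopP[ls [M [M0 hM]]] bs] := h _ ltr01.
apply: (@mk_bop _ _ _ _ (M + 1)).
- move=> a x y; apply: subr0_eq.
 apply: (@nm_small_eq0 _ _ _ (nm (a *: x + y) + (cn a * nm x + nm y))) => e e0.
 have [u bu hu] := h _ e0; have lu := bop_lin bu.
 have -> : t (a *: x + y) - (a *: t x + t y) = (t (a *: x + y) - u (a *: x + y)) - (a *: (t x - u x) + (t y - u y)).
  by rewrite lu scalerBr addrACA -opprD opprB addrA subrK.
 apply: le_trans (nmB _ _) _; rewrite mulrDl lerD //.
  by rewrite mulrC; exact: hu.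
 apply: le_trans (nmD _ _) _; rewrite nmZ mulrDl lerD //; last by rewrite mulrC; exact: hu.
 by rewrite -mulrA ler_wpM2l ?cn_ge0 // mulrC; exact: hu.
- by rewrite addr_ge0.
- by have := bndD hM bs; rewrite [s + _]addrC subrK.
Qed.
Lemma op_cauchy H K (u : nat -> op H K) :
 (forall e : R, 0 < e -> exists N, forall n m, (N <= n)%N -> (N <= m)%N -> bnd e (u n - u m)) ->
 exists l, forall e : R, 0 < e -> exists N, forall n, (N <= n)%N -> bnd e (u n - l).
move=> h.
have ptw x : exists l, forall e : R, 0 < e -> exists N, forall n, (N <= n)%N -> nm (u n x - l) <= e.
 apply: cauchy_lim => e e0.
 have c0 : 0 < nm x + 1 by rewrite ltr_wpDl ?nm_ge0.
 have d0 : 0 < e / (nm x + 1) by rewrite divr_gt0.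
 have [N hN] := h _ d0; exists N => n m Nn Nm; apply: le_trans (hN n m Nn Nm x) _.
 rewrite mulrAC -mulrA ler_piMr ?(ltW e0) //.
 by rewrite ler_pdivrMr ?mul1r ?lerDl // ltr_wpDl.
have [l hl] := boolp.choice ptw.
exists l => e e0; have [N hN] := h _ e0; exists N => n Nn x.
rewrite -subr_le0; apply: (@small_le0 _ _ 1) => d d0.
have [N' hN'] := hl x _ d0.
have h1 := hN n (maxn N N') Nn (leq_maxl _ _) x.
have h2 := hN' _ (leq_maxr N N').
have := nm_tri (u n x) (u (maxn N N') x) (l x); rewrite opBE mul1r.
move: h1 h2; rewrite opBE; lra.
Qed.
End NormClosure.
Arguments bndZ {R H K M} a {t}.
Arguments csub_pre {R H K H' K' D X} F C.

(** * Square roots of operators by iteration *)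

Section Squares.
Variable R : realType.
Implicit Types H K : hilbert R.
Lemma half2 (V : lmodType R[i]) (x : V) : (2^-1 : R[i]) *: (x + x) = x.
have -> : x + x = (2 : R[i]) *: x by rewrite scaler_nat mulr2n.
by rewrite scalerA mulVf ?pnatr_eq0 // scale1r. Qed.

(* The fixed point of [t -> (s + t^2) / 2] plays the role of [1 - sqrt (1 - s)]. *)
Lemma sqrt_iter H (s : op H H) : bop s -> bnd 1 s -> exists b : op H H, [/\ bnd 1 b, b + b = s + (b \o b) &
  forall P : set (op H H), P 0 -> (forall t, P t -> P ((2^-1 : R[i]) *: (s + (t \o t)))) ->
   nclosure P `<=` P -> P b].
move=> bs s1.
pose F t : op H H := (2^-1 : R[i]) *: (s + (t \o t)).
pose u n := iter n F 0.
(* The same iteration with the scalar 1 in place of [s]. It increases to 1 and majorises the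
   operator iterates and their increments, so operator convergence is reduced to that of a real
   sequence. *)
pose be n : R := iter n (fun r => 2^-1 * (1 + r ^+ 2)) 0.
have half : cn (2^-1 : R[i]) = 2^-1.
 have -> : (2^-1 : R[i]) = (2^-1)%:C%C by rewrite fmorphV rmorph_nat.
 by rewrite cn_real ?invr_ge0.
have bu n : bop (u n).
 elim: n => [|n IH]; first exact: bop0.
 by apply: bopZ; apply: bopD => //; apply: bop_comp.
have be01 n : 0 <= be n <= 1.
 elim: n => [|n /andP[IH1 IH2]]; first by rewrite lexx ler01.
 rewrite /be iterS -/(be n); move: (be n) IH1 IH2 => r r0 r1.
 by apply/andP; split; nra.
have ub n : bnd (be n) (u n).
 elim: n => [|n IH]; first by move=> x; rewrite nm0 mul0r.
 rewrite /be iterS -/(be n) -half /u iterS; apply: bndZ; apply: bndD => //.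
 by rewrite expr2; apply: bnd_comp => //; have /andP[] := be01 n.
have ud n : bnd (be n.+1 - be n) (u n.+1 - u n).
 elim: n => [|n IH].
  by rewrite subr0 [u 0%N]/= subr0; exact: ub.
 have -> : be n.+2 - be n.+1 = 2^-1 * ((be n.+1 + be n) * (be n.+1 - be n)).
  rewrite {1}/be iterS -/(be n.+1) {2}/be iterS -/(be n); ring.
 have -> : u n.+2 - u n.+1 = (2^-1 : R[i]) *: ((u n.+1 \o (u n.+1 - u n)) + ((u n.+1 - u n) \o u n)).
  rewrite {1}/u iterS -/(u n.+1) {2}/u iterS -/(u n) -scalerBr; congr (_ *: _).
  apply/funext => x; rewrite opBE !opDE opprD addrACA subrr add0r /= !opBE.
  by have lF : linear (F (u n)) := bop_lin (bu n.+1); rewrite (linB lF) addrA subrK.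
 rewrite -half; apply: bndZ; rewrite mulrDl; apply: bndD.
  by apply: bnd_comp => //; have /andP[] := be01 n.+1.
 rewrite mulrC; apply: bnd_comp => //.
 rewrite /be iterS -/(be n); have := be01 n; move: (be n) => r; nra.
have udm n k : bnd (be (n + k)%N - be n) (u (n + k)%N - u n).
 elim: k => [|k IH]; first by rewrite addn0 !subrr => x; rewrite nm0 mul0r.
 have -> : be (n + k.+1)%N - be n = (be (n + k).+1 - be (n + k)%N) + (be (n + k)%N - be n).
  by rewrite addnS addrA subrK.
 have -> : u (n + k.+1)%N - u n = (u (n + k).+1 - u (n + k)%N) + (u (n + k)%N - u n).
  by rewrite addnS addrA subrK.
 exact: bndD.
(* The induction is run on the slightly stronger bound (1 - be n) (n + 2) <= 2. *)
have ga n : 1 - be n <= 2 * n.+1%:R^-1.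
 have e1 k : k.+1%:R = k%:R + 1 :> R by rewrite -natr1.
 have : (1 - be n) * (n%:R + 2) <= 2.
  elim: n => [|n IH]; first by rewrite /be /=; lra.
  rewrite /be iterS -/(be n) (e1 n); have := be01 n.
  have n0 : 0 <= n%:R :> R by exact: ler0n.
  move: (be n) (n%:R : R) n0 IH => r m m0 IH /andP[r0 r1].
  have : (1 - r) * (m + 2) <= 2 by [].
  have -> : (1 - 2^-1 * (1 + r ^+ 2)) * (m + 1 + 2) =
    ((1 - r) * (m + 2)) * (1 - (1 - r) / 2) + ((1 - r) - (1 - r) ^+ 2 / 2) by field.
  move=> h.
  have g0 : 0 <= 1 - r by lra.
  have : (1 - r) * ((1 - r) * (m + 2)) <= (1 - r) * 2 by rewrite ler_wpM2l.
  nra.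
 have n1 : 0 < n.+1%:R :> R by rewrite ltr0n.
 rewrite ler_pdivlMr // (e1 n) => h; apply: le_trans h.
 have /andP[_ ?] := be01 n.
 by rewrite ler_wpM2l ?lerD2l ?subr_ge0 //; lra.
have [b hb] : exists l, forall e : R, 0 < e -> exists N, forall n, (N <= n)%N -> bnd e (u n - l).
 apply: op_cauchy => e e0.
 have d0 : 0 < e / 4 by rewrite divr_gt0.
 have [N hN] := inv_small d0; exists N => n m Nn Nm.
 have hk k : (N <= k)%N -> bnd (e / 2) (u k - u N).
  move=> Nk; rewrite -(subnKC Nk); apply: bnd_le (udm _ _).
  have := ga N; have := hN N (leqnn N); have /andP[_] := be01 (N + (k - N))%N.
  move: (be _) (be N) (N.+1%:R^-1) => x y z *; lra.
 have := bndD (hk n Nn) (bnd_sub (hk m Nm)); rewrite addrA subrK => /bnd_le; apply.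
 by rewrite -splitr.
have bb (P : set (op H H)) : P 0 -> (forall t, P t -> P ((2^-1 : R[i]) *: (s + (t \o t)))) ->
   nclosure P `<=` P -> P b.
 move=> P0 PS Pc; apply/Pc/nclP => e e0; have [N hN] := hb _ e0.
 exists (u N); last by apply: bnd_sub; exact: hN.
 by elim: N {hN} => [//|N IH]; exact: PS.
have bbop : bop b.
 apply: bb; [exact: bop0| |by case: (csub_bop H H)].
 by move=> t bt; apply: bopZ; apply: bopD => //; apply: bop_comp.
have b1 : bnd 1 b.
 apply: bnd_approx => e e0; have [N hN] := hb _ e0.
 have := bndD (ub N) (bnd_sub (hN N (leqnn N))); rewrite [u N + _]addrC subrK.
 by apply: bnd_le; rewrite lerD2r; have /andP[] := be01 N.
exists b; split=> //.
apply/eqP; rewrite -subr_eq0; apply/eqP/bnd_eq0 => e e0.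
have d0 : 0 < e / 6 by rewrite divr_gt0.
have [N hN] := hb _ d0.
have hx := hN N (leqnn N); have hy := hN N.+1 (leqnSn N).
have eqN : u N.+1 + u N.+1 = s + (u N \o u N).
 by rewrite {1 2}/u iterS -/(u N) -scalerDr half2.
have -> : b + b - (s + (b \o b)) = (b - u N.+1) + (b - u N.+1) + ((u N \o (u N - b)) + ((u N - b) \o b)).
 have -> : b + b - (s + (b \o b)) = (b - u N.+1) + (b - u N.+1) + (u N.+1 + u N.+1 - (s + (b \o b))).
  by rewrite [X in _ = X + _]addrACA -opprD addrA subrK.
 congr (_ + _); rewrite eqN; apply/funext => x.
 rewrite opBE !opDE opprD addrACA subrr add0r /= !opBE.
 by rewrite (linB (bop_lin (bu N))) addrA subrK.
have /andP[be0 be1] := be01 N.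
have h1 : bnd (1 * (e / 6)) (u N \o (u N - b)) by apply: bnd_comp => //; exact: bnd_le (ub N).
have h2 : bnd (e / 6 * 1) ((u N - b) \o b) by apply: bnd_comp => //; exact: ltW.
have := bndD (bndD (bnd_sub hy) (bnd_sub hy)) (bndD h1 h2).
by apply: bnd_le; lra.
Qed.
End Squares.

(** * Closed operator algebras: contractivity, isometry, approximate units *)

Section StarAlgebras.
Variable R : realType.
Implicit Types H K : hilbert R.
Definition csalg H (X : set (op H H)) := [/\ csub X, X `<=` @bop R H H, (forall a b, X a -> X b -> X (a \o b)) &
   forall a, X a -> X (adj a)].
Definition shom H K (X : set (op H H)) (f : H ~> K) := [/\ (forall a, X a -> bop (f a)),
   (forall c a b, X a -> X b -> f (c *: a + b) = c *: f a + f b),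
   (forall a b, X a -> X b -> f (a \o b) = f a \o f b) & (forall a, X a -> f (adj a) = adj (f a))].

Section Csalg.
Variables (H : hilbert R) (X : set (op H H)) (cX : csalg X).
Lemma csa_sub : csub X. by case: cX. Qed.
Lemma csa_bop a : X a -> bop a. by case: cX => _ h _ _; exact: h. Qed.
Lemma csa_comp a b : X a -> X b -> X (a \o b).
by case: cX => _ _ h _; exact: h. Qed.
Lemma csa_adj a : X a -> X (adj a). by case: cX => _ _ _; exact. Qed.
End Csalg.

Section Shom.
Variables (H K : hilbert R) (X : set (op H H)) (f : H ~> K) (cX : csalg X) (sf : shom X f).
Let sX := csa_sub cX.
Lemma shom_bop a : X a -> bop (f a). by case: sf => h _ _ _; exact: h. Qed.
Lemma shom_lin c a b : X a -> X b -> f (c *: a + b) = c *: f a + f b.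
by case: sf => _ h _ _; exact: h. Qed.
Lemma shom_comp a b : X a -> X b -> f (a \o b) = f a \o f b.
by case: sf => _ _ h _; exact: h. Qed.
Lemma shom_adj a : X a -> f (adj a) = adj (f a).
by case: sf => _ _ _; exact. Qed.
Lemma shomD a b : X a -> X b -> f (a + b) = f a + f b.
by move=> ha hb; have := shom_lin 1 ha hb; rewrite !scale1r. Qed.
Lemma shom0 : f 0 = 0.
have X0 := csub0 sX; have := shom_lin (-1) X0 X0.
by rewrite !scaleN1r oppr0 addr0 addNr.
Qed.
Lemma shomZ c a : X a -> f (c *: a) = c *: f a.
move=> ha; have X0 := csub0 sX.
by rewrite -[c *: a]addr0 shom_lin // shom0 addr0.
Qed.
Lemma shomB a b : X a -> X b -> f (a - b) = f a - f b.
by move=> ha hb; rewrite addrC -scaleN1r shom_lin // scaleN1r addrC.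
Qed.
Lemma shom_sum I (r : seq I) (P : pred I) (F : I -> op H H) : (forall i, P i -> X (F i)) ->
 f (\sum_(i <- r | P i) F i) = \sum_(i <- r | P i) f (F i).
move=> hF; elim: r => [|i r IH]; first by rewrite !big_nil shom0.
rewrite !big_cons; case: ifP => // Pi.
by rewrite shomD ?IH //; [exact: hF | exact: csub_sum].
Qed.
End Shom.
Definition sadj H (t : op H H) := is_adj t t.
Lemma sadj_rip H (t : op H H) x y : sadj t -> rip (t x) y = rip x (t y).
by move=> h; rewrite /rip h. Qed.
(** The iteration stays in every norm-closed set that contains 0 and is stable under one step.
    Membership in [X], self-adjointness and commutation with y are such conditions, hence they pass
    to the limit. *)
Lemma sqrt_alg H (X : set (op H H)) s : csalg X -> X s -> sadj s -> bnd 1 s ->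
 exists b, [/\ X b, sadj b, bnd 1 b, b + b = s + (b \o b) & forall y, bop y -> s \o y = y \o s -> b \o y = y \o b].
move=> cX Xs ss s1; have sX := csa_sub cX; have bs := csa_bop cX Xs.
have [b [b1 eb hb]] := sqrt_iter bs s1.
have half : (2^-1 : R[i])^* = 2^-1 by rewrite fmorphV rmorph_nat.
have Xb : X b.
 apply: hb => [|t Xt|]; [exact: csub0| |by case: sX].
 by apply: csubZ => //; apply: csubD => //; exact: csa_comp.
exists b; split=> //.
- apply: (hb [set t | is_adj t t]) => [x y|t ht x y|t /nclP ht x y] /=.
 + by rewrite ip0l ip0r.
 + by rewrite !opZE !opDE ipZl ipZr half ipDl ipDr ss /= -!ht.
 + apply/eqP; rewrite -subr_eq0; apply/eqP/cn_eq0.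
  apply: (@small_eq0 _ _ (2 * (nm x * nm y))); first exact: cn_ge0.
  move=> e e0; have [u hu bu] := ht _ e0.
  have -> : ip (t x) y - ip x (t y) = ip ((t - u) x) y - ip x ((t - u) y).
   by rewrite !opBE ipBl ipBr hu opprB addrA subrK.
  apply: le_trans (cnD _ _) _; rewrite cnN.
  have h1 := le_trans (cauchy_schwarz _ _) (ler_wpM2r (nm_ge0 y) (bu x)).
  have h2 := le_trans (cauchy_schwarz _ _) (ler_wpM2l (nm_ge0 x) (bu y)).
  by apply: le_trans (lerD h1 h2) _; lra.
- move=> y by_ ey.
 have [M [M0 hM]] := bop_bnd by_.
 suff : [set t | bop t /\ (t \o y) - (y \o t) = 0] b.
  by move=> [_ /eqP]; rewrite subr_eq0 => /eqP.
 pose D := @bop R H H.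
 have cc : csub [set t | D t /\ [set 0 : op H H] ((t \o y) - (y \o t))].
  apply: (@csub_pre _ _ _ _ _ _ _ _ (2 * M)) => //=.
  + exact: csub_bop.
  + split=> // [a _ _ -> ->|t /nclP ht] /=; first by rewrite scaler0 addr0.
   by apply: bnd_eq0 => e /ht[_ ->]; rewrite subr0.
  + by rewrite mulr_ge0.
  + move=> a u v bu bv; exists a; apply/funext => x.
   rewrite !(opBE, opDE, opZE) /= !(opBE, opDE, opZE) (linD (bop_lin by_)) (linZ (bop_lin by_)).
   by rewrite scalerBr opprD addrACA.
  + move=> u v bu bv; apply/funext => x.
   rewrite !(opBE, opDE, opZE) /= !(opBE, opDE, opZE) (linB (bop_lin by_)).
   by rewrite !opprB addrACA [RHS]addrACA; congr (_ + _); exact: addrC.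
  + move=> N t N0 bt hN; have -> : 2 * M * N = N * M + M * N by ring.
   by apply: bndD; [exact: bnd_comp|apply: bnd_lin; exact: bnd_comp].
 apply: hb => [|t [bt ht]|].
 + exact: (csub0 cc).
 + split; first by apply: bopZ; apply: bopD => //; exact: bop_comp.
  have h2 : t \o y = y \o t by apply: subr0_eq.
  apply/eqP; rewrite subr_eq0; apply/eqP/funext => x.
  rewrite /= !opZE !opDE (linZ (bop_lin by_)) (linD (bop_lin by_)) /=.
  have -> : t (y x) = y (t x) by move/(congr1 (fun g => g x)): h2.
  have -> : t (y (t x)) = y (t (t x)) by move/(congr1 (fun g => g (t x))): h2.
  by have -> : s (y x) = y (s x) by move/(congr1 (fun g => g x)): ey.
 + by case: cc.
Qed.
Lemma sadj_sq H K (a : op H K) : bop a -> sadj (adj a \o a).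
by move=> ba x y /=; rewrite adjPr // adjP. Qed.
Lemma bnd_sq H K (a : op H K) (M : R) : 0 <= M -> bop a -> bnd M a -> bnd (M * M) (adj a \o a).
by move=> M0 ba h; apply: bnd_comp => //; exact: adj_bnd. Qed.
Lemma rip_sq H K (a : op H K) x : bop a -> rip x (adj a (a x)) = nm (a x) ^+ 2.
by move=> ba; rewrite /rip -adjP // -/(rip _ _) ripxx. Qed.
Lemma nm_1sub H (b : op H H) x : sadj b -> nm (x - b x) ^+ 2 = nm x ^+ 2 - rip x (b x + b x) + rip x (b (b x)).
by move=> sb; rewrite nmB2 ripDr -(sadj_rip x (b x) sb) ripxx; ring. Qed.
Lemma bnd1P H (t : op H H) : (forall x, nm (t x) ^+ 2 <= nm x ^+ 2) <-> bnd 1 t.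
split=> h x; have := h x; rewrite ?mul1r.
 by rewrite ler_pXn2r ?nnegrE ?nm_ge0.
by move=> ?; rewrite ler_pXn2r ?nnegrE ?nm_ge0.
Qed.
Lemma bnd_scale1 H K (a : op H K) (C : R) : 0 < C -> bnd C a <-> bnd 1 ((C^-1)%:C%C *: a).
move=> C0; have Ci : 0 <= C^-1 by rewrite invr_ge0 ltW.
split=> [h|/(bndZ C%:C%C)].
 by have := bndZ (C^-1)%:C%C h; rewrite cn_real // mulVf ?gt_eqF.
by rewrite scalerA -rmorphM /= divff ?gt_eqF // scale1r cn_real ?ltW // mulr1.
Qed.

Section Contraction.
Variables (H K : hilbert R) (X : set (op H H)) (f : H ~> K) (cX : csalg X) (sf : shom X f).
Let sX := csa_sub cX.
Lemma shom_sadj b : X b -> sadj b -> sadj (f b).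
move=> Xb /adj_eq eb; have := shom_adj sf Xb; rewrite eb => e.
by move=> x y; rewrite {2}e (adjP (shom_bop sf Xb)).
Qed.
(** Let b solve b + b = s + b \o b for s = adj a \o a. Applying [f] to this equation shows nm (x - f
    b x) ^+ 2 = nm x ^+ 2 - nm (f a x) ^+ 2, and the left side is nonnegative. This replaces the
    usual spectral radius argument. *)
Lemma shom_contr1 a : X a -> bnd 1 a -> bnd 1 (f a).
move=> Xa a1; have ba := csa_bop cX Xa; have bfa := shom_bop sf Xa.
have Xs : X (adj a \o a) by apply: csa_comp => //; exact: csa_adj.
have s1 : bnd 1 (adj a \o a) by have := bnd_sq ler01 ba a1; rewrite mulr1.
have [b [Xb sb b1 eb _]] := sqrt_alg cX Xs (sadj_sq ba) s1.
apply/bnd1P => x; have sfb := shom_sadj Xb sb.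
have := nm_1sub x sfb.
have : f b + f b = f (adj a \o a) + (f b \o f b) by rewrite -(shom_comp sf) // -!(shomD sf) ?eb //; exact: csa_comp.
move=> /(congr1 (fun t => t x)); rewrite !opDE /= => ->.
rewrite (shom_comp sf) ?(shom_adj sf) //; last exact: csa_adj.
rewrite ripDr rip_sq //= => e.
have : 0 <= nm (x - f b x) ^+ 2 by exact: sqr_ge0.
by rewrite e; lra.
Qed.
Lemma shom_contr a (C : R) : X a -> 0 <= C -> bnd C a -> bnd C (f a).
move=> Xa C0 Ca; apply: bnd_approx => e e0.
have Ce : 0 < C + e by rewrite ltr_wpDl.
apply/(bnd_scale1 _ Ce); rewrite -(shomZ cX sf) //; apply: shom_contr1; first exact: csubZ.
by apply/(bnd_scale1 _ Ce); apply: bnd_le Ca; rewrite lerDl ltW.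
Qed.
(** Polarising the quadratic form bounds [rip y (t x)]; then y is taken parallel to t x with the
    norm of x. *)
Lemma num_radius (t : op H H) : bop t -> sadj t -> (forall x, `|rip x (t x)| <= nm x ^+ 2) -> bnd 1 t.
move=> bt st h x; rewrite mul1r.
have key y : 4 * rip y (t x) <= 2 * nm x ^+ 2 + 2 * nm y ^+ 2.
 have := h (x + y); have := h (x - y); rewrite !ler_norml => /andP[h1 _] /andP[_ h2].
 move: h1 h2; rewrite (linB (bop_lin bt)) (linD (bop_lin bt)).
 rewrite !ripBr !ripBl !ripDr !ripDl nmB2 nmD2.
 rewrite -[rip x (t y)](sadj_rip x y st) (ripC (t x) y); lra.
have [x0|x0] := eqVneq (nm x) 0.
 by rewrite (nm_eq0 x0) (lin0 (bop_lin bt)).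
have x1 : 0 < nm x by rewrite lt_neqAle eq_sym x0 nm_ge0.
have [->|tx0] := eqVneq (nm (t x)) 0; first exact: nm_ge0.
have tx1 : 0 < nm (t x) by rewrite lt_neqAle eq_sym tx0 nm_ge0.
have := key ((nm x / nm (t x))%:C%C *: t x).
rewrite ripC ripZr ripxx nmZ cn_real ?divr_ge0 ?nm_ge0 // mulfVK // => h1.
have : nm x * nm (t x) <= nm x * nm x.
 have e : nm x / nm (t x) * nm (t x) ^+ 2 = nm x * nm (t x) by field.
 by rewrite e in h1; lra.
by rewrite ler_pM2l.
Qed.
Definition finj := forall a b, X a -> X b -> f a = f b -> a = b.
Hypothesis fi : finj.
Lemma bndN1 (V : hilbert R) (M : R) (t : op V V) : bnd M t -> forall x, - (M * nm x ^+ 2) <= rip x (t x) <= M * nm x ^+ 2.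
move=> h x; have h1 := rip_le x (t x); have h2 := rip_le x (- t x).
rewrite ripNr nmN in h2.
have := ler_wpM2l (nm_ge0 x) (h x); rewrite mulrCA -expr2 => h3.
by apply/andP; split; lra.
Qed.

(* With [s = a^* a] and [(1 - b)^2 = (1 - s)^2], both [1 - f b] and [1 - f s]
  are positive square roots of the same operator, hence [b = s]. *)
Lemma shom_isom1 a : X a -> bnd 1 (f a) -> (forall x, nm (a x) ^+ 2 <= 2 * nm x ^+ 2) -> bnd 1 a.
move=> Xa fa1 a2; have ba := csa_bop cX Xa; have bfa := shom_bop sf Xa.
set s := adj a \o a.
have Xs : X s by apply: csa_comp => //; exact: csa_adj.
have ss : sadj s := sadj_sq ba.
have bs := csa_bop cX Xs; have ls := bop_lin bs.
have rs x : rip x (s x) = nm (a x) ^+ 2 by rewrite rip_sq.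
(* The a priori bound 2 on s puts 1 - s between -1 and 1, so q = 1 - (1 - s)^2 is a contraction and
   [sqrt_alg] applies to it. *)
have y1 x : nm (x - s x) ^+ 2 <= nm x ^+ 2.
 rewrite -[leLHS]/(nm ((id - s) x) ^+ 2); move: x; apply/bnd1P; apply: num_radius.
 - by apply: bopB => //; exact: bop_id.
 - by move=> u v; rewrite !opBE ipBl ipBr ss.
 - move=> x; rewrite opBE ripBr ripxx rs ler_norml; have := a2 x.
  by have : 0 <= nm (a x) ^+ 2 := sqr_ge0 _; lra.
pose q := s + s - (s \o s).
have Xss : X (s \o s) by exact: csa_comp.
have Xq : X q by apply: csubB => //; exact: csubD.
have sq : sadj q by move=> x y; rewrite /q !(opBE, opDE) /= !ipBl !ipBr !ipDl !ipDr !ss.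
have q1 : bnd 1 q.
 apply: num_radius => //; first exact: csa_bop Xq.
 move=> x; have e := nm_1sub x ss; rewrite /q opBE opDE ripBr /=.
 have h := y1 x; have h0 : 0 <= nm (x - s x) ^+ 2 := sqr_ge0 _.
 by rewrite ler_norml; apply/andP; split; lra.
have [b [Xb sb b1 eb cb]] := sqrt_alg cX Xq sq q1.
have bb := csa_bop cX Xb.
have sbc : s \o b = b \o s.
 symmetry; apply: cb => //; apply/funext => x; rewrite /= /q !(opBE, opDE) /=.
 by rewrite (linB ls) (linD ls).
have fsc : f s \o f b = f b \o f s by rewrite -!(shom_comp sf) // sbc.
have fs_sq : f b + f b - (f b \o f b) = f s + f s - (f s \o f s).
 rewrite -!(shom_comp sf) // -!(shomD sf) // -!(shomB sf) //; try by [exact: csubD|exact: csa_comp].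
 by congr f; rewrite eb addrK.
have bfb := shom_bop sf Xb; have bfs := shom_bop sf Xs.
have sfb := shom_sadj Xb sb; have sfs := shom_sadj Xs ss.
have fb1 := shom_contr1 Xb b1.
pose D := f s - f b.
have bD : bop D by exact: bopB.
have lD := bop_lin bD.
have DE x : D x = f s x - f b x by [].
clearbody D.
have sD : sadj D by move=> x y; rewrite !DE ipBl ipBr sfs sfb.
have posb x : 0 <= nm x ^+ 2 - rip x (f b x) by have /andP[_] := bndN1 fb1 x; rewrite mul1r subr_ge0.
have poss x : 0 <= nm x ^+ 2 - rip x (f s x).
 rewrite (shom_comp sf) ?(shom_adj sf) //; last exact: csa_adj.
 rewrite /= rip_sq // subr_ge0.
 by move: x; apply/bnd1P.
(* The sum of 1 - f s and 1 - f b annihilates the range of D. Both summands are positive, so both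
   quadratic forms vanish there, hence D^3 = 0, and D = 0 as D is self-adjoint. *)
have DD x : D x + D x - (f s (D x) + f b (D x)) = 0.
 have e1 : (f b + f b - (f b \o f b)) x = (f s + f s - (f s \o f s)) x by rewrite fs_sq.
 have e2 : f s (f b x) = f b (f s x) by move/(congr1 (fun g => g x)): fsc.
 move: e1; rewrite !(opBE, opDE) /= => e1.
 have -> : f s (D x) + f b (D x) = f s (f s x) - f b (f b x).
  by rewrite !DE (linB (bop_lin bfs)) (linB (bop_lin bfb)) e2 addrA subrK.
 rewrite !DE [f s x - f b x + _]addrACA -opprD.
 have -> : f s x + f s x - (f b x + f b x) = f s (f s x) - f b (f b x).
  apply/eqP; rewrite subr_eq -[X in X == _](subrK (f s (f s x))) -e1.
  by rewrite addrAC [X in _ == X]addrAC [_ + (f b x + f b x)]addrC.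
 by rewrite subrr.
have DxD x : rip (D x) (D (D x)) = 0.
 have h1 := posb (D x); have h2 := poss (D x).
 have : rip (D x) (D x + D x - (f s (D x) + f b (D x))) = 0 by rewrite DD /rip ip0r.
 rewrite ripBr !ripDr ripxx => h3.
 by rewrite (DE (D x)) ripBr; lra.
have DxDy x y : rip (D x) (D (D y)) = 0.
 have := DxD (x + y); rewrite !(linD lD) !ripDr !ripDl !DxD.
 rewrite [rip (D y) (D (D x))]ripC (sadj_rip (D x) (D y) sD); lra.
have D3 x : D (D (D x)) = 0 by apply: nm_eq0; apply/eqP; rewrite -sqrf_eq0 -ripxx (DxDy (D (D x)) (D x)).
have D2 x : D (D x) = 0 by apply: nm_eq0; apply/eqP; rewrite -sqrf_eq0 -ripxx (sadj_rip _ _ sD) D3 /rip ip0r.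
have D1 x : D x = 0 by apply: nm_eq0; apply/eqP; rewrite -sqrf_eq0 -ripxx (sadj_rip _ _ sD) D2 /rip ip0r.
have es : s = b by apply: fi => //; apply/funext => x; apply/eqP; rewrite -subr_eq0 -DE D1.
apply/bnd1P => x; rewrite -rs es.
by have /andP[_] := bndN1 b1 x; rewrite mul1r.
Qed.
(** The a priori bound required by [shom_isom1] is removed by rescaling: a bound (4/3)^(k+1) on a is
    lowered to (4/3)^k. The ratio 4/3 works because its square is at most 2. *)
Lemma shom_isom a (C : R) : X a -> 0 <= C -> bnd C (f a) -> bnd C a.
pose r : R := 4 / 3.
have r0 : 0 < r by rewrite /r divr_gt0.
have step k : forall a, X a -> bnd 1 (f a) -> bnd (r ^+ k) a -> bnd 1 a.
 elim: k => [|k IH] u Xu fu1 hu; first by rewrite expr0 in hu.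
 have rk0 : 0 < r ^+ k by rewrite exprn_gt0.
 apply: IH => //; apply/(bnd_scale1 _ rk0); apply: shom_isom1; first exact: csubZ.
  rewrite (shomZ cX sf) //; apply/(bnd_scale1 _ rk0); apply: bnd_le fu1.
  by rewrite exprn_ege1 // /r; lra.
 move=> x; rewrite opZE nmZ cn_real ?invr_ge0 ?(ltW rk0) //.
 have : (r ^+ k)^-1 * nm (u x) <= r * nm x by rewrite ler_pdivrMl // mulrA -exprSr; exact: hu.
 have h0 : 0 <= (r ^+ k)^-1 * nm (u x) by rewrite mulr_ge0 ?invr_ge0 ?(ltW rk0) ?nm_ge0.
 have hx := nm_ge0 x; rewrite /r => h.
 have : ((r ^+ k)^-1 * nm (u x)) ^+ 2 <= (4 / 3 * nm x) ^+ 2 by rewrite ler_pXn2r // nnegrE // mulr_ge0.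
 have : 0 <= nm x ^+ 2 by exact: sqr_ge0.
 by rewrite [X in _ -> _ <= X -> _]exprMn; lra.
have big (M : R) : exists k, M <= r ^+ k.
 exists (Num.truncn (3 * M)).+1.
 have h k : 1 + k%:R / 3 <= r ^+ k.
  elim: k => [|k IH]; first by rewrite expr0 mul0r addr0.
  rewrite exprS; have -> : k.+1%:R = k%:R + 1 :> R by rewrite -natr1.
  have k0 : 0 <= k%:R :> R := ler0n _ _.
  by move: IH; rewrite /r; move: (r ^+ k) (k%:R : R) k0 => y z *; lra.
 have aux (z : R) : 3 * M < z -> M <= 1 + z / 3 by lra.
 by apply: le_trans (h _); apply/aux/truncnS_gt.
move=> Xa C0 hC; apply: bnd_approx => e e0.
have Ce : 0 < C + e by rewrite ltr_wpDl.
apply/(bnd_scale1 _ Ce).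
have Xc : X (((C + e)^-1)%:C%C *: a) by exact: csubZ.
have [M [M0 hM]] := bop_bnd (csa_bop cX Xc).
have [k hk] := big M.
apply: (step k) => //; last exact: bnd_le hM.
rewrite (shomZ cX sf) //; apply/(bnd_scale1 _ Ce); apply: bnd_le hC.
by rewrite lerDl ltW.
Qed.
End Contraction.
Lemma bop_csalg H : csalg (@bop R H H).
by split=> //; [exact: csub_bop|exact: bop_comp|exact: bop_adj]. Qed.
(** With (1 - b)^2 = 1 - adj a' \o a' one has nm (c z) ^+ 2 = nm z ^+ 2 - nm (a' z) ^+ 2 for c = 1 -
    b. Summing along the iterates of c shows that a c^k tends to 0 like the inverse square root of
    k, and 1 - c^k is the approximate unit. *)
Lemma csalg_approx1 H (X : set (op H H)) a (e : R) : csalg X -> X a -> 0 < e -> exists2 y, X y & bnd e (a - (a \o y)).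
move=> cX Xa e0; have sX := csa_sub cX; have ba := csa_bop cX Xa.
have [M [M0 hM]] := bop_bnd ba.
have M1 : 0 < M + 1 by rewrite ltr_wpDl.
pose a' := ((M + 1)^-1)%:C%C *: a.
have Xa' : X a' by exact: csubZ.
have ba' := csa_bop cX Xa'.
have a1 : bnd 1 a' by apply/(bnd_scale1 _ M1); apply: bnd_le hM; rewrite lerDl.
have Xs : X (adj a' \o a') by apply: csa_comp => //; exact: csa_adj.
have s1 : bnd 1 (adj a' \o a') by have := bnd_sq ler01 ba' a1; rewrite mulr1.
have [b [Xb sb b1 eb _]] := sqrt_alg cX Xs (sadj_sq ba') s1.
have bb := csa_bop cX Xb; have lb := bop_lin bb.
pose c x := x - b x.
have c_a z : nm (c z) ^+ 2 = nm z ^+ 2 - nm (a' z) ^+ 2.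
 rewrite nm_1sub //; have /(congr1 (fun t => t z)) := eb; rewrite !opDE /= => ->.
 by rewrite ripDr rip_sq //; ring.
(* The left side is nonnegative, so nm (iter k c z) ^+ 2 is convex in k and its decrements nm (a'
   (iter k c z)) ^+ 2 decrease. *)
have cz z : nm (z - c (c z)) ^+ 2 = nm z ^+ 2 - 2 * nm (c z) ^+ 2 + nm (c (c z)) ^+ 2.
 have sc u v : rip (c u) v = rip u (c v) by rewrite /c ripBl ripBr (sadj_rip _ _ sb).
 by rewrite nmB2 -sc ripxx.
have aN k z : k.+1%:R * nm (a' (iter k c z)) ^+ 2 <= nm z ^+ 2 - nm (iter k.+1 c z) ^+ 2.
 elim: k => [|k IH]; first by rewrite mul1r /= c_a; lra.
 have -> : k.+2%:R = k.+1%:R + 1 :> R by rewrite -[k.+2]addn1 natrD.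
 have h1 := c_a (iter k c z); have h2 := c_a (iter k.+1 c z).
 have h3 := cz (iter k c z); rewrite -!iterS in h1 h2 h3.
 have h4 : 0 <= nm (iter k c z - iter k.+2 c z) ^+ 2 := sqr_ge0 _.
 have h5 : nm (a' (iter k.+1 c z)) ^+ 2 <= nm (a' (iter k c z)) ^+ 2 by lra.
 have k0 : 0 <= k.+1%:R :> R := ler0n _ _.
 have := ler_wpM2l k0 h5; move: (k.+1%:R : R) IH => K IH; lra.
(* 1 - c^k belongs to [X], although 1 itself need not. *)
have /boolp.choice[y hy] (k : nat) : exists y, X y /\ forall x, x - y x = iter k c x.
 elim: k => [|k [u [Xu hu]]].
  by exists 0; split; [exact: csub0|move=> x; rewrite op0E subr0].
 exists (u + b - (b \o u)); split.
  by apply: csubB => //; [exact: csubD|exact: csa_comp].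
 move=> x; rewrite iterS -hu /c (linB lb) opBE opDE /=.
 by rewrite -[u x + _ - _]addrA opprD addrA.
have d0 : 0 < (e / (M + 1)) ^+ 2 by rewrite exprn_gt0 // divr_gt0.
have [N hN] := inv_small d0; have [XyN hyN] := hy N.
exists (y N) => // x; rewrite opBE /= -(linB (bop_lin ba)) hyN.
have -> : a (iter N c x) = (M + 1)%:C%C *: a' (iter N c x).
 by rewrite /a' opZE scalerA -rmorphM /= divff ?gt_eqF // scale1r.
rewrite nmZ cn_real ?(ltW M1) //.
rewrite -ler_pdivlMl // mulrA [_^-1 * e]mulrC.
rewrite -(ler_pXn2r (n := 2)) ?nnegrE ?nm_ge0 //; last by rewrite mulr_ge0 ?nm_ge0 // divr_ge0 // ltW.
rewrite exprMn; have := aN N x; have := hN N (leqnn N).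
have n1 : 0 < N.+1%:R :> R by rewrite ltr0n.
have h0 : 0 <= nm (iter N.+1 c x) ^+ 2 := sqr_ge0 _.
have hx : 0 <= nm x ^+ 2 := sqr_ge0 _.
move=> h1 h2; apply: le_trans (ler_wpM2r hx h1); rewrite ler_pdivlMl //.
by apply: le_trans h2 _; rewrite lerBlDr lerDl.
Qed.
End StarAlgebras.

(** * Total sets of vectors *)

Section Dense.
Variable R : realType.
Implicit Types H K M : hilbert R.
Definition hdense H (D : set H) := forall x (e : R), 0 < e -> exists2 y, lspan D y & nm (x - y) <= e.
Lemma denseP H (D : set H) : closure (lspan D) = [set: H] <-> hdense D.
split=> [h x e e0|h].
 by have /closureP/(_ _ e0) : closure (lspan D) x by rewrite h.
by apply/seteqP; split=> // x _; apply/closureP => e /h.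
Qed.
Lemma hdense_sub H (D E : set H) : D `<=` E -> hdense D -> hdense E.
move=> DE hD x e e0; have [y Dy h] := hD x e e0; exists y => //.
elim/lspan_ind: y / Dy {h} => [|a v w /DE]; [exact: lspan0|exact: lspan_cons].
Qed.

Lemma hdense_trans H (D E : set H) : hdense D ->
 (forall v (e : R), D v -> 0 < e -> exists2 y, lspan E y & nm (v - y) <= e) -> hdense E.
move=> hD hE x e e0; have e2 : 0 < e / 2 by rewrite divr_gt0.
have [y Dy hy] := hD x _ e2.
have [z Ez hz] : exists2 z, lspan E z & nm (y - z) <= e / 2.
 move: (e / 2) e2 {hy} => d d0.
 elim/lspan_ind: y / Dy d d0 => [|a v w Dv IH] d d0.
  by exists 0; [exact: lspan0|rewrite subrr nm0 ltW].
 have c0 : 0 < cn a + 1 by rewrite ltr_wpDl // cn_ge0.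
 have f0 : 0 < d / (cn a + 1) by rewrite divr_gt0.
 have [z1 E1 h1] := hE _ _ Dv f0; have [z2 E2 h2] := IH _ f0.
 exists (a *: z1 + z2); first exact: lspan_lincomb.
 rewrite opprD addrACA -scalerBr; apply: le_trans (nmD _ _) _; rewrite nmZ.
 apply: (@le_trans _ _ (cn a * (d / (cn a + 1)) + d / (cn a + 1))).
  by rewrite lerD // ler_wpM2l ?cn_ge0.
 by rewrite -[X in _ + X]mul1r -mulrDl mulrC divfK // gt_eqF.
exists z => //; apply: le_trans (nm_tri _ y _) _; lra.
Qed.
Lemma hdense_eq H K (D : set H) (s t : op H K) : hdense D -> bop s -> bop t -> (forall v, D v -> s v = t v) -> s = t.
move=> hD bs bt h; apply/funext => x; apply: subr0_eq.
have bst := bopB bs bt; have [M [M0 hM]] := bop_bnd bst.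
apply: (@nm_small_eq0 _ _ _ M) => e e0.
have [y Dy hy] := hD x _ e0.
have y0 : (s - t) y = 0.
 elim/lspan_ind: y / Dy {hy} => [|a v w /h hv]; first by rewrite (lin0 (bop_lin bst)).
 by rewrite (bop_lin bst) => ->; rewrite opBE hv subrr scaler0 addr0.
rewrite -opBE -[x](subrK y) (linD (bop_lin bst)) y0 addr0.
by apply: le_trans (hM _) _; rewrite ler_wpM2l.
Qed.
(** The vectors [u i] may be linearly dependent; the estimate over all finite combinations is what
    makes the assignment of [v i] to [u i] well defined and bounded. *)
Lemma graph_ext H K (I : Type) (S : set I) (u : I -> H) (v : I -> K) (C : R) : 0 <= C -> hdense [set u i | i in S] ->
 (forall n (c : 'I_n -> R[i]) (s : 'I_n -> I), (forall i, S (s i)) ->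
  nm (\sum_i c i *: v (s i)) <= C * nm (\sum_i c i *: u (s i))) ->
 exists t : op H K, [/\ bop t, bnd C t & forall i, S i -> t (u i) = v i].
move=> C0 hd hb.
pose P : set (H * K) := [set (u i, v i) | i in S].
have gsum n (c : 'I_n -> R[i]) (s : 'I_n -> I) :
  \sum_i c i *: ((u (s i), v (s i)) : H * K) = (\sum_i c i *: u (s i), \sum_i c i *: v (s i)).
 rewrite [LHS]surjective_pairing; congr (_, _).
  exact: (big_morph (fun p : H * K => p.1)).
 exact: (big_morph (fun p : H * K => p.2)).
have hP x y : lspan P (x, y) -> exists n (c : 'I_n -> R[i]) (s : 'I_n -> I),
  [/\ (forall i, S (s i)), x = \sum_i c i *: u (s i) & y = \sum_i c i *: v (s i)].
 move=> [n [c [s [hs e]]]].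
 have /boolp.choice[s' hs'] (i : 'I_n) : exists j, S j /\ (u j, v j) = s i.
  by have [j Sj <-] := hs i; exists j.
 exists n, c, s'; split=> [i||]; first by case: (hs' i).
  move: e; rewrite (eq_bigr (fun i => c i *: ((u (s' i), v (s' i)) : H * K))).
   by rewrite gsum => -[].
  by move=> i _; have [_ ->] := hs' i.
 move: e; rewrite (eq_bigr (fun i => c i *: ((u (s' i), v (s' i)) : H * K))).
  by rewrite gsum => -[].
 by move=> i _; have [_ ->] := hs' i.
have [||||t [lt bt ht]] := @extend_graph R H K (fun x y => lspan P (x, y)) C C0.
- exact: lspan0.
- by move=> a x y x' y' h h'; exact: (lspan_lincomb a h h').
- by move=> x y /hP[n [c [s [hs -> ->]]]]; exact: hb.
- move=> x e e0; have [y Dy hy] := hd x e e0.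
 have [z hz] : exists z, lspan P (y, z).
  elim/lspan_ind: y / Dy {hy} => [|a _ w [i Si <-] [z hz]]; first by exists 0; exact: lspan0.
  exists (a *: v i + z).
  by apply: (@lspan_cons _ _ P a (u i, v i) (w, z)) => //; exists i.
 by exists y, z.
exists t; split=> // [|i Si]; first exact: mk_bop lt C0 bt.
by apply: ht; apply: sub_lspan; exists i.
Qed.
End Dense.

(** * Nondegenerate representations and their extension to multipliers *)

Section Reps.
Variable R : realType.
Implicit Types (H K M N : hilbert R) (A B D : opalg R).
Definition vecs H K (Y : set (op H K)) : set K := [set a z | a in Y & z in [set: H]].
Lemma cstarP A : cstar A -> csalg (els A) /\ hdense (vecs (els A)).
move=> [h1 h2 h3 h4 h5]; split; last exact/denseP.
split=> //; split.
- exact/h2/(csub0 (csub_cspan _)).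
- by move=> a s t As At; apply: h2; apply: (csub_lincomb (csub_cspan _)); exact: sub_cspan.
- move=> t /nclP h; apply/h2/nclP => e /h[s As bs]; exists s => //.
 exact: sub_lspan.
Qed.
Lemma cs_alg A : cstar A -> csalg (els A). by move=> /cstarP[]. Qed.
Lemma cs_bop A a : cstar A -> A a -> bop a. by move/cs_alg/csa_bop/[apply]. Qed.
Lemma cstar_dense A : cstar A -> hdense (vecs (els A)). by move=> /cstarP[]. Qed.
Lemma cstar_sub A : cstar A -> csub (els A). by move=> /cs_alg/csa_sub. Qed.
Lemma mk_cstar A : csalg (els A) -> hdense (vecs (els A)) -> cstar A.
move=> hA hd; split; [exact: (csa_bop hA)| |exact: (csa_comp hA)|exact: (csa_adj hA)|exact/denseP].
by apply: cspan_min => //; exact: csa_sub.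
Qed.
Definition rep A M (f : sp A ~> M) := shom (els A) f /\ hdense (vecs (f @` els A)).
Lemma rep_id A : cstar A -> rep (M := sp A) id.
move=> cA; have hA := cs_alg cA; split.
 by split=> // a Aa; exact: (csa_bop hA Aa).
by rewrite image_id; exact: cstar_dense.
Qed.
Lemma mult_csalg A : cstar A -> csalg (mult A).
move=> cA; have hA := cs_alg cA; have sA := csa_sub hA.
have bA a : A a -> bop a by exact: csa_bop.
split=> [|t []//|a b [ba ha] [bb hb]|t [bt ht]].
- split=> [|a s t [bs hs] [bt ht]|t /nclP h].
 + split; first exact: bop0.
  move=> a Aa; have -> : (0 : bo (sp A)) \o a = 0 by [].
  have -> : a \o (0 : bo (sp A)) = 0 by apply/funext => x; rewrite /= (lin0 (bop_lin (bA _ Aa))).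
  by split; exact: csub0.
 + split=> [|b Ab]; first exact: bop_lincomb.
  have [h1 h2] := hs _ Ab; have [h3 h4] := ht _ Ab; split.
   have -> : (a *: s + t) \o b = a *: (s \o b) + (t \o b) by [].
   exact: csub_lincomb.
  have -> : b \o (a *: s + t) = a *: (b \o s) + (b \o t) by apply/funext => x; rewrite /= [LHS](bop_lin (bA _ Ab)).
  exact: csub_lincomb.
 + have bt : bop t.
   by apply: (csub_lim (csub_bop _ _)) => e /h[s [bs _] hs]; exists s.
  split=> // a Aa; have [M [M0 hM]] := bop_bnd (bA _ Aa).
  have M1 : 0 < M + 1 by rewrite ltr_wpDl.
  split; apply: (csub_lim sA) => e e0; have d0 : 0 < e / (M + 1) by rewrite divr_gt0.
   have [s [bs hs] hts] := h _ d0; have [h1 _] := hs _ Aa; exists (s \o a) => //.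
   have : bnd (e / (M + 1) * M) ((t - s) \o a) by apply: bnd_comp => //; exact: ltW.
   apply: bnd_le; rewrite mulrAC -mulrA ler_piMr ?(ltW e0) //.
   by rewrite ler_pdivrMr // mul1r lerDl.
  have [s [bs hs] hts] := h _ d0; have [_ h1] := hs _ Aa; exists (a \o s) => //.
  have : bnd (M * (e / (M + 1))) (a \o (t - s)) by apply: bnd_comp.
  have -> : a \o (t - s) = (a \o t) - (a \o s) by apply/funext => x; rewrite /= !opBE (linB (bop_lin (bA _ Aa))).
  apply: bnd_le; rewrite mulrCA ler_piMr ?(ltW e0) //.
  by rewrite ler_pdivrMr // mul1r lerDl.
- split=> [|c Ac]; first exact: bop_comp.
 have [h1 h2] := hb _ Ac; have [h3 h4] := ha _ Ac.
 by have [h5 _] := ha _ h1; have [_ h6] := hb _ h4.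
- split=> [|a Aa]; first exact: bop_adj.
 have Aa' := csa_adj hA Aa; have [h1 h2] := ht _ Aa'; have ba := bA _ Aa.
 split.
  have -> : adj t \o a = adj (adj a \o t) by rewrite adj_comp ?adjK //; exact: bop_adj.
  exact: csa_adj.
 have -> : a \o adj t = adj (t \o adj a) by rewrite adj_comp ?adjK //; exact: bop_adj.
 exact: csa_adj.
Qed.
Lemma mult_bop A t : mult A t -> bop t. by case. Qed.
Lemma mult_l A t a : mult A t -> A a -> A (t \o a). by move=> [_ h] /h[]. Qed.
Lemma mult_r A t a : mult A t -> A a -> A (a \o t). by move=> [_ h] /h[]. Qed.
Lemma mult_id A : mult A id. by split=> //; exact: bop_id. Qed.
Lemma mult_in A a : cstar A -> A a -> mult A a.
move=> /cs_alg cA Aa; split=> [|b Ab]; first exact: csa_bop Aa.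
by split; exact: csa_comp.
Qed.
(** Counterpart of [mext] for a representation on a Hilbert space: the value is only required to be
    bounded, not to multiply a target algebra. For morphisms the two agree, see [mextE]. *)
Definition ext A M (f : sp A ~> M) t : op M M := xget 0 [set s | bop s /\ forall a, A a -> s \o f a = f (t \o a)].

Section Ext.
Variables (A : opalg R) (M : hilbert R) (f : sp A ~> M) (cA : cstar A) (rf : rep f).
Let hA := cs_alg cA.
Let sA := csa_sub hA.
Let mA := mult_csalg cA.
Let sf : shom (els A) f := rf.1.
Lemma ext_sum_ip n (a : 'I_n -> bo (sp A)) (z : 'I_n -> M) u v : (forall i, A (a i)) -> mult A u -> mult A v ->
 ip (\sum_i f (u \o a i) (z i)) (\sum_i f (v \o a i) (z i))
 = ip (\sum_i f (a i) (z i)) (\sum_i f ((adj u \o v) \o a i) (z i)).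
move=> Aa mu mv; rewrite !ip_suml; apply: eq_bigr => i _.
rewrite !ip_sumr; apply: eq_bigr => j _.
have Aui := mult_l mu (Aa i); have Avj := mult_l mv (Aa j).
have bu := mult_bop mu; have bi := csa_bop hA (Aa i).
rewrite (adjP (shom_bop sf Aui)) (adjP (shom_bop sf (Aa i))) -!(shom_adj sf) //.
congr (ip _ _); rewrite adj_comp //.
have Aai' := csa_adj hA (Aa i).
have Aiu' : A (adj (a i) \o adj u) by apply: mult_r => //; exact: csa_adj.
have Auv : A ((adj u \o v) \o a j) by apply: mult_l => //; apply: csa_comp => //; exact: csa_adj.
rewrite -[LHS]/((f (adj (a i) \o adj u) \o f (v \o a j)) (z j)).
by rewrite -[RHS]/((f (adj (a i)) \o f ((adj u \o v) \o a j)) (z j)) -!(shom_comp sf).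
Qed.
(** The estimate that makes t f(a) z = f(t a) z well defined. After scaling t to a contraction t', 1
    - adj t' \o t' is the square of 1 - b inside the multiplier algebra, and the difference of the
    two squared norms becomes the square of a norm. *)
Lemma ext_sum_bnd n (a : 'I_n -> bo (sp A)) (z : 'I_n -> M) t (C : R) :
 (forall i, A (a i)) -> mult A t -> 0 < C -> bnd C t ->
 nm (\sum_i f (t \o a i) (z i)) <= C * nm (\sum_i f (a i) (z i)).
move=> Aa mt C0 hC.
pose F u := \sum_i f (u \o a i) (z i).
pose x := \sum_i f (a i) (z i).
have FZ c u : mult A u -> F (c *: u) = c *: F u.
 move=> mu; rewrite /F scaler_sumr; apply: eq_bigr => i _.
 have -> : (c *: u) \o a i = c *: (u \o a i) by [].
 by rewrite (shomZ hA sf) //; exact: mult_l.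
have FD u v : mult A u -> mult A v -> F (u + v) = F u + F v.
 move=> mu mv; rewrite /F -big_split; apply: eq_bigr => i _.
 have -> : (u + v) \o a i = (u \o a i) + (v \o a i) by [].
 by rewrite (shomD sf) //; exact: mult_l.
pose t' := (C^-1)%:C%C *: t.
have mt' : mult A t' by apply: csubZ => //; exact: csa_sub.
have t1 : bnd 1 t' by apply/(bnd_scale1 _ C0).
have bt' := mult_bop mt'.
have ms : mult A (adj t' \o t') by apply: csa_comp => //; exact: csa_adj.
have s1 : bnd 1 (adj t' \o t') by have := bnd_sq ler01 bt' t1; rewrite mulr1.
have [b [mb sb b1 eb _]] := sqrt_alg mA ms (sadj_sq bt') s1.
have mbb : mult A (b \o b) by exact: csa_comp.
have e1 : nm (F t') ^+ 2 = rip x (F (adj t' \o t')) by rewrite -ripxx /rip ext_sum_ip.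
have e2 : nm (F b) ^+ 2 = rip x (F (b \o b)) by rewrite -ripxx /rip ext_sum_ip // (adj_eq sb).
have : 0 <= nm (x - F b) ^+ 2 by exact: sqr_ge0.
rewrite nmB2 e2.
have := congr1 F eb; rewrite !FD // => /(congr1 (rip x)); rewrite !ripDr -e1 => e3.
have -> : nm x ^+ 2 - 2 * rip x (F b) + rip x (F (b \o b)) = nm x ^+ 2 - nm (F t') ^+ 2 by lra.
rewrite subr_ge0 ler_pXn2r ?nnegrE ?nm_ge0 // FZ // nmZ cn_real ?invr_ge0 ?(ltW C0) //.
by rewrite ler_pdivrMl.
Qed.
Lemma ext_ex t : mult A t -> exists s : op M M, bop s /\ forall a, A a -> s \o f a = f (t \o a).
move=> mt; have [C [C0 hC]] := bop_bnd (mult_bop mt).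
have C1 : 0 < C + 1 by rewrite ltr_wpDl.
have hC1 : bnd (C + 1) t by apply: bnd_le hC; rewrite lerDl.
have [||s [bs _ hs]] := @graph_ext R M M (bo (sp A) * M) [set p | A p.1]
  (fun p => f p.1 p.2) (fun p => f (t \o p.1) p.2) (C + 1) (ltW C1).
- by apply: hdense_sub rf.2 => _ [_ [a Aa <-] [z _ <-]]; exists (a, z).
- move=> n c s hs.
 have e u : mult A u -> \sum_i c i *: f (u \o (s i).1) (s i).2 = \sum_i f (u \o (s i).1) (c i *: (s i).2).
  move=> mu; apply: eq_bigr => i _; rewrite (linZ (bop_lin (shom_bop sf _))) //.
  exact: mult_l (hs i).
 have := e _ (mult_id A) => /= ->; rewrite e //.
 exact: ext_sum_bnd.
by exists s; split=> // a Aa; apply/funext => z; exact: (hs (a, z)).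
Qed.
Lemma ext_uniq t s : bop s -> (forall a, A a -> s \o f a = f (t \o a)) -> ext f t = s.
move=> bs hs; apply: xget_unique => // s' [bs' hs'].
apply: (hdense_eq rf.2) => // _ [_ [a Aa <-] [z _ <-]].
by rewrite -[LHS]/((s' \o f a) z) -[RHS]/((s \o f a) z) hs // hs'.
Qed.
Lemma extP t : mult A t -> bop (ext f t) /\ forall a, A a -> ext f t \o f a = f (t \o a).
by move=> /ext_ex[s [bs hs]]; rewrite (ext_uniq bs hs). Qed.
Lemma ext_bop t : mult A t -> bop (ext f t).
by move=> /extP[]. Qed.
Lemma ext_l t a : mult A t -> A a -> ext f t \o f a = f (t \o a).
by move=> /extP[_ h]; exact: h. Qed.
Lemma ext_in a : A a -> ext f a = f a.
move=> Aa; apply: ext_uniq; first exact: (shom_bop sf Aa).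
by move=> b Ab; rewrite (shom_comp sf).
Qed.
Lemma ext_id : ext f id = id.
by apply: ext_uniq => //; exact: bop_id. Qed.
Lemma ext_shom : shom (mult A) (ext f).
split=> [t /ext_bop//|c s t ms mt|s t ms mt|t mt].
- apply: ext_uniq => [|a Aa]; first by apply: bop_lincomb; exact: ext_bop.
 have -> : (c *: s + t) \o a = c *: (s \o a) + (t \o a) by [].
 rewrite (shom_lin sf) ?mult_l //; [|exact: mult_l..].
 by rewrite -(ext_l ms Aa) -(ext_l mt Aa).
- apply: ext_uniq => [|a Aa]; first by apply: bop_comp; exact: ext_bop.
 have e1 := ext_l mt Aa; have e2 := ext_l ms (mult_l mt Aa).
 by rewrite -[_ \o f a]/(ext f s \o (ext f t \o f a)) e1 e2.
- have bt := ext_bop mt; have mt' := csa_adj mA mt.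
 apply: ext_uniq => [|a Aa]; first exact: bop_adj.
 apply: (@hdense_eq _ _ _ setT) => [x e e0||| z _].
 + by exists x; [exact: sub_lspan|rewrite subrr nm0 ltW].
 + by apply: bop_comp; [exact: bop_adj|exact: (shom_bop sf Aa)].
 + by apply: (shom_bop sf); exact: mult_l.
 + have Ata := mult_l mt' Aa.
  apply: subr0_eq.
  have hz v : vecs (f @` els A) v -> ip v (adj (ext f t) (f a z) - f (adj t \o a) z) = 0.
   move=> [_ [b Ab <-] [w _ <-]]; rewrite ipBr -adjP //.
   rewrite -[ext f t _]/((ext f t \o f b) w) ext_l //.
   have Atb := mult_l mt Ab.
   rewrite !(adjP (shom_bop sf _)) // -!(shom_adj sf) //.
   rewrite -[f _ (f a z)]/((f (adj (t \o b)) \o f a) z) -[f _ (f _ z)]/((f (adj b) \o f (adj t \o a)) z).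
   rewrite -!(shom_comp sf) //; try exact: csa_adj.
   by rewrite adj_comp ?subrr //; [exact: mult_bop|exact: (csa_bop hA Ab)].
  set w := (X in X = 0) in hz *.
  (* A vector orthogonal to a total set is zero: the rank-one operator of w with itself vanishes on
     that set. *)
  have : (rank1 w w : op M M) = 0.
   apply: (hdense_eq rf.2) => [||v hv]; [|exact: bop0|].
    apply: (@mk_bop _ _ _ _ (nm w * nm w)) => [c x y||x].
    * by rewrite /rank1 ipDr ipZr scalerDl scalerA.
    * by rewrite mulr_ge0 ?nm_ge0.
    * rewrite /rank1 nmZ mulrAC ler_wpM2r ?nm_ge0 //; exact: cauchy_schwarz.
   by rewrite /rank1 ipC hz // conjC0 scale0r.
  move=> /(congr1 (fun g => g w)); rewrite /rank1 ipxx op0E => /eqP.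
  rewrite scaler_eq0 => /orP[/eqP e|/eqP//].
  by apply: nm_eq0; apply/eqP; rewrite -sqrf_eq0; move: e => [->].
Qed.
Lemma ext_inj : finj (els A) f -> finj (mult A) (ext f).
move=> fi s t ms mt e; apply: (hdense_eq (cstar_dense cA)); [exact: mult_bop..|].
move=> _ [a Aa [z _ <-]]; rewrite -[s _]/((s \o a) z) -[t _]/((t \o a) z); congr (_ z).
by apply: fi; [exact: mult_l|exact: mult_l|rewrite -(ext_l ms Aa) -(ext_l mt Aa) e].
Qed.
Lemma ext_un t : mult A t -> unitary t -> unitary (ext f t).
move=> mt /unP[bt h1 h2]; apply/unP; have mt' := csa_adj mA mt.
split; first exact: ext_bop.
 by rewrite -(shom_adj ext_shom) // -(shom_comp ext_shom) // h1 ext_id.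
by rewrite -(shom_adj ext_shom) // -(shom_comp ext_shom) // h2 ext_id.
Qed.
End Ext.
End Reps.

(** * Morphisms, compact operators and composition *)

Section Morphisms.
Variable R : realType.
Implicit Types (H K M N : hilbert R) (A B D : opalg R).
Lemma csub_mull H K L (X : set (op H L)) (s : op K L) : csub X -> bop s ->
 csub [set t : op H K | bop t /\ X (s \o t)].
move=> cX bs; have [C [C0 hC]] := bop_bnd bs; have ls := bop_lin bs.
apply: (csub_pre (fun t => s \o t) C) => //.
- exact: csub_bop.
- by move=> a u v _ _; exists a; apply/funext => x; rewrite /= !opDE !opZE /= ls.
- by move=> u v _ _; apply/funext => x; rewrite /= !opBE /= (linB ls).
- by move=> M t M0 _ h; exact: bnd_comp.
Qed.
Lemma csub_mulr H K L (X : set (op H L)) (s : op H K) : csub X -> bop s ->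
 csub [set t : op K L | bop t /\ X (t \o s)].
move=> cX bs; have [C [C0 hC]] := bop_bnd bs.
apply: (csub_pre (fun t => t \o s) C) => //.
- exact: csub_bop.
- by move=> a u v _ _; exists a.
- by move=> M t M0 _ h; rewrite mulrC; exact: bnd_comp.
Qed.
Lemma csub_adj H K (X : set (op K H)) : csub X -> csub [set t : op H K | bop t /\ X (adj t)].
move=> cX.
apply: (csub_pre (fun t => adj t) 1) => //.
- exact: csub_bop.
- by move=> a u v bu bv; exists (a^*); rewrite adj_lincomb.
- by move=> u v bu bv; rewrite adjB.
- by move=> M t M0 bt h; rewrite mul1r; exact: adj_bnd.
Qed.
Lemma prodset_sub H (X Y Z : set (op H H)) : csub Z -> (forall x y, X x -> Y y -> Z (x \o y)) -> prodset X Y `<=` Z.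
by move=> cZ h; apply: cspan_min => // _ [x Xx [y Yy <-]]; exact: h. Qed.
Lemma prodset_in H (X Y : set (op H H)) x y : X x -> Y y -> prodset X Y (x \o y).
by move=> Xx Yy; apply: sub_cspan; exists x => //; exists y. Qed.
Lemma rank1_bop H (x y : H) : bop (rank1 x y).
apply: (@mk_bop _ _ _ _ (nm x * nm y)) => [c u v||u].
- by rewrite /rank1 ipDr ipZr scalerDl scalerA.
- by rewrite mulr_ge0 ?nm_ge0.
- rewrite /rank1 nmZ mulrC -mulrA ler_wpM2l ?nm_ge0 //; exact: cauchy_schwarz.
Qed.
Lemma rank1_adj H (x y : H) : adj (rank1 x y) = rank1 y x.
apply: adj_eq => u v; rewrite /rank1 ipZl ipZr mulrC; congr (_ * _).
by rewrite -ipC.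
Qed.
Lemma bop_rank1 H (t : op H H) (x y : H) : bop t -> t \o rank1 x y = rank1 (t x) y.
by move=> bt; apply/funext => z; rewrite /= /rank1 (linZ (bop_lin bt)). Qed.
Lemma rank1_bopr H (t : op H H) (x y : H) : bop t -> rank1 x y \o t = rank1 x (adj t y).
by move=> bt; apply/funext => z; rewrite /= /rank1 adjPr. Qed.
Lemma ip_dense_eq H (D : set H) (v w : H) : hdense D -> (forall x, D x -> ip x v = ip x w) -> v = w.
move=> hD h; apply: subr0_eq; set u := v - w.
have e0 : rank1 u u = 0 :> op H H.
 apply: (hdense_eq hD) => [||x Dx]; [exact: rank1_bop|exact: bop0|].
 by rewrite /rank1 ipC ipBr h // subrr conjC0 scale0r.
move: (congr1 (fun g => g u) e0).
rewrite /rank1 ipxx op0E => /eqP; rewrite scaler_eq0 => /orP[/eqP e|/eqP//].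
by apply: nm_eq0; apply/eqP; rewrite -sqrf_eq0; move: e => [->].
Qed.
Lemma adj_dense H K (D : set H) (E : set K) (t : op H K) (s : op K H) : hdense D -> hdense E -> bop t -> bop s ->
 (forall x y, D x -> E y -> ip (t x) y = ip x (s y)) -> adj t = s.
move=> hD hE bt bs h; apply: (hdense_eq hE) => [||y Ey]; [exact: bop_adj|exact: bs|].
by apply: (ip_dense_eq hD) => x Dx; rewrite -adjP // h.
Qed.
Lemma Kop_mult H : mult (Kop H) = @bop R H H.
apply/seteqP; split=> [t []//|t bt]; split=> // a Ka; have cK := csub_cspan [set rank1 x y | x in [set: H] & y in [set: H]].
split.
 have := cspan_min (csub_mull cK bt); case/(_ _ _ _ Ka) => // _ [x _ [y _ <-]].
 by split; [exact: rank1_bop|rewrite bop_rank1 //; apply: sub_cspan; exists (t x) => //; exists y].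
have := cspan_min (csub_mulr cK bt); case/(_ _ _ _ Ka) => // _ [x _ [y _ <-]].
by split; [exact: rank1_bop|rewrite rank1_bopr //; apply: sub_cspan; exists x => //; exists (adj t y)].
Qed.
Lemma unitvec H (x : H) : exists y : H, ip y y *: x = x.
have [->|x0] := eqVneq x 0; first by exists 0; rewrite scaler0.
have n0 : nm x != 0 by apply: contra x0 => /eqP/nm_eq0/eqP.
exists ((nm x)^-1%:C%C *: x).
by rewrite ipxx nmZ cn_real ?invr_ge0 ?nm_ge0 // mulVf // expr1n scale1r.
Qed.
Lemma Kop_cstar H : cstar (Kop H).
have cK := csub_cspan [set rank1 x y | x in [set: H] & y in [set: H]].
have bK a : Kop H a -> bop a by apply: cspan_min; [exact: csub_bop|move=> _ [x _ [y _ <-]]; exact: rank1_bop].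
apply: mk_cstar.
 split=> //.
  by move=> a b Ka /bK bb; have : mult (Kop H) b by [rewrite Kop_mult]; move=> /mult_r; exact.
 move=> a Ka; have := cspan_min (csub_adj cK); case/(_ _ _ _ Ka) => // _ [x _ [y _ <-]].
 by split; [exact: rank1_bop|rewrite rank1_adj; apply: sub_cspan; exists y => //; exists x].
move=> x e e0; exists x; last by rewrite subrr nm0 ltW.
have [y hy] := unitvec x; apply: sub_lspan.
exists (rank1 x y); last by exists y.
by apply: sub_cspan; exists x => //; exists y.
Qed.

Section Morphism.
Variables (A B : opalg R) (f : premor A B) (cA : cstar A) (cB : cstar B) (mf : morphism f).
Lemma mor_mult a : A a -> mult B (f a). by case: mf => h _ _ _ _; exact: h. Qed.
Lemma morph_shom : shom (els A) f.
by case: mf => h1 h2 h3 h4 _; split=> // a Aa; exact: mult_bop (h1 _ Aa). Qed.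
Lemma morph_prod : prodset (f @` els A) (els B) = els B.
by case: mf. Qed.
Lemma morph_rep : rep f.
split; first exact: morph_shom.
apply: hdense_trans (cstar_dense cB) _ => _ e [b Bb [z _ <-]] e0.
have : prodset (f @` els A) (els B) b by rewrite morph_prod.
have d0 : 0 < e / (nm z + 1) by rewrite divr_gt0 // ltr_wpDl ?nm_ge0.
move=> /nclP /(_ _ d0) [s Ls hs]; exists (s z).
 elim/lspan_ind: s / Ls {hs} => [|c s v [x [a Aa <-] [b' Bb' <-]] IH]; first exact: lspan0.
 by apply: lspan_cons => //; exists (f a); [exists a|exists (b' z)].
apply: le_trans (hs z) _; rewrite mulrAC -mulrA ler_piMr ?(ltW e0) //.
by rewrite ler_pdivrMr ?mul1r ?lerDl // ltr_wpDl ?nm_ge0.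
Qed.
Lemma morph_ind (X : set (bo (sp B))) : csub X -> (forall a b, A a -> B b -> X (f a \o b)) -> els B `<=` X.
by move=> cX h; rewrite -morph_prod; apply: prodset_sub => // _ b [a Aa <-]; exact: h.
Qed.
Lemma ext_mult t : mult A t -> mult B (ext f t).
move=> mt; have rf := morph_rep; have bt := ext_bop cA rf mt.
have key t' : mult A t' -> forall b, B b -> B (ext f t' \o b).
 move=> mt' b Bb; have bt' := ext_bop cA rf mt'.
 have := morph_ind (csub_mull (cstar_sub cB) bt'); case/(_ _ _ Bb) => // a b' Aa Bb'.
 split; first exact: bop_comp (mult_bop (mor_mult Aa)) (cs_bop cB Bb').
 rewrite -[_ \o _]/((ext f t' \o f a) \o b') ext_l //.
 by apply: mult_l => //; apply: mor_mult; exact: mult_l.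
split=> // b Bb; split; first exact: key.
have Bb' := csa_adj (cs_alg cB) Bb; have bb := cs_bop cB Bb.
have mt' := csa_adj (mult_csalg cA) mt.
have := csa_adj (cs_alg cB) (key _ mt' _ Bb').
have bb' := bop_adj bb; have bext := ext_bop cA rf mt'.
by rewrite (adj_comp bext bb') adjK // (shom_adj (ext_shom cA rf)) // adjK.
Qed.
Lemma mextE t : mult A t -> mext f t = ext f t.
move=> mt; have rf := morph_rep; apply: xget_unique.
 by split; [exact: ext_mult|move=> a Aa; exact: ext_l].
move=> s [[bs _] hs].
by symmetry; apply: (ext_uniq rf).
Qed.
Lemma mext_mult t : mult A t -> mult B (mext f t).
by move=> mt; rewrite mextE //; exact: ext_mult. Qed.
Lemma mext_in a : A a -> mext f a = f a.
move=> Aa; have ma := mult_in cA Aa; rewrite mextE //.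
exact: (ext_in morph_rep Aa).
Qed.

Section Comp.
Variables (M : hilbert R) (g : sp B ~> M) (rg : rep g).
Lemma rep_comp : rep (ext g \o f).
have eg := ext_shom cB rg; have sf := morph_shom.
split.
 split.
 - by move=> a Aa; apply: (ext_bop cB rg); exact: mor_mult.
 - move=> c a b Aa Ab /=; rewrite (shom_lin sf) // (shom_lin eg) //; exact: mor_mult.
 - move=> a b Aa Ab; rewrite /= (shom_comp sf) // (shom_comp eg) //; exact: mor_mult.
 - move=> a Aa /=; rewrite (shom_adj sf) // (shom_adj eg) //; exact: mor_mult.
apply: hdense_trans rg.2 _ => _ e [_ [b Bb <-] [z _ <-]] e0.
have : prodset (f @` els A) (els B) b by rewrite morph_prod.
have d0 : 0 < e / (nm z + 1) by rewrite divr_gt0 // ltr_wpDl ?nm_ge0.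
move=> /nclP /(_ _ d0) [s Ls hs].
have [Bs Ls'] : B s /\ lspan (vecs ((ext g \o f) @` els A)) (g s z).
 elim/lspan_ind: s / Ls {hs} => [|c s v [x [a Aa <-] [b' Bb' <-]] [IH1 IH2]].
  by split; [exact: csub0 (cstar_sub cB)|rewrite (shom0 (cs_alg cB) rg.1); exact: lspan0].
 have Bab : B (f a \o b') by apply: mult_l => //; exact: mor_mult.
 split; first exact: (csub_lincomb (cstar_sub cB)).
 rewrite (shom_lin rg.1) //; apply: lspan_cons => //.
 exists (ext g (f a)); first by exists a.
 exists (g b' z) => //; rewrite -[LHS]/((ext g (f a) \o g b') z) ext_l //.
 exact: mor_mult.
exists (g s z) => //.
have := shom_contr (cs_alg cB) rg.1 (csubB (cstar_sub cB) Bb Bs) (ltW d0) hs z.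
rewrite (shomB rg.1) // opBE => /le_trans; apply.
rewrite mulrAC -mulrA ler_piMr ?(ltW e0) //.
by rewrite ler_pdivrMr ?mul1r ?lerDl // ltr_wpDl ?nm_ge0.
Qed.
Lemma ext_comp t : mult A t -> ext (ext g \o f) t = ext g (ext f t).
move=> mt; have mft := ext_mult mt.
apply: (ext_uniq rep_comp) => [|a Aa /=]; first exact: ext_bop.
by rewrite -(shom_comp (ext_shom cB rg)) ?(ext_l cA morph_rep) //; exact: mor_mult.
Qed.
End Comp.
End Morphism.
Lemma mk_morphism A B (f : sp A ~> sp B) : cstar B -> shom (els A) f -> (forall a, A a -> mult B (f a)) ->
 els B `<=` prodset (f @` els A) (els B) -> morphism (PreMor A B f).
move=> cB [h1 h2 h3 h4] hm hp; split=> //; apply/seteqP; split=> //.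
apply: prodset_sub; first exact: cstar_sub.
by move=> _ b [a Aa <-] Bb; apply: mult_l => //; exact: hm.
Qed.
(** The approximate right unit of [csalg_approx1] factors every element up to a small error. *)
Lemma cstar_prod A : cstar A -> els A `<=` prodset (els A) (els A).
move=> cA a Aa; apply: (csub_lim (csub_cspan _)) => e e0.
have [y Ay hy] := csalg_approx1 (cs_alg cA) Aa e0.
by exists (a \o y) => //; exact: prodset_in.
Qed.
Lemma idm_morphism A : cstar A -> morphism (idm A).
move=> cA; apply: mk_morphism => //; first exact: (rep_id cA).1.
 by move=> a; exact: mult_in.
by rewrite image_id; exact: cstar_prod.
Qed.
Lemma ext_idE A t : cstar A -> mult A t -> ext (A := A) (M := sp A) id t = t.
by move=> cA mt; apply: (ext_uniq (rep_id cA)) => //; exact: mult_bop mt. Qed.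
Lemma morphism_Kop A M (f : premor A (Kop M)) : morphism f -> rep f.
by move=> mf; apply: morph_rep => //; exact: Kop_cstar. Qed.
Lemma morph_comp A B D (f : premor A B) (g : premor B D) : cstar A -> cstar B -> cstar D ->
 morphism f -> morphism g -> morphism (PreMor A D (ext g \o f)).
move=> cA cB cD mf mg; have rg := morph_rep cD mg.
apply: mk_morphism => //; first exact: (rep_comp cB mf rg).1.
 by move=> a Aa; apply: ext_mult => //; exact: mor_mult.
have cP := csub_cspan [set x \o y | x in (ext g \o f) @` els A & y in els D].
apply: (morph_ind mg) => // b y Bb Dy.
have by_ : bop y := cs_bop cD Dy.
suff : [set b | B b /\ prodset ((ext g \o f) @` els A) (els D) (g b \o y)] b by case.
have [C [C0 hC]] := bop_bnd by_.
have sg := morph_shom mg.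
apply: (morph_ind mf) Bb.
 apply: (csub_pre (fun b => g b \o y) C) => //.
 - exact: cstar_sub.
 - by move=> a s t Bs Bt; exists a; rewrite (shom_lin sg).
 - by move=> s t Bs Bt; rewrite (shomB sg).
 - move=> M t M0 Bt hM; rewrite mulrC; apply: bnd_comp => //.
  exact: (shom_contr (cs_alg cB) sg Bt M0 hM).
move=> a b' Aa Bb'; have mfa := mor_mult mf Aa; split; first exact: mult_l.
rewrite -(ext_l cB rg mfa Bb').
apply: (@prodset_in _ _ _ (ext g (f a)) (g b' \o y)); first by exists a.
by apply: mult_l => //; exact: mor_mult.
Qed.
Lemma shom_eq_ext A M (f g : sp A ~> M) t : cstar A -> rep f ->
 (forall a, A a -> f a = g a) -> mult A t -> ext g t = ext f t.
move=> cA rf e mt.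
rewrite /ext; congr (xget _ _); apply/funext => s; apply/propext; split=> -[bs hs]; split=> // a Aa.
 by rewrite e // hs // e //; exact: mult_l.
by rewrite -e // hs // e //; exact: mult_l.
Qed.
Lemma rep_eq A M (f g : sp A ~> M) : rep f -> cstar A -> (forall a, A a -> f a = g a) -> rep g.
move=> [[h1 h2 h3 h4] hd] cA e; have hA := cs_alg cA; split.
 split.
 - by move=> a Aa; rewrite -e //; exact: h1.
 - by move=> c a b Aa Ab; rewrite -(e _ Aa) -(e _ Ab) -(e _ (csub_lincomb (csa_sub hA) c Aa Ab)) h2.
 - by move=> a b Aa Ab; rewrite -(e _ Aa) -(e _ Ab) -(e _ (csa_comp hA Aa Ab)) h3.
 - by move=> a Aa; rewrite -(e _ Aa) -(e _ (csa_adj hA Aa)) h4.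
suff -> : g @` els A = f @` els A by [].
by apply/seteqP; split=> _ [a Aa <-]; exists a => //; rewrite e.
Qed.

Section Conj.
Variables (A : opalg R) (M N : hilbert R) (f : sp A ~> M) (u : op M N) (cA : cstar A) (rf : rep f) (uu : unitary u).
End Conj.
End Morphisms.

(** * Unitaries from Gram matrices and the estimate for one tensor leg *)

Section GraphIso.
Variable R : realType.
Implicit Types H K L M : hilbert R.
(** Equal Gram matrices make the assignment isometric in both directions; the two extensions are
    then inverse to each other on total sets. *)
Lemma graph_un H K (I : Type) (S : set I) (u : I -> H) (v : I -> K) :
 hdense [set u i | i in S] -> hdense [set v i | i in S] ->
 (forall i j, S i -> S j -> ip (v i) (v j) = ip (u i) (u j)) ->
 exists t : op H K, [/\ unitary t, (forall i, S i -> t (u i) = v i) & forall i, S i -> adj t (v i) = u i].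
move=> du dv huv.
have nms (H' : hilbert R) (w : I -> H') n (c : 'I_n -> R[i]) (s : 'I_n -> I) :
  nm (\sum_i c i *: w (s i)) ^+ 2 = complex.Re (\sum_i \sum_j (c i)^* * (c j * ip (w (s i)) (w (s j)))).
 rewrite -ripxx /rip ip_suml; congr complex.Re; apply: eq_bigr => i _.
 rewrite ip_sumr; apply: eq_bigr => j _.
 by rewrite ipZl ipZr.
have iso n (c : 'I_n -> R[i]) (s : 'I_n -> I) : (forall i, S (s i)) ->
  nm (\sum_i c i *: v (s i)) = nm (\sum_i c i *: u (s i)).
 move=> hs; apply/eqP; rewrite -(eqrXn2 (n := 2)) ?nm_ge0 // !nms; apply/eqP.
 by congr complex.Re; apply: eq_bigr => i _; apply: eq_bigr => j _; rewrite huv.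
have [||t [bt _ ht]] := @graph_ext R H K I S u v 1 ler01 => //.
 by move=> n c s hs; rewrite iso // mul1r.
have [||t' [bt' _ ht']] := @graph_ext R K H I S v u 1 ler01 => //.
 by move=> n c s hs; rewrite -iso // mul1r.
have h1 : t' \o t = id.
 apply: (hdense_eq du) => [||_ [i Si <-]]; [exact: bop_comp|exact: bop_id|].
 by rewrite /= ht // ht'.
have h2 : t \o t' = id.
 apply: (hdense_eq dv) => [||_ [i Si <-]]; [exact: bop_comp|exact: bop_id|].
 by rewrite /= ht' // ht.
have ea : adj t = t'.
 apply: (hdense_eq dv) => [||_ [i Si <-]]; [exact: bop_adj|exact: bt'|].
 by apply: (ip_dense_eq du) => _ [j Sj <-]; rewrite -adjP // ht // ht' // huv.
exists t; split=> // [|i Si]; last by rewrite ea ht'.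
by apply/unP; split; rewrite ?ea.
Qed.

(* Bilinear maps with a multiplicative inner product: both the tensor and the
  swapped tensor are instances. *)
Lemma half_bnd H H' K L L' (p : H -> K -> L) (p' : H' -> K -> L') (s : op H H') (C : R) :
 (forall k, linear (p^~ k)) -> (forall k, linear (p'^~ k)) ->
 (forall h k h1 k1, ip (p h k) (p h1 k1) = ip h h1 * ip k k1) ->
 (forall h k h1 k1, ip (p' h k) (p' h1 k1) = ip h h1 * ip k k1) -> bop s -> 0 < C -> bnd C s ->
 forall n (h : 'I_n -> H) (k : 'I_n -> K), nm (\sum_i p' (s (h i)) (k i)) <= C * nm (\sum_i p (h i) (k i)).
move=> lp lp' ipp ipp' bs C0 hC n h k.
pose s' := (C^-1)%:C%C *: s.
have bs' : bop s' by exact: bopZ.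
have s1 : bnd 1 s' by apply/(bnd_scale1 _ C0).
have ms : bop (adj s' \o s') by apply: bop_comp => //; exact: bop_adj.
have ss1 : bnd 1 (adj s' \o s') by have := bnd_sq ler01 bs' s1; rewrite mulr1.
have [b [bb sb b1 eb _]] := sqrt_alg (bop_csalg H) ms (sadj_sq bs') ss1.
pose x := \sum_i p (h i) (k i); pose F u := \sum_i p (u (h i)) (k i).
have eip u v : is_adj u v -> forall w, ip (F u) (F w) = ip x (F (v \o w)).
 move=> huv w; rewrite !ip_suml; apply: eq_bigr => i _.
 by rewrite !ip_sumr; apply: eq_bigr => j _; rewrite !ipp huv.
have e1 : nm (\sum_i p' (s' (h i)) (k i)) ^+ 2 = rip x (F (adj s' \o s')).
 rewrite -ripxx /rip; congr complex.Re; rewrite !ip_suml; apply: eq_bigr => i _.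
 by rewrite !ip_sumr; apply: eq_bigr => j _; rewrite ipp ipp' adjP.
have e2 : nm (F b) ^+ 2 = rip x (F (b \o b)) by rewrite -ripxx /rip (eip _ _ sb).
have FD u v : F (u + v) = F u + F v by rewrite /F -big_split; apply: eq_bigr => i _; rewrite opDE (linD (lp _)).
have : 0 <= nm (x - F b) ^+ 2 by exact: sqr_ge0.
rewrite nmB2 e2.
have := congr1 F eb; rewrite !FD => /(congr1 (rip x)); rewrite !ripDr -e1 => e3 h0.
have : nm (\sum_i p' (s' (h i)) (k i)) ^+ 2 <= nm x ^+ 2 by lra.
rewrite ler_pXn2r ?nnegrE ?nm_ge0 //.
have -> : \sum_i p' (s' (h i)) (k i) = (C^-1)%:C%C *: \sum_i p' (s (h i)) (k i).
 by rewrite scaler_sumr; apply: eq_bigr => i _; rewrite /s' opZE (linZ (lp' _)).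
by rewrite nmZ cn_real ?invr_ge0 ?(ltW C0) // ler_pdivrMl.
Qed.
Lemma cspan_csalg H (S : set (op H H)) : S `<=` @bop R H H ->
 (forall a b, S a -> S b -> cspan S (a \o b)) -> (forall a, S a -> cspan S (adj a)) -> csalg (cspan S).
move=> Sb Sc Sa; have cS := csub_cspan S.
have bS a : cspan S a -> bop a by apply: cspan_min => //; exact: csub_bop.
split=> // [a b ha hb|a ha].
 have := cspan_min (csub_mulr cS (bS _ hb)); case/(_ _ _ _ ha) => // s Ss.
 split; first exact: Sb.
 have := cspan_min (csub_mull cS (Sb _ Ss)); case/(_ _ _ _ hb) => // t St.
 by split; [exact: Sb|exact: Sc].
have := cspan_min (csub_adj cS); case/(_ _ _ _ ha) => // s Ss.
by split; [exact: Sb|exact: Sa].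
Qed.
End GraphIso.

(** * Tensor products of operators, flip and associator *)

Section Tensors.
Variables (R : realType) (T : hilbert_tensor R).
Local Notation "H *t K" := (ht T H K) (at level 40, left associativity).
Local Notation "A *T B" := (tens T A B) (at level 40, left associativity).
Local Notation otens := (@Defs.otens R T _ _ _ _).
Local Notation flip H K := (@Defs.flip R T H K).
Local Notation assoc H K L := (@Defs.assoc R T H K L).

Section TensorOps.
Implicit Types H K L M : hilbert R.
Implicit Types A B C : opalg R.
Local Notation pt := (pt T).
Lemma ptl H K (k : K) : linear (fun h : H => pt h k : H *t K).
by move=> a x y; exact: (@pt_linearl _ T H K k). Qed.
Lemma ptr H K (h : H) : linear (fun k : K => pt h k : H *t K).
exact: pt_linearr. Qed.
Lemma nm_pt H K (h : H) (k : K) : nm (pt h k) = nm h * nm k.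
apply/eqP; rewrite -(eqrXn2 (n := 2)) ?mulr_ge0 ?nm_ge0 // exprMn -!ripxx /rip pt_ip !ipxx.
by rewrite -rmorphM.
Qed.
Lemma bop_ptl H K (k : K) : bop (fun h : H => pt h k : H *t K).
by apply: (@mk_bop _ _ _ _ (nm k)); [exact: ptl|exact: nm_ge0|move=> h; rewrite nm_pt mulrC].
Qed.
Lemma bop_ptr H K (h : H) : bop (fun k : K => pt h k : H *t K).
by apply: (@mk_bop _ _ _ _ (nm h)); [exact: ptr|exact: nm_ge0|move=> k; rewrite nm_pt].
Qed.
Definition pures H K (D : set H) (E : set K) : set (H *t K) := [set pt h k | h in D & k in E].
Lemma hdenseT H : hdense [set: H].
by move=> x e e0; exists x; [exact: sub_lspan|rewrite subrr nm0 ltW]. Qed.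
Lemma pures_dense H K : hdense (pures [set: H] [set: K]).
by apply/denseP; exact: pt_total. Qed.

Lemma lspan_approx H K (D : set H) (E : set K) (t : op H K) x (e : R) : bop t ->
 hdense D -> (forall v, D v -> lspan E (t v)) -> 0 < e -> exists2 y, lspan E y & nm (t x - y) <= e.
move=> bt hD hE e0; have [M [M0 hM]] := bop_bnd bt.
have M1 : 0 < M + 1 by rewrite ltr_wpDl.
have d0 : 0 < e / (M + 1) by rewrite divr_gt0.
have [y Ly hy] := hD x _ d0; exists (t y).
 elim/lspan_ind: y / Ly {hy} => [|a v w Dv IH].
  by rewrite (lin0 (bop_lin bt)); exact: lspan0.
 by rewrite (bop_lin bt); apply: lspan_lincomb => //; exact: hE.
rewrite -(linB (bop_lin bt)); apply: le_trans (hM _) _.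
apply: le_trans (ler_wpM2l M0 hy) _; rewrite mulrCA ler_piMr ?(ltW e0) //.
by rewrite ler_pdivrMr // mul1r lerDl.
Qed.
Lemma pt_dense H K (D : set H) (E : set K) : hdense D -> hdense E -> hdense (pures D E).
move=> hD hE.
have h1 : hdense (pures [set: H] E).
 apply: hdense_trans (@pures_dense H K) _ => _ e [h _ [k _ <-]] e0.
 have hv v : E v -> lspan (pures [set: H] E) (pt h v) by move=> Ev; apply: sub_lspan; exists h => //; exists v.
 have [y Ly hy] := lspan_approx k (@bop_ptr H K h) hE hv e0.
 by exists y.
apply: hdense_trans h1 _ => _ e [h _ [k Ek <-]] e0.
have hv v : D v -> lspan (pures D E) (pt v k) by move=> Dv; apply: sub_lspan; exists v => //; exists k.
have [y Ly hy] := lspan_approx h (@bop_ptl H K k) hD hv e0.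
by exists y.
Qed.
Lemma bop_pt_eq H K L (s t : op (H *t K) L) : bop s -> bop t -> (forall h k, s (pt h k) = t (pt h k)) -> s = t.
by move=> bs bt h; apply: (hdense_eq (@pures_dense H K)) => // _ [x _ [y _ <-]].
Qed.
(** One leg at a time: [half_bnd] bounds the action of s on the first factor, then, for the swapped
    bilinear map, the action of t on the second. *)
Lemma otens_ex H K H' K' (s : op H H') (t : op K K') (C D : R) :
 bop s -> bop t -> 0 < C -> 0 < D -> bnd C s -> bnd D t ->
 exists r : op (H *t K) (H' *t K'), [/\ bop r, bnd (C * D) r & forall h k, r (pt h k) = pt (s h) (t k)].
move=> bs bt C0 D0 hC hD.
have [|||r [br hr er]] := @graph_ext R (H *t K) (H' *t K') (H * K) setT
 (fun p => pt p.1 p.2) (fun p => pt (s p.1) (t p.2)) (C * D).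
- by rewrite mulr_ge0 // ltW.
- apply: hdense_sub (@pures_dense H K) => _ [h _ [k _ <-]].
 by exists (h, k).
- move=> n c p _.
 have e1 : \sum_i c i *: pt (p i).1 (p i).2 = \sum_i pt (c i *: (p i).1) (p i).2.
  by apply: eq_bigr => i _; rewrite (linZ (@ptl _ _ _)).
 have e2 : \sum_i c i *: pt (s (p i).1) (t (p i).2) = \sum_i pt (s (c i *: (p i).1)) (t (p i).2).
  by apply: eq_bigr => i _; rewrite -(linZ (@ptl _ _ _)) (linZ (bop_lin bs)).
 rewrite e1 e2.
 have h1 : nm (\sum_i pt (s (c i *: (p i).1)) (t (p i).2)) <= C * nm (\sum_i pt (c i *: (p i).1) (t (p i).2)).
  apply: (@half_bnd R H H' K' (H *t K') (H' *t K') (@Defs.pt R T H K') (@Defs.pt R T H' K')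
   s C _ _ _ _ bs C0 hC n (fun i => c i *: (p i).1) (fun i => t (p i).2)).
  + exact: ptl.
  + exact: ptl.
  + by move=> *; exact: pt_ip.
  + by move=> *; exact: pt_ip.
 have h2 : nm (\sum_i pt (c i *: (p i).1) (t (p i).2)) <= D * nm (\sum_i pt (c i *: (p i).1) (p i).2).
  apply: (@half_bnd R K K' H (H *t K) (H *t K') (fun k h => pt h k) (fun k h => pt h k)
   t D _ _ _ _ bt D0 hD n (fun i => (p i).2) (fun i => c i *: (p i).1)).
  + by move=> h; exact: ptr.
  + by move=> h; exact: ptr.
  + by move=> *; rewrite pt_ip mulrC.
  + by move=> *; rewrite pt_ip mulrC.
 by apply: le_trans h1 _; rewrite -mulrA ler_wpM2l // ltW.
by exists r; split=> // h k; exact: (er (h, k)).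
Qed.

Section Otens.
Variables (H K H' K' : hilbert R).
Implicit Types (s : op H H') (t : op K K').
Lemma otens_uniq s t (r : op (H *t K) (H' *t K')) : bop r ->
 (forall h k, r (pt h k) = pt (s h) (t k)) -> otens s t = r.
move=> br hr; apply: xget_unique => // r' [br' hr'].
by apply: bop_pt_eq => // h k; rewrite hr hr'.
Qed.
Lemma otensP s t : bop s -> bop t -> bop (otens s t) /\ forall h k, otens s t (pt h k) = pt (s h) (t k).
move=> bs bt; have [C [C0 hC]] := bop_bnd bs; have [D [D0 hD]] := bop_bnd bt.
have C1 : 0 < C + 1 by rewrite ltr_wpDl.
have D1 : 0 < D + 1 by rewrite ltr_wpDl.
have hC1 : bnd (C + 1) s by apply: bnd_le hC; rewrite lerDl.
have hD1 : bnd (D + 1) t by apply: bnd_le hD; rewrite lerDl.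
have [r [br _ hr]] := otens_ex bs bt C1 D1 hC1 hD1.
by rewrite (otens_uniq br hr).
Qed.
Lemma bop_otens s t : bop s -> bop t -> bop (otens s t).
by move=> bs bt; have [] := otensP bs bt. Qed.
Lemma otensE s t h k : bop s -> bop t -> otens s t (pt h k) = pt (s h) (t k).
by move=> bs bt; have [] := otensP bs bt. Qed.
Lemma otens_bnd s t (C D : R) : bop s -> bop t -> 0 <= C -> 0 <= D -> bnd C s -> bnd D t -> bnd (C * D) (otens s t).
move=> bs bt C0 D0 hC hD; apply: bnd_approx => e e0.
(* [otens_ex] asks for positive bounds while C or D may vanish; both are enlarged by a d that costs
   at most e in the product. *)
have [d d0 hd] : exists2 d : R, 0 < d & (C + d) * (D + d) <= C * D + e.
 pose d := Num.min 1 (e / (C + D + 1)).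
 have CD : 0 < C + D + 1 by rewrite ltr_wpDl // addr_ge0.
 have d0 : 0 < d by rewrite lt_min ltr01 divr_gt0.
 exists d => //; have d1 : d <= 1 by rewrite ge_min lexx.
 have d2 : d * (C + D + 1) <= e by rewrite -ler_pdivlMr // ge_min lexx orbT.
 have : d * d <= d * 1 by rewrite ler_wpM2l // ltW.
 lra.
have C1 : 0 < C + d by rewrite ltr_wpDl.
have D1 : 0 < D + d by rewrite ltr_wpDl.
have hC1 : bnd (C + d) s by apply: bnd_le hC; rewrite lerDl ltW.
have hD1 : bnd (D + d) t by apply: bnd_le hD; rewrite lerDl ltW.
have [r [br hr er]] := otens_ex bs bt C1 D1 hC1 hD1.
by rewrite (otens_uniq br er); exact: bnd_le hr.
Qed.
Lemma otens_linl t : bop t -> forall a s s', bop s -> bop s' -> otens (a *: s + s') t = a *: otens s t + otens s' t.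
move=> bt a s s' bs bs'; apply: otens_uniq => [|h k].
 by apply: bop_lincomb; exact: bop_otens.
by rewrite opDE opZE !otensE // (@ptl H' K').
Qed.
Lemma otens_linr s : bop s -> forall a t t', bop t -> bop t' -> otens s (a *: t + t') = a *: otens s t + otens s t'.
move=> bs a t t' bt bt'; apply: otens_uniq => [|h k].
 by apply: bop_lincomb; exact: bop_otens.
by rewrite opDE opZE !otensE // (@ptr H' K').
Qed.
Lemma otensBl t s s' : bop t -> bop s -> bop s' -> otens (s - s') t = otens s t - otens s' t.
by move=> bt bs bs'; rewrite addrC -scaleN1r otens_linl // scaleN1r addrC.
Qed.
Lemma otensBr s t t' : bop s -> bop t -> bop t' -> otens s (t - t') = otens s t - otens s t'.
by move=> bt bs bs'; rewrite addrC -scaleN1r otens_linr // scaleN1r addrC.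
Qed.
End Otens.
Lemma otens_adj H K H' K' (s : op H H') (t : op K K') : bop s -> bop t -> adj (otens s t) = otens (adj s) (adj t).
move=> bs bt; have bs' := bop_adj bs; have bt' := bop_adj bt.
apply: (adj_dense (@pures_dense H K) (@pures_dense H' K')); [exact: bop_otens|exact: bop_otens|].
move=> _ _ [h _ [k _ <-]] [h' _ [k' _ <-]].
by rewrite !otensE // !pt_ip !adjP.
Qed.
Lemma otens_comp H K H' K' H'' K'' (s' : op H' H'') (t' : op K' K'') (s : op H H') (t : op K K') :
 bop s -> bop t -> bop s' -> bop t' -> otens s' t' \o otens s t = otens (s' \o s) (t' \o t).
move=> bs bt bs' bt'; symmetry; apply: otens_uniq => [|h k].
 by apply: bop_comp; exact: bop_otens.
by rewrite /= !otensE.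
Qed.
Lemma otens_id H K : otens (@id H) (@id K) = id.
by apply: otens_uniq => //; exact: bop_id. Qed.
Lemma un_otens H K H' K' (s : op H H') (t : op K K') : unitary s -> unitary t -> unitary (otens s t).
move=> /unP[bs s1 s2] /unP[bt t1 t2]; have bs' := bop_adj bs; have bt' := bop_adj bt.
apply/unP; split; first exact: bop_otens.
 by rewrite otens_adj // otens_comp // s1 t1 otens_id.
by rewrite otens_adj // otens_comp // s2 t2 otens_id.
Qed.
Lemma flip_ex H K : exists t : op (H *t K) (K *t H), [/\ unitary t,
 (forall h k, t (pt h k) = pt k h) & forall h k, adj t (pt k h) = pt h k].
have [|||t [ut h1 h2]] := @graph_un R (H *t K) (K *t H) (H * K) setT (fun p => pt p.1 p.2) (fun p => pt p.2 p.1).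
- by apply: hdense_sub (@pures_dense H K) => _ [h _ [k _ <-]]; exists (h, k).
- by apply: hdense_sub (@pures_dense K H) => _ [k _ [h _ <-]]; exists (h, k).
- by move=> [h k] [h' k'] _ _; rewrite !pt_ip mulrC.
by exists t; split=> // h k; [exact: (h1 (h, k))|exact: (h2 (h, k))].
Qed.
Lemma flip_uniq H K (r : op (H *t K) (K *t H)) : bop r -> (forall h k, r (pt h k) = pt k h) -> flip H K = r.
move=> br hr; apply: xget_unique => // r' [br' hr'].
by apply: bop_pt_eq => // h k; rewrite hr hr'.
Qed.
Lemma flipP H K : [/\ unitary (flip H K), (forall h k, flip H K (pt h k) = pt k h) & adj (flip H K) = flip K H].
have [t [ut h1 h2]] := flip_ex H K; have bt := un_bop ut.
rewrite (flip_uniq bt h1); split=> //; symmetry; apply: flip_uniq => //.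
exact: bop_adj.
Qed.
Lemma flip_un H K : unitary (flip H K). by have [] := flipP H K. Qed.
Lemma flipE H K h k : flip H K (pt h k) = pt k h. by have [] := flipP H K. Qed.
Lemma flip_adj H K : adj (flip H K) = flip K H. by have [] := flipP H K. Qed.
Lemma assoc_ex H K L : exists t : op ((H *t K) *t L) (H *t (K *t L)), [/\ unitary t,
 (forall h k l, t (pt (pt h k) l) = pt h (pt k l)) & forall h k l, adj t (pt h (pt k l)) = pt (pt h k) l].
have [|||t [ut h1 h2]] := @graph_un R ((H *t K) *t L) (H *t (K *t L)) (H * K * L) setT
 (fun p => pt (pt p.1.1 p.1.2) p.2) (fun p => pt p.1.1 (pt p.1.2 p.2)).
- apply: hdense_sub (pt_dense (@pures_dense H K) (@hdenseT L)) => _ [_ [h _ [k _ <-]] [l _ <-]].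
 by exists (h, k, l).
- apply: hdense_sub (pt_dense (@hdenseT H) (@pures_dense K L)) => _ [h _ [_ [k _ [l _ <-]] <-]].
 by exists (h, k, l).
- by move=> [[h k] l] [[h' k'] l'] _ _; rewrite !pt_ip mulrA.
by exists t; split=> // h k l; [exact: (h1 (h, k, l))|exact: (h2 (h, k, l))].
Qed.
Lemma bop_pt3_eq H K L M (s t : op ((H *t K) *t L) M) : bop s -> bop t ->
 (forall h k l, s (pt (pt h k) l) = t (pt (pt h k) l)) -> s = t.
move=> bs bt h; apply: (hdense_eq (pt_dense (@pures_dense H K) (@hdenseT L))) => //.
by move=> _ [_ [x _ [y _ <-]] [z _ <-]].
Qed.
Lemma bop_pt3r_eq H K L M (s t : op (H *t (K *t L)) M) : bop s -> bop t ->
 (forall h k l, s (pt h (pt k l)) = t (pt h (pt k l))) -> s = t.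
move=> bs bt h; apply: (hdense_eq (pt_dense (@hdenseT H) (@pures_dense K L))) => //.
by move=> _ [x _ [_ [y _ [z _ <-]] <-]].
Qed.
Lemma assocP H K L : [/\ unitary (assoc H K L), (forall h k l, assoc H K L (pt (pt h k) l) = pt h (pt k l)) &
 forall h k l, adj (assoc H K L) (pt h (pt k l)) = pt (pt h k) l].
have [t [ut h1 h2]] := assoc_ex H K L; have bt := un_bop ut.
suff -> : assoc H K L = t by [].
apply: xget_unique => // r' [br' hr'].
by apply: bop_pt3_eq => // h k l; rewrite hr' h1.
Qed.
Lemma assoc_un H K L : unitary (assoc H K L). by have [] := assocP H K L. Qed.
Lemma assocE H K L h k l : assoc H K L (pt (pt h k) l) = pt h (pt k l).
by have [] := assocP H K L. Qed.
Lemma assocVE H K L h k l : adj (assoc H K L) (pt h (pt k l)) = pt (pt h k) l.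
by have [] := assocP H K L. Qed.
Lemma Ad_assoc_otens H K L (s : op H H) (t : op K K) (r : op L L) : bop s -> bop t -> bop r ->
 Ad (assoc H K L) (otens (otens s t) r) = otens s (otens t r).
move=> bs bt br; have bst := bop_otens bs bt; have btr := bop_otens bt br.
apply: bop_pt3r_eq => [||h k l].
- by apply: bop_Ad; [exact: assoc_un|exact: bop_otens].
- exact: bop_otens.
- by rewrite AdE assocVE !otensE // assocE.
Qed.
Lemma Ad_flip_otens H K (s : op H H) (t : op K K) : bop s -> bop t -> Ad (flip H K) (otens s t) = otens t s.
move=> bs bt; apply: bop_pt_eq => [||k h].
- by apply: bop_Ad; [exact: flip_un|exact: bop_otens].
- exact: bop_otens.
- by rewrite AdE flip_adj flipE !otensE // flipE.
Qed.
Lemma tens_cs A B : cstar A -> cstar B -> cstar (tens T A B).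
move=> cA cB; have hA := cs_alg cA; have hB := cs_alg cB.
have bA a : A a -> bop a by move=> Aa; exact: (csa_bop hA Aa).
have bB b : B b -> bop b by move=> Bb; exact: (csa_bop hB Bb).
apply: mk_cstar.
 apply: cspan_csalg.
 - by move=> _ [a Aa [b Bb <-]]; apply: bop_otens; [exact: bA|exact: bB].
 - move=> _ _ [a Aa [b Bb <-]] [a' Aa' [b' Bb' <-]].
  rewrite otens_comp; [|exact: bA|exact: bB|exact: bA|exact: bB].
  by apply: sub_cspan; exists (a \o a'); [exact: (csa_comp hA)|exists (b \o b') => //; exact: (csa_comp hB)].
 - move=> _ [a Aa [b Bb <-]]; rewrite otens_adj; [|exact: bA|exact: bB].
  by apply: sub_cspan; exists (adj a); [exact: (csa_adj hA)|exists (adj b) => //; exact: (csa_adj hB)].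
apply: hdense_sub (pt_dense (cstar_dense cA) (cstar_dense cB)).
move=> _ [_ [a Aa [x _ <-]] [_ [b Bb [y _ <-]] <-]].
exists (otens a b); first by apply: sub_cspan; exists a => //; exists b.
by exists (pt x y) => //; rewrite otensE //; [exact: bA|exact: bB].
Qed.
Lemma tens_in A B a b : A a -> B b -> tens T A B (otens a b).
by move=> Aa Bb; apply: sub_cspan; exists a => //; exists b. Qed.
Lemma tens_ind A B (X : set (bo (sp A *t sp B))) : csub X ->
 (forall a b, A a -> B b -> X (otens a b)) -> els (tens T A B) `<=` X.
by move=> cX h; apply: cspan_min => // _ [a Aa [b Bb <-]]; exact: h. Qed.
Lemma mult_otens A B s t : cstar A -> cstar B -> mult A s -> mult B t -> mult (tens T A B) (otens s t).
move=> cA cB ms mt; have bs := mult_bop ms; have bt := mult_bop mt.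
have bA a : A a -> bop a by move=> Aa; exact: (cs_bop cA Aa).
have bB b : B b -> bop b by move=> Bb; exact: (cs_bop cB Bb).
have bst := bop_otens bs bt; have cT := cstar_sub (tens_cs cA cB).
split=> // x Tx; split.
 have := tens_ind (csub_mull cT bst); case/(_ _ x Tx) => // a b Aa Bb.
 split; first by apply: bop_otens; [exact: bA|exact: bB].
 rewrite otens_comp //; [|exact: bA|exact: bB].
 by apply: tens_in; exact: mult_l.
have := tens_ind (csub_mulr cT bst); case/(_ _ x Tx) => // a b Aa Bb.
split; first by apply: bop_otens; [exact: bA|exact: bB].
rewrite otens_comp //; [|exact: bA|exact: bB].
by apply: tens_in; exact: mult_r.
Qed.
End TensorOps.

(** * Completion of a densely defined homomorphism *)

Section CompleteHom.
Implicit Types H K L M : hilbert R.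
(** [G] is a graph, not a function: contractivity applied to differences of pairs shows that its
    closure is single-valued, so no well-definedness has to be checked beforehand. The reverse
    estimate gives injectivity. *)
Lemma complete_hom H K (G : set (op H H * op K K)) : (forall p, G p -> bop p.1 /\ bop p.2) -> G (0, 0) ->
 (forall a p q, G p -> G q -> G (a *: p.1 + q.1, a *: p.2 + q.2)) ->
 (forall p q, G p -> G q -> G (p.1 \o q.1, p.2 \o q.2)) -> (forall p, G p -> G (adj p.1, adj p.2)) ->
 (forall p (C : R), G p -> 0 <= C -> bnd C p.1 -> bnd C p.2) ->
 exists F : H ~> K, [/\ shom (nclosure [set p.1 | p in G]) F, (forall p, G p -> F p.1 = p.2),
  (forall t, nclosure [set p.1 | p in G] t -> forall e : R, 0 < e ->
   exists p, [/\ G p, bnd e (t - p.1) & bnd e (F t - p.2)]) &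
  ((forall p (C : R), G p -> 0 <= C -> bnd C p.2 -> bnd C p.1) -> finj (nclosure [set p.1 | p in G]) F)].
move=> Gb G0 Glin Gmul Gadj Gc.
set X := nclosure _.
have GB p q : G p -> G q -> G (p.1 - q.1, p.2 - q.2).
 move=> hp hq; have := Glin (-1) q p hq hp.
 by rewrite !scaleN1r ![- _ + _]addrC.
pose P t t' := forall e : R, 0 < e -> exists p, [/\ G p, bnd e (t - p.1) & bnd e (t' - p.2)].
have PX t t' : P t t' -> X t by move=> h; apply/nclP => e /h[p [Gp h1 _]]; exists p.1 => //; exists p.
have Pbop t t' : P t t' -> bop t /\ bop t'.
 move=> h; split; apply: (csub_lim (csub_bop _ _)) => e /h[p [Gp h1 h2]].
  by exists p.1 => //; case: (Gb _ Gp).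
 by exists p.2 => //; case: (Gb _ Gp).
have GP p : G p -> P p.1 p.2.
 by move=> Gp e e0; exists p; split=> //; rewrite subrr => x; rewrite nm0 mulr_ge0 ?nm_ge0 // ltW.
have Plin a s s' t t' : P s s' -> P t t' -> P (a *: s + t) (a *: s' + t').
 move=> hs ht e e0; have c0 : 0 < cn a + 1 by rewrite ltr_wpDl // cn_ge0.
 have d0 : 0 < e / (cn a + 1) by rewrite divr_gt0.
 have [p [Gp p1 p2]] := hs _ d0; have [q [Gq q1 q2]] := ht _ d0.
 have est H' (u u1 v v1 : op H' H') : bnd (e / (cn a + 1)) (u - u1) ->
   bnd (e / (cn a + 1)) (v - v1) -> bnd e (a *: u + v - (a *: u1 + v1)).
  move=> hu hv; rewrite opprD addrACA -scalerBr.
  have := bndD (bndZ a hu) hv.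
  by rewrite -[X in _ + X]mul1r -mulrDl mulrC divfK // gt_eqF.
 by exists (a *: p.1 + q.1, a *: p.2 + q.2); split; [exact: Glin|exact: est|exact: est].
have Pc t t' (C : R) : P t t' -> 0 <= C -> bnd C t -> bnd C t'.
 move=> h C0 hC; apply: bnd_approx => e e0; have e2 : 0 < e / 2 by rewrite divr_gt0.
 have [p [Gp p1 p2]] := h _ e2.
 have : bnd (C + e / 2) p.2.
  apply: Gc => //; first by rewrite addr_ge0 // ltW.
  by have := bndD hC (bnd_sub p1); rewrite [t + _]addrC subrK.
 by move=> /(bndD p2); rewrite subrK; apply: bnd_le; lra.
have Pu t s s' : P t s -> P t s' -> s = s'.
 move=> h h'; have := Plin (-1) _ _ _ _ h h'; rewrite !scaleN1r !addNr => /Pc hc.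
 apply/eqP; rewrite -subr_eq0; apply/eqP/bnd_eq0 => e e0.
 have := hc 0 (lexx 0); rewrite addrC => h0.
 have /bnd_lin : bnd e (s' - s); last by rewrite opprB.
 by apply: (bnd_le _ (h0 _)); [exact: ltW|move=> x; rewrite nm0 mul0r].
have Pex t : X t -> exists t', P t t'.
 move=> /nclP h.
 have n0 (n : nat) : 0 < n.+1%:R^-1 :> R by rewrite invr_gt0 ltr0n.
 have /boolp.choice[u hu] (n : nat) : exists p, G p /\ bnd n.+1%:R^-1 (t - p.1).
  by have [_ [p Gp <-] hp] := h _ (n0 n); exists p.
 have [l hl] : exists l, forall e : R, 0 < e -> exists N, forall n, (N <= n)%N -> bnd e ((u n).2 - l).
  apply: op_cauchy => e e0; have e2 : 0 < e / 2 by rewrite divr_gt0.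
  have [N hN] := inv_small e2; exists N => n m Nn Nm.
  have [Gn hn] := hu n; have [Gm hm] := hu m.
  apply: (Gc _ _ (GB _ _ Gn Gm)); first exact: ltW.
  have := bndD (bnd_sub hn) hm; rewrite addrA subrK; apply: bnd_le.
  by rewrite [e]splitr lerD // hN.
 exists l => e e0; have [N1 h1] := inv_small e0; have [N2 h2] := hl _ e0.
 have [Gn hn] := hu (maxn N1 N2); exists (u (maxn N1 N2)); split=> //.
  by apply: bnd_le hn; rewrite h1 // leq_maxl.
 by apply: bnd_sub; apply: h2; rewrite leq_maxr.
have Pmul s s' t t' : P s s' -> P t t' -> P (s \o t) (s' \o t').
 move=> hs ht e e0; have [bs bs'] := Pbop _ _ hs; have [bt bt'] := Pbop _ _ ht.
 have [C [C0 hC]] := bop_bnd bs; have [D [D0 hD]] := bop_bnd bt.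
 pose d := Num.min 1 (e / (C + D + 2)).
 have CD : 0 < C + D + 2 by rewrite ltr_wpDl // addr_ge0.
 have d0 : 0 < d by rewrite lt_min ltr01 divr_gt0.
 have d1 : d <= 1 by rewrite ge_min lexx.
 have d2 : d * (C + D + 2) <= e by rewrite -ler_pdivlMr // ge_min lexx orbT.
 have [p [Gp p1 p2]] := hs _ d0; have [q [Gq q1 q2]] := ht _ d0.
 have est H' (u u1 v v1 : op H' H') : bop u -> bnd C u -> bnd D v -> bnd d (u - u1) -> bnd d (v - v1) ->
   bop u1 -> bnd e ((u \o v) - (u1 \o v1)).
  move=> bu hu hv hu1 hv1 bu1.
  have -> : (u \o v) - (u1 \o v1) = ((u - u1) \o v) + (u1 \o (v - v1)).
   by apply/funext => x; rewrite opBE opDE /= !opBE (linB (bop_lin bu1)) addrA subrK.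
  have hu2 : bnd (C + d) u1 by have := bndD hu (bnd_sub hu1); rewrite [u + _]addrC subrK.
  have h1 : bnd (d * D) ((u - u1) \o v) by apply: bnd_comp => //; exact: ltW.
  have h2 : bnd ((C + d) * d) (u1 \o (v - v1)) by apply: bnd_comp => //; rewrite addr_ge0 // ltW.
  apply: bnd_le (bndD h1 h2).
  have : d * d <= d * 1 by rewrite ler_wpM2l // ltW.
  lra.
 have [b1 b2] := Gb _ Gp.
 exists (p.1 \o q.1, p.2 \o q.2); split; [exact: Gmul|exact: est|].
 by apply: est => //; [exact: Pc hs C0 hC|exact: Pc ht D0 hD].
have Padj t t' : P t t' -> P (adj t) (adj t').
 move=> h e e0; have [p [Gp p1 p2]] := h _ e0; exists (adj p.1, adj p.2).
 have [b1 b2] := Gb _ Gp; have [bt bt'] := Pbop _ _ h.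
 split; [exact: Gadj| |]; rewrite -adjB //.
  by apply: adj_bnd => //; [exact: ltW|exact: bopB].
 by apply: adj_bnd => //; [exact: ltW|exact: bopB].
have /boolp.choice[F hF] : forall t, exists t', X t -> P t t'.
 by move=> t; have [/Pex[t' ht]|nX] := pselect (X t); [exists t'|exists 0].
exists F; split.
- split.
 + by move=> t Xt; have [] := Pbop _ _ (hF _ Xt).
 + move=> c s t Xs Xt; have h := Plin c _ _ _ _ (hF _ Xs) (hF _ Xt).
  exact: (Pu _ _ _ (hF _ (PX _ _ h)) h).
 + move=> s t Xs Xt; have h := Pmul _ _ _ _ (hF _ Xs) (hF _ Xt).
  exact: (Pu _ _ _ (hF _ (PX _ _ h)) h).
 + move=> t Xt; have h := Padj _ _ (hF _ Xt).
  exact: (Pu _ _ _ (hF _ (PX _ _ h)) h).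
- by move=> p Gp; exact: (Pu _ _ _ (hF _ (PX _ _ (GP _ Gp))) (GP _ Gp)).
- by move=> t Xt; exact: hF.
- move=> Gi s t Xs Xt e.
 have := Plin (-1) _ _ _ _ (hF _ Xt) (hF _ Xs); rewrite !scaleN1r e addNr => h.
 apply/eqP; rewrite -subr_eq0 addrC; apply/eqP/bnd_eq0 => d d0.
 have d2 : 0 < d / 2 by rewrite divr_gt0.
 have [p [Gp p1 p2]] := h _ d2; rewrite sub0r in p2.
 have /(Gi _ _ Gp (ltW d2)) : bnd (d / 2) p.2 by rewrite -[p.2]opprK; exact: bnd_lin.
 by move=> /(bndD p1); rewrite subrK; apply: bnd_le; rewrite -splitr.
Qed.
End CompleteHom.

(** * Finite matrix corners and homomorphisms on one tensor leg *)

Section GramSchmidt.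
Variables (K : hilbert R).
Definition ortho N (e : 'I_N -> K) := forall i j, ip (e i) (e j) = (i == j)%:R.
Definition spanned N (e : 'I_N -> K) v := \sum_j ip (e j) v *: e j = v.
Lemma gram_schmidt (s : seq K) : exists N (e : 'I_N -> K), ortho e /\ forall v, v \in s -> spanned e v.
elim: s => [|v s [N [e [oe se]]]].
 by exists 0%N, (fun=> 0); split=> [[]|].
pose w := v - \sum_j ip (e j) v *: e j.
have we j : ip (e j) w = 0.
 rewrite ipBr ip_sumr (bigD1 j) //= big1 => [|i ij].
  by rewrite ipZr oe eqxx mulr1 addr0 subrr.
 by rewrite ipZr oe eq_sym (negPf ij) mulr0.
have [w0|w0] := eqVneq w 0.
 exists N, e; split=> // u; rewrite inE => /orP[/eqP->|/se//].
 by apply/eqP; rewrite eq_sym -subr_eq0 -/w w0.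
have n0 : nm w != 0 by apply: contra w0 => /eqP/nm_eq0/eqP.
have n1 : 0 < nm w by rewrite lt_neqAle eq_sym n0 nm_ge0.
pose c : R[i] := (nm w)^-1%:C%C.
pose e' (i : 'I_N.+1) := if unlift ord0 i is Some j then e j else c *: w.
have ew j : ip w (e j) = 0 by rewrite ipC we conjC0.
have cw : ip (c *: w) (c *: w) = 1 by rewrite ipxx nmZ cn_real ?invr_ge0 ?nm_ge0 // mulVf // expr1n.
exists N.+1, e'; split.
 move=> i j; rewrite /e'; case: unliftP => [i' ->|->]; case: unliftP => [j' ->|->].
 - by rewrite oe (inj_eq lift_inj).
 - by rewrite ipZr we mulr0 eq_sym (negPf (neq_lift _ _)).
 - by rewrite ipZl ew mulr0 (negPf (neq_lift _ _)).
 - by rewrite cw eqxx.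
move=> u us; rewrite /spanned big_ord_recl /e' unlift_none.
under eq_bigr => i _ do rewrite liftK.
move: us; rewrite inE => /orP[/eqP->|/se su]; last first.
 have -> : ip (c *: w) u = 0.
  rewrite -su ip_sumr big1 // => j _.
  by rewrite ipZr ipZl ew !mulr0.
 by rewrite scale0r add0r.
have -> : ip (c *: w) v *: (c *: w) = w.
 have e1 : ip (c *: w) v = ip (c *: w) w.
  have {1}-> : v = w + \sum_j ip (e j) v *: e j by rewrite subrK.
  by rewrite ipDr ip_sumr big1 ?addr0 // => j _; rewrite ipZr ipZl ew !mulr0.
 have c0 : c != 0 by apply/eqP => /(congr1 (@complex.Re R)) /eqP /=; rewrite invr_eq0 (negPf n0).
 have e2 : c * ip (c *: w) w = 1 by rewrite -ipZr cw.
 by rewrite e1 scalerA mulrC e2 scale1r.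
by rewrite /w subrK.
Qed.
End GramSchmidt.

Section Matrices.
Variables (K : hilbert R).
Implicit Types H M : hilbert R.
Local Notation pt := (pt T).
Definition ket H (e : K) : op H (H *t K) := fun h => pt h e.
Definition bra H (e : K) : op (H *t K) H := adj (@ket H e).
Arguments ket : clear implicits.
Arguments bra : clear implicits.
Lemma bop_ket H e : bop (ket H e). exact: bop_ptl. Qed.
Lemma bop_bra H e : bop (bra H e). exact/bop_adj/bop_ket. Qed.
Lemma adj_ket H e : adj (ket H e) = bra H e. by []. Qed.
Lemma adj_bra H e : adj (bra H e) = ket H e. exact/adjK/bop_ket. Qed.
Lemma braE H e h k : bra H e (pt h k) = ip e k *: h.
by apply: ip_extr => x; rewrite -adjP ?pt_ip ?ipZr 1?mulrC //; exact: bop_ket.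
Qed.
Lemma bra_ket H e e' h : bra H e (ket H e' h) = ip e e' *: h.
exact: braE. Qed.
Lemma bra_otens_ket H M (s : op H M) (t : op K K) e e' : bop s -> bop t ->
 bra M e \o otens s t \o ket H e' = ip e (t e') *: s.
by move=> bs bt; apply/funext => h; rewrite /= /ket otensE // braE. Qed.
Variables (N : nat) (e : 'I_N -> K) (oe : ortho e).
Definition prj H : bo (H *t K) := \sum_i (ket H (e i) \o bra H (e i)).
Arguments prj : clear implicits.
Lemma prjE H x : prj H x = \sum_i ket H (e i) (bra H (e i) x).
by rewrite /prj op_sumE. Qed.
Lemma bop_prj H : bop (prj H).
by apply: bop_sum => i _; apply: bop_comp; [exact: bop_ket|exact: bop_bra]. Qed.
Lemma prj_adj H : adj (prj H) = prj H.
have bk := @bop_ket H; have bb := @bop_bra H.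
rewrite adj_sum; last by move=> i; apply: bop_comp.
by apply: eq_bigr => i _; rewrite adj_comp // adj_bra.
Qed.
Lemma bra_prj H i x : bra H (e i) (prj H x) = bra H (e i) x.
rewrite prjE (lin_sum (bop_lin (@bop_bra H _))) (bigD1 i) //= big1 ?addr0.
 by rewrite bra_ket oe eqxx scale1r.
by move=> j ji; rewrite bra_ket oe eq_sym (negPf ji) scale0r.
Qed.
Lemma prj_prj H x : prj H (prj H x) = prj H x.
by rewrite prjE [RHS]prjE; apply: eq_bigr => i _; rewrite /= bra_prj. Qed.
Lemma prj_fixl H (t : bo (H *t K)) x : prj H \o t \o prj H = t -> prj H (t x) = t x.
by move=> et; rewrite -et /= prj_prj. Qed.
Lemma prj_fixr H (t : bo (H *t K)) x : prj H \o t \o prj H = t -> t (prj H x) = t x.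
by move=> et; rewrite -et /= prj_prj. Qed.
Lemma prj_bnd H : bnd 1 (prj H).
apply/bnd1P => x; rewrite -ripxx (sadj_rip (t := prj H)); last first.
 by move=> u v; rewrite -{2}prj_adj adjP //; exact: bop_prj.
rewrite prj_prj; have := rip_le x (prj H x); rewrite -[X in X <= _](_ : nm (prj H x) ^+ 2 = _); last first.
 rewrite -ripxx (sadj_rip (t := prj H)) ?prj_prj //.
 by move=> u v; rewrite -{2}prj_adj adjP //; exact: bop_prj.
have -> : rip x (prj H x) = nm (prj H x) ^+ 2.
 rewrite -ripxx (sadj_rip (t := prj H)) ?prj_prj //.
 by move=> u v; rewrite -{2}prj_adj adjP //; exact: bop_prj.
have h1 := nm_ge0 x; have h2 := nm_ge0 (prj H x); nra.
Qed.
Lemma prj_pure H h k : spanned e k -> prj H (pt h k) = pt h k.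
move=> sk; rewrite prjE -[in RHS]sk (lin_sum (@ptr _ _ h)); apply: eq_bigr => i _.
by rewrite /= braE /ket (linZ (@ptl _ _ _)) (linZ (@ptr _ _ _)).
Qed.
(** Matrices over [X], realised as the corner of the operators on the tensor product cut out by the
    projection onto the span of [e] in the second leg. Being a closed *-algebra, the corner is
    subject to automatic contractivity. *)
Definition mxalg H (X : set (op H H)) : set (bo (H *t K)) :=
 [set t | [/\ bop t, (forall i j, X (bra H (e i) \o t \o ket H (e j))) & prj H \o t \o prj H = t]].
Lemma csub_and H1 H2 (X Y : set (op H1 H2)) : csub X -> csub Y -> csub (X `&` Y).
move=> cX cY; split.
- by split; exact: csub0.
- by move=> a s t [Xs Ys] [Xt Yt]; split; exact: csub_lincomb.
- by move=> t /nclP h; split; apply: csub_lim => // r /h[s [Xs Ys] hs]; exists s.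
Qed.
Lemma csub_all H1 H2 (I : Type) (X : I -> set (op H1 H2)) : (forall i, csub (X i)) -> csub [set t | forall i, X i t].
move=> cX; split.
- by move=> i; exact: csub0.
- by move=> a s t Xs Xt i; exact: csub_lincomb.
- by move=> t /nclP h i; apply: csub_lim => // r /h[s Xs hs]; exists s.
Qed.
Lemma csub_zero H1 H2 : csub [set 0 : op H1 H2].
split=> // [a _ _ -> ->|t /nclP ht] /=; first by rewrite scaler0 addr0.
by apply: bnd_eq0 => r /ht[_ ->]; rewrite subr0.
Qed.
Lemma csub_eq_mx H : csub [set t | bop t /\ [set 0 : bo (H *t K)] ((prj H \o t \o prj H) - t)].
have bp := bop_prj H; have lp := bop_lin bp; have [C [C0 hC]] := bop_bnd bp.
apply: (@csub_pre _ _ _ _ _ _ _ _ (C * C + 1)) => //.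
- exact: csub_bop.
- exact: csub_zero.
- by rewrite addr_ge0 // mulr_ge0.
- move=> a s t bs bt; exists a; apply/funext => x.
 by rewrite !(opBE, opDE, opZE) /= !(opBE, opDE, opZE) lp scalerBr opprD addrACA.
- move=> s t bs bt; apply/funext => x.
 rewrite !(opBE, opDE) /= !(opBE, opDE) (linB lp) !opprB addrACA [RHS]addrACA.
 by congr (_ + _); exact: addrC.
- move=> Q t Q0 bt hQ; rewrite mulrDl mul1r; apply: bndD; last exact: bnd_lin.
 by rewrite mulrAC; apply: bnd_comp; rewrite ?mulr_ge0 //; exact: bnd_comp.
Qed.
Lemma mxalg_csalg H (X : set (op H H)) : csalg X -> csalg (mxalg X).
move=> cX; have sX := csa_sub cX.
have bk := @bop_ket H; have bb := @bop_bra H; have bp := bop_prj H.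
have -> : mxalg X = [set t | bop t /\ [set 0 : bo (H *t K)] ((prj H \o t \o prj H) - t)] `&`
  [set t | forall p, [set t | bop t /\ [set u | bop u /\ X (bra H (e p.1) \o u)] (t \o ket H (e p.2))] t].
 apply/seteqP; split=> t /=.
  move=> [bt ht e1]; split; first by split=> //; rewrite e1 subrr.
  by move=> p; split=> //; split; [exact: bop_comp|exact: ht].
 move=> [[bt e1] h]; split=> // [i j|]; last by apply: subr0_eq.
 by have [_ []] := h (i, j).
split.
- apply: csub_and; first exact: csub_eq_mx.
 by apply: csub_all => p; apply: csub_mulr => //; apply: csub_mull.
- by move=> t [[]].
- move=> s t [[bs es] hs] [[bt et] ht].
 have {es} es : prj H \o s \o prj H = s by apply: subr0_eq.
 have {et} et : prj H \o t \o prj H = t by apply: subr0_eq.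
 split.
  split; first exact: bop_comp.
  have -> : prj H \o (s \o t) \o prj H = s \o t; last by rewrite /= subrr.
  by apply/funext => x; rewrite /= prj_fixl // prj_fixr.
 move=> p; split; first exact: bop_comp.
 split; first by apply: bop_comp => //; exact: bop_comp.
 have -> : bra H (e p.1) \o (s \o t \o ket H (e p.2)) =
   \sum_i ((bra H (e p.1) \o (s \o ket H (e i))) \o (bra H (e i) \o (t \o ket H (e p.2)))).
  apply/funext => x; rewrite op_sumE /=.
  rewrite -[in LHS](prj_fixl _ et) prjE (lin_sum (bop_lin bs)) (lin_sum (bop_lin (bb _))).
  by apply: eq_bigr.
 apply: csub_sum => // i _; apply: (csa_comp cX).
  by have [_ []] := hs (p.1, i).
 by have [_ []] := ht (i, p.2).
- move=> t [[bt et] ht]; have bt' := bop_adj bt.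
 have {et} et : prj H \o t \o prj H = t by apply: subr0_eq.
 split.
  split=> //; apply/eqP; rewrite subr_eq0; apply/eqP.
  rewrite -[in RHS]et adj_comp //; last exact: bop_comp.
  by rewrite adj_comp // prj_adj.
 move=> p; split=> //; split; first exact: bop_comp.
 have -> : bra H (e p.1) \o (adj t \o ket H (e p.2)) = adj (bra H (e p.2) \o (t \o ket H (e p.1))).
  rewrite adj_comp //; last exact: bop_comp.
  by rewrite adj_comp // adj_bra.
 by apply: (csa_adj cX); have [_ []] := ht (p.2, p.1).
Qed.

Section MxHom.
Variables (H M : hilbert R) (X : set (op H H)) (f : H ~> M) (cX : csalg X) (sf : shom X f).
Definition mxhom t : bo (M *t K) := \sum_i \sum_j (ket M (e i) \o f (bra H (e i) \o t \o ket H (e j)) \o bra M (e j)).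
Lemma bra_mxhom t i j : (forall i j, X (bra H (e i) \o t \o ket H (e j))) ->
 bra M (e i) \o mxhom t \o ket M (e j) = f (bra H (e i) \o t \o ket H (e j)).
move=> ht; apply/funext => x; rewrite /= /mxhom op_sumE (lin_sum (bop_lin (@bop_bra M _))).
have bf i' j' := shom_bop sf (ht i' j').
rewrite (bigD1 i) //= [X in _ + X]big1 ?addr0 => [|i' i'i]; last first.
 rewrite op_sumE (lin_sum (bop_lin (@bop_bra M _))) big1 // => j' _ /=.
 by rewrite bra_ket oe eq_sym (negPf i'i) scale0r.
rewrite op_sumE (lin_sum (bop_lin (@bop_bra M _))) (bigD1 j) //= [X in _ + X]big1 ?addr0 => [|j' j'j].
 by rewrite !bra_ket !oe !eqxx !scale1r.
rewrite !bra_ket !oe (negPf j'j) scale0r (lin0 (bop_lin (bf _ _))).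
by rewrite scaler0.
Qed.
Lemma mxhom_prj t : mxhom t = prj M \o mxhom t \o prj M.
have bb := @bop_bra M; have bk := @bop_ket M.
apply/funext => x; rewrite /= /mxhom op_sumE [in RHS]op_sumE (lin_sum (bop_lin (bop_prj M))).
apply: eq_bigr => i _; rewrite !op_sumE (lin_sum (bop_lin (bop_prj M))).
apply: eq_bigr => j _ /=; rewrite bra_prj prjE (bigD1 i) //= big1 ?addr0.
 by rewrite bra_ket oe eqxx scale1r.
by move=> i' i'i; rewrite bra_ket oe (negPf i'i) scale0r (lin0 (bop_lin (bk _))).
Qed.
Lemma mx_ext (s t : bo (M *t K)) : bop s -> bop t -> prj M \o s \o prj M = s -> prj M \o t \o prj M = t ->
 (forall i j, bra M (e i) \o s \o ket M (e j) = bra M (e i) \o t \o ket M (e j)) -> s = t.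
move=> bs bt es et h; rewrite -es -et; apply/funext => x /=.
rewrite prjE [RHS]prjE; apply: eq_bigr => i _ /=; congr (ket M _ _).
rewrite [prj M x]prjE (lin_sum (bop_lin bs)) (lin_sum (bop_lin bt)).
rewrite !(lin_sum (bop_lin (@bop_bra M _))); apply: eq_bigr => j _ /=.
exact: (congr1 (fun g => g (bra M (e j) x)) (h i j)).
Qed.
Lemma bop_mxhom t : (forall i j, X (bra H (e i) \o t \o ket H (e j))) -> bop (mxhom t).
move=> ht; apply: bop_sum => i _; apply: bop_sum => j _.
apply: bop_comp; last exact: bop_bra.
by apply: bop_comp; [exact: bop_ket|exact: (shom_bop sf)].
Qed.
Lemma bra_mul (H' : hilbert R) (s t : bo (H' *t K)) i j : bop s -> prj H' \o t \o prj H' = t ->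
 bra H' (e i) \o (s \o t) \o ket H' (e j) =
 \sum_l ((bra H' (e i) \o s \o ket H' (e l)) \o (bra H' (e l) \o t \o ket H' (e j))).
move=> bs et; apply/funext => x; rewrite op_sumE /=.
rewrite -[in LHS](prj_fixl _ et) prjE (lin_sum (bop_lin bs)) (lin_sum (bop_lin (@bop_bra H' _))).
by apply: eq_bigr.
Qed.
Lemma mxhom_shom : shom (mxalg X) mxhom.
have cm := mxalg_csalg cX; have sX := csa_sub cX.
have bb := @bop_bra H; have bk := @bop_ket H.
have bb' := @bop_bra M; have bk' := @bop_ket M.
split=> [t [bt ht _]|c s t hs ht|s t hs ht|t ht].
- exact: bop_mxhom.
- have [bs xs es] := hs; have [bt xt et] := ht.
 have [bst xst est] := csub_lincomb (csa_sub cm) c hs ht.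
 have bl := bop_lincomb c (bop_mxhom xs) (bop_mxhom xt).
 apply: mx_ext => //; [exact: bop_mxhom|by rewrite -mxhom_prj| |].
  apply/funext => x; rewrite /= !(opDE, opZE) (bop_lin (bop_prj M)).
  by rewrite !(fun t y => prj_fixl y (esym (mxhom_prj t)), fun t y => prj_fixr y (esym (mxhom_prj t))).
 move=> i j; rewrite bra_mxhom //.
 have -> : bra M (e i) \o (c *: mxhom s + mxhom t) \o ket M (e j) =
   c *: (bra M (e i) \o mxhom s \o ket M (e j)) + (bra M (e i) \o mxhom t \o ket M (e j)).
  by apply/funext => x; rewrite /= !(opDE, opZE) (bop_lin (bb' _)).
 rewrite !bra_mxhom // -(shom_lin sf) //; congr f; apply/funext => x.
 by rewrite /= !(opDE, opZE) (bop_lin (bb _)).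
- have [bs xs es] := hs; have [bt xt et] := ht.
 have [bst xst est] := csa_comp cm hs ht.
 have bl := bop_comp (bop_mxhom xs) (bop_mxhom xt).
 apply: mx_ext => //; [exact: bop_mxhom|by rewrite -mxhom_prj| |].
  by apply/funext => x; rewrite /= !(fun t y => prj_fixl y (esym (mxhom_prj t)), fun t y => prj_fixr y (esym (mxhom_prj t))).
 move=> i j; rewrite bra_mxhom // bra_mul // (bra_mul (H' := M)); last 2 first.
 + exact: bop_mxhom.
 + by rewrite -mxhom_prj.
 rewrite (shom_sum cX sf); last by move=> l _; apply: (csa_comp cX).
 by apply: eq_bigr => l _; rewrite !bra_mxhom // (shom_comp sf).
- have [bt xt et] := ht; have [bt' xt' et'] := csa_adj cm ht.
 have bl := bop_mxhom xt; have bl' := bop_adj bl; have bp := bop_prj M.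
 apply: mx_ext => //; [exact: bop_mxhom|by rewrite -mxhom_prj| |].
  rewrite [in RHS](mxhom_prj t) adj_comp //; last exact: bop_comp.
  by rewrite adj_comp // prj_adj.
 have adjbk (H' : hilbert R) (s : bo (H' *t K)) i j : bop s ->
   bra H' (e i) \o adj s \o ket H' (e j) = adj (bra H' (e j) \o s \o ket H' (e i)).
  move=> bs; have b1 := @bop_bra H'; have b2 := @bop_ket H'.
  rewrite adj_comp //; last exact: bop_comp.
  by rewrite adj_comp // adj_bra.
 by move=> i j; rewrite bra_mxhom // !adjbk // bra_mxhom // (shom_adj sf).
Qed.
Lemma mxhom_inj : finj X f -> finj (mxalg X) mxhom.
move=> fi s t [bs xs es] [bt xt et] est.
have bb := @bop_bra H; have bk := @bop_ket H.
rewrite -es -et; apply/funext => x /=.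
rewrite prjE [RHS]prjE; apply: eq_bigr => i _ /=; congr (ket H _ _).
rewrite [prj H x]prjE (lin_sum (bop_lin bs)) (lin_sum (bop_lin bt)).
rewrite !(lin_sum (bop_lin (bb _))); apply: eq_bigr => j _ /=.
have h : bra H (e i) \o s \o ket H (e j) = bra H (e i) \o t \o ket H (e j).
 by apply: fi => //; rewrite -!bra_mxhom // est.
exact: (congr1 (fun g => g (bra H (e j) x)) h).
Qed.
End MxHom.
End Matrices.

Section DenseBound.
Implicit Types H K : hilbert R.
Lemma bnd_dense H K (D : set H) (t : op H K) (C : R) : hdense D -> bop t -> 0 <= C ->
 (forall x, lspan D x -> nm (t x) <= C * nm x) -> bnd C t.
move=> hD bt C0 hC x; have [M [M0 hM]] := bop_bnd bt.
rewrite -subr_le0; apply: (@small_le0 _ _ (C + M)) => e e0.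
have [y Dy xy] := hD x e e0.
have h1 : nm (t x) <= nm (t y) + M * e.
 apply: le_trans (nm_ler _ (t y)) _; rewrite lerD2l -(linB (bop_lin bt)).
 by apply: le_trans (hM _) _; rewrite ler_wpM2l.
have h2 : nm y <= nm x + e by apply: le_trans (nm_ler _ x) _; rewrite lerD2l nm_sub.
have h3 := hC _ Dy.
have h4 : C * nm y <= C * (nm x + e) by rewrite ler_wpM2l.
by rewrite lerBlDr; apply: le_trans h1 _; lra.
Qed.
Lemma bnd_Ad H K (u : op H K) (t : op H H) (C : R) : unitary u -> bnd C t -> bnd C (Ad u t).
move=> uu hC x; rewrite AdE un_nm // -(un_nm x (un_adj uu)); exact: hC.
Qed.
Lemma Ad_sum H K (u : op H K) I (r : seq I) (F : I -> op H H) : unitary u ->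
 Ad u (\sum_(i <- r) F i) = \sum_(i <- r) Ad u (F i).
move=> uu; apply/funext => x; rewrite AdE !op_sumE (lin_sum (bop_lin (un_bop uu))).
by [].
Qed.
End DenseBound.

Section FirstLeg.
Variables (K : hilbert R).
Implicit Types H M : hilbert R.
Local Notation pt := (pt T).
Local Notation prj e := (@prj K _ e _).
Local Notation bra e := (@bra K _ e).
Local Notation ket e := (@ket K _ e).
Local Notation pures H := (@pures H K [set: H] [set: K]).
Variable I : Type.
Definition tsum H (r : seq I) (a : I -> op H H) (k : I -> op K K) : bo (H *t K) := \sum_(i <- r) otens (a i) (k i).
Lemma bop_tsum H r (a : I -> op H H) (k : I -> op K K) : (forall i, bop (a i)) ->
 (forall i, bop (k i)) -> bop (tsum r a k).
by move=> ba bk; apply: bop_sum => i _; exact: bop_otens. Qed.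
(** A finite combination of pure tensors and its image under a finite sum of elementary operators
    involve finitely many vectors of [K]; Gram-Schmidt provides a corner that fixes both. *)
Lemma tsum_loc H r (a : I -> op H H) (k : I -> op K K) x : (forall i, bop (a i)) ->
 (forall i, bop (k i)) -> lspan (pures H) x ->
 exists N (e : 'I_N -> K), [/\ ortho e, prj e x = x & prj e (tsum r a k x) = tsum r a k x].
move=> ba bk hx.
suff [s hs] : exists s : seq K, forall N (e : 'I_N -> K), ortho e -> (forall v, v \in s -> spanned e v) ->
  prj e x = x /\ prj e (tsum r a k x) = tsum r a k x.
 have [N [e [oe /(hs N e oe)[h1 h2]]]] := gram_schmidt s.
 by exists N, e.
have bs := bop_lin (bop_tsum r ba bk).
move: x hx; apply: lspan_ind.
 by exists [::] => N e oe _; rewrite (lin0 bs) (lin0 (bop_lin (bop_prj e _))).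
move=> c _ x [h _ [kk _ <-]] [s hs].
exists (kk :: [seq k i kk | i <- r] ++ s) => N e oe hv.
have lp := bop_lin (bop_prj e H).
have [|h1 h2] := hs N e oe; first by move=> v vs; apply: hv; rewrite inE mem_cat vs !orbT.
rewrite bs !lp h1 h2 prj_pure; last by apply: hv; rewrite inE eqxx.
split=> //; congr (_ *: _ + _); rewrite /tsum op_sumE (lin_sum lp).
have : forall v, v \in [seq k i kk | i <- r] -> spanned e v by move=> v vs; apply: hv; rewrite inE mem_cat vs orbT.
elim: (r) => [|i r' IH] hr; first by rewrite !big_nil.
rewrite !big_cons IH => [|v vr]; last by apply: hr; rewrite inE vr orbT.
by congr (_ + _); rewrite otensE // prj_pure //; apply: hr; rewrite inE eqxx.
Qed.

Section MapLeg.
Variables (H M : hilbert R) (X : set (op H H)) (f : H ~> M) (cX : csalg X) (sf : shom X f).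
Variables (r : seq I) (a : I -> op H H) (k : I -> op K K) (Xa : forall i, X (a i)) (bk : forall i, bop (k i)).
Let ba i : bop (a i). exact: (csa_bop cX). Qed.
Let bf i : bop (f (a i)). exact: (shom_bop sf). Qed.
Let f' i := f (a i).
Lemma prj_tsum (H' : hilbert R) (b : I -> op H' H') N (e : 'I_N -> K) i j : ortho e -> (forall l, bop (b l)) ->
 bra (e i) \o (prj e \o tsum r b k \o prj e) \o ket (e j) = \sum_(l <- r) ip (e i) (k l (e j)) *: b l.
move=> oe bb; apply/funext => x; rewrite /= bra_prj // [prj _ (ket _ _)]prj_pure.
 rewrite /tsum !op_sumE (lin_sum (bop_lin (bop_bra _ _))); apply: eq_bigr => l _.
 by rewrite otensE // braE.
rewrite /spanned (bigD1 j) //= oe eqxx scale1r big1 ?addr0 // => l lj.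
by rewrite oe (negPf lj) scale0r.
Qed.
Lemma mxalg_tsum N (e : 'I_N -> K) : ortho e -> mxalg e X (prj e \o tsum r a k \o prj e).
move=> oe; have bp := @bop_prj K N e H; split.
- by apply: bop_comp => //; apply: bop_comp => //; exact: bop_tsum.
- move=> i j; rewrite prj_tsum //; apply: (csub_sum (csa_sub cX)) => l _.
 exact: (csubZ (csa_sub cX)).
- by apply/funext => x; rewrite /= !prj_prj.
Qed.
Lemma mxhom_tsum N (e : 'I_N -> K) : ortho e ->
 mxhom e f (prj e \o tsum r a k \o prj e) = prj e \o tsum r f' k \o prj e.
move=> oe; have [b1 h1 e1] := mxalg_tsum oe; have bp := @bop_prj K N e M.
apply: (mx_ext (e := e)) => //.
- exact: (bop_mxhom sf).
- by apply: bop_comp => //; apply: bop_comp => //; exact: bop_tsum.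
- by rewrite -mxhom_prj.
- by apply/funext => x; rewrite /= !prj_prj.
move=> i j; rewrite (bra_mxhom _ sf) // !prj_tsum // (shom_sum cX sf).
 by apply: eq_bigr => l _; rewrite (shomZ cX sf).
by move=> l _; exact: (csubZ (csa_sub cX)).
Qed.
Lemma prj_cut_bnd (H' : hilbert R) N (e : 'I_N -> K) (t : bo (H' *t K)) (C : R) :
 ortho e -> 0 <= C -> bnd C t -> bnd C (prj e \o t \o prj e).
move=> oe C0 hC; rewrite -[C]mul1r -[_ * C]mulr1.
apply: bnd_comp; rewrite ?mul1r //; last exact: prj_bnd.
by rewrite -[C]mul1r; apply: bnd_comp => //; exact: prj_bnd.
Qed.
(** The tensor product of f with the identity is not yet known to be defined. On a finite corner it
    acts entrywise on matrices over [X], where it is a *-homomorphism and hence contractive; vectors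
    living in finite corners are dense. *)
Lemma tsum_bnd (C : R) : 0 <= C -> bnd C (tsum r a k) -> bnd C (tsum r f' k).
move=> C0 hC; apply: (bnd_dense (@pures_dense M K)) => // [|x hx]; first exact: bop_tsum.
have [N [e [oe e1 e2]]] := tsum_loc r bf bk hx.
have := shom_contr (mxalg_csalg oe cX) (mxhom_shom oe cX sf) (mxalg_tsum oe) C0 (prj_cut_bnd oe C0 hC).
by rewrite mxhom_tsum // => /(_ x) /=; rewrite e1 e2.
Qed.
Lemma tsum_bndV (C : R) : finj X f -> 0 <= C -> bnd C (tsum r f' k) -> bnd C (tsum r a k).
move=> fi C0 hC; apply: (bnd_dense (@pures_dense H K)) => // [|x hx]; first exact: bop_tsum.
have [N [e [oe e1 e2]]] := tsum_loc r ba bk hx.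
have h : bnd C (prj e \o tsum r a k \o prj e).
 apply: (shom_isom (mxalg_csalg oe cX) (mxhom_shom oe cX sf)) => //.
 - exact: (mxhom_inj oe sf).
 - exact: mxalg_tsum.
 - by rewrite mxhom_tsum //; exact: prj_cut_bnd.
by have := h x; rewrite /= e1 e2.
Qed.
End MapLeg.
End FirstLeg.

(** * Spatial tensor products of representations *)

Section TensorRep.
Implicit Types (H K L M N : hilbert R) (A B : opalg R).
Local Notation tsum := (@tsum _ _ _).
Lemma tsum_flip (I : Type) H K (r : seq I) (a : I -> op H H) (k : I -> op K K) :
 (forall i, bop (a i)) -> (forall i, bop (k i)) -> Ad (flip H K) (tsum r a k) = tsum r k a.
by move=> ba bk; rewrite Ad_sum; [apply: eq_bigr => i _; exact: Ad_flip_otens|exact: flip_un].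
Qed.
Lemma otens0l H K (t : op K K) : bop t -> otens (0 : op H H) t = 0.
move=> bt; have b0 := bop0 H H.
by have := otens_linl bt (-1) b0 b0; rewrite scaler0 addr0 scaleN1r addNr.
Qed.
Lemma otensZl H K c (s : op H H) (t : op K K) : bop s -> bop t -> otens (c *: s) t = c *: otens s t.
move=> bs bt; have := otens_linl bt c bs (bop0 H H).
by rewrite otens0l // !addr0.
Qed.
Lemma comp_sum H (I J : Type) (r : seq I) (q : seq J) (F : I -> op H H) (E : J -> op H H) : (forall i, bop (F i)) ->
 (\sum_(i <- r) F i) \o (\sum_(j <- q) E j) = \sum_(i <- r) \sum_(j <- q) (F i \o E j).
move=> bF; apply/funext => x; rewrite /= !op_sumE; apply: eq_bigr => i _.
by rewrite op_sumE (lin_sum (bop_lin (bF i))).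
Qed.

Section SecondLeg.
Variables (I : Type) (H K N : hilbert R) (Y : set (op K K)) (g : K ~> N) (cY : csalg Y) (sg : shom Y g).
Variables (r : seq I) (a : I -> op H H) (b : I -> op K K) (ba : forall i, bop (a i)) (Yb : forall i, Y (b i)).
Let bb i : bop (b i). exact: (csa_bop cY). Qed.
Let bg i : bop (g (b i)). exact: (shom_bop sg). Qed.
Let g' i := g (b i).
Lemma tsum_bndr (C : R) : 0 <= C -> bnd C (tsum r a b) -> bnd C (tsum r a g').
move=> C0 hC; rewrite -tsum_flip //; apply: bnd_Ad; first exact: flip_un.
apply: (tsum_bnd cY sg) => //; rewrite -tsum_flip //.
by apply: bnd_Ad => //; exact: flip_un.
Qed.
Lemma tsum_bndrV (C : R) : finj Y g -> 0 <= C -> bnd C (tsum r a g') -> bnd C (tsum r a b).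
move=> gi C0 hC; rewrite -tsum_flip //; apply: bnd_Ad; first exact: flip_un.
apply: (tsum_bndV cY sg) => //; rewrite -tsum_flip //.
by apply: bnd_Ad => //; exact: flip_un.
Qed.
End SecondLeg.

Section Rep.
Variables (A B : opalg R) (M N : hilbert R) (f : sp A ~> M) (g : sp B ~> N).
Hypotheses (cA : cstar A) (cB : cstar B) (rf : rep f) (rg : rep g).
(** The type of all admissible pairs, so that coefficient families are total functions with
    membership built in. *)
Let I := {p : bo (sp A) * bo (sp B) | A p.1 /\ B p.2}.
Let a (i : I) := (sval i).1.
Let b (i : I) := (sval i).2.
Let Aa i : A (a i). by case: i => [[? ?] []]. Qed.
Let Bb i : B (b i). by case: i => [[? ?] []]. Qed.
Let hA := cs_alg cA.
Let hB := cs_alg cB.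
Let sf := rf.1.
Let sg := rg.1.
Let ba i : bop (a i). exact: (csa_bop hA). Qed.
Let bb i : bop (b i). exact: (csa_bop hB). Qed.
Let bf i : bop (f (a i)). exact: (shom_bop sf). Qed.
Let bg i : bop (g (b i)). exact: (shom_bop sg). Qed.
Let mk x y (Ax : A x) (By : B y) : I := exist _ (x, y) (conj Ax By).
Let sclI c (i : I) := mk (csubZ (csa_sub hA) c (Aa i)) (Bb i).
Let mulI (i j : I) := mk (csa_comp hA (Aa i) (Aa j)) (csa_comp hB (Bb i) (Bb j)).
Let adjI (i : I) := mk (csa_adj hA (Aa i)) (csa_adj hB (Bb i)).
Let t1 (r : seq I) := tsum r a b.
Let t2 (r : seq I) := tsum r (fun i => f (a i)) (fun i => g (b i)).
Let G : set (bo (sp A *t sp B) * bo (M *t N)) := [set p | exists r, p = (t1 r, t2 r)].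
Let GP p : G p -> exists r, p.1 = t1 r /\ p.2 = t2 r.
by move=> [r ->]; exists r. Qed.
Let G_span : [set p.1 | p in G] = lspan [set otens x y | x in els A & y in els B].
apply/seteqP; split=> t.
 move=> [_ [r ->] <-] /=; elim: r => [|i r IH]; first by rewrite /t1 /tsum big_nil; exact: lspan0.
 rewrite /t1 /tsum big_cons -[otens _ _]scale1r; apply: lspan_cons IH.
 by exists (a i) => //; exists (b i).
move: t; apply: lspan_ind.
 by exists (t1 [::], t2 [::]); [exists [::]|rewrite /t1 /tsum big_nil].
move=> c _ v [x Ax [y By <-]] [_ [r ->] <-].
have Acx : A (c *: x) by exact: (csubZ (csa_sub hA)).
exists (t1 (mk Acx By :: r), t2 (mk Acx By :: r)); first by eexists.
rewrite /= /t1 /tsum big_cons; congr (_ + _); rewrite /a /b /=.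
by rewrite otensZl //; [exact: (csa_bop hA)|exact: (csa_bop hB)].
Qed.
(** On finite sums of elementary tensors the map is contractive by [tsum_bnd] in the first leg
    followed by [tsum_bndr] in the second; [complete_hom] extends it. Faithfulness comes from the
    two reverse estimates. *)
Lemma tens_rep_ex : exists F : sp A *t sp B ~> M *t N,
 [/\ rep (A := tens T A B) F, (forall x y, A x -> B y -> F (otens x y) = otens (f x) (g y)) &
  (finj (els A) f -> finj (els B) g -> finj (els (tens T A B)) F)].
have [p Gp||c p q Gp Gq|p q Gp Gq|p Gp|p C Gp C0 h|F [sF FG _ Fi]] := @complete_hom _ _ G.
- by have [r [-> ->]] := GP Gp; split; exact: bop_tsum.
- by exists [::]; rewrite /t1 /tsum /t2 /tsum !big_nil.
- have [r [-> ->]] := GP Gp; have [r' [-> ->]] := GP Gq.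
 exists ([seq sclI c i | i <- r] ++ r'); rewrite /t1 /tsum /t2 /tsum !big_cat !big_map !scaler_sumr.
 congr (_, _); congr (_ + _); apply: eq_bigr => i _; rewrite -otensZl //.
 by rewrite -(shomZ hA sf).
- have [r [-> ->]] := GP Gp; have [r' [-> ->]] := GP Gq.
 exists [seq mulI i j | i <- r, j <- r']; rewrite /t1 /tsum /t2 /tsum !big_allpairs_dep.
 congr (_, _).
  rewrite comp_sum //; last by move=> i; exact: bop_otens.
  by apply: eq_bigr => i _; apply: eq_bigr => j _; exact: otens_comp.
 rewrite comp_sum //; last by move=> i; exact: bop_otens.
 apply: eq_bigr => i _; apply: eq_bigr => j _; rewrite otens_comp //.
 by rewrite -(shom_comp sf) // -(shom_comp sg).
- have [r [-> ->]] := GP Gp.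
 exists [seq adjI i | i <- r]; rewrite /t1 /tsum /t2 /tsum !big_map.
 rewrite !adj_sum; try by move=> i; exact: bop_otens.
 congr (_, _); apply: eq_bigr => i _; rewrite otens_adj //.
 by rewrite -(shom_adj sf) // -(shom_adj sg).
- have [r [e1 e2]] := GP Gp; rewrite e2; apply: (tsum_bndr hB sg) => //.
 by apply: (tsum_bnd hA sf) => //; rewrite -/(t1 r) -e1.
have eX : nclosure [set p.1 | p in G] = els (tens T A B) by rewrite G_span.
rewrite eX in sF Fi.
have FE x y : A x -> B y -> F (otens x y) = otens (f x) (g y).
 move=> Ax By; have := FG (t1 [:: mk Ax By], t2 [:: mk Ax By]).
 by rewrite /t1 /tsum /t2 /tsum !big_seq1 /=; apply; exists [:: mk Ax By]; rewrite /t1 /tsum /t2 /tsum !big_seq1.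
exists F; split=> //.
 split=> //; apply: (hdense_sub _ (pt_dense rf.2 rg.2)).
 move=> _ [_ [_ [x Ax <-] [z _ <-]] [_ [_ [y By <-] [w _ <-]] <-]].
 exists (F (otens x y)); first by exists (otens x y) => //; exact: tens_in.
 by exists (pt T z w) => //; rewrite FE // otensE //; [exact: (shom_bop sf)|exact: (shom_bop sg)].
move=> fi gi; apply: Fi => p C Gp C0; have [r [-> ->]] := GP Gp => h.
apply: (tsum_bndV hA sf) => //; apply: (tsum_bndrV hB sg) => //.
Qed.
End Rep.
End TensorRep.

(** * Normal amplifications *)

Section NormalAmplifications.
Implicit Types (H K L M N P : hilbert R) (A B : opalg R).
(** The model is an amplification followed by conjugation with a unitary. The last clause stands in
    for normality: it keeps the composition with a representation nondegenerate. *)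
Definition namp M N (al : M ~> N) := [/\ shom (@bop R M M) al, al id = id &
   forall Y : set (op M M), Y `<=` @bop R M M -> hdense (vecs Y) -> hdense (vecs (al @` Y))].

Section Basics.
Variables (M N : hilbert R) (al : M ~> N) (na : namp al).
Let sa : shom (@bop R M M) al. by case: na. Qed.
Lemma namp_shom : shom (@bop R M M) al. exact: sa. Qed.
Lemma namp_bop t : bop t -> bop (al t). exact: (shom_bop sa). Qed.
Lemma namp_comp s t : bop s -> bop t -> al (s \o t) = al s \o al t.
exact: (shom_comp sa). Qed.
Lemma namp_adj t : bop t -> al (adj t) = adj (al t). exact: (shom_adj sa). Qed.
Lemma namp_id : al id = id. by case: na. Qed.
Lemma namp_un u : unitary u -> unitary (al u).
move=> /unP[bu h1 h2]; apply/unP; have ba := bop_adj bu.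
by split; [exact: namp_bop|rewrite -namp_adj // -namp_comp // h1 namp_id
 |rewrite -namp_adj // -namp_comp // h2 namp_id].
Qed.
Lemma namp_conj u t : bop u -> bop t -> al (Ad u t) = Ad (al u) (al t).
move=> bu bt; have ba := bop_adj bu; have b1 := bop_comp bu bt.
by rewrite /Ad namp_comp // namp_comp // namp_adj.
Qed.
Lemma rep_namp A (f : sp A ~> M) : rep f -> rep (al \o f).
move=> [[f1 f2 f3 f4] df]; split; last first.
 have -> : (al \o f) @` els A = al @` (f @` els A).
  apply/seteqP; split=> [_ [a Aa <-]|_ [_ [a Aa <-] <-]]; last by exists a.
  by exists (f a) => //; exists a.
 by case: na => _ _; apply => // _ [a Aa <-]; exact: f1.
split=> /=.
- by move=> a Aa; apply: namp_bop; exact: f1.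
- by move=> c a b Aa Ab; rewrite f2 // (shom_lin sa) //; exact: f1.
- by move=> a b Aa Ab; rewrite f3 // namp_comp //; exact: f1.
- by move=> a Aa; rewrite f4 // namp_adj //; exact: f1.
Qed.
Lemma ext_namp A (f : sp A ~> M) t : cstar A -> rep f -> mult A t -> ext (al \o f) t = al (ext f t).
move=> cA rf mt; have bt := ext_bop cA rf mt.
apply: (ext_uniq (rep_namp rf)) => [|a Aa /=]; first exact: namp_bop.
by rewrite -namp_comp ?ext_l //; exact: (shom_bop rf.1).
Qed.
Lemma namp_bnd t (C : R) : bop t -> 0 <= C -> bnd C t -> bnd C (al t).
by move=> bt; apply: (shom_contr (bop_csalg M) sa). Qed.
End Basics.
Lemma namp_idf M : namp (@idfun (op M M)).
by split=> // Y _; rewrite image_id. Qed.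
Lemma namp_trans M N P (al : M ~> N) (be : N ~> P) : namp al -> namp be -> namp (be \o al).
move=> na nb; have [[a1 a2 a3 a4] a5 a6] := na; have [[b1 b2 b3 b4] b5 b6] := nb; split.
- split=> /= [t bt|c s t bs bt|s t bs bt|t bt].
 + exact/b1/a1.
 + by rewrite a2 // b2 //; exact: a1.
 + by rewrite a3 // b3 //; exact: a1.
 + by rewrite a4 // b4 //; exact: a1.
- by rewrite /= a5.
- move=> Y YB dY; rewrite -image_comp; apply: b6; last exact: a6.
 by move=> _ [t Yt <-]; apply: a1; exact: YB.
Qed.
Lemma namp_Ad M N (u : op M N) : unitary u -> namp (Ad u).
move=> uu; have bu := un_bop uu; split.
- split=> [t bt|c s t bs bt|s t bs bt|t bt].
 + exact: bop_Ad.
 + exact: Ad_lincomb.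
 + exact: Ad_comp.
 + by rewrite Ad_adj.
- exact: Ad_id.
move=> Y YB dY x e e0; have [y Ly hy] := dY (adj u x) e e0.
exists (u y).
 elim/lspan_ind: y / Ly {hy} => [|c v w [a Ya [z _ <-]] IH].
  by rewrite (lin0 (bop_lin bu)); exact: lspan0.
 rewrite (bop_lin bu); apply: lspan_cons => //.
 by exists (Ad u a); [exists a|exists (u z) => //; rewrite AdE unK].
by rewrite -[x](unVK _ uu) -(linB (bop_lin bu)) un_nm.
Qed.
Lemma rep_bop A M (f : sp A ~> M) a : rep f -> A a -> bop (f a).
by move=> rf; exact: (shom_bop rf.1). Qed.
Lemma mult_Ad A B (u : op (sp A) (sp B)) t : cstar A -> cstar B -> unitary u ->
 (forall a, A a -> B (Ad u a)) -> (forall b, B b -> A (Ad (adj u) b)) -> mult A t -> mult B (Ad u t).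
move=> cA cB uu AB BA mt; split; first by apply: bop_Ad => //; exact: mult_bop mt.
move=> b Bb; rewrite -[b](AdVK _ uu) -!Ad_comp //.
by split; apply: AB; [apply: mult_l|apply: mult_r] => //; exact: BA.
Qed.
End NormalAmplifications.

Implicit Types (H K L M N P Q : hilbert R) (A B C D : opalg R).
Ltac bdd := first [assumption | eapply rep_bop; eassumption | apply un_bop; assumption
 | eapply cs_bop; eassumption | eapply namp_bop; [eassumption | bdd] | apply bop_comp; bdd].

(** * Joint representations of two algebras on one space *)

Section JointRepresentations.
Lemma namp_ampl M N : namp (fun t : op M M => otens t (@id N)).
have bi := bop_id N; split.
- split=> [t bt|c s t bs bt|s t bs bt|t bt].
 + exact: bop_otens.
 + exact: otens_linl.
 + by rewrite otens_comp.
 + by rewrite otens_adj // adj_id.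
- exact: otens_id.
move=> Y YB dY; apply: hdense_sub (pt_dense dY (@hdenseT N)).
move=> _ [_ [a Ya [z _ <-]] [k _ <-]]; exists (otens a id); first by exists a.
by exists (pt T z k) => //; rewrite otensE //; exact: YB.
Qed.
Lemma namp_ampr M N : namp (fun t : op N N => otens (@id M) t).
have bi := bop_id M; split.
- split=> [t bt|c s t bs bt|s t bs bt|t bt].
 + exact: bop_otens.
 + exact: otens_linr.
 + by rewrite otens_comp.
 + by rewrite otens_adj // adj_id.
- exact: otens_id.
move=> Y YB dY; apply: hdense_sub (pt_dense (@hdenseT M) dY).
move=> _ [k _ [_ [a Ya [z _ <-]] <-]]; exists (otens id a); first by exists a.
by exists (pt T k z) => //; rewrite otensE //; exact: YB.
Qed.
Lemma otens_split H K (s : op H H) (t : op K K) : bop s -> bop t -> otens s t = otens s id \o otens id t.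
by move=> bs bt; have b1 := bop_id H; have b2 := bop_id K; rewrite otens_comp. Qed.
Lemma shom_tens_eq A B M (F F' : sp A *t sp B ~> M) :
 cstar A -> cstar B -> shom (els (A *T B)) F -> shom (els (A *T B)) F' ->
 (forall a b, A a -> B b -> F (otens a b) = F' (otens a b)) -> forall t, (A *T B) t -> F t = F' t.
move=> cA cB sF sF' h t; have hT := cs_alg (tens_cs cA cB).
suff : els (A *T B) `<=` [set t | (A *T B) t /\ [set 0 : op M M] (F t - F' t)].
 by move=> /[apply] -[_ /eqP]; rewrite subr_eq0 => /eqP.
apply: tens_ind => [|a b Aa Bb]; last by split; [exact: tens_in|rewrite h // subrr].
apply: (csub_pre (fun t => F t - F' t) 2) => //.
- exact: csa_sub.
- split=> // [a _ _ -> ->|s /nclP hs] /=; first by rewrite scaler0 addr0.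
 by apply: bnd_eq0 => r /hs[_ ->]; rewrite subr0.
- by move=> a s u Ts Tu; exists a; rewrite (shom_lin sF) // (shom_lin sF') // scalerBr opprD addrACA.
- move=> s u Ts Tu; rewrite (shomB sF) // (shomB sF') // !opprB addrACA [RHS]addrACA.
 by congr (_ + _); exact: addrC.
- move=> Q u Q0 Tu hQ; rewrite -[2]/(1 + 1) mulrDl !mul1r; apply: bndD.
  exact: (shom_contr hT sF).
 by apply: bnd_lin; exact: (shom_contr hT sF').
Qed.
Definition jrP A B M (f : sp A ~> M) (g : sp B ~> M) (F : sp A *t sp B ~> M) :=
 shom (els (A *T B)) F /\ forall a b, A a -> B b -> F (otens a b) = f a \o g b.
(** Commuting images alone would give a representation of the maximal tensor product; the
    factorisation through the spatial one is therefore part of the notion. *)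
Definition jn A B M (f : sp A ~> M) (g : sp B ~> M) := [/\ rep f, rep g & exists F, @jrP A B M f g F].
Definition jr A B M (f : sp A ~> M) (g : sp B ~> M) := xget (fun=> 0) [set F | @jrP A B M f g F].
(** The substitute for leg numbering: t with its first leg sent by f and its second by g. For f and
    g placed on suitable factors this is t in legs 12, 13, 32 and so on, always as an operator on
    the same space. *)
Definition lg A B M (f : sp A ~> M) (g : sp B ~> M) t := ext (A := A *T B) (@jr A B M f g) t.

Section JointRep.
Variables (A B : opalg R) (M : hilbert R) (f : sp A ~> M) (g : sp B ~> M).
Hypotheses (cA : cstar A) (cB : cstar B) (jfg : @jn A B M f g).
Let rf : rep f. by case: jfg. Qed.
Let rg : rep g. by case: jfg. Qed.
Let hA := cs_alg cA.
Let hB := cs_alg cB.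
Let cT := tens_cs cA cB.
Let bf a : A a -> bop (f a). bdd. Qed.
Let bg b : B b -> bop (g b). bdd. Qed.
Let bA a : A a -> bop a. exact: (csa_bop hA). Qed.
Let bB b : B b -> bop b. exact: (csa_bop hB). Qed.
Lemma jn_l : rep f. exact: rf. Qed.
Lemma jn_r : rep g. exact: rg. Qed.
Lemma jr_prop : @jrP A B M f g (@jr A B M f g).
by rewrite /jr; case: xgetP => [F _ //|h]; case: jfg => _ _ [F /h]. Qed.
Lemma jrE a b : A a -> B b -> @jr A B M f g (otens a b) = f a \o g b.
by case: jr_prop => _; apply. Qed.
(** Compare the adjoint of the image of a elementary tensor with the image of its adjoint: the order
    of the two factors is reversed. *)
Lemma jn_comm a b : A a -> B b -> f a \o g b = g b \o f a.
move=> Aa Bb; have [sF FE] := jr_prop.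
have h := shom_adj sF (tens_in Aa Bb).
rewrite otens_adj ?FE // in h;
 try first [exact: bA|exact: bB|exact: (csa_adj hA)|exact: (csa_adj hB)].
rewrite (shom_adj rf.1) // (shom_adj rg.1) // adj_comp in h; [|exact: bf|exact: bg].
have h' := congr1 (@adj R M M) h.
have b1 := bop_adj (bf Aa); have b2 := bop_adj (bg Bb).
rewrite (adj_comp b1 b2) (adj_comp b2 b1) in h'.
by rewrite (adjK (bf Aa)) (adjK (bg Bb)) in h'.
Qed.
Lemma jr_rep : rep (A := A *T B) (@jr A B M f g).
split; first exact: jr_prop.1.
apply: (hdense_trans rf.2) => v e [_ [a Aa <-] [z _ <-]] e0.
apply: (lspan_approx (t := f a) z _ rg.2 _ e0); first exact: bf.
move=> _ [_ [b Bb <-] [w _ <-]]; apply: sub_lspan.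
exists (jr f g (otens a b)); first by exists (otens a b) => //; exact: tens_in.
by exists w => //; rewrite jrE.
Qed.
Lemma lg_bop t : mult (A *T B) t -> bop (lg f g t). exact: (ext_bop cT jr_rep). Qed.
Lemma lg_shom : shom (mult (A *T B)) (lg f g). exact: (ext_shom cT jr_rep). Qed.
Lemma lg_comp s t : mult (A *T B) s -> mult (A *T B) t -> lg f g (s \o t) = lg f g s \o lg f g t.
exact: (shom_comp lg_shom). Qed.
Lemma lg_adj t : mult (A *T B) t -> lg f g (adj t) = adj (lg f g t).
exact: (shom_adj lg_shom). Qed.
Lemma lg_un t : mult (A *T B) t -> unitary t -> unitary (lg f g t).
exact: (ext_un cT jr_rep). Qed.
Lemma lg_in t : (A *T B) t -> lg f g t = @jr A B M f g t. exact: (ext_in jr_rep). Qed.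
Lemma jr_uniq F t : @jrP A B M f g F -> (A *T B) t -> F t = @jr A B M f g t.
move=> [sF FE]; have [sJ JE] := jr_prop.
by apply: shom_tens_eq => // a b Aa Bb; rewrite FE // JE.
Qed.
Lemma lg_uniq Phi t : shom (mult (A *T B)) Phi ->
 (forall a b, A a -> B b -> Phi (otens a b) = f a \o g b) -> mult (A *T B) t -> Phi t = lg f g t.
move=> sP PE mt.
have sP' : shom (els (A *T B)) Phi.
 have mi x : (A *T B) x -> mult (A *T B) x by exact: mult_in.
 case: sP => p1 p2 p3 p4; split=> [x /mi|c x y /mi hx /mi|x y /mi hx /mi|x /mi].
 - exact: p1.
 - exact: p2.
 - exact: p3.
 - exact: p4.
have PJ x : (A *T B) x -> Phi x = jr f g x by exact: jr_uniq.
rewrite /lg; apply/esym/(ext_uniq jr_rep) => [|x Tx]; first exact: (shom_bop sP).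
rewrite -!PJ //; last exact: mult_l.
by rewrite (shom_comp sP) //; exact: mult_in.
Qed.
Lemma ext_comm_r a t : A a -> mult B t -> ext g t \o f a = f a \o ext g t.
move=> Aa mt; have be := ext_bop cB rg mt; have bfa := bf Aa.
apply: (hdense_eq rg.2); [bdd|bdd|].
move=> _ [_ [b Bb <-] [z _ <-]].
rewrite -[LHS]/((ext g t \o (f a \o g b)) z) -[RHS]/((f a \o (ext g t \o g b)) z).
rewrite jn_comm // ext_l // jn_comm //; last exact: mult_l.
by rewrite -(ext_l cB rg mt Bb).
Qed.
Lemma lg_otens s t : mult A s -> mult B t -> lg f g (otens s t) = ext f s \o ext g t.
move=> ms mt; have m2 := mult_otens cA cB ms mt.
have bs := ext_bop cA rf ms; have bt := ext_bop cB rg mt; have bst := bop_comp bs bt.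
apply: (hdense_eq jr_rep.2) => //; first exact: lg_bop.
suff h a b : A a -> B b -> lg f g (otens s t) \o (f a \o g b) = (ext f s \o ext g t) \o (f a \o g b).
 move=> _ [_ [x Tx <-] [z _ <-]].
 suff : els (A *T B) `<=` [set x | (A *T B) x /\ [set 0 : op M M] ((lg f g (otens s t) \o jr f g x) - (ext f s \o ext g t \o jr f g x))].
  by move=> /(_ x Tx)[_ /(congr1 (fun q => q z))] /eqP; rewrite opBE subr_eq0 => /eqP.
 have [sJ JE] := jr_prop.
 have bm := lg_bop m2; have [C [C0 hC]] := bop_bnd (bopB bm bst).
 have e x' : (lg f g (otens s t) \o jr f g x') - (ext f s \o ext g t \o jr f g x') =
  (lg f g (otens s t) - (ext f s \o ext g t)) \o jr f g x' by [].
 have bl := bop_lin (bopB bm bst).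
 apply: tens_ind => [|a b Aa Bb]; last first.
  by split; [exact: tens_in|rewrite JE // h // subrr].
 apply: (csub_pre (fun x => (lg f g (otens s t) \o jr f g x) - (ext f s \o ext g t \o jr f g x)) C) => //.
 - exact: cstar_sub.
 - split=> // [c _ _ -> ->|q /nclP hs] /=; first by rewrite scaler0 addr0.
  by apply: bnd_eq0 => r /hs[_ ->]; rewrite subr0.
 - move=> c u v Tu Tv; exists c; rewrite !e (shom_lin sJ) //.
  by apply/funext => y; exact: bl.
 - move=> u v Tu Tv; rewrite !e (shomB sJ) //.
  by apply/funext => y; exact: (linB bl).
 - by move=> Q u Q0 Tu hQ; rewrite e; apply: bnd_comp => //; exact: (shom_contr (cs_alg cT) sJ).
move=> Aa Bb; rewrite -jrE // -lg_in; last exact: tens_in.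
rewrite -lg_comp //; last by apply: mult_in => //; exact: tens_in.
have b1 := bA Aa; have b2 := bB Bb; have b3 := mult_bop ms; have b4 := mult_bop mt.
rewrite otens_comp // lg_in; last by apply: tens_in; exact: mult_l.
rewrite jrE; [|exact: mult_l|exact: mult_l].
rewrite lg_in; last exact: tens_in.
rewrite jrE // -(ext_l cA rf ms Aa) -(ext_l cB rg mt Bb); apply/funext => x /=.
by congr (ext f s _); exact: (congr1 (fun q => q (g b x)) (esym (ext_comm_r Aa mt))).
Qed.
End JointRep.
End JointRepresentations.

(** * Calculus of joint representations under morphisms and amplifications *)

Section JointCalculus.
Lemma csub_namp M N (al : M ~> N) (X : set (op N N)) : namp al -> csub X -> csub [set t | bop t /\ X (al t)].
move=> na cX; have sa := namp_shom na; have bM := bop_csalg M.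
apply: (csub_pre al 1) => //.
- exact: csub_bop.
- by move=> a s t bs bt; exists a; rewrite (shom_lin sa).
- by move=> s t bs bt; rewrite (shomB sa).
- by move=> C t C0 bt; rewrite mul1r; exact: (shom_contr bM sa).
Qed.
Lemma csub_otensl H K (k : op K K) (X : set (bo (H *t K))) : bop k -> csub X -> csub [set t | bop t /\ X (otens t k)].
move=> bk cX; have [C [C0 hC]] := bop_bnd bk.
apply: (csub_pre (fun t => otens t k) C) => //.
- exact: csub_bop.
- by move=> a s t bs bt; exists a; rewrite otens_linl.
- by move=> s t bs bt; rewrite otensBl.
- by move=> D t D0 bt hD; rewrite mulrC; exact: otens_bnd.
Qed.
Lemma csub_otensr H K (h : op H H) (X : set (bo (H *t K))) : bop h -> csub X -> csub [set t | bop t /\ X (otens h t)].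
move=> bh cX; have [C [C0 hC]] := bop_bnd bh.
apply: (csub_pre (fun t => otens h t) C) => //.
- exact: csub_bop.
- by move=> a s t bs bt; exists a; rewrite otens_linr.
- by move=> s t bs bt; rewrite otensBr.
- by move=> D t D0 bt hD; exact: otens_bnd.
Qed.
Lemma tens_ind2 A B (X : set (bo (sp A *t sp B))) (Y : set (bo (sp A))) (Z : set (bo (sp B))) : csub X ->
 cstar A -> cstar B ->
 (forall Q : set _, csub Q -> Y `<=` Q -> els A `<=` Q) -> (forall Q : set _, csub Q -> Z `<=` Q -> els B `<=` Q) ->
 Y `<=` @bop R _ _ -> Z `<=` @bop R _ _ -> (forall y z, Y y -> Z z -> X (otens y z)) -> els (A *T B) `<=` X.
move=> cX cA cB hY hZ bY bZ h; apply: tens_ind => // a b Aa Bb.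
have ba := cs_bop cA Aa.
suff /(_ b Bb)[] : els B `<=` [set b | bop b /\ X (otens a b)] by [].
apply: hZ => [|z Zz]; first exact: csub_otensr.
split; first exact: bZ.
have bz := bZ _ Zz.
suff /(_ a Aa)[] : els A `<=` [set a | bop a /\ X (otens a z)] by [].
apply: hY => [|y Yy]; first exact: csub_otensl.
by split; [exact: bY|exact: h].
Qed.
Definition ampl N M (t : op M M) : bo (M *t N) := otens t (@id N).
Definition ampr M N (t : op N N) : bo (M *t N) := otens (@id M) t.
Arguments ampl {N M} t.
Arguments ampr {M N} t.
Lemma namp_l N M : namp (@ampl N M). exact: namp_ampl. Qed.
Lemma namp_r M N : namp (@ampr M N). exact: namp_ampr. Qed.
Lemma Ad_otens H K H' K' (u : op H H') (v : op K K') s t : unitary u -> unitary v ->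
 bop s -> bop t -> Ad (otens u v) (otens s t) = otens (Ad u s) (Ad v t).
move=> uu uv bs bt; have bu := un_bop uu; have bv := un_bop uv.
have bu' := bop_adj bu; have bv' := bop_adj bv.
have c1 := bop_comp bu bs; have c2 := bop_comp bv bt.
by rewrite /Ad otens_adj // otens_comp // otens_comp.
Qed.

Section TensorMorphism.
Variables (A B A' B' : opalg R) (f : premor A A') (g : premor B B').
Variables (cA : cstar A) (cB : cstar B) (cA' : cstar A') (cB' : cstar B') (mf : morphism f) (mg : morphism g).
Let cT := tens_cs cA cB.
Let cT' := tens_cs cA' cB'.
(** The candidate for the choice in [tmor] is the spatial tensor product of the underlying
    representations. It takes multiplier values because elementary tensors do, and its nondegeneracy
    is checked on products in each factor. *)
Lemma tmorP : morphism (tmor T f g) /\ forall a b, A a -> B b -> tmor T f g (otens a b) = otens (f a) (g b).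
rewrite /tmor /=; case: xgetP => [h _ //|nh].
have [F [rF FE _]] := tens_rep_ex cA cB (morph_rep cA' mf) (morph_rep cB' mg).
case: (nh F); split=> //.
have hA' := cs_alg cA'; have hB' := cs_alg cB'.
have sF := rF.1; have hT := cs_alg cT.
apply: mk_morphism => //.
 have : els (A *T B) `<=` [set t | els (A *T B) t /\ mult (A' *T B') (F t)]; last first.
  by move=> h a /h[].
 apply: tens_ind => [|a b Aa Bb].
  apply: (csub_pre F 1) => //.
  - exact: csa_sub.
  - exact: (csa_sub (mult_csalg cT')).
  - by move=> a s t bs bt; exists a; rewrite (shom_lin sF).
  - by move=> s t bs bt; rewrite (shomB sF).
  - by move=> C t C0 bt; rewrite mul1r; exact: (shom_contr hT sF).
 split; first exact: tens_in.
 by rewrite FE //; apply: mult_otens => //; exact: mor_mult.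
apply: (tens_ind2 (Y := [set f a \o a' | a in els A & a' in els A'])
 (Z := [set g a \o a' | a in els B & a' in els B'])) => //.
- exact: csub_cspan.
- by move=> Q cQ h; apply: (morph_ind mf cQ) => a b Aa Bb; apply: h; exists a => //; exists b.
- by move=> Q cQ h; apply: (morph_ind mg cQ) => a b Aa Bb; apply: h; exists a => //; exists b.
- move=> _ [a Aa [a' Aa' <-]]; apply: bop_comp; last exact: (csa_bop hA').
 exact/mult_bop/mor_mult.
- move=> _ [a Aa [a' Aa' <-]]; apply: bop_comp; last exact: (csa_bop hB').
 exact/mult_bop/mor_mult.
move=> _ _ [a Aa [a' Aa' <-]] [b Bb [b' Bb' <-]].
have b1 := csa_bop hA' Aa'; have b2 := csa_bop hB' Bb'.
have b3 := mult_bop (mor_mult mf Aa); have b4 := mult_bop (mor_mult mg Bb).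
rewrite -otens_comp // -FE //; apply: prodset_in; last exact: tens_in.
by exists (otens a b) => //; exact: tens_in.
Qed.
Lemma tmor_morphism : morphism (tmor T f g). by have [] := tmorP. Qed.
Lemma tmorE a b : A a -> B b -> tmor T f g (otens a b) = otens (f a) (g b).
by have [_] := tmorP; apply. Qed.
Lemma tapp_ext t : mult (A *T B) t -> tapp f g t = ext (A := A *T B) (tmor T f g) t.
exact: (mextE cT cT' tmor_morphism). Qed.
Lemma tapp_mult t : mult (A *T B) t -> mult (A' *T B') (tapp f g t).
exact: (mext_mult cT cT' tmor_morphism). Qed.
Variables (M : hilbert R) (h : sp A' ~> M) (k : sp B' ~> M) (jhk : jn h k).
Lemma jn_mor : jn (ext h \o f) (ext k \o g).
have [rh rk _] := jhk.
split; [exact: rep_comp|exact: rep_comp|].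
exists (ext (A := A' *T B') (jr h k) \o tmor T f g); split.
 exact: (rep_comp cT' tmor_morphism (jr_rep jhk)).1.
move=> a b Aa Bb; rewrite -[LHS]/(lg h k (tmor T f g (otens a b))) tmorE //.
by rewrite lg_otens //; exact: mor_mult.
Qed.
Lemma lg_mor t : mult (A *T B) t -> lg (ext h \o f) (ext k \o g) t = lg h k (tapp f g t).
move=> mt; rewrite tapp_ext // /lg -(ext_comp cT cT' tmor_morphism (jr_rep jhk)) //.
have rF := rep_comp cT' tmor_morphism (jr_rep jhk).
apply: (shom_eq_ext) => // x Tx; apply: (jr_uniq cA cB jn_mor) => //.
split; first exact: rF.1.
move=> a b Aa Bb; rewrite -[LHS]/(lg h k (tmor T f g (otens a b))) tmorE //.
by rewrite lg_otens //; exact: mor_mult.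
Qed.
End TensorMorphism.

Section Transport.
Variables (A B : opalg R) (cA : cstar A) (cB : cstar B).
Let cT := tens_cs cA cB.
Lemma jr_eq M (f f' : sp A ~> M) (g g' : sp B ~> M) :
 jn f g -> (forall a, A a -> f a = f' a) -> (forall b, B b -> g b = g' b) ->
 jn f' g' /\ forall t, (A *T B) t -> jr f' g' t = jr f g t.
move=> j hf hg; have [rf rg _] := j; have [sJ JE] := jr_prop j.
have j' : jn f' g'.
 split; [exact: rep_eq rf cA hf|exact: rep_eq rg cB hg|].
 by exists (jr f g); split=> // a b Aa Bb; rewrite JE // hf // hg.
split=> // t Tt; apply/esym/(jr_uniq cA cB j') => //.
by split=> // a b Aa Bb; rewrite JE // hf // hg.
Qed.
Lemma lg_eq M (f f' : sp A ~> M) (g g' : sp B ~> M) t :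
 jn f g -> (forall a, A a -> f a = f' a) -> (forall b, B b -> g b = g' b) ->
 mult (A *T B) t -> lg f' g' t = lg f g t.
move=> j hf hg mt; have [j' e] := jr_eq j hf hg.
by apply: (shom_eq_ext cT (jr_rep j)) => // x /e.
Qed.
Lemma jn_namp M N (al : M ~> N) f g : namp al -> jn f g -> jn (al \o f : bo (sp A) -> _) (al \o g : bo (sp B) -> _).
move=> na j; have [rf rg _] := j; have rJ := jr_rep j.
split; [exact: rep_namp|exact: rep_namp|exists (al \o jr f g)]; split.
 exact: (rep_namp na rJ).1.
move=> a b Aa Bb; rewrite /= (jrE j) // (namp_comp na) //; bdd.
Qed.
Lemma jr_namp M N (al : M ~> N) f g t : namp al -> jn f g -> (A *T B) t ->
 jr (al \o f : bo (sp A) -> _) (al \o g : bo (sp B) -> _) t = al (jr f g t).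
move=> na j Tt; have [rf rg _] := j; have rJ := jr_rep j.
apply/esym/(jr_uniq (F := al \o jr f g) cA cB (jn_namp na j)) => //; split.
 exact: (rep_namp na rJ).1.
move=> a b Aa Bb; rewrite /= (jrE j) // (namp_comp na) //; bdd.
Qed.
Lemma lg_namp M N (al : M ~> N) f g t : namp al -> jn f g -> mult (A *T B) t ->
 lg (al \o f : bo (sp A) -> _) (al \o g : bo (sp B) -> _) t = al (lg f g t).
move=> na j mt; have rJ := jr_rep j.
rewrite /lg -(ext_namp na cT rJ mt).
apply: (shom_eq_ext cT (rep_namp na rJ)) => // x Tx.
by rewrite /= jr_namp.
Qed.

Section Local.
Variables (M N : hilbert R) (f : sp A ~> M) (g : sp B ~> N) (rf : rep f) (rg : rep g).
Lemma jn_local : jn (@ampl N M \o f) (@ampr M N \o g).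
split; [exact: (rep_namp (namp_l _ _) rf)|exact: (rep_namp (namp_r _ _) rg)|].
have [F [rF FE _]] := tens_rep_ex cA cB rf rg.
exists F; split=> [|a b Aa Bb]; first exact: rF.1.
by rewrite FE // /= /ampl /ampr -otens_split //; bdd.
Qed.
Lemma jr_local a b : A a -> B b -> jr (@ampl N M \o f) (@ampr M N \o g) (otens a b) = otens (f a) (g b).
by move=> Aa Bb; rewrite (jrE jn_local) //= /ampl /ampr -otens_split //; bdd.
Qed.
(** Faithfulness on the spatial tensor product, extended to multipliers. Hence an identity between
    multipliers may be verified in a single pair of faithful representations on separate legs. *)
Lemma lg_inj : finj (els A) f -> finj (els B) g -> finj (mult (A *T B)) (lg (@ampl N M \o f) (@ampr M N \o g)).
move=> fi gi; have [F [rF FE Fi]] := tens_rep_ex cA cB rf rg.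
apply: (ext_inj cT (jr_rep jn_local)) => x y Tx Ty.
have e z : (A *T B) z -> F z = jr (ampl \o f) (ampr \o g) z.
 move=> Tz; apply: (jr_uniq cA cB jn_local) => //; split=> [|a b Aa Bb]; first exact: rF.1.
 by rewrite FE // /= /ampl /ampr -otens_split //; bdd.
by rewrite -!e //; exact: Fi.
Qed.
End Local.
Lemma lg_local_id t : mult (A *T B) t -> lg (@ampl (sp B) (sp A)) (@ampr (sp A) (sp B)) t = t.
move=> mt; have rA := rep_id cA; have rB := rep_id cB.
have j := jn_local rA rB.
have := lg_uniq (Phi := id) cA cB j _ _ mt; rewrite /= => <- //.
- by have [_ h2 h3 h4] := mult_csalg cT.
- move=> a b Aa Bb; rewrite /= /ampl /ampr -otens_split //; bdd.
Qed.
End Transport.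
(** The passage from the tensor notation of the definitions to leg form. *)
Lemma tapp_lg A B A' B' (f : premor A A') (g : premor B B') t :
 cstar A -> cstar B -> cstar A' -> cstar B' -> morphism f -> morphism g -> mult (A *T B) t ->
 tapp f g t = lg (@ampl (sp B') (sp A') \o f) (@ampr (sp A') (sp B') \o g) t.
move=> cA cB cA' cB' mf mg mt.
have rA := rep_id cA'; have rB := rep_id cB'; have j := jn_local cA' cB' rA rB.
have m2 := tapp_mult cA cB cA' cB' mf mg mt.
rewrite -[LHS](lg_local_id cA' cB') // -(lg_mor cA cB cA' cB' mf mg j) //.
have nl := @namp_l (sp B') (sp A'); have nr := @namp_r (sp A') (sp B').
apply/(lg_eq cA cB) => //.
- by have := jn_local cA cB (morph_rep cA' mf) (morph_rep cB' mg).
- move=> a Aa; rewrite /= (ext_namp nl) //; last exact: mor_mult.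
 by rewrite ext_idE //; exact: mor_mult.
- move=> a Aa; rewrite /= (ext_namp nr) //; last exact: mor_mult.
 by rewrite ext_idE //; exact: mor_mult.
Qed.
End JointCalculus.
Arguments ampl {N M} t.
Arguments ampr {M N} t.

(** * Flips, reassociation and three legs *)

Section Legs.
Lemma flip_tens A B t : cstar A -> cstar B -> (A *T B) t -> (B *T A) (Ad (flip (sp A) (sp B)) t).
move=> cA cB Tt; have nf := namp_Ad (flip_un (sp A) (sp B)).
suff /(_ t Tt)[] : els (A *T B) `<=` [set t | bop t /\ (B *T A) (Ad (flip (sp A) (sp B)) t)] by [].
apply: tens_ind => [|a b Aa Bb].
 exact: (csub_namp nf (cstar_sub (tens_cs cB cA))).
have ba := cs_bop cA Aa; have bb := cs_bop cB Bb.
by split; [exact: bop_otens|rewrite Ad_flip_otens //; exact: tens_in].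
Qed.
Lemma mult_flip A B t : cstar A -> cstar B -> mult (A *T B) t -> mult (B *T A) (Ad (flip (sp A) (sp B)) t).
move=> cA cB; apply: (mult_Ad (B := B *T A)).
- exact: tens_cs.
- exact: tens_cs.
- exact: flip_un.
- by move=> a; exact: flip_tens.
- by move=> a; rewrite flip_adj; exact: flip_tens.
Qed.
Lemma jn_flip A B M (f : sp A ~> M) (g : sp B ~> M) : cstar A -> cstar B -> jn f g -> jn g f.
move=> cA cB j; have [rf rg _] := j; have [sJ JE] := jr_prop j.
have uf := flip_un (sp B) (sp A).
have hf x : (B *T A) x -> (A *T B) (Ad (flip (sp B) (sp A)) x) by exact: flip_tens.
have bx x : (B *T A) x -> bop x by exact: (cs_bop (tens_cs cB cA)).
split=> //; exists (jr f g \o Ad (flip (sp B) (sp A))); split.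
 split=> /= [t Tt|c s t Ts Tt|s t Ts Tt|t Tt].
 - exact/(shom_bop sJ)/hf.
 - by rewrite Ad_lincomb ?(shom_lin sJ) //; [exact: hf|exact: hf|bdd].
 - by rewrite Ad_comp ?(shom_comp sJ) //; exact: hf.
 - by rewrite -Ad_adj ?(shom_adj sJ) //; [exact: hf|exact: bx].
move=> b a Bb Aa; have ba := cs_bop cA Aa; have bb := cs_bop cB Bb.
by rewrite /= Ad_flip_otens // JE // (jn_comm cA cB j).
Qed.
Lemma shom_mult_Ad A B M (F : sp B ~> M) (u : op (sp A) (sp B)) :
 cstar A -> unitary u -> shom (mult B) F -> (forall t, mult A t -> mult B (Ad u t)) -> shom (mult A) (F \o Ad u).
move=> cA uu sF hm; split=> /= [t Tt|c s t Ts Tt|s t Ts Tt|t Tt].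
- exact/(shom_bop sF)/hm.
- by rewrite Ad_lincomb ?(shom_lin sF) //; [exact: hm|exact: hm|bdd].
- by rewrite Ad_comp ?(shom_comp sF) //; exact: hm.
- by rewrite -Ad_adj ?(shom_adj sF) //; [exact: hm|exact: mult_bop Tt].
Qed.
Lemma lg_flip A B M (f : sp A ~> M) (g : sp B ~> M) t : cstar A -> cstar B -> jn f g -> mult (A *T B) t ->
 lg g f (Ad (flip (sp A) (sp B)) t) = lg f g t.
move=> cA cB j mt; have j' := jn_flip cA cB j.
apply: (lg_uniq (Phi := lg g f \o Ad (flip (sp A) (sp B))) cA cB j) => //.
 apply: (shom_mult_Ad (B := B *T A)).
 - exact: tens_cs.
 - exact: flip_un.
 - exact: lg_shom.
 - by move=> s; exact: mult_flip.
move=> a b Aa Bb; have ba := cs_bop cA Aa; have bb := cs_bop cB Bb.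
rewrite /= Ad_flip_otens // lg_in //; last exact: tens_in.
by rewrite (jrE j') // (jn_comm cB cA j').
Qed.
Lemma Ad_assocV_otens H K L (s : op H H) (t : op K K) (r : op L L) : bop s -> bop t -> bop r ->
 Ad (adj (assoc H K L)) (otens s (otens t r)) = otens (otens s t) r.
by move=> bs bt br; rewrite -Ad_assoc_otens // AdK //; exact: assoc_un.
Qed.

Section Assoc.
Variables (A B C : opalg R) (cA : cstar A) (cB : cstar B) (cC : cstar C).
Let bA a : A a -> bop a. bdd. Qed.
Let bB a : B a -> bop a. bdd. Qed.
Let bC a : C a -> bop a. bdd. Qed.
Let cAB := tens_cs cA cB.
Let cBC := tens_cs cB cC.
Let ua := assoc_un (sp A) (sp B) (sp C).
Lemma assoc_tens t : (A *T B *T C) t -> (A *T (B *T C)) (Ad (assoc (sp A) (sp B) (sp C)) t).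
move=> Tt; have cX := cstar_sub (tens_cs cA cBC).
pose X := [set t | bop t /\ (A *T (B *T C)) (Ad (assoc (sp A) (sp B) (sp C)) t)].
suff /(_ t Tt)[] : els (A *T B *T C) `<=` X by [].
have csX : csub X by exact: (csub_namp (namp_Ad ua) cX).
apply: (tens_ind) => // x c Tx Cc.
suff /(_ x Tx)[] : els (A *T B) `<=` [set x | bop x /\ X (otens x c)] by [].
have bc := bC Cc.
apply: tens_ind => [|a b Aa Bb]; first exact: csub_otensl.
have ba := bA Aa; have bb := bB Bb; have bab := bop_otens ba bb.
split=> //; split; first exact: bop_otens.
rewrite Ad_assoc_otens //; apply: (@tens_in A (B *T C)) => //; exact: tens_in.
Qed.
Lemma assocV_tens t : (A *T (B *T C)) t -> (A *T B *T C) (Ad (adj (assoc (sp A) (sp B) (sp C))) t).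
move=> Tt; have cX := cstar_sub (tens_cs cAB cC).
pose X := [set t | bop t /\ (A *T B *T C) (Ad (adj (assoc (sp A) (sp B) (sp C))) t)].
suff /(_ t Tt)[] : els (A *T (B *T C)) `<=` X by [].
have csX : csub X by exact: (csub_namp (namp_Ad (un_adj ua)) cX).
apply: (tens_ind) => // a x Aa Tx.
suff /(_ x Tx)[] : els (B *T C) `<=` [set x | bop x /\ X (otens a x)] by [].
have ba := bA Aa.
apply: tens_ind => [|b c Bb Cc]; first exact: csub_otensr.
have bb := bB Bb; have bc := bC Cc; have bbc := bop_otens bb bc.
split=> //; split; first exact: bop_otens.
rewrite Ad_assocV_otens //; apply: (@tens_in (A *T B) C) => //; exact: tens_in.
Qed.
Lemma mult_assoc t : mult (A *T B *T C) t -> mult (A *T (B *T C)) (Ad (assoc (sp A) (sp B) (sp C)) t).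
apply: (mult_Ad (B := A *T (B *T C))) => //.
- exact: tens_cs.
- exact: tens_cs.
- exact: assoc_tens.
- exact: assocV_tens.
Qed.
Lemma mult_leg12 t : mult (A *T B) t -> mult (A *T (B *T C)) (leg12 (sp C) t).
move=> mt; apply: mult_assoc; apply: (@mult_otens (A *T B) C) => //; exact: mult_id.
Qed.
Lemma mult_leg23 t : mult (B *T C) t -> mult (A *T (B *T C)) (leg23 (sp A) t).
move=> mt; apply: (@mult_otens A (B *T C)) => //; exact: mult_id.
Qed.
End Assoc.
Lemma mult_leg13 A B C t : cstar A -> cstar B -> cstar C -> mult (A *T C) t -> mult (A *T (B *T C)) (leg13 (sp B) t).
move=> cA cB cC mt; have m2 := mult_leg12 cA cC cB mt.
have idu := un_id (sp A).
have h D E x : cstar D -> cstar E -> (A *T (D *T E)) x ->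
  (A *T (E *T D)) (Ad (otens (@id (sp A)) (flip (sp D) (sp E))) x).
 move=> cD cE Tx; have uf := flip_un (sp D) (sp E).
 have un := un_otens idu uf.
 suff /(_ x Tx)[] : els (A *T (D *T E)) `<=` [set x | bop x /\
   (A *T (E *T D)) (Ad (otens (@id (sp A)) (flip (sp D) (sp E))) x)] by [].
 have cX := cstar_sub (tens_cs cA (tens_cs cE cD)).
 apply: (tens_ind) => [|a y Aa Ty]; first exact: (csub_namp (namp_Ad un) cX).
 have ba := cs_bop cA Aa.
 have by_ := cs_bop (tens_cs cD cE) Ty.
 split; first exact: bop_otens.
 rewrite Ad_otens //; apply: (@tens_in A (E *T D)); last exact: flip_tens.
 by rewrite /Ad adj_id.
apply: (mult_Ad (B := A *T (B *T C))) m2.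
- by apply: tens_cs => //; exact: tens_cs.
- by apply: tens_cs => //; exact: tens_cs.
- by apply: un_otens => //; exact: flip_un.
- by move=> x; exact: h.
- move=> x; have b1 := bop_id (sp A); have b2 := un_bop (flip_un (sp C) (sp B)).
 by rewrite otens_adj // adj_id flip_adj; exact: h.
Qed.
(** Bracketed to the right like the triple tensor products, so that [lg3] applies directly to
    operators written with [leg12], [leg13] and [leg23]. Joint representability of the other pairs
    is derived below. *)
Definition jn3 A B C M (f : sp A ~> M) (g : sp B ~> M) (h : sp C ~> M) := jn g h /\ @jn A (B *T C) M f (jr g h).
Definition lg3 A B C M (f : sp A ~> M) (g : sp B ~> M) (h : sp C ~> M) t := @lg A (B *T C) M f (jr g h) t.

Section Triple.
Variables (A B C : opalg R) (M : hilbert R).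
Variables (f : sp A ~> M) (g : sp B ~> M) (h : sp C ~> M).
Hypotheses (cA : cstar A) (cB : cstar B) (cC : cstar C) (j3 : @jn3 A B C M f g h).
Let bA a : A a -> bop a. bdd. Qed.
Let bB a : B a -> bop a. bdd. Qed.
Let bC a : C a -> bop a. bdd. Qed.
Let cAB := tens_cs cA cB.
Let cBC := tens_cs cB cC.
Let jgh : jn g h := j3.1.
Let j1 := j3.2.
Let rf : rep f. by case: j1. Qed.
Let rg : rep g. by case: jgh. Qed.
Let rh : rep h. by case: jgh. Qed.
Let lg3s : shom (mult (A *T (B *T C))) (lg3 f g h). exact: (lg_shom cA cBC j1). Qed.
Lemma lg3_comp s t : mult (A *T (B *T C)) s -> mult (A *T (B *T C)) t ->
 lg3 f g h (s \o t) = lg3 f g h s \o lg3 f g h t.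
exact: (shom_comp lg3s). Qed.
Lemma lg3E s t r : mult A s -> mult B t -> mult C r ->
 lg3 f g h (otens s (otens t r)) = ext f s \o (ext g t \o ext h r).
move=> ms mt mr; rewrite /lg3 (lg_otens cA cBC j1) //; last exact: mult_otens.
by congr (_ \o _); exact: (lg_otens cB cC jgh).
Qed.
Lemma lg3_23 t : mult (B *T C) t -> lg3 f g h (leg23 (sp A) t) = lg g h t.
move=> mt; rewrite /lg3 /leg23 (lg_otens cA cBC j1) //; last exact: mult_id.
by rewrite ext_id.
Qed.
Let s12 : shom (mult (A *T B)) (lg3 f g h \o leg12 (sp C)).
have ma := @mult_assoc A B C cA cB cC.
have h2 := shom_mult_Ad (B := A *T (B *T C)) (tens_cs cAB cC) (assoc_un _ _ _) lg3s ma.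
have ml t : mult (A *T B) t -> mult (A *T B *T C) (otens t id).
 by move=> mt; apply: (@mult_otens (A *T B) C) => //; exact: mult_id.
have bm t : mult (A *T B) t -> bop t by exact: mult_bop.
have bi := bop_id (sp C).
split=> [t Tt|c s t Ts Tt|s t Ts Tt|t Tt]; rewrite /= /leg12.
- exact/(shom_bop h2)/ml.
- rewrite -[RHS](shom_lin h2) /=; [|exact: ml|exact: ml].
 by rewrite otens_linl //; exact: bm.
- rewrite -[RHS](shom_comp h2) /=; [|exact: ml|exact: ml].
 by rewrite otens_comp //; exact: bm.
- rewrite -[RHS](shom_adj h2) /=; [|exact: ml].
 by rewrite otens_adj ?adj_id //; exact: bm.
Qed.
Let m1 (E : opalg R) : mult E id. exact: mult_id. Qed.
Let mi (E : opalg R) a : cstar E -> E a -> mult E a. exact: mult_in. Qed.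
Let e12 a b : A a -> B b -> lg3 f g h (leg12 (sp C) (otens a b)) = f a \o g b.
move=> Aa Bb; rewrite /leg12 Ad_assoc_otens //; [|exact: bA|exact: bB|exact: bop_id].
rewrite lg3E //; [|exact: mi|exact: mi].
by rewrite (ext_in rf) // (ext_in rg) // ext_id.
Qed.
Lemma jn3_12 : jn f g.
split=> //; exists (lg3 f g h \o leg12 (sp C)); split=> //.
have mi' x : (A *T B) x -> mult (A *T B) x by exact: mult_in.
case: s12 => p1 p2 p3 p4; split=> [x /mi'|c x y /mi' hx /mi'|x y /mi' hx /mi'|x /mi'].
- exact: p1.
- exact: p2.
- exact: p3.
- exact: p4.
Qed.
Lemma lg3_12 t : mult (A *T B) t -> lg3 f g h (leg12 (sp C) t) = lg f g t.
exact: (lg_uniq cA cB jn3_12 s12 e12). Qed.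
Lemma jn3_12_3 : @jn (A *T B) C M (jr f g) h /\ forall t, mult (A *T B *T C) t ->
 @lg (A *T B) C M (jr f g) h t = lg3 f g h (Ad (assoc (sp A) (sp B) (sp C)) t).
have ma := @mult_assoc A B C cA cB cC.
have sP := shom_mult_Ad (B := A *T (B *T C)) (tens_cs cAB cC) (assoc_un _ _ _) lg3s ma.
have PE x c : (A *T B) x -> C c -> (lg3 f g h \o Ad (assoc (sp A) (sp B) (sp C))) (otens x c) = jr f g x \o h c.
 move=> Tx Cc; have bx := cs_bop cAB Tx; have bc := bC Cc.
 have mx : mult (A *T B) x by exact: mult_in.
 rewrite otens_split // (shom_comp sP); last 2 first.
 - by apply: (@mult_otens (A *T B) C) => //; exact: mult_id.
 - by apply: (@mult_otens (A *T B) C) => //; exact: mi.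
 congr (_ \o _).
  by rewrite -(lg_in jn3_12) // -lg3_12.
 have ii := otens_id (sp A) (sp B).
 rewrite /= -ii Ad_assoc_otens //; [|exact: bop_id|exact: bop_id].
 by rewrite lg3E //; [rewrite !ext_id // (ext_in rh)|exact: mi].
have j : @jn (A *T B) C M (jr f g) h.
 split=> //; first exact: (jr_rep jn3_12).
 exists (lg3 f g h \o Ad (assoc (sp A) (sp B) (sp C))); split=> //.
 have cT := tens_cs cAB cC.
 have mi' x : (A *T B *T C) x -> mult (A *T B *T C) x by exact: mult_in.
 case: sP => p1 p2 p3 p4; split=> [x /mi'|c x y /mi' hx /mi'|x y /mi' hx /mi'|x /mi'].
 - exact: p1.
 - exact: p2.
 - exact: p3.
 - exact: p4.
split=> // t mt; apply/esym.
exact: (lg_uniq cAB cC j sP PE mt).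
Qed.
End Triple.

Section Thirteen.
Variables (A B C : opalg R) (M : hilbert R).
Variables (f : sp A ~> M) (g : sp B ~> M) (h : sp C ~> M).
Hypotheses (cA : cstar A) (cB : cstar B) (cC : cstar C) (j3 : @jn3 A B C M f g h).
Let cAC := tens_cs cA cC.
Let rf : rep f. by case: j3.2. Qed.
Let rg : rep g. by case: j3.1. Qed.
Let rh : rep h. by case: j3.1. Qed.
Let s13 : shom (mult (A *T C)) (lg3 f g h \o leg13 (sp B)).
have sL : shom (mult (A *T (B *T C))) (lg3 f g h) by exact: (lg_shom cA (tens_cs cB cC) j3.2).
have nb : namp (@Defs.leg13 R T (sp A) (sp B) (sp C)).
 have u1 := assoc_un (sp A) (sp C) (sp B).
 have u2 := un_otens (un_id (sp A)) (flip_un (sp C) (sp B)).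
 exact: (namp_trans (namp_trans (@namp_ampl _ (sp B)) (namp_Ad u1)) (namp_Ad u2)).
have [n1 n2 n3 n4] := namp_shom nb.
have ml t : mult (A *T C) t -> mult (A *T (B *T C)) (leg13 (sp B) t) by exact: mult_leg13.
have bm t : mult (A *T C) t -> bop t by exact: mult_bop.
split=> [t Tt|c s t Ts Tt|s t Ts Tt|t Tt] /=.
- exact/(shom_bop sL)/ml.
- by rewrite n2 ?(shom_lin sL) //; [exact: ml|exact: ml|exact: bm|exact: bm].
- by rewrite n3 ?(shom_comp sL) //; [exact: ml|exact: ml|exact: bm|exact: bm].
- by rewrite n4 ?(shom_adj sL) //; [exact: ml|exact: bm].
Qed.
Let e13 a b : A a -> C b -> (lg3 f g h \o leg13 (sp B)) (otens a b) = f a \o h b.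
move=> Aa Cb; have ba := cs_bop cA Aa; have bb := cs_bop cC Cb.
have bi := bop_id (sp B); have ui := un_id (sp A).
have uf := flip_un (sp C) (sp B); have bo := bop_otens bb bi.
rewrite /= /leg13 /leg12 Ad_assoc_otens // Ad_otens // Ad_flip_otens //.
rewrite /Ad adj_id (lg3E cA cB cC j3) //; try exact: mult_id; try exact: mult_in.
by rewrite (ext_in rf) // (ext_in rh) // ext_id.
Qed.
Lemma jn3_13 : jn f h.
split=> //; exists (lg3 f g h \o leg13 (sp B)); split=> //.
have mi' x : (A *T C) x -> mult (A *T C) x by exact: mult_in.
case: s13 => p1 p2 p3 p4; split=> [x /mi'|c x y /mi' hx /mi'|x y /mi' hx /mi'|x /mi'].
- exact: p1.
- exact: p2.
- exact: p3.
- exact: p4.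
Qed.
Lemma lg3_13 t : mult (A *T C) t -> lg3 f g h (leg13 (sp B) t) = lg f h t.
exact: (lg_uniq cA cC jn3_13 s13 e13). Qed.
End Thirteen.

(** * Bicharacter identities in leg form *)

Section Bicharacters.
Variables (M : hilbert R).
Lemma bichar2_gen A B C D (f : sp A ~> M) (g : sp B ~> M) (h : sp C ~> M) (d : premor D (B *T C)) t :
 cstar A -> cstar B -> cstar C -> cstar D -> morphism d -> @jn3 A B C M f g h -> mult (A *T D) t ->
 jn f (fun s => lg g h (d s)) /\
 lg f (fun s => lg g h (d s)) t = lg3 f g h (tapp (idm A) d t).
move=> cA cB cC cD md [jgh j1] mt; have cBC := tens_cs cB cC.
have [rf _ _] := j1; have mA := idm_morphism cA.
have j := jn_mor cA cD cA cBC mA md j1.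
have e a : A a -> (ext f \o idm A) a = f a by move=> Aa; rewrite /= (ext_in rf).
have [j' _] := jr_eq cA cD (g' := fun s => lg g h (d s)) j e (fun b _ => erefl).
split=> //; rewrite /lg3 -(lg_mor cA cD cA cBC mA md j1) //.
exact: (lg_eq cA cD j e (fun b _ => erefl)).
Qed.
Lemma bichar1_gen A B C D (f : sp A ~> M) (g : sp B ~> M) (h : sp C ~> M) (d : premor D (A *T B)) t :
 cstar A -> cstar B -> cstar C -> cstar D -> morphism d -> @jn3 A B C M f g h -> mult (D *T C) t ->
 jn (fun s => lg f g (d s)) h /\ lg (fun s => lg f g (d s)) h t
  = lg3 f g h (Ad (assoc (sp A) (sp B) (sp C)) (tapp d (idm C) t)).
move=> cA cB cC cD md j3 mt; have cAB := tens_cs cA cB.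
have [j1 e1] := jn3_12_3 cA cB cC j3.
have [_ rh _] := j1; have mC := idm_morphism cC.
have j := jn_mor cD cC cAB cC md mC j1.
have e a : C a -> (ext h \o idm C) a = h a by move=> Ca; rewrite /= (ext_in rh).
have [j' _] := jr_eq cD cC (f' := fun s => lg f g (d s)) j (fun b _ => erefl) e.
split=> //; rewrite -e1; last first.
 exact: (tapp_mult cD cC cAB cC md mC).
rewrite -(lg_mor cD cC cAB cC md mC j1) //.
exact: (lg_eq cD cC j (fun b _ => erefl) e).
Qed.
Variables (A B : opalg R) (cA : cstar A) (cB : cstar B).
Lemma bichar2 (f : sp A ~> M) (g h : sp B ~> M)
  (d : premor B (B *T B)) t : morphism d -> @jn3 A B B M f g h -> mult (A *T B) t ->
 tapp (idm A) d t = leg12 (sp B) t \o leg13 (sp B) t -> jn f (fun s => lg g h (d s)) /\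
 lg f (fun s => lg g h (d s)) t = lg f g t \o lg f h t.
move=> md j3 mt e; have [j ->] := bichar2_gen cA cB cB cB md j3 mt; split=> //.
rewrite e (lg3_comp cA cB cB j3); [|exact: mult_leg12|exact: mult_leg13].
by rewrite (lg3_12 cA cB cB j3) // (lg3_13 cA cB cB j3).
Qed.
Lemma bichar1 (f g : sp A ~> M) (h : sp B ~> M)
  (d : premor A (A *T A)) t : morphism d -> @jn3 A A B M f g h -> mult (A *T B) t ->
 Ad (assoc _ _ _) (tapp d (idm B) t) = leg23 (sp A) t \o leg13 (sp A) t ->
 jn (fun s => lg f g (d s)) h /\ lg (fun s => lg f g (d s)) h t = lg g h t \o lg f h t.
move=> md j3 mt e; have [j ->] := bichar1_gen cA cA cB cA md j3 mt; split=> //.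
rewrite e (lg3_comp cA cA cB j3); [|exact: mult_leg23|exact: mult_leg13].
by rewrite (lg3_23 cA cA cB j3) // (lg3_13 cA cA cB j3).
Qed.
End Bicharacters.

(** * Independent legs *)

Section Independence.
(** Amplifications are defined on all maps, with arbitrary values outside the bounded operators, so
    agreement is asked for bounded operators only. *)
Definition eqb M Q (al be : M ~> Q) := forall t, bop t -> al t = be t.
(** Moves a computation from legs in general position to the concrete tensor product through which
    they factor. *)
Lemma lg_eqb A B M N Q Q' (eta : Q ~> Q') (a1 : M ~> Q) (b1 : N ~> Q) (al : M ~> Q') (be : N ~> Q')
 (f : sp A ~> M) (g : sp B ~> N) t : cstar A -> cstar B -> namp eta ->
 eqb al (eta \o a1) -> eqb be (eta \o b1) -> jn (a1 \o f) (b1 \o g) -> mult (A *T B) t -> rep f -> rep g ->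
 lg (al \o f) (be \o g) t = eta (lg (a1 \o f) (b1 \o g) t).
move=> cA cB ne ea eb j mt rf rg; rewrite -(lg_namp cA cB ne j mt).
by apply: (lg_eq cA cB (jn_namp ne j)) => // x Hx; rewrite /= ?ea ?eb //; bdd.
Qed.
(** Two legs in general position: both come from one normal map on the tensor product. This is
    stronger than commutation and guarantees that representations placed on the two legs are
    joint. *)
Definition ind2 M N Q (al : M ~> Q) (be : N ~> Q) := exists2 eta : M *t N ~> Q, namp eta &
  eqb al (fun t => eta (ampl t)) /\ eqb be (fun t => eta (ampr t)).
Definition ind3 M N P Q (al : M ~> Q) (be : N ~> Q) (ga : P ~> Q) := exists2 eta : M *t (N *t P) ~> Q, namp eta &
  [/\ eqb al (fun t => eta (ampl t)), eqb be (fun t => eta (ampr (ampl t)))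
   & eqb ga (fun t => eta (ampr (ampr t)))].
Lemma namp_eqb M Q (al be : M ~> Q) : namp al -> eqb be al -> namp be.
move=> [[a1 a2 a3 a4] a5 a6] e; split.
- split=> [t bt|c s t bs bt|s t bs bt|t bt].
 + by rewrite e //; exact: a1.
 + by rewrite !e ?a2 //; exact: bop_lincomb.
 + by rewrite (e _ (bop_comp bs bt)) (e _ bs) (e _ bt) a3.
 + by rewrite !e ?a4 //; exact: bop_adj.
- by rewrite e //; exact: bop_id.
move=> Y YB dY; rewrite (_ : be @` Y = al @` Y); first exact: a6.
by apply/seteqP; split=> _ [t Yt <-]; exists t => //; rewrite e //; exact: YB.
Qed.
Lemma ind2_l M N Q (al : M ~> Q) (be : N ~> Q) : ind2 al be -> namp al.
by move=> [eta ne [e _]]; exact: namp_eqb (namp_trans (namp_l N M) ne) e. Qed.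
Lemma ind2_r M N Q (al : M ~> Q) (be : N ~> Q) : ind2 al be -> namp be.
by move=> [eta ne [_ e]]; exact: namp_eqb (namp_trans (namp_r M N) ne) e. Qed.
Lemma ind2_comm M N Q (al : M ~> Q) (be : N ~> Q) s t : ind2 al be -> bop s -> bop t -> al s \o be t = be t \o al s.
move=> [eta ne [e1 e2]] bs bt; rewrite e1 // e2 //.
have b1 := namp_bop (namp_l N M) bs; have b2 := namp_bop (namp_r M N) bt.
rewrite -!(namp_comp ne) //; congr eta.
by rewrite /ampl /ampr !otens_comp //; exact: bop_id.
Qed.
Lemma ind2_jn A B M N Q (al : M ~> Q) (be : N ~> Q) (f : sp A ~> M) (g : sp B ~> N) :
 cstar A -> cstar B -> ind2 al be -> rep f -> rep g -> jn (al \o f) (be \o g).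
move=> cA cB [eta ne [e1 e2]] rf rg.
have j := jn_namp ne (jn_local cA cB rf rg).
have [] // := jr_eq cA cB (f' := al \o f) (g' := be \o g) j.
- by move=> a Aa /=; rewrite e1 //; bdd.
- by move=> a Aa /=; rewrite e2 //; bdd.
Qed.
Lemma ind2_namp M N P Q (al : M ~> P) (be : N ~> P) (de : P ~> Q) :
 namp de -> ind2 al be -> ind2 (de \o al) (de \o be).
move=> nd [eta ne [e1 e2]]; exists (de \o eta); first exact: namp_trans.
by split=> t bt /=; rewrite ?e1 ?e2.
Qed.
Lemma ind2_amp M N : ind2 (@ampl N M) (@ampr M N).
by exists idfun; [exact: namp_idf|]. Qed.
Lemma ind2_sym M N Q (al : M ~> Q) (be : N ~> Q) : ind2 al be -> ind2 be al.
move=> [eta ne [e1 e2]]; exists (eta \o Ad (flip N M)).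
 exact: (namp_trans (namp_Ad (flip_un N M)) ne).
have [bN bM] := (bop_id N, bop_id M).
by split=> t bt /=; rewrite ?e1 ?e2 // /ampl /ampr Ad_flip_otens.
Qed.
Lemma ind3_swap23 M N P Q (al : M ~> Q) (be : N ~> Q) (ga : P ~> Q) : ind3 al be ga -> ind3 al ga be.
move=> [eta ne [e1 e2 e3]].
have uf := flip_un P N; have uM := un_id M.
have uu := un_otens uM uf.
exists (eta \o Ad (otens (@id M) (flip P N))); first exact: (namp_trans (namp_Ad uu) ne).
have bM := bop_id M; have bN := bop_id N; have bP := bop_id P; have bNP := bop_id (N *t P).
have bPN := bop_id (P *t N).
have AM t : Ad (@id M) t = t by rewrite /Ad adj_id.
split=> t bt /=; rewrite ?e1 ?e2 ?e3 //; congr eta.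
- by rewrite /ampl Ad_otens // AM Ad_id.
- rewrite /ampr /ampl Ad_otens //; last exact: bop_otens.
 by rewrite AM Ad_flip_otens.
- rewrite /ampr /ampl Ad_otens //; last exact: bop_otens.
 by rewrite AM Ad_flip_otens.
Qed.
Lemma ind3_swap12 M N P Q (al : M ~> Q) (be : N ~> Q) (ga : P ~> Q) : ind3 al be ga -> ind3 be al ga.
move=> [eta ne [e1 e2 e3]].
have uf := flip_un N M; have uP := un_id P.
have u2 := un_otens uf uP.
have ua := assoc_un M N P; have ua' := un_adj (assoc_un N M P).
exists (eta \o (Ad (assoc M N P) \o (Ad (otens (flip N M) (@id P)) \o Ad (adj (assoc N M P))))).
 exact: (namp_trans (namp_trans (namp_trans (namp_Ad ua') (namp_Ad u2)) (namp_Ad ua)) ne).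
have bM := bop_id M; have bN := bop_id N; have bP := bop_id P.
have AP t : Ad (@id P) t = t by rewrite /Ad adj_id.
have key s t r : bop s -> bop t -> bop r ->
  Ad (assoc M N P) (Ad (otens (flip N M) (@id P)) (Ad (adj (assoc N M P)) (otens s (otens t r))))
  = otens t (otens s r).
 move=> bs bt br; rewrite Ad_assocV_otens // Ad_otens //; last exact: bop_otens.
 by rewrite Ad_flip_otens // AP Ad_assoc_otens.
split=> t bt /=; rewrite ?e1 ?e2 ?e3 //; congr eta.
- have e0 : ampl t = otens t (otens (@id M) (@id P)) :> op (N *t (M *t P)) _ by rewrite otens_id.
 by rewrite e0 key.
- by rewrite /ampl /ampr key // otens_id.
- by rewrite /ampr key.
Qed.
Lemma ind3_23 M N P Q (al : M ~> Q) (be : N ~> Q) (ga : P ~> Q) : ind3 al be ga -> ind2 be ga.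
move=> [eta ne [e1 e2 e3]]; exists (eta \o ampr); last by split.
exact: (namp_trans (namp_r M (N *t P)) ne).
Qed.
Lemma ind3_13 M N P Q (al : M ~> Q) (be : N ~> Q) (ga : P ~> Q) : ind3 al be ga -> ind2 al ga.
by move=> /ind3_swap12; exact: ind3_23. Qed.
Lemma ind3_12 M N P Q (al : M ~> Q) (be : N ~> Q) (ga : P ~> Q) : ind3 al be ga -> ind2 al be.
by move=> /ind3_swap23; exact: ind3_13. Qed.
Lemma ind2_split M N P Q (al : M ~> Q) (be : N *t P ~> Q) :
 ind2 al be -> ind3 al (fun t => be (ampl t)) (fun t => be (ampr t)).
move=> [eta ne [e1 e2]]; exists eta => //; split=> // t bt; rewrite e2 //.
 exact: (namp_bop (namp_l P N)).
exact: (namp_bop (namp_r N P)).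
Qed.
(** The discarded half of the third leg is carried along as an idle factor of the common tensor
    product, after reassociation. *)
Lemma ind3_sub M N P P' Q (al : M ~> Q) (be : N ~> Q) (ga : P *t P' ~> Q) :
 ind3 al be ga -> ind3 al be (fun t => ga (ampl t)).
move=> [eta ne [e1 e2 e3]].
have uN := un_otens (un_id M) (assoc_un N P P').
have ua := assoc_un M (N *t P) P'.
exists (eta \o (Ad (otens (@id M) (assoc N P P')) \o (Ad (assoc M (N *t P) P') \o ampl))).
 exact: (namp_trans (namp_trans (namp_trans (namp_l P' _) (namp_Ad ua)) (namp_Ad uN)) ne).
have bM := bop_id M; have bN := bop_id N; have bP := bop_id P; have bP' := bop_id P'.
have AM t : Ad (@id M) t = t by rewrite /Ad adj_id.
have key s t r : bop s -> bop t -> bop r ->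
  Ad (otens (@id M) (assoc N P P')) (Ad (assoc M (N *t P) P') (otens (otens s (otens t r)) (@id P')))
  = otens s (otens t (otens r (@id P'))).
 move=> bs bt br; have b1 := bop_otens bt br.
 rewrite Ad_assoc_otens // Ad_otens //; last 3 first.
 - exact: un_id.
 - exact: assoc_un.
 - exact: bop_otens.
 by rewrite Ad_assoc_otens // AM.
split=> t bt /=; rewrite ?e1 ?e2 ?e3 //.
- congr eta; have e0 : ampl t = otens t (otens (@id N) (@id P)) :> op (M *t (N *t P)) _ by rewrite otens_id.
 by rewrite e0 /ampl key // !otens_id.
- by congr eta; rewrite /ampl /ampr key // otens_id.
- by congr eta; rewrite /ampl /ampr key.
- exact: (namp_bop (namp_l P' P)).
Qed.
Lemma ind3_Ad M N P P' Q (al : M ~> Q) (be : N ~> Q) (ga : P ~> Q) (u : op P' P) : unitary u ->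
 ind3 al be ga -> ind3 al be (fun t => ga (Ad u t)).
move=> uu [eta ne [e1 e2 e3]].
have u1 := un_otens (un_id N) uu.
have u2 := un_otens (un_id M) u1.
exists (eta \o Ad (otens (@id M) (otens (@id N) u))); first exact: (namp_trans (namp_Ad u2) ne).
have bM := bop_id M; have bN := bop_id N; have bP := bop_id P'.
have AM K t : Ad (@id K) t = t by rewrite /Ad adj_id.
have uM := un_id M; have uN := un_id N.
have bMN K K' : bop (@id (K *t K')) by exact: bop_id.
split=> t bt /=; rewrite ?e1 ?e2 ?e3 //.
- by congr eta; rewrite /ampl Ad_otens // AM Ad_id.
- congr eta; rewrite /ampl /ampr Ad_otens //; last exact: bop_otens.
 by rewrite AM Ad_otens // AM Ad_id.
- congr eta; rewrite /ampl /ampr Ad_otens //; last exact: bop_otens.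
 by rewrite AM Ad_otens // AM.
- exact: bop_Ad.
Qed.
Lemma ind3_jn3 A B C M N P Q (al : M ~> Q) (be : N ~> Q) (ga : P ~> Q) (f : sp A ~> M) (g : sp B ~> N)
  (h : sp C ~> P) : cstar A -> cstar B -> cstar C -> ind3 al be ga -> rep f -> rep g -> rep h ->
 jn3 (al \o f) (be \o g) (ga \o h).
move=> cA cB cC i3 rf rg rh; have i2 := ind3_23 i3.
have j := ind2_jn cB cC i2 rg rh; split=> //.
have [eta ne [e1 e2 e3]] := i3; have cBC := tens_cs cB cC.
have jl := jn_local cB cC rg rh.
have jJ := @ind2_jn A (B *T C) _ _ _ _ _ f (jr (ampl \o g) (ampr \o h)) cA cBC
 (ind2_namp ne (ind2_amp M (N *t P))) rf (jr_rep jl).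
have [] // := jr_eq cA cBC (f' := al \o f) (g' := jr (be \o g) (ga \o h)) jJ.
- by move=> a Aa /=; rewrite e1 //; bdd.
have nr := namp_trans (namp_r M (N *t P)) ne.
have jx := jn_namp nr jl.
move=> x Tx; rewrite /= -[LHS]/((eta \o ampr) (jr (ampl \o g) (ampr \o h) x)).
rewrite -(jr_namp cB cC nr jl Tx); apply/esym.
have e4 a : B a -> ((eta \o ampr) \o (ampl \o g)) a = (be \o g) a by move=> Aa /=; rewrite e2 //; bdd.
have e5 a : C a -> ((eta \o ampr) \o (ampr \o h)) a = (ga \o h) a by move=> Aa /=; rewrite e3 //; bdd.
by have [_ e6] := jr_eq cB cC jx e4 e5; exact: e6.
Qed.
End Independence.
End Legs.

(** * Slices, and separation of representations by a bicharacter *)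

Section Slices.
Definition sl N L (x y : L) (t : bo (N *t L)) : op N N := bra x \o t \o ket y.
Lemma slE N L (x y : L) (t : bo (N *t L)) h h' : ip h (sl x y t h') = ip (pt T h x) (t (pt T h' y)).
by rewrite /sl /= -adjP //; exact: bop_ket. Qed.
Lemma bop_sl N L (x y : L) (t : bo (N *t L)) : bop t -> bop (sl x y t).
by move=> bt; apply: bop_comp; [apply: bop_comp => //; exact: bop_bra|exact: bop_ket].
Qed.
Lemma sl_bnd N L (x y : L) (t : bo (N *t L)) (C : R) : 0 <= C -> bnd C t -> bnd (nm x * nm y * C) (sl x y t).
move=> C0 hC.
have k1 (z : L) : bnd (nm z) (ket z : op N _) by move=> h; rewrite /ket nm_pt mulrC.
have b1 : bnd (nm x) (bra x : op (N *t L) N) by apply: adj_bnd (k1 x); [exact: nm_ge0|exact: bop_ket].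
have -> : nm x * nm y * C = nm x * C * nm y by rewrite mulrAC.
apply: bnd_comp (k1 y); first by rewrite mulr_ge0 // nm_ge0.
by apply: bnd_comp => //; exact: nm_ge0.
Qed.
Lemma sl_lincomb N L (x y : L) a (s t : bo (N *t L)) : sl x y (a *: s + t) = a *: sl x y s + sl x y t.
by apply/funext => h; rewrite /sl /= !(opDE, opZE) (bop_lin (bop_bra _ _)). Qed.
Lemma slB N L (x y : L) (s t : bo (N *t L)) : sl x y (s - t) = sl x y s - sl x y t.
by apply/funext => h; rewrite /sl /= !opBE (linB (bop_lin (bop_bra _ _))). Qed.
Lemma sl_liny N L (x y y' : L) a (t : bo (N *t L)) : bop t -> sl x (a *: y + y') t = a *: sl x y t + sl x y' t.
move=> bt; apply/funext => h; rewrite /sl /= opDE opZE /= /ket (ptr).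
by rewrite (bop_lin bt) (bop_lin (bop_bra _ _)).
Qed.
Lemma sl_By N L (x y y' : L) (t : bo (N *t L)) : bop t -> sl x (y - y') t = sl x y t - sl x y' t.
move=> bt; have := sl_liny x y' y (-1) bt.
by rewrite !scaleN1r addrC => ->; rewrite addrC.
Qed.
Lemma sl_otens N L (x y : L) (s : op N N) (t : op L L) : bop s -> bop t -> sl x y (otens s t) = ip x (t y) *: s.
exact: bra_otens_ket. Qed.

Section Separation.
Variables (A B : opalg R) (L E : hilbert R) (be : sp B ~> E) (pi : sp A ~> L).
Variables (cA : cstar A) (cB : cstar B) (rb : rep be) (rp : rep pi) (fb : finj (els B) be).
Let hB := cs_alg cB.
Let cT := tens_cs cB cA.
Lemma csub_image_rep (X : set (bo (sp B))) : csub X -> X `<=` els B -> csub (be @` els B) -> csub (be @` X).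
move=> cX XB cI; split.
- by exists 0; [exact: csub0|rewrite (shom0 hB rb.1)].
- move=> a _ _ [s Xs <-] [t Xt <-]; exists (a *: s + t); first exact: csub_lincomb.
 by rewrite (shom_lin rb.1) //; exact: XB.
move=> t /nclP h.
have [b Bb eb] : (be @` els B) t.
 by apply: (csub_lim cI) => e /h[_ [s Xs <-] hs]; exists (be s) => //; exists s => //; exact: XB.
exists b => //; apply: (csub_lim cX) => e e0; have [_ [s Xs <-] hs] := h e e0; exists s => //.
have Bs := XB _ Xs.
apply: (shom_isom hB rb.1 fb); [exact: (csubB (csa_sub hB))|exact: ltW|].
by rewrite (shomB rb.1) // eb.
Qed.
Variables (N : hilbert R) (f : sp B ~> N) (rf : rep f).
Local Notation lb := (lg (@ampl L E \o be) (@ampr E L \o pi)).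
Local Notation lf := (lg (@ampl L N \o f) (@ampr N L \o pi)).
Hypothesis cI : csub (be @` els B).
Let jb := jn_local cB cA rb rp.
Let jf := jn_local cB cA rf rp.
(** One element b of B represents the slice in both representations. It is recovered through [be],
    which is faithful and, by [cI], has closed range; agreement with f is then an identity of
    bounded maps, checked on elementary tensors. *)
Lemma sl_rep (x z : L) w : (B *T A) w -> exists b, [/\ B b, be b = sl x z (lb w) & f b = sl x z (lf w)].
have sb := lg_shom cB cA jb; have sf := lg_shom cB cA jf.
have mi u : (B *T A) u -> mult (B *T A) u by exact: mult_in.
pose C := nm x * nm z.
have C0 : 0 <= C by rewrite mulr_ge0 // nm_ge0.
have b1 (D : R) u : (B *T A) u -> 0 <= D -> bnd D u -> bnd (C * D) (sl x z (lb u)).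
 move=> Tu D0 hD; apply: sl_bnd => //.
 exact: (shom_contr (mult_csalg cT) sb (mi _ Tu) D0 hD).
have b2 (D : R) u : (B *T A) u -> 0 <= D -> bnd D u -> bnd (C * D) (sl x z (lf u)).
 move=> Tu D0 hD; apply: sl_bnd => //.
 exact: (shom_contr (mult_csalg cT) sf (mi _ Tu) D0 hD).
have eb a b : B b -> A a -> be (ip x (pi a z) *: b) = sl x z (lb (otens b a)).
 move=> Bb Aa; rewrite lg_in //; last exact: tens_in.
 have bb := rep_bop rb Bb; have ba := rep_bop rp Aa.
 by rewrite (jrE jb) //= /ampl /ampr -otens_split // sl_otens // (shomZ hB rb.1).
have ef a b : B b -> A a -> f (ip x (pi a z) *: b) = sl x z (lf (otens b a)).
 move=> Bb Aa; rewrite lg_in //; last exact: tens_in.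
 have bb := rep_bop rf Bb; have ba := rep_bop rp Aa.
 by rewrite (jrE jf) //= /ampl /ampr -otens_split // sl_otens // (shomZ hB rf.1).
have h1 : els (B *T A) `<=` [set u | (B *T A) u /\ (be @` els B) (sl x z (lb u))].
 apply: tens_ind => [|b a Bb Aa].
  apply: (csub_pre (fun u => sl x z (lb u)) C) => //.
  - exact: cstar_sub.
  - by move=> a s t Ts Tt; exists a; rewrite (shom_lin sb) ?sl_lincomb //; exact: mi.
  - by move=> s t Ts Tt; rewrite (shomB sb) ?slB //; exact: mi.
  - by move=> M t M0 Tt; exact: b1.
 split; first exact: tens_in.
 by exists (ip x (pi a z) *: b); [exact: (csubZ (csa_sub hB))|rewrite eb].
have /boolp.choice[bi hbi] : forall s, exists b, (be @` els B) s -> B b /\ be b = s.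
 move=> s; have [[b Bb eb']|n] := pselect ((be @` els B) s); first by exists b.
 by exists 0.
have h2 : els (B *T A) `<=` [set u | (B *T A) u /\ [set 0 : op N N] (f (bi (sl x z (lb u))) - sl x z (lf u))].
 have Bi u : (B *T A) u -> B (bi (sl x z (lb u))) /\ be (bi (sl x z (lb u))) = sl x z (lb u) by move=> /h1[_ /hbi].
 have bl a s t : (B *T A) s -> (B *T A) t -> bi (sl x z (lb (a *: s + t))) =
   a *: bi (sl x z (lb s)) + bi (sl x z (lb t)).
  move=> Ts Tt; have [B1 e1] := Bi _ Ts; have [B2 e2] := Bi _ Tt.
  have [B3 e3] := Bi _ (csub_lincomb (cstar_sub cT) a Ts Tt).
  have B4 := csub_lincomb (csa_sub hB) a B1 B2.
  apply: fb => //; rewrite e3 (shom_lin rb.1) // e1 e2 (shom_lin sb) ?sl_lincomb //; exact: mi.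
 apply: tens_ind => [|b a Bb Aa]; last first.
  have Tba := tens_in Bb Aa; split=> //; have [B1 e1] := Bi _ Tba.
  rewrite -ef //; rewrite -eb // in B1 e1 *.
  by rewrite (fb B1 (csubZ (csa_sub hB) _ Bb) e1) subrr.
 apply: (csub_pre (fun u => f (bi (sl x z (lb u))) - sl x z (lf u)) (C + C)) => //.
 - exact: cstar_sub.
 - split=> // [c _ _ -> ->|q /nclP hs] /=; first by rewrite scaler0 addr0.
  by apply: bnd_eq0 => r /hs[_ ->]; rewrite subr0.
 - exact: addr_ge0.
 - move=> a s t Ts Tt; exists a; have [B1 e1] := Bi _ Ts; have [B2 e2] := Bi _ Tt.
  rewrite bl // (shom_lin rf.1) // (shom_lin sf) ?sl_lincomb; [|exact: mi|exact: mi].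
  by rewrite scalerBr opprD addrACA.
 - move=> s t Ts Tt; have [B1 e1] := Bi _ Ts; have [B2 e2] := Bi _ Tt.
  have -> : bi (sl x z (lb (s - t))) = bi (sl x z (lb s)) - bi (sl x z (lb t)).
   by have := bl (-1) _ _ Tt Ts; rewrite !scaleN1r addrC => ->; rewrite addrC.
  rewrite (shomB rf.1) // (shomB sf) ?slB; [|exact: mi|exact: mi].
  by rewrite !opprB addrACA [RHS]addrACA; congr (_ + _); exact: addrC.
 - move=> M u M0 Tu hM; have [B1 e1] := Bi _ Tu.
  rewrite mulrDl; apply: bndD; last by apply: bnd_lin; exact: b2.
  apply: (shom_contr hB rf.1) => //; first exact: mulr_ge0.
  apply: (shom_isom hB rb.1 fb) => //; first exact: mulr_ge0.
  by rewrite e1; exact: b1.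
move=> Tw; have [_ /hbi[B1 e1]] := h1 _ Tw; have [_ /= e2] := h2 _ Tw.
by exists (bi (sl x z (lb w))); split=> //; apply/eqP; rewrite -subr_eq0 e2.
Qed.
(** Multiplying the slice at pi a z by the image of b' gives the slice at z of V times the
    elementary tensor of b' and a. That product lies in the tensor product itself, where [sl_rep]
    applies. *)
Lemma sl_rep_mult (x z : L) a b V : mult (B *T A) V -> A a -> B b ->
 be b = sl x (pi a z) (lb V) -> f b = sl x (pi a z) (lf V).
move=> mV Aa Bb e.
have bV := lg_bop cB cA jf mV; have bV' := lg_bop cB cA jb mV.
have key (M : hilbert R) (g : sp B ~> M) b' : rep g -> B b' -> sl x (pi a z) (lg (ampl \o g) (ampr \o pi) V) \o g b' =
  sl x z (lg (ampl \o g) (ampr \o pi) (V \o otens b' a)).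
 move=> rg Bb'; have jg := jn_local cB cA rg rp.
 rewrite (lg_comp cB cA jg mV (mult_in cT (tens_in Bb' Aa))).
 rewrite [lg _ _ (otens b' a)]lg_in //; last exact: tens_in.
 have bb := rep_bop rg Bb'; have ba := rep_bop rp Aa.
 rewrite (jrE jg) //= /ampl /ampr -otens_split //.
 by apply/funext => h; rewrite /sl /= /ket otensE.
apply: (hdense_eq rf.2); [bdd|exact: bop_sl|].
move=> _ [_ [b' Bb' <-] [h _ <-]].
have Tw : (B *T A) (V \o otens b' a) by apply: mult_l => //; exact: tens_in.
have [b2 [B2 e2 e3]] := sl_rep x z Tw.
have : be (b \o b') = be b2 by rewrite (shom_comp rb.1) // e key.
move/(fb (csa_comp hB Bb Bb') B2) => eb.
have := congr1 (fun q => q h) (key _ f b' rf Bb') => /= ->.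
by rewrite -e3 -eb (shom_comp rf.1).
Qed.
End Separation.
(** The elements on which f1 and f2 agree form a closed subspace. It contains the slices of V at
    vectors pi a z by [sl_rep_mult]; such vectors are total, and the slices span B. Equality of
    representations is thereby reduced to equality of two images of V. *)
Lemma separation A B L E N (be : sp B ~> E) (pi : sp A ~> L) (f1 f2 : sp B ~> N) V :
 cstar A -> cstar B -> rep be -> rep pi -> finj (els B) be -> mult (B *T A) V ->
 be @` els B = cspan (rslices (lg (@ampl L E \o be) (@ampr E L \o pi) V)) -> rep f1 -> rep f2 ->
 lg (@ampl L N \o f1) (@ampr N L \o pi) V = lg (@ampl L N \o f2) (@ampr N L \o pi) V -> forall b, B b -> f1 b = f2 b.
move=> cA cB rb rp fb mV eI r1 r2 e12.
have jb := jn_local cB cA rb rp; have bV := lg_bop cB cA jb mV.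
set tV := lg _ _ V in eI bV.
have cI : csub (be @` els B) by rewrite eI; exact: csub_cspan.
pose B0 := [set b | els B b /\ [set 0 : op N N] (f1 b - f2 b)].
have hB := cs_alg cB.
have c0 : csub B0.
 apply: (csub_pre (fun t => f1 t - f2 t) 2) => //.
 - exact: csa_sub.
 - split=> // [a _ _ -> ->|s /nclP hs] /=; first by rewrite scaler0 addr0.
  by apply: bnd_eq0 => r /hs[_ ->]; rewrite subr0.
 - by move=> a s u Ts Tu; exists a; rewrite (shom_lin r1.1) // (shom_lin r2.1) // scalerBr opprD addrACA.
 - move=> s u Ts Tu; rewrite (shomB r1.1) // (shomB r2.1) // !opprB addrACA [RHS]addrACA.
  by congr (_ + _); exact: addrC.
 - move=> Q u Q0 Tu hQ; rewrite -[2]/(1 + 1) mulrDl !mul1r; apply: bndD.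
   exact: (shom_contr hB r1.1).
  by apply: bnd_lin; exact: (shom_contr hB r2.1).
have cX : csub (be @` B0) by apply: csub_image_rep => // b [].
have sI x y : (be @` els B) (sl x y tV).
 rewrite eI; apply: sub_cspan; split; first exact: bop_sl.
 by exists x, y => k k'; rewrite slE.
have sX x y : (be @` B0) (sl x y tV).
 have [C [C0 hC]] := bop_bnd bV.
 apply: (csub_lim cX) => e e0; pose D := nm x * C + 1.
 have D0 : 0 < D by rewrite ltr_wpDl // mulr_ge0 // nm_ge0.
 have [y' Ly hy] := rp.2 y (e / D) (divr_gt0 e0 D0).
 exists (sl x y' tV); last first.
  rewrite -sl_By //; apply: (bnd_le _ (sl_bnd x (y - y') C0 hC)).
  have n1 := nm_ge0 (y - y').
  have h1 : nm x * nm (y - y') * C = nm x * C * nm (y - y') by rewrite mulrAC.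
  rewrite h1; have h2 : nm x * C * nm (y - y') <= D * nm (y - y') by rewrite ler_wpM2r // lerDl.
  apply: le_trans h2 _; apply: le_trans (_ : D * (e / D) <= _); first by rewrite ler_pM2l.
  by rewrite mulrC divfK // gt_eqF.
 move: y' Ly {hy}; apply: lspan_ind => [|c v w [_ [a Aa <-] [z _ <-]] IH].
  have -> : sl x 0 tV = 0 by have := sl_By x y y bV; rewrite !subrr.
  exact: csub0.
 rewrite sl_liny //; apply: csub_lincomb => //.
 have [b Bb eb] := sI x (pi a z); exists b => //; split=> //.
 rewrite /= (sl_rep_mult cA cB rb rp fb r1 cI mV Aa Bb eb).
 by rewrite (sl_rep_mult cA cB rb rp fb r2 cI mV Aa Bb eb) e12 subrr.
have hX : be @` els B `<=` be @` B0.
 rewrite eI; apply: cspan_min => // s [bs [x [y h]]].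
 have -> : s = sl x y tV by apply/funext => k; apply: ip_extr => k'; rewrite h slE.
 exact: sX.
move=> b Bb; have [|b' [Bb' e] eb] := hX (be b); first by exists b.
by rewrite -(fb _ _ Bb' Bb eb); apply: subr0_eq.
Qed.
End Slices.

(** * Quantum groups in leg form and Heisenberg pairs *)

Section QuantumGroups.
Lemma rep_Kop M Q (al : M ~> Q) : namp al -> rep (A := Kop M) al.
by move=> na; exact: (rep_namp na (rep_id (Kop_cstar M))). Qed.
Lemma ext_Kop M Q (al : M ~> Q) t : namp al -> bop t -> ext (A := Kop M) al t = al t.
move=> na bt; have mt : mult (Kop M) t by rewrite Kop_mult.
have := ext_namp na (Kop_cstar M) (rep_id (Kop_cstar M)) mt.
by rewrite (ext_idE (Kop_cstar M) mt).
Qed.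
Lemma jn3_rot A B C M (f : sp A ~> M) (g : sp B ~> M) (h : sp C ~> M) : cstar A -> cstar B -> cstar C ->
 jn3 f g h -> jn3 h f g.
move=> cA cB cC j3; have [j1 _] := jn3_12_3 cA cB cC j3.
have cAB := tens_cs cA cB.
split; [exact: (jn3_12 cA cB cC j3)|exact: (jn_flip cAB cC j1)].
Qed.

Section LgKop.
Variables (A B : opalg R) (M N Q : hilbert R) (al : M ~> Q) (be : N ~> Q).
Variables (f : premor A (Kop M)) (g : premor B (Kop N)).
Variables (cA : cstar A) (cB : cstar B) (mf : morphism f) (mg : morphism g) (i2 : ind2 al be).
Lemma jn_Kop : @jn (Kop M) (Kop N) Q al be.
exact: (ind2_jn (Kop_cstar M) (Kop_cstar N) i2 (rep_id (Kop_cstar M)) (rep_id (Kop_cstar N))).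
Qed.
Lemma lg_Kop t : mult (A *T B) t -> @lg (Kop M) (Kop N) Q al be (tapp f g t) = lg (al \o f) (be \o g) t.
move=> mt; rewrite -(lg_mor cA cB (Kop_cstar M) (Kop_cstar N) mf mg jn_Kop mt).
have j := ind2_jn cA cB i2 (morphism_Kop mf) (morphism_Kop mg).
apply: (lg_eq cA cB j) => // x Xx /=; rewrite ext_Kop //; first exact: ind2_l i2.
- by have := mor_mult mf Xx; rewrite Kop_mult.
- exact: ind2_r i2.
- by have := mor_mult mg Xx; rewrite Kop_mult.
Qed.
End LgKop.
Lemma ind3_lg_comm B C M N P Q (al : M ~> Q) (be : N ~> Q) (ga : P ~> Q) (f : sp B ~> N) (g : sp C ~> P) s t :
 cstar B -> cstar C -> ind3 al be ga -> rep f -> rep g -> bop s -> mult (B *T C) t ->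
 al s \o lg (be \o f) (ga \o g) t = lg (be \o f) (ga \o g) t \o al s.
move=> cB cC [eta ne [e1 e2 e3]] rf rg bs mt.
have jl := jn_local cB cC rf rg.
have ni := namp_trans (namp_r M (N *t P)) ne.
have bl := lg_bop cB cC jl mt.
rewrite (lg_eqb cB cC ni e2 e3 jl mt) //.
have i2 := ind2_namp ne (ind2_amp M (N *t P)).
by rewrite e1 //; exact: (ind2_comm i2).
Qed.

(** The axioms rewritten for arbitrary joint representations, together with the separation property
    of either leg of W ([hq_S], [hq_Sd]). In this form they pass to the dual, see [hq_dual]. *)
Record hq (G : qgroup T) : Prop := Hq {
 hq_A : cstar (qA G);
 hq_Ad : cstar (qAd G);
 hq_pi : morphism (qpi G);
 hq_pif : finj (els (qA G)) (qpi G);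
 hq_pid : morphism (qpid G);
 hq_pidf : finj (els (qAd G)) (qpid G);
 hq_W : umult (qAd G *T qA G) (qW G);
 hq_Delta : morphism (qDelta G);
 hq_Deltad : morphism (qDeltad G);
 hq_D : forall M (f : sp (qAd G) ~> M) (g h : sp (qA G) ~> M), jn3 f g h -> jn f (fun s => lg g h (qDelta G s)) /\
  lg f (fun s => lg g h (qDelta G s)) (qW G) = lg f g (qW G) \o lg f h (qW G);
 hq_Dd : forall M (f g : sp (qAd G) ~> M) (h : sp (qA G) ~> M), jn3 f g h -> jn (fun s => lg f g (qDeltad G s)) h /\
  lg (fun s => lg f g (qDeltad G s)) h (qW G) = lg g h (qW G) \o lg f h (qW G);
 hq_P : forall Q (al be ga : qL G ~> Q), ind3 al be ga ->
  lg (be \o qpid G) (ga \o qpi G) (qW G) \o lg (al \o qpid G) (be \o qpi G) (qW G) =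
  lg (al \o qpid G) (be \o qpi G) (qW G) \o lg (al \o qpid G) (ga \o qpi G) (qW G)
   \o lg (be \o qpid G) (ga \o qpi G) (qW G);
 hq_S : forall N (f g : sp (qA G) ~> N), rep f -> rep g -> lg (@ampl N _ \o qpid G) (@ampr _ N \o f) (qW G) =
  lg (@ampl N _ \o qpid G) (@ampr _ N \o g) (qW G) -> forall a, qA G a -> f a = g a;
 hq_Sd : forall N (f g : sp (qAd G) ~> N), rep f -> rep g -> lg (@ampl _ N \o f) (@ampr N _ \o qpi G) (qW G) =
  lg (@ampl _ N \o g) (@ampr N _ \o qpi G) (qW G) -> forall a, qAd G a -> f a = g a }.
Lemma lg_flip_local A B M N (f : sp A ~> M) (g : sp B ~> N) t :
 cstar A -> cstar B -> rep f -> rep g -> mult (A *T B) t ->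
 Ad (flip M N) (lg (ampl \o f) (ampr \o g) t) = lg (ampl \o g) (ampr \o f) (Ad (flip (sp A) (sp B)) t).
move=> cA cB rf rg mt; have j := jn_local cA cB rf rg.
have nf := namp_Ad (flip_un M N); have bM := bop_id M; have bN := bop_id N.
have j' := jn_flip cB cA (jn_local cB cA rg rf).
rewrite -(lg_namp cA cB nf j mt) (lg_flip cA cB j' mt); apply/esym/(lg_eq cA cB (jn_namp nf j)) => //.
 by move=> a Aa /=; rewrite /ampl Ad_flip_otens //; bdd.
by move=> a Aa /=; rewrite /ampr Ad_flip_otens //; bdd.
Qed.
Lemma lslices_flip M (t : bo (M *t M)) : lslices t = rslices (Ad (flip M M) t).
have uf := flip_un M M.
have h x y k k' : ip (pt T k x) (Ad (flip M M) t (pt T k' y)) = ip (pt T x k) (t (pt T y k')).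
 rewrite AdE flip_adj flipE -{1}(flipE x k).
 by case: uf => _ ->.
apply/seteqP; split=> s [bs [x [y e]]]; split=> //; exists x, y => k k'.
 by rewrite h e.
by rewrite -h e.
Qed.
Lemma is_qgroup_hq (G : qgroup T) : is_qgroup G -> hq G.
case=> _ [[uU pent] _] cA cAd [mp fp] [mpd fpd] slA slAd uW eW mD mDd eD eDd.
have mW := uW.1.
have rp := morphism_Kop mp; have rpd := morphism_Kop mpd.
have eU : lg (ampl \o qpid G) (@ampr _ (qL G) \o qpi G) (qW G) = qU G.
 by rewrite -[RHS]eW; exact: (esym (tapp_lg cAd cA (Kop_cstar _) (Kop_cstar _) mpd mp mW)).
split=> //.
- by move=> M f g h j3; exact: (bichar2 cAd cA mD j3 mW eD).
- by move=> M f g h j3; exact: (bichar1 cAd cA mDd j3 mW eDd).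
- move=> Q al be ga i3; have cK := Kop_cstar (qL G).
 have i12 := ind3_12 i3; have i13 := ind3_13 i3; have i23 := ind3_23 i3.
 have j3 := ind3_jn3 cK cK cK i3 (rep_id cK) (rep_id cK) (rep_id cK).
 have mU : mult (Kop (qL G) *T Kop (qL G)) (qU G) by rewrite -eW; exact: tapp_mult.
 rewrite -!lg_Kop // eW.
 rewrite -(lg3_12 cK cK cK j3 mU) -(lg3_13 cK cK cK j3 mU) -(lg3_23 cK cK cK j3 mU).
 have m12 := mult_leg12 cK cK cK mU; have m13 := mult_leg13 cK cK cK mU.
 have m23 := mult_leg23 cK cK cK mU.
 have mc := csa_comp (mult_csalg (tens_cs cK (tens_cs cK cK))) m12 m13.
 have := congr1 (@lg3 (Kop (qL G)) (Kop (qL G)) (Kop (qL G)) Q al be ga) pent.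
 rewrite (lg3_comp cK cK cK j3 m23 m12) (lg3_comp cK cK cK j3 mc m23).
 by rewrite (lg3_comp cK cK cK j3 m12 m13).
(* Slices over the first leg become slices over the second after the flip, so [separation] applies
   to the flipped W. *)
- move=> N f g rf rg e.
 have eV : lg (@ampl _ N \o f) (ampr \o qpid G) (Ad (flip _ _) (qW G)) =
      lg (@ampl _ N \o g) (ampr \o qpid G) (Ad (flip _ _) (qW G)).
  by have := congr1 (Ad (flip (qL G) N)) e; rewrite !lg_flip_local.
 apply: (separation (be := qpi G) (pi := qpid G)) eV => //.
 - exact: mult_flip.
 - by rewrite -lg_flip_local // eU -lslices_flip.
- move=> N f g rf rg; apply: (separation cA cAd rpd rp fpd mW _ rf rg).
 by rewrite eU.
Qed.
Lemma lg_dual (G : qgroup T) M (f : sp (qAd G) ~> M) (g : sp (qA G) ~> M) : hq G -> jn f g ->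
 lg g f (qW (dual G)) = adj (lg f g (qW G)).
move=> hG j; have cA := hq_A hG; have cAd := hq_Ad hG; have [mW _] := hq_W hG.
have ma := csa_adj (mult_csalg (tens_cs cAd cA)) mW.
by rewrite /= /dualW (lg_flip cAd cA j ma) (lg_adj cAd cA j).
Qed.
(** The bicharacter of the dual is the flipped adjoint, so each relation is the adjoint of a
    relation for [G] with its legs rearranged; for the pentagon the three legs are reversed. *)
Lemma hq_dual (G : qgroup T) : hq G -> hq (dual G).
move=> hG; have cA := hq_A hG; have cAd := hq_Ad hG; have [mW uW] := hq_W hG.
have [rp rpd] := (morphism_Kop (hq_pi hG), morphism_Kop (hq_pid hG)).
have ma := csa_adj (mult_csalg (tens_cs cAd cA)) mW.
have bo M (f : sp (qAd G) ~> M) (g : sp (qA G) ~> M) : jn f g -> bop (lg f g (qW G)) by move=> j; exact: lg_bop.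
case: (hG) => _ _ mp fp mpd fpd _ mD mDd D Dd P S Sd; split=> //.
- by split; [exact: mult_flip|apply: un_Ad; [exact: flip_un|exact: un_adj]].
- move=> M f g h j3; have j3' := jn3_rot cA cAd cAd j3; have j3'' := jn3_rot cAd cA cAd j3'.
 have [j e] := Dd _ _ _ _ j3''; split; first exact: (jn_flip cAd cA j).
 have jfg := jn_flip cA cAd (jn3_12 cA cAd cAd j3); have jfh := jn_flip cA cAd (jn3_13 cA cAd cAd j3).
 rewrite (lg_dual hG j) (lg_dual hG jfg) (lg_dual hG jfh) e adj_comp //; exact: bo.
- move=> M f g h j3; have j3' := jn3_rot cA cA cAd j3.
 have [j e] := D _ _ _ _ j3'; split; first exact: (jn_flip cAd cA j).
 have jfh := jn_flip cA cAd (jn3_13 cA cA cAd j3); have jgh := jn_flip cA cAd j3.1.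
 rewrite (lg_dual hG j) (lg_dual hG jfh) (lg_dual hG jgh) e adj_comp //; exact: bo.
- move=> Q al be ga i3.
 have i12 := ind3_12 i3; have i13 := ind3_13 i3; have i23 := ind3_23 i3.
 have j12 := ind2_jn cAd cA (ind2_sym i12) rpd rp.
 have j13 := ind2_jn cAd cA (ind2_sym i13) rpd rp.
 have j23 := ind2_jn cAd cA (ind2_sym i23) rpd rp.
 have i3' : ind3 ga be al by apply: ind3_swap12; apply: ind3_swap23; apply: ind3_swap12; exact: i3.
 have e := P _ _ _ _ i3'.
 have [b12 [b13 b23]] := (bo _ _ _ j12, (bo _ _ _ j13, bo _ _ _ j23)).
 rewrite (lg_dual hG j12) (lg_dual hG j13) (lg_dual hG j23).
 rewrite -(adj_comp b12 b23) e -(adj_comp b13 b12) -adj_comp //; last bdd.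
- move=> N f g rf rg e a Aa.
 have jf := jn_local cA cAd rp rf; have jg := jn_local cA cAd rp rg.
 have jf' := jn_flip cA cAd jf; have jg' := jn_flip cA cAd jg.
 move: e; rewrite (lg_dual hG jf') (lg_dual hG jg') => /(congr1 (@adj _ _ _)).
 rewrite (adjK (bo _ _ _ jf')) (adjK (bo _ _ _ jg')) => e; apply: (Sd _ _ _ rf rg _ a Aa).
 have jlg := jn_local cAd cA rg rp.
 have uf := flip_un N (qL G).
 rewrite -[LHS](AdK _ uf) -[RHS](AdK _ uf) !lg_flip_local //.
 by rewrite (lg_flip cAd cA jf') // (lg_flip cAd cA jg') // e.
- move=> N f g rf rg e a Aa.
 have jf := jn_local cA cAd rf rpd; have jg := jn_local cA cAd rg rpd.
 have jf' := jn_flip cA cAd jf; have jg' := jn_flip cA cAd jg.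
 move: e; rewrite (lg_dual hG jf') (lg_dual hG jg') => /(congr1 (@adj _ _ _)).
 rewrite (adjK (bo _ _ _ jf')) (adjK (bo _ _ _ jg')) => e; apply: (S _ _ _ rf rg _ a Aa).
 have uf := flip_un (qL G) N.
 rewrite -[LHS](AdK _ uf) -[RHS](AdK _ uf) !lg_flip_local //.
 by rewrite (lg_flip cAd cA jf') // (lg_flip cAd cA jg') // e.
Qed.

Section Heisenberg.
Variables (G : qgroup T) (hG : hq G).
Let cA := hq_A hG.
Let cAd := hq_Ad hG.
Let mW : mult (qAd G *T qA G) (qW G). by case: (hq_W hG). Qed.
Let uW : unitary (qW G). by case: (hq_W hG). Qed.
Let rp := morphism_Kop (hq_pi hG).
Let rpd := morphism_Kop (hq_pid hG).
Local Notation W := (qW G).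
Local Notation p := (qpi G).
Local Notation pd := (qpid G).
Local Notation Dl := (qDelta G).
Lemma un_lgW Q (f : sp (qAd G) ~> Q) (g : sp (qA G) ~> Q) : jn f g -> unitary (lg f g W).
by move=> j; exact: (lg_un cAd cA j). Qed.
(** Both sides are representations of A, so [hq_S] allows comparing their images of W. The
    comultiplication turns into the product of W in two legs, the conjugation into W_23 W_12 adj
    W_23, and the pentagon identifies them. *)
Lemma Heisenberg_pi s : qA G s -> lg (@ampl (qL G) _ \o p) (@ampr _ (qL G) \o p) (Dl s) =
 Ad (lg (@ampl (qL G) _ \o pd) (@ampr _ (qL G) \o p) W) (ampl (p s)).
set L := qL G; pose l1 := @ampl L L; pose l2 := @ampr L L.
have i2 : ind2 l1 l2 := ind2_amp L L.
have jpp : jn (l1 \o p) (l2 \o p) := ind2_jn cA cA i2 rp rp.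
have jdp : jn (l1 \o pd) (l2 \o p) := ind2_jn cAd cA i2 rpd rp.
pose U := lg (l1 \o pd) (l2 \o p) W; have uU : unitary U := un_lgW jdp.
pose g1 s := lg (l1 \o p) (l2 \o p) (Dl s); pose g2 := Ad U \o (l1 \o p).
have r1 : rep g1 := rep_comp (tens_cs cA cA) (hq_Delta hG) (jr_rep jpp).
have n1 : namp l1 := ind2_l i2.
have r2 : rep g2 := rep_namp (namp_Ad uU) (rep_namp n1 rp).
apply: (hq_S hG r1 r2).
pose k1 := @ampl (L *t L) L; pose r := @ampr L (L *t L).
have i3 : ind3 k1 (r \o l1) (r \o l2) := ind2_split (ind2_amp L (L *t L)).
have nr : namp r := namp_r L (L *t L).
have j3 := ind3_jn3 cAd cA cA i3 rpd rp rp.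
have [j e] := hq_D hG j3.
have mD a : qA G a -> mult (qA G *T qA G) (Dl a) by exact: (mor_mult (hq_Delta hG)).
have e1 : lg (k1 \o pd) (r \o g1) W = lg (k1 \o pd) (r \o l1 \o p) W \o lg (k1 \o pd) (r \o l2 \o p) W.
 rewrite -e; apply: (lg_eq cAd cA j) => // a Aa.
 by rewrite -[RHS](lg_namp cA cA nr jpp (mD _ Aa)).
have rU : r U = lg (r \o l1 \o pd) (r \o l2 \o p) W by rewrite -[LHS](lg_namp cAd cA nr jdp mW).
have urU : unitary (r U) by exact: (namp_un nr).
have i12 := ind3_12 i3.
have j12 := ind2_jn cAd cA i12 rpd rp.
have j12' := jn_namp (namp_Ad urU) j12.
have e2 : lg (k1 \o pd) (r \o g2) W = Ad (r U) (lg (k1 \o pd) (r \o l1 \o p) W).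
 rewrite -[RHS](lg_namp cAd cA (namp_Ad urU) j12 mW); apply: (lg_eq cAd cA j12') => // a Aa /=.
  have ba : bop (pd a) by bdd.
  rewrite /Ad rU -(ind3_lg_comm cAd cA i3 rpd rp ba mW) -rU -compA.
  by have /unP[_ _ ->] := urU.
 have ba : bop (p a) by bdd.
 by rewrite -(namp_conj nr) //; [bdd|bdd].
rewrite [LHS]e1 [RHS]e2 /Ad rU (hq_P hG i3) -rU -[RHS]compA.
by have /unP[_ _ ->] := urU.
Qed.
(** Both sides are images of multipliers X1 and X2 of the compacts tensored with A, and these do not
    involve al, be and c. The case c = pi, with pi faithful, gives X1 = X2. *)
Lemma Heisenberg Q N (al : qL G ~> Q) (be : N ~> Q) (c : sp (qA G) ~> N) s : ind2 al be -> rep c -> qA G s ->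
 lg (al \o p) (be \o c) (Dl s) = Ad (lg (al \o pd) (be \o c) W) (al (p s)).
move=> i2 rc As; set L := qL G.
have cK := Kop_cstar L; have cKA := tens_cs cK cA.
have mi := idm_morphism cA; have mD := mor_mult (hq_Delta hG) As.
pose X1 := tapp p (idm (qA G)) (Dl s).
pose Wp := tapp pd (idm (qA G)) W.
pose X2 := Ad Wp (otens (p s) (@id (sp (qA G)))).
have bs : bop (p s) by exact: (rep_bop rp).
have bi := bop_id (sp (qA G)).
have mW' : mult (Kop L *T qA G) Wp by apply: tapp_mult => //; exact: hq_pid hG.
have m1 : mult (Kop L *T qA G) X1 by apply: tapp_mult => //; exact: hq_pi hG.
have ms : mult (Kop L *T qA G) (otens (p s) (@id (sp (qA G)))).
 by apply: (@mult_otens (Kop L) (qA G)) => //; rewrite Kop_mult.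
have ma := csa_adj (mult_csalg cKA) mW'.
have mc := csa_comp (mult_csalg cKA) mW' ms.
have m2 : mult (Kop L *T qA G) X2 := csa_comp (mult_csalg cKA) mc ma.
have key (Q' N' : hilbert R) (al' : L ~> Q') (be' : N' ~> Q') (c' : sp (qA G) ~> N') : ind2 al' be' -> rep c' ->
  @lg (Kop L) (qA G) Q' al' (be' \o c') X1 = lg (al' \o p) (be' \o c') (Dl s) /\
  @lg (Kop L) (qA G) Q' al' (be' \o c') X2 = Ad (lg (al' \o pd) (be' \o c') W) (al' (p s)).
 move=> i2' rc'; have na' := ind2_l i2'.
 have j : @jn (Kop L) (qA G) Q' al' (be' \o c').
  exact: (@ind2_jn (Kop L) (qA G) _ _ _ _ _ id c' cK cA i2' (rep_id cK) rc').
 have h B (f : premor B (Kop L)) (t : op (sp (B *T qA G)) (sp (B *T qA G))) :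
   cstar B -> morphism f -> mult (B *T qA G) t ->
   @lg (Kop L) (qA G) Q' al' (be' \o c') (tapp f (idm (qA G)) t) = lg (al' \o f) (be' \o c') t.
  move=> cB mf mt; rewrite -(lg_mor cB cA cK cA mf mi j mt).
  have j' := ind2_jn cB cA i2' (morphism_Kop mf) rc'.
  apply: (lg_eq cB cA j') => // a Ba /=.
   by rewrite ext_Kop //; have := mor_mult mf Ba; rewrite Kop_mult.
  by rewrite (ext_in (rep_namp (ind2_r i2') rc')).
 split; first by apply: h => //; exact: hq_pi hG.
 rewrite /X2 /Ad (lg_comp cK cA j mc ma) (lg_comp cK cA j mW' ms) (lg_adj cK cA j mW').
 rewrite /Wp h //; last exact: hq_pid hG.
 congr (_ \o _ \o _); rewrite (lg_otens cK cA j); [|by rewrite Kop_mult|exact: mult_id].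
 by rewrite ext_Kop // ext_id //; exact: (jn_r j).
have [h1 h2] := key _ _ _ _ _ (ind2_amp L L) rp.
have eX : X1 = X2.
 apply: (@lg_inj (Kop L) (qA G) cK cA _ _ id p (rep_id cK) rp) => //; first exact: hq_pif hG.
 by rewrite [LHS]h1 [RHS]h2; exact: Heisenberg_pi.
by have [<- <-] := key _ _ _ _ _ i2 rc; rewrite eX.
Qed.

Definition corep_on E (X : op (sp (E *T qA G)) (sp (E *T qA G))) := mult (E *T qA G) X /\ forall M (f : sp E ~> M)
  (g h : sp (qA G) ~> M), jn3 f g h -> jn f (fun s => lg g h (Dl s)) /\
  lg f (fun s => lg g h (Dl s)) X = lg f g X \o lg f h X.
(** The corepresentation identity, with the comultiplication written as conjugation by W through
    [Heisenberg]. *)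
Lemma corep_pentagon E X H N Q (al : H ~> Q) (be : qL G ~> Q) (ga : N ~> Q) (e : sp E ~> H) (c : sp (qA G) ~> N) :
 cstar E -> @corep_on E X -> ind3 al be ga -> rep e -> rep c ->
 lg (be \o pd) (ga \o c) W \o lg (al \o e) (be \o p) X =
 lg (al \o e) (be \o p) X \o lg (al \o e) (ga \o c) X \o lg (be \o pd) (ga \o c) W.
move=> cE [mX cX] i3 re rc.
have j3 := ind3_jn3 cE cA cA i3 re rp rc; have [j <-] := cX _ _ _ _ j3.
have i23 := ind3_23 i3; have j23 := ind2_jn cAd cA i23 rpd rc.
have uw := un_lgW j23; set w := lg _ _ W in uw *.
have j12 := ind2_jn cE cA (ind3_12 i3) re rp.
have e1 : lg (al \o e) (fun s => lg (be \o p) (ga \o c) (Dl s)) X = Ad w (lg (al \o e) (be \o p) X).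
 rewrite -[RHS](lg_namp cE cA (namp_Ad uw) j12 mX); apply: (lg_eq cE cA (jn_namp (namp_Ad uw) j12)) => // a Ea /=.
  have ba : bop (e a) by bdd.
  rewrite /Ad /w -(ind3_lg_comm cAd cA i3 rpd rc ba mW) -/w -compA.
  by have /unP[_ _ ->] := uw.
 by rewrite (Heisenberg i23).
by rewrite e1 /Ad; apply/funext => x /=; rewrite unK.
Qed.
End Heisenberg.
End QuantumGroups.

(** * Universal duals and bicharacters on them *)

Section Universal.
Lemma un_AdP H K (u : op H K) (s : op H H) (t : op K K) : unitary u -> (Ad u s = t) <-> (u \o s = t \o u).
move=> uu; split=> [<-|e]; apply/funext => x.
 by rewrite /Ad /= unK.
by rewrite /Ad; have := congr1 (fun q => q (adj u x)) e; rewrite /= unVK.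
Qed.
Lemma un_AdVP H K (u : op H K) (s : op H H) (t : op K K) : unitary u -> (Ad (adj u) t = s) <-> (u \o s = t \o u).
move=> uu; have bu := un_bop uu.
split=> [<-|e]; apply/funext => x.
 by rewrite /Ad (adjK bu) /= unVK.
by rewrite /Ad (adjK bu) /=; have := congr1 (fun q => q x) e => /= <-; rewrite unK.
Qed.

(** The analogue of [hq] for a universal dual; [hu_S] is the separation property obtained from the
    slices of [uV]. *)
Record hu (G : qgroup T) (u : udual G) : Prop := Hu {
 hu_A : cstar (uA u);
 hu_V : umult (uA u *T qA G) (uV u);
 hu_Delta : morphism (uDelta u);
 hu_Lambda : morphism (uLambda u);
 hu_L : tapp (uLambda u) (idm (qA G)) (uV u) = qW G;
 hu_X : corep_on (uV u);
 hu_Dd : forall M (f g : sp (uA u) ~> M) (h : sp (qA G) ~> M), jn3 f g h -> jn (fun s => lg f g (uDelta u s)) h /\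
  lg (fun s => lg f g (uDelta u s)) h (uV u) = lg g h (uV u) \o lg f h (uV u);
 hu_S : forall N (f g : sp (uA u) ~> N), rep f -> rep g -> lg (@ampl _ N \o f) (@ampr N _ \o qpi G) (uV u) =
  lg (@ampl _ N \o g) (@ampr N _ \o qpi G) (uV u) -> forall a, uA u a -> f a = g a }.
Lemma is_udual_hu (G : qgroup T) (u : udual G) : hq G -> is_udual u -> hu u.
move=> hG [cU uV' eD sl _ mD eDd mL eL]; have cA := hq_A hG; have mV := uV'.1.
have mp := hq_pi hG.
split=> //.
- split=> // M f g h j3; exact: (bichar2 cU cA (hq_Delta hG) j3 mV eD).
- by move=> M f g h j3; exact: (bichar1 cU cA mD j3 mV eDd).
move=> N f g rf rg.
apply: (separation cA cU (rep_id cU) (morphism_Kop mp) _ mV _ rf rg) => //.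
rewrite image_id sl; congr (cspan (rslices _)).
exact: (tapp_lg cU cA cU (Kop_cstar _) (idm_morphism cU) mp mV).
Qed.

Section UniversalHeisenberg.
Variables (G : qgroup T) (hG : hq G) (u : udual G) (hU : hu u).
Let cA := hq_A hG.
Let cAd := hq_Ad hG.
Let cU := hu_A hU.
Let rp := morphism_Kop (hq_pi hG).
Let rpd := morphism_Kop (hq_pid hG).
Let mV : mult (uA u *T qA G) (uV u). by case: (hu_V hU). Qed.
Let uV1 : unitary (uV u). by case: (hu_V hU). Qed.
Local Notation W := (qW G).
Local Notation V := (uV u).
Local Notation p := (qpi G).
Local Notation pd := (qpid G).
(** The reducing map followed by the regular representation: on this leg universal objects turn into
    reduced ones. *)
Definition ulam := ext pd \o uLambda u.
Local Notation pL := ulam.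
Lemma rep_ulam : rep pL. exact: (rep_comp cAd (hu_Lambda hU) rpd). Qed.
Lemma un_lgV Q (f : sp (uA u) ~> Q) (g : sp (qA G) ~> Q) : jn f g -> unitary (lg f g V).
by move=> j; exact: (lg_un cU cA j). Qed.
Lemma lg_ulam Q (al : qL G ~> Q) (g : sp (qA G) ~> Q) :
 namp al -> jn (al \o pd) g -> lg (al \o pL) g V = lg (al \o pd) g W.
move=> na j; have mi := idm_morphism cA; have rg := jn_r j.
rewrite -(hu_L hU) -(lg_mor cU cA cAd cA (hu_Lambda hU) mi j mV).
have j' := jn_mor cU cA cAd cA (hu_Lambda hU) mi j.
apply: (lg_eq cU cA j') => // a Aa /=.
 by rewrite (ext_namp na) //; exact: (mor_mult (hu_Lambda hU)).
by rewrite (ext_in rg).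
Qed.

Section OneRep.
Variables (H : hilbert R) (r : sp (uA u) ~> H) (rr : rep r).
Let rL := rep_ulam.
(** With one leg reduced, the universal comultiplication is implemented by the corepresentation of
    the other leg. Separation by [uV] reduces this to comparing two unitaries: one side is a
    conjugate of W, the other a product by the character property of [uV], and [corep_pentagon]
    equates them. *)
Lemma universal_Heisenberg_loc x : uA u x -> Ad (adj (lg (@ampl (qL G) _ \o r) (@ampr H _ \o p) V)) (ampr (pL x))
 = lg (@ampr H _ \o pL) (@ampl (qL G) _ \o r) (uDelta u x).
set L := qL G; pose l1 := @ampl L H; pose l2 := @ampr H L.
have i2 : ind2 l1 l2 := ind2_amp H L.
have jr1 : jn (l1 \o r) (l2 \o p) := ind2_jn cU cA i2 rr rp.
have jr2 : jn (l2 \o pL) (l1 \o r) := ind2_jn cU cU (ind2_sym i2) rL rr.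
pose Vr := lg (l1 \o r) (l2 \o p) V; have uVr : unitary Vr := un_lgV jr1.
have uVr' := un_adj uVr.
pose F := Ad (adj Vr) \o (l2 \o pL); pose E x := lg (l2 \o pL) (l1 \o r) (uDelta u x).
have n2 : namp l2 := ind2_r i2.
have rF : rep F := rep_namp (namp_Ad uVr') (rep_namp n2 rL).
have rE : rep E := rep_comp (tens_cs cU cU) (hu_Delta hU) (jr_rep jr2).
apply: (hu_S hU rF rE).
pose k1 := @ampl L (H *t L); pose k2 := @ampr (H *t L) L.
have i3 : ind3 (k1 \o l1) (k1 \o l2) k2.
 have := ind2_split (ind2_sym (ind2_amp (H *t L) L)).
 by move=> /ind3_swap12/ind3_swap23.
have i3' : ind3 k2 (k1 \o l1) (k1 \o l2) by apply: ind3_swap12; apply: ind3_swap23.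
have n1 : namp k1 := namp_l L (H *t L).
have eV : k1 Vr = lg (k1 \o l1 \o r) (k1 \o l2 \o p) V by rewrite -[LHS](lg_namp cU cA n1 jr1 mV).
have ukV : unitary (k1 Vr) by exact: namp_un.
have j23 := ind2_jn cAd cA (ind3_23 i3) rpd rp.
have j23' := ind2_jn cU cA (ind3_23 i3) rL rp.
have nV := namp_Ad (un_adj ukV).
have e1 : lg (k1 \o F) (k2 \o p) V = Ad (adj (k1 Vr)) (lg (k1 \o l2 \o pd) (k2 \o p) W).
 rewrite -lg_ulam //; last exact: ind2_l (ind3_23 i3).
 rewrite -[RHS](lg_namp cU cA nV j23' mV); apply: (lg_eq cU cA (jn_namp nV j23')) => // a Aa.
  have bF : bop (l2 (pL a)) by apply: (namp_bop n2); exact: (rep_bop rL).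
  by rewrite /F /= (namp_conj n1) ?(namp_adj n1) //; bdd.
 have ba : bop (p a) by bdd.
 apply/(un_AdVP _ _ ukV); rewrite eV.
 exact: (esym (ind3_lg_comm cU cA i3' rr rp ba mV)).
have i3'' : ind3 (k1 \o l2) (k1 \o l1) k2 by exact: ind3_swap12.
have j3 := ind3_jn3 cU cU cA i3'' rL rr rp.
have [j e2] := hu_Dd hU j3.
have e3 : lg (k1 \o E) (k2 \o p) V = lg (k1 \o l1 \o r) (k2 \o p) V \o lg (k1 \o l2 \o pL) (k2 \o p) V.
 rewrite -e2; apply: (lg_eq cU cA j) => // a Aa.
 rewrite -[RHS](lg_namp cU cU n1 jr2) //; exact: (mor_mult (hu_Delta hU)).
rewrite [LHS]e1 [RHS]e3 lg_ulam //; last exact: ind2_l (ind3_23 i3).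
apply/(un_AdVP _ _ ukV).
by rewrite eV (corep_pentagon hG cU (hu_X hU) i3 rr rp).
Qed.

Section Anywhere.
Variables (Q : hilbert R) (al : H ~> Q) (be : qL G ~> Q).
Lemma universal_Heisenberg x : ind2 al be -> uA u x ->
 Ad (adj (lg (al \o r) (be \o p) V)) (be (pL x)) = lg (be \o pL) (al \o r) (uDelta u x).
move=> [eta ne [e1 e2]] Ux; have i2 := ind2_amp H (qL G).
have jr1 := ind2_jn cU cA i2 rr rp.
have jr2 := ind2_jn cU cU (ind2_sym i2) rL rr.
have mD : mult (uA u *T uA u) (uDelta u x) by exact: (mor_mult (hu_Delta hU)).
rewrite (lg_eqb cU cA ne e1 e2 jr1 mV) //.
rewrite (lg_eqb cU cU ne e2 e1 jr2 mD) //.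
have bp : bop (pL x) by exact: (rep_bop rL).
have uu := un_lgV jr1; have bu := un_bop uu; have bu' := bop_adj bu.
rewrite e2 // -universal_Heisenberg_loc // (namp_conj ne) ?(namp_adj ne) //.
exact: (namp_bop (ind2_r i2)).
Qed.
Variables (D : opalg R) (X : op (sp (uA u) *t sp D) (sp (uA u) *t sp D)).
Variables (N : hilbert R) (ga : N ~> Q) (psi : sp D ~> N).
(** Only the character property in the first leg is recorded, so that a bicharacter and its flipped
    adjoint are treated alike, see [bichar_left] and [bichar_right]. *)
Definition left_bichar := mult (uA u *T D) X /\ forall M (f g : sp (uA u) ~> M) (h : sp D ~> M),
  jn3 f g h -> jn (fun s => lg f g (uDelta u s)) h /\ lg (fun s => lg f g (uDelta u s)) h X = lg g h X \o lg f h X.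
(** Expresses X on an arbitrary representation r of the universal dual through its value on the
    reduced leg. This is the device by which the unknown twisting unitary is traded for computable
    ones. *)
Lemma universal_leg : cstar D -> left_bichar -> ind3 al be ga -> rep psi ->
 Ad (adj (lg (al \o r) (be \o p) V)) (lg (be \o pL) (ga \o psi) X)
 = lg (al \o r) (ga \o psi) X \o lg (be \o pL) (ga \o psi) X.
move=> cD [mX hX] i3 rs.
have i3' : ind3 be al ga by exact: ind3_swap12.
have j3 := ind3_jn3 cU cU cD i3' rL rr rs; have [j <-] := hX _ _ _ _ j3.
have i12 := ind3_12 i3; have j12 := ind2_jn cU cA i12 rr rp.
have uv := un_lgV j12.
have nv := namp_Ad (un_adj uv).
have j23 := ind2_jn cU cD (ind3_23 i3) rL rs.
rewrite -(lg_namp cU cD nv j23 mX).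
apply/esym/(lg_eq cU cD (jn_namp nv j23)) => // a Aa /=.
 by rewrite -universal_Heisenberg.
have ba : bop (psi a) by bdd.
have i3'' : ind3 ga al be by apply: ind3_swap12; apply: ind3_swap23.
apply/(un_AdVP _ _ uv).
exact: (esym (ind3_lg_comm cU cA i3'' rr rp ba mV)).
Qed.
End Anywhere.
End OneRep.
End UniversalHeisenberg.
Lemma bichar_left (G : qgroup T) (u : udual G) B (dB : premor B (B *T B)) X :
 cstar (uA u) -> cstar B -> morphism (uDelta u) -> bicharacter (uDelta u) dB X -> left_bichar (u := u) (D := B) X.
move=> cU cB mD [[mX _] e _]; split=> // M f g h j3.
exact: (bichar1 cU cB mD j3 mX e).
Qed.
Lemma bichar_right (G : qgroup T) (u : udual G) B (dB : premor B (B *T B)) X :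
 cstar (uA u) -> cstar B -> morphism (uDelta u) ->
 bicharacter dB (uDelta u) X -> left_bichar (u := u) (D := B) (Ad (flip (sp B) (sp (uA u))) (adj X)).
move=> cU cB mD [[mX _] _ e].
have ma := csa_adj (mult_csalg (tens_cs cB cU)) mX.
have mf : mult (uA u *T B) (Ad (flip (sp B) (sp (uA u))) (adj X)) by exact: mult_flip.
split=> // M f g h j3; have j3' := jn3_rot cU cU cB j3.
have [j e'] := bichar2 cB cU mD j3' mX e; split; first exact: (jn_flip cB cU j).
have jfh := jn_flip cU cB (jn3_13 cU cU cB j3); have jgh := jn_flip cU cB j3.1.
rewrite (lg_flip cB cU j ma) (lg_flip cB cU jfh ma) (lg_flip cB cU jgh ma).
rewrite (lg_adj cB cU j mX) e' adj_comp; [|exact: (lg_bop cB cU)|exact: (lg_bop cB cU)].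
by rewrite (lg_adj cB cU jfh mX) (lg_adj cB cU jgh mX).
Qed.
End Universal.

(** * Commutants and restriction of a representation to tensor factors *)

Section Commutation.
Lemma csub_comm M t : bop t -> csub [set s : op M M | bop s /\ t \o s = s \o t].
move=> bt; have [C [C0 hC]] := bop_bnd bt; have lt := bop_lin bt.
have e0 : [set s : op M M | bop s /\ t \o s = s \o t] = [set s | bop s /\ [set 0 : op M M] ((t \o s) - (s \o t))].
 apply/seteqP; split=> s [bs e]; split=> //; first by rewrite e /= subrr.
 by apply: subr0_eq.
rewrite e0; apply: (csub_pre (fun s => (t \o s) - (s \o t)) (C + C)) => //.
- exact: csub_bop.
- exact: csub_zero.
- exact: addr_ge0.
- move=> a s u bs bu; exists a; apply/funext => x.
 by rewrite !(opBE, opDE, opZE) /= !(opBE, opDE, opZE) lt scalerBr opprD addrACA.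
- move=> s u bs bu; apply/funext => x; rewrite !(opBE, opDE) /= !(opBE, opDE) (linB lt).
 by rewrite !opprB addrACA [RHS]addrACA; congr (_ + _); exact: addrC.
- move=> D s D0 bs hD; rewrite mulrDl; apply: bndD; first exact: bnd_comp.
 by apply: bnd_lin; rewrite mulrC; exact: bnd_comp.
Qed.
Lemma rep_commute A M (q : sp A ~> M) t z : cstar A -> rep q -> bop t ->
 (forall x, A x -> t \o q x = q x \o t) -> mult A z -> t \o ext q z = ext q z \o t.
move=> cA rq bt h mz; have bz := ext_bop cA rq mz.
apply: (hdense_eq rq.2); [bdd|bdd|].
move=> _ [_ [x Ax <-] [v _ <-]].
have e1 := congr1 (fun g => g v) (ext_l cA rq mz Ax).
have e2 := congr1 (fun g => g v) (h _ (mult_l mz Ax)).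
have e3 := congr1 (fun g => g v) (h _ Ax).
have e4 := congr1 (fun g => g (t v)) (ext_l cA rq mz Ax).
by rewrite /= in e1 e2 e3 e4 *; rewrite e1 e2 e3 e4.
Qed.
Lemma lg_commute A B M (f : sp A ~> M) (g : sp B ~> M) t z : cstar A -> cstar B -> jn f g -> bop t ->
 (forall x, A x -> t \o f x = f x \o t) -> (forall x, B x -> t \o g x = g x \o t) ->
 mult (A *T B) z -> t \o lg f g z = lg f g z \o t.
move=> cA cB j bt hf hg; have cT := tens_cs cA cB; have rJ := jr_rep j.
apply: (rep_commute cT rJ bt) => x Tx; have sJ := rJ.1.
suff /(_ x Tx)[_ []] : els (A *T B) `<=` [set x | (A *T B) x /\ [set s | bop s /\ t \o s = s \o t] (jr f g x)] by [].
apply: tens_ind => [|a b Aa Bb].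
 apply: (csub_pre (jr f g) 1) => //.
 - exact: cstar_sub.
 - exact: csub_comm.
 - by move=> c s u Ts Tu; exists c; rewrite (shom_lin sJ).
 - by move=> s u Ts Tu; rewrite (shomB sJ).
 - by move=> C s C0 Ts; rewrite mul1r; exact: (shom_contr (cs_alg cT) sJ).
have Tab := tens_in Aa Bb; split=> //; split; first exact: (shom_bop sJ).
by rewrite (jrE j) // compA hf // -compA hg // compA.
Qed.
Lemma Ad_fix H (u t : op H H) : unitary u -> u \o t = t \o u -> Ad u t = t.
by move=> uu e; apply/(un_AdP _ _ uu). Qed.
Lemma csub_dense H K (D : set K) :
 csub [set t : op H K | forall z (e : R), 0 < e -> exists2 y, lspan D y & nm (t z - y) <= e].
split.
- by move=> z e e0; exists 0; [exact: lspan0|rewrite subr0 nm0 ltW].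
- move=> a s t hs ht z e e0; have c0 : 0 < cn a + 1 by rewrite ltr_wpDl // cn_ge0.
 have d0 : 0 < e / (cn a + 1) by rewrite divr_gt0.
 have [y Ly hy] := hs z _ d0; have [w Lw hw] := ht z _ d0.
 exists (a *: y + w); first exact: lspan_lincomb.
 rewrite opDE opZE opprD addrACA -scalerBr; apply: le_trans (nmD _ _) _; rewrite nmZ.
 apply: le_trans (_ : (cn a + 1) * (e / (cn a + 1)) <= _); last by rewrite mulrC divfK // gt_eqF.
 by rewrite mulrDl mul1r lerD // ler_wpM2l // cn_ge0.
- move=> t /nclP h z e e0; have d0 : 0 < e / 2 / (nm z + 1).
  by rewrite !divr_gt0 // ltr_wpDl // nm_ge0.
 have [s hs hb] := h _ d0; have [y Ly hy] := hs z (e / 2) (divr_gt0 e0 (ltr0Sn _ 1)).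
 exists y => //; apply: le_trans (nm_tri _ (s z) _) _; rewrite [e]splitr lerD //.
 apply: le_trans (hb z) _; have z0 := nm_ge0 z.
 have z1 : nm z + 1 != 0 by rewrite gt_eqF // ltr_wpDl.
 apply: le_trans (_ : e / 2 / (nm z + 1) * (nm z + 1) <= _); last by rewrite divfK.
 by rewrite ler_wpM2l ?lerDl // ltW.
Qed.

Section SplitRep.
Variables (A B : opalg R) (M : hilbert R) (q : sp A *t sp B ~> M).
Hypotheses (cA : cstar A) (cB : cstar B) (rq : rep (A := A *T B) q).
(** The algebra A need not sit inside the tensor product, so its restriction is taken after
    extending q to multipliers. *)
Definition rep1 (s : bo (sp A)) : op M M := ext (A := A *T B) q (otens s (@id (sp B))).
Definition rep2 (t : bo (sp B)) : op M M := ext (A := A *T B) q (otens (@id (sp A)) t).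
Let cT := tens_cs cA cB.
Let sq := ext_shom cT rq.
Let m1 s : mult A s -> mult (A *T B) (otens s (@id (sp B))).
by move=> ms; apply: mult_otens => //; exact: mult_id. Qed.
Let m2 s : mult B s -> mult (A *T B) (otens (@id (sp A)) s).
by move=> ms; apply: mult_otens => //; exact: mult_id. Qed.
Let s1 : shom (els A) rep1.
have [n1 n2 n3 n4] := namp_shom (@namp_ampl (sp A) (sp B)).
have mi s : A s -> mult (A *T B) (otens s (@id (sp B))) by move=> As; apply: m1; exact: mult_in.
have bi s : A s -> bop s by bdd.
split=> [s As|c s t As At|s t As At|s As]; rewrite /rep1.
- exact/(shom_bop sq)/mi.
- by rewrite (n2 _ _ _ (bi _ As) (bi _ At)) (shom_lin sq _ (mi _ As) (mi _ At)).
- by rewrite (n3 _ _ (bi _ As) (bi _ At)) (shom_comp sq (mi _ As) (mi _ At)).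
- by rewrite (n4 _ (bi _ As)) (shom_adj sq (mi _ As)).
Qed.
Let s2 : shom (els B) rep2.
have [n1 n2 n3 n4] := namp_shom (@namp_ampr (sp A) (sp B)).
have mi s : B s -> mult (A *T B) (otens (@id (sp A)) s) by move=> As; apply: m2; exact: mult_in.
have bi s : B s -> bop s by bdd.
split=> [s As|c s t As At|s t As At|s As]; rewrite /rep2.
- exact/(shom_bop sq)/mi.
- by rewrite (n2 _ _ _ (bi _ As) (bi _ At)) (shom_lin sq _ (mi _ As) (mi _ At)).
- by rewrite (n3 _ _ (bi _ As) (bi _ At)) (shom_comp sq (mi _ As) (mi _ At)).
- by rewrite (n4 _ (bi _ As)) (shom_adj sq (mi _ As)).
Qed.
Let e12 a b : A a -> B b -> q (otens a b) = rep1 a \o rep2 b.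
move=> Aa Bb; have ba := cs_bop cA Aa; have bb := cs_bop cB Bb.
rewrite /rep1 /rep2 -(shom_comp sq); [|exact/m1/mult_in|exact/m2/mult_in].
by rewrite -otens_split // (ext_in rq) //; exact: tens_in.
Qed.
Let e21 a b : A a -> B b -> q (otens a b) = rep2 b \o rep1 a.
move=> Aa Bb; have ba := cs_bop cA Aa; have bb := cs_bop cB Bb.
rewrite /rep1 /rep2 -(shom_comp sq); [|exact/m2/mult_in|exact/m1/mult_in].
have b1 := bop_id (sp A); have b2 := bop_id (sp B).
by rewrite otens_comp // (ext_in rq) //; exact: tens_in.
Qed.
Let dn (D : set M) : (forall a b z, A a -> B b -> D (q (otens a b) z)) -> hdense D.
move=> hD; apply: (hdense_trans rq.2) => _ e [_ [x Tx <-] [z _ <-]] e0.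
suff /(_ x Tx)[_ h] : els (A *T B) `<=` [set x | (A *T B) x /\
  [set t | forall z (e : R), 0 < e -> exists2 y, lspan D y & nm (t z - y) <= e] (q x)].
 exact: h.
apply: tens_ind => [|a b Aa Bb].
 apply: (csub_pre q 1) => //.
 - exact: cstar_sub.
 - exact: csub_dense.
 - by move=> c s u Ts Tu; exists c; rewrite (shom_lin rq.1).
 - by move=> s u Ts Tu; rewrite (shomB rq.1).
 - by move=> C s C0 Ts; rewrite mul1r; exact: (shom_contr (cs_alg cT) rq.1).
split; first exact: tens_in.
by move=> v r r0; exists (q (otens a b) v); [apply: sub_lspan; exact: hD|rewrite subrr nm0 ltW].
Qed.
Lemma jn_split : jn rep1 rep2.
split; [split=> //|split=> //|by exists q; split=> //; exact: rq.1].
 apply: dn => a b z Aa Bb; exists (rep1 a); first by exists a.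
 by exists (rep2 b z) => //; rewrite e12.
apply: dn => a b z Aa Bb; exists (rep2 b); first by exists b.
by exists (rep1 a z) => //; rewrite e21.
Qed.
Lemma jr_split x : (A *T B) x -> jr rep1 rep2 x = q x.
by move=> Tx; apply/esym/(jr_uniq cA cB jn_split) => //; split=> //; exact: rq.1. Qed.
End SplitRep.

Section Permutations.
Variables (A B C : opalg R) (M : hilbert R).
Variables (f : sp A ~> M) (g : sp B ~> M) (h : sp C ~> M).
Hypotheses (cA : cstar A) (cB : cstar B) (cC : cstar C).
Lemma jn3_of_23_1 : jn g h -> @jn (B *T C) A M (jr g h) f -> jn3 f g h.
by move=> j1 j2; split=> //; exact: (jn_flip (tens_cs cB cC) cA j2).
Qed.
Lemma jn3_swap23 : jn3 f g h -> jn3 f h g.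
move=> [j1 j2]; have j1' := jn_flip cB cC j1; split=> //.
have cBC := tens_cs cB cC; have cCB := tens_cs cC cB.
have nf := namp_Ad (flip_un (sp C) (sp B)).
have mf : morphism (PreMor (C *T B) (B *T C) (Ad (flip (sp C) (sp B)))).
 apply: mk_morphism => //.
 - have [n1 n2 n3 n4] := namp_shom nf.
  have bi s : (C *T B) s -> bop s by bdd.
  split=> [s Ts|c s t Ts Tt|s t Ts Tt|s Ts].
  + exact/n1/bi.
  + by apply: n2; exact: bi.
  + by apply: n3; exact: bi.
  + by apply: n4; exact: bi.
 - by move=> a Ta; apply: (mult_in cBC); exact: flip_tens.
 have -> : Ad (flip (sp C) (sp B)) @` els (C *T B) = els (B *T C).
  apply/seteqP; split=> [_ [x Tx <-]|x Tx]; first exact: flip_tens.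
  exists (Ad (flip (sp B) (sp C)) x); first exact: flip_tens.
  by rewrite -flip_adj AdK //; exact: flip_un.
 exact: cstar_prod.
have j := jn_mor cA cCB cA cBC (idm_morphism cA) mf j2.
have [] // := jr_eq cA cCB (f' := f) (g' := jr h g) j.
 by move=> a Aa /=; rewrite (ext_in (jn_l j2)).
move=> x Tx; rewrite /= (ext_in (jr_rep j1)); last exact: flip_tens.
have mx : mult (C *T B) x by exact: (mult_in cCB).
rewrite -(lg_in j1') // -(lg_flip cC cB j1' mx) (lg_in j1) //; exact: flip_tens.
Qed.
End Permutations.

(** * Four legs and the exchange of the middle two *)

Section Quadruples.
Lemma mid_un H K L M K' L' (t : op (K *t L) (L' *t K')) : unitary t -> unitary (mid H M t).
move=> ut; have uH := un_id H; have uM := un_id M.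
have u1 := un_otens ut uM; have u2 := un_adj (assoc_un K L M).
have u3 := un_comp (un_comp (assoc_un L' K' M) u1) u2.
have u4 := un_otens uH u3.
exact: (un_comp (un_comp (un_adj (assoc_un H L' (K' *t M))) u4) (assoc_un H K (L *t M))).
Qed.
Lemma Ad_mid H K L M K' L' (t : op (K *t L) (L' *t K')) h x m : unitary t -> bop h -> bop x -> bop m ->
 Ad (mid H M t) (Ad (adj (assoc H K (L *t M))) (otens h (Ad (assoc K L M) (otens x m)))) =
 Ad (adj (assoc H L' (K' *t M))) (otens h (Ad (assoc L' K' M) (otens (Ad t x) m))).
move=> ut bh bx bm; have uH := un_id H; have uM := un_id M.
have ua := assoc_un H K (L *t M); have ua2 := assoc_un K L M.
have u1 := un_otens ut uM; have u2 := un_adj ua2.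
have u5 := un_comp (assoc_un L' K' M) u1.
have u3 := un_comp u5 u2.
have u4 := un_otens uH u3.
have b1 := un_bop ua; have b4 := un_bop u4.
have b6 := un_bop (un_adj (assoc_un H L' (K' *t M))).
have AH s : Ad (@id H) s = s by rewrite /Ad adj_id.
have AM s : Ad (@id M) s = s by rewrite /Ad adj_id.
have bxm := bop_otens bx bm.
have e1 : Ad (mid H M t) = Ad (adj (assoc H L' (K' *t M))) \o (Ad (otens (@id H)
  (assoc L' K' M \o otens t (@id M) \o adj (assoc K L M))) \o Ad (assoc H K (L *t M))).
 apply/funext => s; rewrite /= Ad_Ad // Ad_Ad //; bdd.
rewrite e1 /= AdVK // Ad_otens //; last exact: bop_Ad.
congr (Ad _ _); rewrite AH; congr (otens _ _).
have e2 : Ad (assoc L' K' M \o otens t (@id M) \o adj (assoc K L M)) =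
  Ad (assoc L' K' M) \o (Ad (otens t (@id M)) \o Ad (adj (assoc K L M))).
 have q1 := un_bop (assoc_un L' K' M); have q2 := un_bop u1.
 have q3 := un_bop u2; have q6 := bop_comp q2 q3.
 by apply/funext => s; rewrite /= (Ad_Ad _ q2 q3) (Ad_Ad _ q1 q6).
by rewrite e2 /= AdK // Ad_otens // AM.
Qed.
Lemma quad_split H K L M h k l m : bop h -> bop k -> bop l -> bop m ->
 otens (otens h k : op (H *t K) _) (otens l m : op (L *t M) _) =
 Ad (adj (assoc H K (L *t M))) (otens h (Ad (assoc K L M) (otens (otens k l) m))).
move=> bh bk bl bm; rewrite Ad_assoc_otens // Ad_assocV_otens //; exact: bop_otens.
Qed.
Lemma Ad_mid_flip H K L M (h : op H H) (k : op K K) (l : op L L) (m : op M M) : bop h -> bop k -> bop l -> bop m ->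
 Ad (mid H M (flip K L)) (otens (otens h k) (otens l m)) = otens (otens h l) (otens k m).
move=> bh bk bl bm; have bkl := bop_otens bk bl.
rewrite quad_split // Ad_mid //; last exact: flip_un.
by rewrite Ad_flip_otens // -quad_split.
Qed.
Lemma mid_comp H K L M K' L' K2 L2 (s : op (L' *t K') (L2 *t K2)) (t : op (K *t L) (L' *t K')) :
 unitary s -> unitary t -> mid H M (s \o t) = mid H M s \o mid H M t.
move=> us ut; have uM := un_id M.
have bs := un_bop us; have bt := un_bop ut; have bM := bop_id M; have bH := bop_id H.
have ua := assoc_un H L' (K' *t M); have ua2 := assoc_un L' K' M.
have u1 := un_otens us uM; have u2 := un_otens ut uM.
have v1 := un_comp (un_comp (assoc_un L2 K2 M) u1) (un_adj ua2).
have v2 := un_comp (un_comp ua2 u2) (un_adj (assoc_un K L M)).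
have b1 := un_bop v1; have b2 := un_bop v2.
have e1 : otens (s \o t) (@id M) = otens s (@id M) \o otens t (@id M) by rewrite otens_comp.
have e2 : assoc L2 K2 M \o otens (s \o t) (@id M) \o adj (assoc K L M) =
  (assoc L2 K2 M \o otens s (@id M) \o adj (assoc L' K' M)) \o
  (assoc L' K' M \o otens t (@id M) \o adj (assoc K L M)).
 by apply/funext => x; rewrite e1 /= unK.
have e3 : otens (@id H) (assoc L2 K2 M \o otens (s \o t) (@id M) \o adj (assoc K L M)) =
  otens (@id H) (assoc L2 K2 M \o otens s (@id M) \o adj (assoc L' K' M)) \o
  otens (@id H) (assoc L' K' M \o otens t (@id M) \o adj (assoc K L M)).
 by rewrite e2 otens_comp.
by apply/funext => x; rewrite /Defs.mid e3 /= unVK.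
Qed.

Section QuadAlgebra.
Variables (A B C D : opalg R) (cA : cstar A) (cB : cstar B) (cC : cstar C) (cD : cstar D).
Let bA a : A a -> bop a. bdd. Qed.
Let bB a : B a -> bop a. bdd. Qed.
Let bC a : C a -> bop a. bdd. Qed.
Let bD a : D a -> bop a. bdd. Qed.
Lemma quad_ind (X : set (op ((sp A *t sp B) *t (sp C *t sp D)) ((sp A *t sp B) *t (sp C *t sp D)))) :
 csub X -> (forall a b c d, A a -> B b -> C c -> D d -> X (otens (otens a b) (otens c d))) ->
 els (A *T B *T (C *T D)) `<=` X.
move=> cX h; apply: (@tens_ind2 (A *T B) (C *T D) X [set otens a b | a in els A & b in els B]
 [set otens c d | c in els C & d in els D]) => //.
- exact: tens_cs.
- exact: tens_cs.
- by move=> Q cQ hQ; apply: tens_ind => // a b Aa Bb; apply: hQ; exists a => //; exists b.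
- by move=> Q cQ hQ; apply: tens_ind => // a b Aa Bb; apply: hQ; exists a => //; exists b.
- by move=> _ [a Aa [b Bb <-]]; apply: bop_otens; [exact: bA|exact: bB].
- by move=> _ [a Aa [b Bb <-]]; apply: bop_otens; [exact: bC|exact: bD].
- by move=> _ _ [a Aa [b Bb <-]] [c Cc [d Dd <-]]; exact: h.
Qed.
End QuadAlgebra.
Lemma mult_mid_flip A B C D t : cstar A -> cstar B -> cstar C -> cstar D -> mult (A *T B *T (C *T D)) t ->
 mult (A *T C *T (B *T D)) (Ad (mid (sp A) (sp D) (flip (sp B) (sp C))) t).
move=> cA cB cC cD.
have uP := mid_un (sp A) (sp D) (flip_un (sp B) (sp C)).
have cAB := tens_cs cA cB; have cCD := tens_cs cC cD.
have cAC := tens_cs cA cC; have cBD := tens_cs cB cD.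
have c1 := tens_cs cAB cCD; have c2 := tens_cs cAC cBD.
have bA a : A a -> bop a by bdd.
have bB a : B a -> bop a by bdd.
have bC a : C a -> bop a by bdd.
have bD a : D a -> bop a by bdd.
apply: (mult_Ad (B := (A *T C) *T (B *T D))) => // x Tx.
 suff /(_ x Tx)[] : els (A *T B *T (C *T D)) `<=` [set x | bop x /\
   (A *T C *T (B *T D)) (Ad (mid (sp A) (sp D) (flip (sp B) (sp C))) x)] by [].
 apply: quad_ind => // [|a b c d Aa Bb Cc Dd].
  exact: (csub_namp (namp_Ad uP) (cstar_sub c2)).
 have [ba [bb [bc bd]]] := (bA _ Aa, (bB _ Bb, (bC _ Cc, bD _ Dd))).
 split; first by apply: bop_otens; exact: bop_otens.
 rewrite Ad_mid_flip //; apply: (@tens_in (A *T C) (B *T D)); exact: tens_in.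
suff /(_ x Tx)[] : els (A *T C *T (B *T D)) `<=` [set x | bop x /\
  (A *T B *T (C *T D)) (Ad (adj (mid (sp A) (sp D) (flip (sp B) (sp C)))) x)] by [].
apply: quad_ind => // [|a c b d Aa Cc Bb Dd].
 exact: (csub_namp (namp_Ad (un_adj uP)) (cstar_sub c1)).
have [ba [bb [bc bd]]] := (bA _ Aa, (bB _ Bb, (bC _ Cc, bD _ Dd))).
split; first by apply: bop_otens; exact: bop_otens.
rewrite -Ad_mid_flip // AdK //; apply: (@tens_in (A *T B) (C *T D)); exact: tens_in.
Qed.

(* On the legs [f, g, f', g'] of [A, C, B, D], reordered as [f, f', g, g']. *)
Lemma jn_quad A B C D M (f : sp A ~> M) (f' : sp B ~> M) (g : sp C ~> M) (g' : sp D ~> M) :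
 cstar A -> cstar B -> cstar C -> cstar D -> jn f f' -> jn g g' -> jn f g -> jn f' g' ->
 @jn (A *T C) (B *T D) M (jr f g) (jr f' g') -> @jn (A *T B) (C *T D) M (jr f f') (jr g g') /\
 forall t, mult (A *T B *T (C *T D)) t ->
 @lg (A *T C) (B *T D) M (jr f g) (jr f' g') (Ad (mid (sp A) (sp D) (flip (sp B) (sp C))) t)
 = @lg (A *T B) (C *T D) M (jr f f') (jr g g') t.
move=> cA cB cC cD jff jgg jfg jfg' j.
have cAB := tens_cs cA cB; have cCD := tens_cs cC cD.
have cAC := tens_cs cA cC; have cBD := tens_cs cB cD.
have c1 := tens_cs cAB cCD.
have [rf [rf' [rg rg']]] := (jn_l jff, (jn_r jff, (jn_l jgg, jn_r jgg))).
pose P := mid (sp A) (sp D) (flip (sp B) (sp C)).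
have uP : unitary P by apply: mid_un; exact: flip_un.
pose Phi := @lg (A *T C) (B *T D) M (jr f g) (jr f' g') \o Ad P.
have sP : shom (mult (A *T B *T (C *T D))) Phi.
 apply: (shom_mult_Ad (B := (A *T C) *T (B *T D))) => //.
  exact: (lg_shom cAC cBD j).
 by move=> x; exact: mult_mid_flip.
have ml x : mult (A *T B) x -> mult (A *T B *T (C *T D)) (otens x (@id (sp C *t sp D))).
 by move=> mx; apply: (@mult_otens (A *T B) (C *T D)) => //; exact: mult_id.
have mr x : mult (C *T D) x -> mult (A *T B *T (C *T D)) (otens (@id (sp A *t sp B)) x).
 by move=> mx; apply: (@mult_otens (A *T B) (C *T D)) => //; exact: mult_id.
have m1 (E : opalg R) : mult E id by exact: mult_id.
have key a b c d : mult A a -> mult B b -> mult C c -> mult D d ->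
  Phi (otens (otens a b) (otens c d)) = (ext f a \o ext g c) \o (ext f' b \o ext g' d).
 move=> ma mb mc md; rewrite /Phi /= Ad_mid_flip //; try exact: mult_bop.
 rewrite (lg_otens cAC cBD j); [|exact: mult_otens|exact: mult_otens].
 by rewrite -/(lg _ _ _) -/(lg _ _ _) (lg_otens cA cC jfg) // (lg_otens cB cD jfg').
have P1 x : (A *T B) x -> Phi (otens x (@id (sp C *t sp D))) = jr f f' x.
 move=> Tx.
 have sx : shom (els (A *T B)) (fun x => Phi (otens x (@id (sp C *t sp D)))).
  have [n1 n2 n3 n4] := namp_shom (@namp_ampl (sp A *t sp B) (sp C *t sp D)).
  have bi s : (A *T B) s -> bop s by bdd.
  have mi s : (A *T B) s -> mult (A *T B *T (C *T D)) (otens s (@id (sp C *t sp D))).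
   by move=> Ts; apply: ml; exact: (mult_in cAB).
  split=> [s As|c s t As At|s t As At|s As].
  - exact/(shom_bop sP)/mi.
  - by rewrite (n2 _ _ _ (bi _ As) (bi _ At)) (shom_lin sP _ (mi _ As) (mi _ At)).
  - by rewrite (n3 _ _ (bi _ As) (bi _ At)) (shom_comp sP (mi _ As) (mi _ At)).
  - by rewrite (n4 _ (bi _ As)) (shom_adj sP (mi _ As)).
 apply: (shom_tens_eq cA cB sx (jr_prop jff).1) => // a b Aa Bb.
 rewrite (jrE jff) // -(otens_id (sp C) (sp D)) key //; [|exact: mult_in|exact: mult_in].
 by rewrite (ext_in rf) // (ext_in rf') // !ext_id.
have P2 x : (C *T D) x -> Phi (otens (@id (sp A *t sp B)) x) = jr g g' x.
 move=> Tx.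
 have sx : shom (els (C *T D)) (fun x => Phi (otens (@id (sp A *t sp B)) x)).
  have [n1 n2 n3 n4] := namp_shom (@namp_ampr (sp A *t sp B) (sp C *t sp D)).
  have bi s : (C *T D) s -> bop s by bdd.
  have mi s : (C *T D) s -> mult (A *T B *T (C *T D)) (otens (@id (sp A *t sp B)) s).
   by move=> Ts; apply: mr; exact: (mult_in cCD).
  split=> [s As|c s t As At|s t As At|s As].
  - exact/(shom_bop sP)/mi.
  - by rewrite (n2 _ _ _ (bi _ As) (bi _ At)) (shom_lin sP _ (mi _ As) (mi _ At)).
  - by rewrite (n3 _ _ (bi _ As) (bi _ At)) (shom_comp sP (mi _ As) (mi _ At)).
  - by rewrite (n4 _ (bi _ As)) (shom_adj sP (mi _ As)).
 apply: (shom_tens_eq cC cD sx (jr_prop jgg).1) => // a b Aa Bb.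
 rewrite (jrE jgg) // -(otens_id (sp A) (sp B)) key //; [|exact: mult_in|exact: mult_in].
 by rewrite (ext_in rg) // (ext_in rg') // !ext_id.
have PE x y : (A *T B) x -> (C *T D) y -> Phi (otens x y) = jr f f' x \o jr g g' y.
 move=> Tx Ty; have bx := cs_bop cAB Tx; have by_ := cs_bop cCD Ty.
 rewrite otens_split // (shom_comp sP); [|exact/ml/(mult_in cAB)|exact/mr/(mult_in cCD)].
 by rewrite P1 // P2.
have j' : @jn (A *T B) (C *T D) M (jr f f') (jr g g').
 split; [exact: jr_rep|exact: jr_rep|exists Phi; split=> //].
 have mi x : (A *T B *T (C *T D)) x -> mult (A *T B *T (C *T D)) x by exact: mult_in.
 case: sP => p1 p2 p3 p4; split=> [x /mi|c x y /mi hx /mi|x y /mi hx /mi|x /mi].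
 - exact: p1.
 - exact: p2.
 - exact: p3.
 - exact: p4.
split=> // t mt.
exact: (lg_uniq cAB cCD j' sP PE mt).
Qed.
End Quadruples.
End Commutation.

(** * Injectivity of amplifications and nonzero Hilbert spaces *)

Section Extras.
Lemma jn3_eq A B C M (f f' : sp A ~> M) (g g' : sp B ~> M) (h h' : sp C ~> M) : cstar A -> cstar B -> cstar C ->
 jn3 f g h -> (forall a, A a -> f a = f' a) -> (forall b, B b -> g b = g' b) ->
 (forall c, C c -> h c = h' c) -> jn3 f' g' h'.
move=> cA cB cC [j1 j2] ef eg eh; have [j1' e1] := jr_eq cB cC j1 eg eh; split=> //.
have e2 x : (B *T C) x -> jr g h x = jr g' h' x by move=> Tx; rewrite e1.
by have [] := jr_eq cA (tens_cs cB cC) j2 ef e2.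
Qed.
Lemma jn3_of_12_3 A B C M (f : sp A ~> M) (g : sp B ~> M) (h : sp C ~> M) : cstar A -> cstar B -> cstar C ->
 jn f g -> @jn (A *T B) C M (jr f g) h -> jn3 f g h.
move=> cA cB cC j1 j2; have j3 := jn3_of_23_1 cC cA cB j1 j2.
by apply: (jn3_rot cB cC cA); exact: (jn3_rot cC cA cB).
Qed.
Lemma lg_morl A A' B M (f : premor A A') (h : sp A' ~> M) (k : sp B ~> M) t : cstar A -> cstar A' -> cstar B ->
 morphism f -> jn h k -> mult (A *T B) t -> jn (ext h \o f) k /\ lg (ext h \o f) k t = lg h k (tapp f (idm B) t).
move=> cA cA' cB mf j mt; have mi := idm_morphism cB.
have j' := jn_mor cA cB cA' cB mf mi j.
have e b : B b -> (ext k \o idm B) b = k b by move=> Bb; rewrite /= (ext_in (jn_r j)).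
have [j'' _] := jr_eq cA cB (f' := ext h \o f) j' (fun _ _ => erefl) e; split=> //.
rewrite -(lg_mor cA cB cA' cB mf mi j mt).
exact: (lg_eq cA cB j' (fun _ _ => erefl) e mt).
Qed.
(** If al kills a nonzero operator u it kills every rank-one operator, hence all compacts. As the
    compacts are nondegenerate, the density clause of [namp] then forces the target space to be
    zero. *)
Lemma namp_inj M Q (al : M ~> Q) s t : namp al -> (exists q : Q, q <> 0) -> bop s -> bop t -> al s = al t -> s = t.
move=> na [q0 q0n] bs bt e; have sa := namp_shom na.
apply/funext => x0; apply/eqP; rewrite -subr_eq0; apply/negPn/negP => /eqP n0.
pose u := s - t; have bu : bop u by exact: bopB.
have au : al u = 0 by rewrite (shomB sa) // e subrr.
pose v := u x0.
have nv : nm v ^+ 2 != 0 by rewrite expf_neq0 //; apply/eqP => /nm_eq0.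
(* Every rank-one operator factors through u because v = u x0 is nonzero. *)
have ak x y : al (rank1 x y) = 0.
 have -> : rank1 x y = rank1 x v \o (u \o rank1 ((nm v ^+ 2)^-1%:C%C *: x0) y).
  apply/funext => z; rewrite /rank1 /= (linZ (bop_lin bu)) (linZ (bop_lin bu)).
  rewrite -/v !ipZr ipxx mulrC -!mulrA; congr (_ *: _).
  by rewrite mulrA -rmorphM mulVf // mul1r.
 rewrite (shom_comp sa) ?(shom_comp sa) ?au //; try exact: rank1_bop.
  by apply/funext => z /=; rewrite (lin0 (bop_lin (shom_bop sa (rank1_bop _ _)))).
 by apply: bop_comp => //; exact: rank1_bop.
have [_ _ ha] := na.
have dK : hdense (vecs (al @` els (Kop M))).
 apply: ha; last exact: cstar_dense (Kop_cstar M).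
 by move=> a; exact: (cs_bop (Kop_cstar M)).
have aK a : Kop M a -> al a = 0.
 have : els (Kop M) `<=` [set a | bop a /\ [set 0 : op Q Q] (al a)].
  apply: cspan_min => [|_ [x _ [y _ <-]]]; last by split; [exact: rank1_bop|exact: ak].
  exact: (csub_namp na (csub_zero Q Q)).
 by move=> h /h[].
apply: q0n; apply: (nm_small_eq0 (M := 1)) => e1 e10; rewrite mul1r.
have [y Ly hy] := dK q0 e1 e10; have y0 : y = 0.
 move: y Ly {hy}; apply: lspan_ind => // c _ y [_ [a Ka <-] [z _ <-]] ->.
 by rewrite aK // scaler0 addr0.
by rewrite y0 subr0 in hy.
Qed.
End Extras.
Lemma rep_nonzero (B : opalg R) (M : hilbert R) (f : sp B ~> M) : cstar B -> rep f ->
 (exists x : M, x <> 0) -> exists y : sp B, y <> 0.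
move=> cB rf [x x0]; apply: contrapT => n.
have z (y : sp B) : y = 0 by apply: contrapT => y0; apply: n; exists y.
apply: x0; apply: (nm_small_eq0 (M := 1)) => r r0; rewrite mul1r.
have [y Ly hy] := rf.2 x r r0; have y0 : y = 0.
 move: y Ly {hy}; apply: lspan_ind => // c _ y [_ [s Bs <-] [w _ <-]] ->.
 have -> : s = 0 by apply/funext => v; exact: z.
 by rewrite (shom0 (cs_alg cB) rf.1) scaler0 addr0.
by rewrite y0 subr0 in hy.
Qed.
Lemma ht_nonzero (M N : hilbert R) : (exists x : M, x <> 0) -> (exists y : N, y <> 0) -> exists z : M *t N, z <> 0.
move=> [x x0] [y y0]; exists (pt T x y) => e.
have := congr1 (@nm R _) e; rewrite nm_pt nm0 => /eqP; rewrite mulf_eq0 => /orP[]/eqP/nm_eq0//.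
Qed.
Lemma ht_nonzero_l (M N : hilbert R) : (exists z : M *t N, z <> 0) -> (exists x : M, x <> 0) /\ (exists y : N, y <> 0).
move=> [z z0]; suff : exists x : M, exists y : N, pt T x y <> 0.
 move=> [x [y h]]; split; [exists x => e|exists y => e]; apply: h.
  by rewrite e (lin0 (ptl _)).
 by rewrite e (lin0 (ptr _)).
apply: contrapT => n; apply: z0; apply: (nm_small_eq0 (M := 1)) => r r0; rewrite mul1r.
have [y Ly hy] := pures_dense z r0; have y0 : y = 0.
 move: y Ly {hy}; apply: lspan_ind => // c _ y [x _ [w _ <-]] ->.
 have -> : pt T x w = 0 by apply: contrapT => h; apply: n; exists x, w.
 by rewrite scaler0 addr0.
by rewrite y0 subr0 in hy.
Qed.

Section ExtrasR.
Lemma lg_morr A B B' M (f : premor B B') (h : sp A ~> M) (k : sp B' ~> M) : cstar A -> cstar B -> cstar B' ->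
 morphism f -> jn h k -> jn h (ext k \o f) /\
 forall t, mult (A *T B) t -> lg h (ext k \o f) t = lg h k (tapp (idm A) f t).
move=> cA cB cB' mf j; have mi := idm_morphism cA.
have j' := jn_mor cA cB cA cB' mi mf j.
have e b : A b -> (ext h \o idm A) b = h b by move=> Ab; rewrite /= (ext_in (jn_l j)).
have [j'' _] := jr_eq cA cB (g' := ext k \o f) j' e (fun _ _ => erefl); split=> // t mt.
rewrite -(lg_mor cA cB cA cB' mi mf j mt).
exact: (lg_eq cA cB j' e (fun _ _ => erefl) mt).
Qed.
Lemma rep1_eq A B M (q : sp A *t sp B ~> M) (f : sp A ~> M) (g : sp B ~> M) s :
 cstar A -> cstar B -> jn f g -> (forall x, (A *T B) x -> jr f g x = q x) -> A s -> @rep1 A B M q s = f s.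
move=> cA cB j e As; have cT := tens_cs cA cB; have ms := mult_in cA As.
have m1 : mult (A *T B) (otens s (@id (sp B))) by apply: mult_otens => //; exact: mult_id.
rewrite /rep1 (shom_eq_ext cT (jr_rep j) e m1) -[LHS]/(lg f g _) lg_otens //.
 by rewrite (ext_in (jn_l j)) // ext_id //; exact: (jn_r j).
exact: mult_id.
Qed.
End ExtrasR.
Lemma un_commV (H : hilbert R) (u t : op H H) : unitary u -> u \o t = t \o u -> adj u \o t = t \o adj u.
move=> uu e; apply/funext => x; have := congr1 (fun q => adj u (q (adj u x))) e.
by rewrite /= unVK // unK.
Qed.
Lemma rep_lg_comp (A B C : opalg R) (M : hilbert R) (f : sp A ~> M) (h : sp B ~> M) (g : premor C (tens T A B)) :
 cstar A -> cstar B -> morphism g -> @jn A B M f h -> rep (A := C) (fun s => @lg A B M f h (g s)).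
move=> cA cB mg j.
exact: (rep_comp (tens_cs cA cB) mg (jr_rep j)).
Qed.
Lemma Ad_id' (H : hilbert R) (t : op H H) : Ad (@id H) t = t.
by rewrite /Ad adj_id. Qed.

(** * Coactions in leg form *)

Section CoactionLegs.
Lemma ind3_group K L N Q (k : K ~> Q) (l : L ~> Q) (ga : N ~> Q) :
 ind3 k l ga -> exists2 nu : L *t N ~> Q, ind2 k nu &
  eqb l (fun t => nu (@ampl N L t)) /\ eqb ga (fun t => nu (@ampr L N t)).
move=> [eta ne [h1 h2 h3]]; exists (fun t => eta (ampr t)).
 by exists eta => //; split=> // t bt; exact: h1.
by split.
Qed.
Lemma jn_eq A B M (f f' : sp A ~> M) (g g' : sp B ~> M) :
 cstar A -> cstar B -> jn f g -> (forall a, A a -> f a = f' a) -> (forall b, B b -> g b = g' b) -> jn f' g'.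
by move=> cA cB j e e'; have [] := jr_eq cA cB j e e'. Qed.
Section Group.
Variables (C A B : opalg R) (K P Q : hilbert R) (k : K ~> Q) (nu : P ~> Q) (phi : sp C ~> K).
Variables (F1 : sp A ~> P) (F2 : sp B ~> P) (cC : cstar C) (cA : cstar A) (cB : cstar B).
Hypotheses (i2 : ind2 k nu) (rphi : rep phi) (j : jn F1 F2).
Let cAB := tens_cs cA cB.
Let jk : @jn C (A *T B) Q (k \o phi) (nu \o jr F1 F2).
exact: (ind2_jn cC cAB i2 rphi (jr_rep j)). Qed.
Let ej x : (A *T B) x -> (nu \o jr F1 F2) x = jr (nu \o F1) (nu \o F2) x.
by move=> Tx; rewrite (jr_namp cA cB (ind2_r i2) j). Qed.
Lemma jn3_group : jn3 (k \o phi) (nu \o F1) (nu \o F2).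
split; first exact: (jn_namp (ind2_r i2) j).
exact: (jn_eq cC cAB jk (fun _ _ => erefl) ej).
Qed.
Lemma lg_group z : mult (C *T (A *T B)) z ->
 lg3 (k \o phi) (nu \o F1) (nu \o F2) z = @lg C (A *T B) Q (k \o phi) (nu \o jr F1 F2) z.
exact: (lg_eq cC cAB jk (fun _ _ => erefl) ej). Qed.
End Group.
Lemma coaction_lg (G : qgroup T) C (g : premor C (C *T qA G)) Q (phi : sp C ~> Q)
  (c1 c2 : sp (qA G) ~> Q) s : hq G -> cstar C -> coaction G g -> jn3 phi c1 c2 -> C s ->
 [/\ jn phi (fun t : op (sp (qA G)) (sp (qA G)) => lg c1 c2 (qDelta G t)),
   jn (fun t => lg phi c1 (g t)) c2 &
   lg phi (fun t : op (sp (qA G)) (sp (qA G)) => lg c1 c2 (qDelta G t)) (g s) =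
   lg (fun t => lg phi c1 (g t)) c2 (g s)].
move=> hG cC hg j3 Cs; have cA := hq_A hG; have mg := co_mor hg.
have ms : mult (C *T qA G) (g s) by exact: (mor_mult mg).
have [j1 e1] := bichar2_gen cC cA cA cA (hq_Delta hG) j3 ms.
have [j2 e2] := bichar1_gen cC cA cA cC mg j3 ms.
by split=> //; rewrite e1 e2 (co_assoc hg Cs).
Qed.
Lemma coaction_jn (G : qgroup T) C (g : premor C (C *T qA G)) A' Q (phi : sp C ~> Q)
  (c : sp (qA G) ~> Q) (h : sp A' ~> Q) : hq G -> cstar C -> cstar A' -> coaction G g -> jn3 phi c h ->
 jn (fun t => lg phi c (g t)) h.
move=> hG cC cA' hg j3; have cA := hq_A hG; have mg := co_mor hg.
have [j2 _] := bichar1_gen cC cA cA' cC mg j3 (mult_id (tens T C A')).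
exact: j2.
Qed.
Local Notation sw A B C := (otens (@id (sp A)) (flip (sp B) (sp C))).
Lemma swap23_tens A B C x : cstar A -> cstar B -> cstar C -> (A *T (B *T C)) x -> (A *T (C *T B)) (Ad (sw A B C) x).
move=> cA cB cC Tx; have un := un_otens (un_id (sp A)) (flip_un (sp B) (sp C)).
suff /(_ x Tx)[] : els (A *T (B *T C)) `<=` [set x | bop x /\ (A *T (C *T B)) (Ad (sw A B C) x)] by [].
have cX := cstar_sub (tens_cs cA (tens_cs cC cB)).
apply: (tens_ind) => [|a y Aa Ty]; first exact: (csub_namp (namp_Ad un) cX).
have ba := cs_bop cA Aa.
have by_ := cs_bop (tens_cs cB cC) Ty.
split; first exact: bop_otens.
rewrite Ad_otens //; [|exact: un_id|exact: flip_un].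
rewrite Ad_id'; apply: (@tens_in A (C *T B)) => //; exact: flip_tens.
Qed.
Lemma swap23_mult A B C x : cstar A -> cstar B -> cstar C -> mult (A *T (B *T C)) x ->
 mult (A *T (C *T B)) (Ad (sw A B C) x).
move=> cA cB cC; have uf := flip_un (sp B) (sp C).
apply: (mult_Ad (B := A *T (C *T B))).
- by apply: tens_cs => //; exact: tens_cs.
- by apply: tens_cs => //; exact: tens_cs.
- by apply: un_otens => //; exact: un_id.
- by move=> y; exact: swap23_tens.
- move=> y; have b1 := bop_id (sp A); have b2 := un_bop uf.
 by rewrite otens_adj // adj_id flip_adj; exact: swap23_tens.
Qed.
Lemma swap23_lg A B C M (f : sp A ~> M) (g : sp B ~> M)
  (h : sp C ~> M) x : cstar A -> cstar B -> cstar C -> jn3 f g h ->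
 mult (A *T (B *T C)) x -> lg3 f h g (Ad (sw A B C) x) = lg3 f g h x.
move=> cA cB cC j mx; have j' := jn3_swap23 cA cB cC j.
have cBC := tens_cs cB cC; have cCB := tens_cs cC cB.
have uf := flip_un (sp B) (sp C).
have un := un_otens (un_id (sp A)) uf.
have sS := @lg_shom A (C *T B) M f (jr h g) cA cCB j'.2.
have sP := shom_mult_Ad (B := A *T (C *T B)) (tens_cs cA cBC) un sS (fun t mt => swap23_mult cA cB cC mt).
apply: (lg_uniq cA cBC j.2 sP _ mx) => a y Aa Ty.
have ba := cs_bop cA Aa; have by_ := cs_bop cBC Ty.
rewrite /= Ad_otens //; last exact: un_id.
have Tf := flip_tens cB cC Ty.
rewrite Ad_id' (lg_in j'.2 (tens_in Aa Tf)).
rewrite (jrE j'.2 Aa Tf); congr (_ \o _).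
rewrite -(lg_in j'.1 Tf) -(lg_in j.1 Ty).
exact: (lg_flip cB cC j.1 (mult_in cBC Ty)).
Qed.
End CoactionLegs.

(** * The Yetter-Drinfeld condition in leg form *)

Section YetterDrinfeldLegs.
Variables (G : qgroup T) (hG : hq G).
Local Notation A := (qA G).
Local Notation Ah := (qAd G).
Local Notation W := (qW G).
Variables (C : opalg R) (cC : cstar C) (g : premor C (C *T A)) (e : premor C (C *T Ah)) (hyd : yetter_drinfeld g e).
Let hGd : hq (dual G) := hq_dual hG.
Let cA : cstar A := hq_A hG.
Let cAh : cstar Ah := hq_Ad hG.
Let mW : mult (Ah *T A) W. by case: (hq_W hG). Qed.
Let uW : unitary W. by case: (hq_W hG). Qed.
Let mg := co_mor (yd_g hyd).
Let me := co_mor (yd_e hyd).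
Lemma yd_split Q (phi : sp C ~> Q) (c : sp A ~> Q) (h : sp Ah ~> Q) s : jn3 phi c h -> C s ->
 lg (fun t => lg phi c (g t)) h (e s) = lg3 phi c h (yd_composite g e s).
move=> j3 Cs; have ms : mult (C *T Ah) (e s) by exact: (mor_mult me).
by have [_ ->] := bichar1_gen cC cA cAh cC mg j3 ms.
Qed.
(** sigma^W is conjugation by W after a flip. In leg form the flip only permutes the representations
    c and h, and what remains is conjugation by W in these two legs. *)
Lemma yd_exchange Q (f : sp C ~> Q) (c : sp A ~> Q) (h : sp Ah ~> Q) s : jn3 f c h -> C s ->
 Ad (lg h c W) (lg (fun t => lg f c (g t)) h (e s)) = lg (fun t => lg f h (e t)) c (g s).
move=> j3 Cs; have mgs : mult (C *T A) (g s) by exact: (mor_mult mg).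
have mes : mult (C *T Ah) (e s) by exact: (mor_mult me).
have j3' := jn3_swap23 cC cA cAh j3.
rewrite (yd_split j3 Cs).
have [_ ->] := bichar1_gen cC cAh cA cC me j3' mgs.
rewrite -(yd_comm hyd Cs) /sigmaW23 /Wflip.
have mX : mult (C *T (A *T Ah)) (yd_composite g e s).
 apply: mult_assoc => //; apply: (@tapp_mult C Ah (C *T A) Ah g (idm Ah)) => //.
 - exact: tens_cs.
 - exact: idm_morphism.
set X := yd_composite g e s in mX *.
have uf := flip_un (sp A) (sp Ah).
have u1 := un_otens (un_id (sp C)) uf.
have u2 := un_otens (un_id (sp C)) uW.
have -> : otens (@id (sp C)) (W \o flip (sp A) (sp Ah)) = otens (@id (sp C)) W \o otens (@id (sp C)) (flip (sp A) (sp Ah)).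
 rewrite otens_comp //; try exact: bop_id; bdd.
rewrite -(Ad_Ad _ (un_bop u2) (un_bop u1)).
have cHA := tens_cs cAh cA.
set Y := Ad (otens (@id (sp C)) (flip (sp A) (sp Ah))) X.
have mY : mult (C *T (Ah *T A)) Y by exact: swap23_mult.
have mW3 : mult (C *T (Ah *T A)) (leg23 (sp C) W) by exact: mult_leg23.
have lg3_Ad : lg3 f h c (Ad (otens (@id (sp C)) W) Y) = Ad (lg h c W) (lg3 f h c Y).
 rewrite /Ad. 
 have mW3' : mult (C *T (Ah *T A)) (adj (leg23 (sp C) W)).
  exact: (csa_adj (mult_csalg (tens_cs cC cHA)) mW3).
 have mc : mult (C *T (Ah *T A)) (leg23 (sp C) W \o Y).
  exact: (csa_comp (mult_csalg (tens_cs cC cHA)) mW3 mY).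
 rewrite (lg3_comp cC cAh cA j3' mc mW3') (lg3_comp cC cAh cA j3' mW3 mY) (lg3_23 cC cAh cA j3' mW).
 congr (_ \o _).
 by rewrite -[LHS]/(@lg C (Ah *T A) Q f (jr h c) _) (lg_adj cC cHA j3'.2 mW3) -[X in adj X]/(lg3 f h c _) (lg3_23 cC cAh cA j3' mW).
by rewrite lg3_Ad; congr (Ad _ _); exact: (esym (swap23_lg cC cA cAh j3 mX)).
Qed.
End YetterDrinfeldLegs.

(** * Covariant representations in leg form *)

Section CovariantPairs.
Lemma lg_Lambda (G : qgroup T) (u : udual G) M Q (al : M ~> Q) (f : sp (qAd G) ~> M) (c : sp (qA G) ~> Q) :
 hq G -> hu u -> namp al -> rep f -> jn (al \o f) c ->
 lg (al \o (ext f \o uLambda u)) c (uV u) = lg (al \o f) c (qW G).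
move=> hG hU na rf j; have cA := hq_A hG; have cAd := hq_Ad hG; have cU := hu_A hU.
have mi := idm_morphism cA; have rc := jn_r j; have mV : mult (uA u *T qA G) (uV u) by case: (hu_V hU).
rewrite -(hu_L hU) -(lg_mor cU cA cAd cA (hu_Lambda hU) mi j mV).
have j' := jn_mor cU cA cAd cA (hu_Lambda hU) mi j.
apply: (lg_eq cU cA j') => // x Hx /=.
 by rewrite (ext_namp na) //; exact: (mor_mult (hu_Lambda hU)).
by rewrite (ext_in rc).
Qed.
(** Covariance for an amplification of K and any representation of the quantum group on an
    independent leg, ready for use inside longer leg computations. The implementing unitary is given
    through a representation of the universal dual. *)
Definition covp (G : qgroup T) (u : udual G) C (g : premor C (C *T qA G)) K (phi : sp C ~> K) (r : sp (uA u) ~> K) :=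
 [/\ rep phi, rep r & forall N Q (al : K ~> Q) (ga : N ~> Q) (c : sp (qA G) ~> N) s, ind2 al ga -> rep c -> C s ->
  lg (al \o phi) (ga \o c) (g s) = Ad (lg (al \o r) (ga \o c) (uV u)) (al (phi s))].
Lemma faithful_covp (G : qgroup T) (u : udual G) C (g : premor C (C *T qA G)) (y : covrep u C) :
 hq G -> hu u -> cstar C -> coaction G g -> is_faithful_covrep g y -> covp g (cphi y) (crho y).
move=> hG hU cC hg hy; have mphi := cr_phi hy; have mr := cr_rho hy.
have cA := hq_A hG; have hUA := hu_A hU; have mi := idm_morphism cA.
split; [exact: morphism_Kop mphi|exact: morphism_Kop mr|].
move=> N Q al ga c s i2 rc Cs; have hK := Kop_cstar (cK y).
have mV : mult (uA u *T qA G) (uV u) by case: (hu_V hU).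
have [[mU uU] _] := cr_U hy.
have na := ind2_l i2.
have jK : jn al (ga \o c).
 exact: (ind2_jn hK cA i2 (rep_id hK) rc).
have mgs : mult (C *T qA G) (g s) by exact: (mor_mult (co_mor hg)).
have bs : bop (cphi y s) by exact: (rep_bop (morphism_Kop mphi)).
have ea B (f : premor B (Kop (cK y))) : cstar B -> morphism f -> forall x, B x -> (ext al \o f) x = (al \o f) x.
 by move=> cB mf x Bx; rewrite /= ext_Kop //; exact: (rep_bop (morphism_Kop mf)).
have ec x : qA G x -> (ext (ga \o c) \o idm (qA G)) x = (ga \o c) x by move=> Ax; rewrite /= (ext_in (jn_r jK)).
have h B (f : premor B (Kop (cK y))) z : cstar B -> morphism f -> mult (B *T qA G) z ->
  lg (al \o f) (ga \o c) z = lg al (ga \o c) (tapp f (idm (qA G)) z).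
 move=> cB mf mz.
 rewrite -(lg_mor cB cA hK cA mf mi jK mz).
 have j' := jn_mor cB cA hK cA mf mi jK.
 exact: (lg_eq cB cA j' (ea _ _ cB mf) ec mz).
rewrite (h _ (cphi y)) // (cr_cov hy Cs) (h _ (crho y)) // (cr_rhoV hy).
have cT := tens_cs hK cA.
have m1 : mult (Kop (cK y) *T qA G) (otens (cphi y s) (@id (sp (qA G)))).
 apply: (@mult_otens (Kop (cK y)) (qA G)) => //; last exact: mult_id.
 by rewrite Kop_mult.
have mU' : mult (Kop (cK y) *T qA G) (adj (cU y)) by exact: (csa_adj (mult_csalg cT) mU).
have mc : mult (Kop (cK y) *T qA G) (cU y \o otens (cphi y s) (@id (sp (qA G)))).
 exact: (csa_comp (mult_csalg cT) mU m1).
rewrite {1}/Ad (lg_comp hK cA jK mc mU') (lg_comp hK cA jK mU m1).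
rewrite (lg_adj hK cA jK mU); congr (_ \o _ \o _).
rewrite (lg_otens hK cA jK) ?Kop_mult //; last exact: mult_id.
by rewrite ext_Kop // ext_id //; exact: (jn_r jK).
Qed.
End CovariantPairs.

Section SubLegs.
Lemma ind3_eqb3 M N P Q (al : M ~> Q) (be : N ~> Q) (ga ga' : P ~> Q) : eqb ga' ga -> ind3 al be ga -> ind3 al be ga'.
by move=> e [eta ne [h1 h2 h3]]; exists eta => //; split=> // t bt; rewrite e // h3. Qed.
Lemma ind3_subr M N P P' Q (al : M ~> Q) (be : N ~> Q) (ga : P' *t P ~> Q) :
 ind3 al be ga -> ind3 al be (fun t => ga (@ampr P' P t)).
move=> i3; have i3' := ind3_sub (ind3_Ad (flip_un P P') i3).
apply: ind3_eqb3 i3' => t bt /=; congr ga.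
by rewrite /ampl Ad_flip_otens //; exact: bop_id.
Qed.
End SubLegs.

(** * The exchange of two subalgebras by slicing *)

Section PodlesSlicing.
Lemma csub_shom H M (X : set (op H H)) (f : H ~> M) (Y : set (op M M)) :
 csalg X -> shom X f -> csub Y -> csub [set t | X t /\ Y (f t)].
move=> cX sf cY; apply: (csub_pre f 1) => //; first exact: (csa_sub cX).
- by move=> a s t Xs Xt; exists a; exact: (shom_lin sf).
- by move=> s t Xs Xt; rewrite (shomB sf).
- by move=> C t C0 Xt; rewrite mul1r; exact: (shom_contr cX sf).
Qed.
Lemma csub_sl M N (v w : N) (Y : set (op M M)) : csub Y -> csub [set t : bo (M *t N) | bop t /\ Y (sl v w t)].
move=> cY; have h1 := csub_mull cY (bop_bra M v).
have h2 := csub_mulr h1 (bop_ket M w).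
have -> : [set t | bop t /\ Y (sl v w t)] = [set t | bop t /\ [set u | bop u /\ Y (bra v \o u)] (t \o ket w)].
 apply/seteqP; split=> t /= [bt]; last by case.
 by move=> Yt; split=> //; split=> //; apply: bop_comp => //; exact: bop_ket.
exact: h2.
Qed.
Lemma sl_ampr M N (v w : N) (x y : op N N) (t : bo (M *t N)) : bop x -> bop y -> bop t ->
 sl v w (@ampr M N x \o t \o @ampr M N y) = sl (adj x v) (y w) t.
move=> bx by_ bt; apply/funext => h'; apply: ip_extr => h; rewrite !slE /=.
have bi := bop_id M; rewrite /ampr (otensE) //.
rewrite -(adjPr (bop_otens bi bx)) otens_adj // adj_id (otensE) //; exact: bop_adj.
Qed.
Lemma sl_adj M N (v w : N) (t : bo (M *t N)) : bop t -> adj (sl v w t) = sl w v (adj t).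
move=> bt; have bv := bop_bra M v; have bw := bop_ket M w.
rewrite /sl (adj_comp (bop_comp bv bt) bw) (adj_comp bv bt).
by rewrite adj_ket adj_bra.
Qed.
Lemma sl_dense_r M N (v : N) (D : set N) (Y : set (op M M)) (t : bo (M *t N)) :
 csub Y -> bop t -> hdense D -> (forall w, D w -> Y (sl v w t)) -> forall w, Y (sl v w t).
move=> cY bt hD h w; have [C [C0 hC]] := bop_bnd bt.
apply: (csub_lim cY) => e e0; pose k := nm v * C + 1.
have k0 : 0 < k by rewrite ltr_wpDl // mulr_ge0 // nm_ge0.
have [w' Dw' hw] := hD w _ (divr_gt0 e0 k0).
exists (sl v w' t).
 elim/lspan_ind: Dw' => [|a x y Dx Yy].
 - have -> : sl v (0 : N) t = 0; last exact: csub0.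
  by rewrite -(subrr (0 : N)) sl_By // subrr.
 - by rewrite sl_liny //; apply: csub_lincomb => //; exact: h.
rewrite -sl_By //; apply: bnd_le (sl_bnd _ _ C0 hC).
rewrite mulrAC; apply: le_trans (_ : k * (e / k) <= _); last by rewrite mulrCA divff ?mulr1 // gt_eqF.
apply: ler_pM => //; [by rewrite mulr_ge0 // nm_ge0|exact: nm_ge0|by rewrite lerDl].
Qed.
Lemma sl_dense M N (D E : set N) (Y : set (op M M)) (t : bo (M *t N)) :
 csub Y -> bop t -> hdense D -> hdense E -> (forall v w, D v -> E w -> Y (sl v w t)) -> forall v w, Y (sl v w t).
move=> cY bt hD hE h v w; have bt' := bop_adj bt.
have h1 v' : D v' -> Y (sl v' w t) by move=> Dv; apply: (sl_dense_r cY bt hE) => w' Ew; exact: h.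
have [_] : [set s | bop s /\ Y (adj s)] (sl w v (adj t)).
 apply: (sl_dense_r (csub_adj cY) bt' hD) => v' Dv'; split; first exact: bop_sl.
 by rewrite sl_adj // adjK //; exact: h1.
by rewrite sl_adj // adjK.
Qed.

Section Podles.
Variables (C A : opalg R) (g : premor C (C *T A)) (cC : cstar C) (cA : cstar A) (mg : morphism g).
Hypothesis hg : prodset (g @` els C) [set otens (@id (sp C)) a | a in els A] = els (C *T A).
Let cT := tens_cs cC cA.
Let bA a : A a -> bop a. bdd. Qed.
Lemma podles_r c a : C c -> A a -> (C *T A) (g c \o otens (@id (sp C)) a).
by move=> Cc Aa; rewrite -hg; apply: prodset_in; [exists c|exists a]. Qed.
Let adj_l c a : C c -> A a -> adj (g c \o otens (@id (sp C)) a) = otens (@id (sp C)) (adj a) \o g (adj c).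
move=> Cc Aa; have bi := bop_id (sp C); have ba := bA Aa.
have bg : bop (g c) := mult_bop (mor_mult mg Cc).
rewrite (adj_comp bg (bop_otens bi ba)) otens_adj // adj_id.
by have [_ _ _ -> //] := morph_shom mg.
Qed.
Lemma podles_l c a : C c -> A a -> (C *T A) (otens (@id (sp C)) a \o g c).
move=> Cc Aa; have Cc' := csa_adj (cs_alg cC) Cc; have Aa' := csa_adj (cs_alg cA) Aa.
have := csa_adj (cs_alg cT) (podles_r Cc' Aa'); rewrite adj_l // (adjK (bA Aa)) adjK //; bdd.
Qed.
Lemma podles_ind_r (X : set (bo (sp C *t sp A))) : csub X ->
 (forall c a, C c -> A a -> X (g c \o otens (@id (sp C)) a)) -> els (C *T A) `<=` X.
move=> cX h; rewrite -hg; apply: prodset_sub => // _ _ [c Cc <-] [a Aa <-]; exact: h.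
Qed.
Lemma podles_ind_l (X : set (bo (sp C *t sp A))) : csub X ->
 (forall c a, C c -> A a -> X (otens (@id (sp C)) a \o g c)) -> els (C *T A) `<=` X.
move=> cX h t Tt; have Tt' := csa_adj (cs_alg cT) Tt.
suff /(_ _ Tt')[_] : els (C *T A) `<=` [set t | bop t /\ X (adj t)].
 by rewrite adjK //; exact: (cs_bop cT).
apply: podles_ind_r => [|c a Cc Aa]; first exact: csub_adj.
split; first exact: (cs_bop cT (podles_r Cc Aa)).
by rewrite adj_l //; apply: h; [exact: (csa_adj (cs_alg cC))|exact: (csa_adj (cs_alg cA))].
Qed.
Variables (M N : hilbert R) (i : sp C ~> M) (r : sp A ~> N) (ri : rep i) (rr : rep r).
Let F := jr (@ampl N M \o i) (@ampr M N \o r).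
Let Fm := lg (@ampl N M \o i) (@ampr M N \o r).
Let j := jn_local cC cA ri rr.
Let m1 a : A a -> mult (C *T A) (otens (@id (sp C)) a).
by move=> Aa; apply: mult_otens => //; [exact: mult_id|exact: mult_in]. Qed.
Let Fm1 a : A a -> Fm (otens (@id (sp C)) a) = @ampr M N (r a).
move=> Aa; rewrite /Fm lg_otens //; [|exact: mult_id|exact: mult_in].
by rewrite ext_id //; [rewrite (ext_in (jn_r j))|exact: (jn_l j)].
Qed.
Lemma podles_rep_r c a : C c -> A a -> F (g c \o otens (@id (sp C)) a) = Fm (g c) \o @ampr M N (r a).
move=> Cc Aa; rewrite /F -(lg_in j (podles_r Cc Aa)) -Fm1 //.
by apply: lg_comp => //; [exact: (mor_mult mg)|exact: m1].
Qed.
Lemma podles_rep_l c a : C c -> A a -> F (otens (@id (sp C)) a \o g c) = @ampr M N (r a) \o Fm (g c).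
move=> Cc Aa; rewrite /F -(lg_in j (podles_l Cc Aa)) -Fm1 //.
by apply: lg_comp => //; [exact: m1|exact: (mor_mult mg)].
Qed.
End Podles.

Section Exchange.
Variables (C1 C2 A1 A2 : opalg R) (g : premor C1 (C1 *T A1)) (e : premor C2 (C2 *T A2)).
Variables (cC1 : cstar C1) (cC2 : cstar C2) (cA1 : cstar A1) (cA2 : cstar A2) (mg : morphism g) (me : morphism e).
Hypothesis hg : prodset (g @` els C1) [set otens (@id (sp C1)) a | a in els A1] = els (C1 *T A1).
Hypothesis he : prodset (e @` els C2) [set otens (@id (sp C2)) a | a in els A2] = els (C2 *T A2).
Variables (M N : hilbert R) (i1 : sp C1 ~> M) (i2 : sp C2 ~> M) (r1 : sp A1 ~> N) (r2 : sp A2 ~> N).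
Hypotheses (ri1 : rep i1) (ri2 : rep i2) (rr1 : rep r1) (rr2 : rep r2).
Local Notation F1m := (lg (@ampl N M \o i1) (@ampr M N \o r1)).
Local Notation F2m := (lg (@ampl N M \o i2) (@ampr M N \o r2)).
Hypothesis comm : forall c1 c2, C1 c1 -> C2 c2 -> F1m (g c1) \o F2m (e c2) = F2m (e c2) \o F1m (g c1).
Let F1 := jr (@ampl N M \o i1) (@ampr M N \o r1).
Let F2 := jr (@ampl N M \o i2) (@ampr M N \o r2).
Let j1 := jn_local cC1 cA1 ri1 rr1.
Let j2 := jn_local cC2 cA2 ri2 rr2.
Let Y := prodset (i1 @` els C1) (i2 @` els C2).
Let cY : csub Y := csub_cspan _.
Let T1 := tens_cs cC1 cA1.
Let T2 := tens_cs cC2 cA2.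
Let b1 z : (C1 *T A1) z -> bop (F1 z).
exact: (rep_bop (A := C1 *T A1) (jr_rep j1)). Qed.
Let b2 z : (C2 *T A2) z -> bop (F2 z).
exact: (rep_bop (A := C2 *T A2) (jr_rep j2)). Qed.
Let bi1 c : C1 c -> bop (i1 c). bdd. Qed.
Let bi2 c : C2 c -> bop (i2 c). bdd. Qed.
Let br1 c : A1 c -> bop (r1 c). bdd. Qed.
Let br2 c : A2 c -> bop (r2 c). bdd. Qed.
Let St v w := [set t : bo (M *t N) | bop t /\ Y (sl v w t)].
Let cSt v w : csub (St v w) := csub_sl v w cY.
Let SXl v w s := [set z | (C1 *T A1) z /\ [set t | bop t /\ St v w (t \o s)] (F1 z)].
Let Xl v w s : bop s -> csub (SXl v w s).
move=> bs; exact: (csub_shom (cs_alg T1) (jr_rep j1).1 (csub_mulr (cSt v w) bs)). Qed.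
Let SXr v w s := [set z | (C1 *T A1) z /\ [set t | bop t /\ St v w (s \o t)] (F1 z)].
Let Xr v w s : bop s -> csub (SXr v w s).
move=> bs; exact: (csub_shom (cs_alg T1) (jr_rep j1).1 (csub_mull (cSt v w) bs)). Qed.
Let SZl v w s := [set z | (C2 *T A2) z /\ [set t | bop t /\ St v w (t \o s)] (F2 z)].
Let Zl v w s : bop s -> csub (SZl v w s).
move=> bs; exact: (csub_shom (cs_alg T2) (jr_rep j2).1 (csub_mulr (cSt v w) bs)). Qed.
Let SZr v w s := [set z | (C2 *T A2) z /\ [set t | bop t /\ St v w (s \o t)] (F2 z)].
Let Zr v w s : bop s -> csub (SZr v w s).
move=> bs; exact: (csub_shom (cs_alg T2) (jr_rep j2).1 (csub_mull (cSt v w) bs)). Qed.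
Let step1 v w z1 z2 : (C1 *T A1) z1 -> (C2 *T A2) z2 -> Y (sl v w (F1 z1 \o F2 z2)).
move=> Tz1 Tz2.
have h1 a1 c1 : C1 c1 -> A1 a1 -> Y (sl v w (F1 (otens c1 a1) \o F2 z2)).
 move=> Cc Aa; have T11 := tens_in Cc Aa.
 suff /(_ _ Tz2)[_ [_ []]] : els (C2 *T A2) `<=` SZr v w (F1 (otens c1 a1)) by [].
 apply: (tens_ind (Zr v w (b1 T11))).
 move=> c2 a2 Cc2 Aa2; have T22 := tens_in Cc2 Aa2; have B2 := b2 T22.
 split=> //; split=> //; split; first exact: (bop_comp (b1 T11) B2).
 rewrite /F1 /F2 (jr_local cC1 cA1 ri1 rr1 Cc Aa) (jr_local cC2 cA2 ri2 rr2 Cc2 Aa2).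
 rewrite (otens_comp (bi2 Cc2) (br2 Aa2) (bi1 Cc) (br1 Aa)).
 rewrite sl_otens; [|bdd|bdd].
 by apply: (csubZ cY); apply: prodset_in; [exists c1|exists c2].
suff /(_ _ Tz1)[_ [_ []]] : els (C1 *T A1) `<=` SXl v w (F2 z2) by [].
apply: (tens_ind (Xl v w (b2 Tz2))).
move=> c1 a1 Cc1 Aa1; have T11 := tens_in Cc1 Aa1.
by split=> //; split; [exact: b1|split; [exact: (bop_comp (b1 T11) (b2 Tz2))|exact: h1]].
Qed.
Let m1 c : C1 c -> mult (C1 *T A1) (g c). exact: (mor_mult mg). Qed.
Let m2 c : C2 c -> mult (C2 *T A2) (e c). exact: (mor_mult me). Qed.
Let bF1 c : C1 c -> bop (F1m (g c)). by move=> Cc; exact: (lg_bop cC1 cA1 j1 (m1 Cc)). Qed.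
Let bF2 c : C2 c -> bop (F2m (e c)). by move=> Cc; exact: (lg_bop cC2 cA2 j2 (m2 Cc)). Qed.
(** By density v and w may be taken in the ranges of r1 and r2. These factors are then absorbed into
    the coaction legs by the Podles condition, which leads to operators covered by [step1]. *)
Let step2 c1 c2 v w : C1 c1 -> C2 c2 -> Y (sl v w (F1m (g c1) \o F2m (e c2))).
move=> Cc1 Cc2; have bT := bop_comp (bF1 Cc1) (bF2 Cc2).
apply: (sl_dense cY bT rr1.2 rr2.2) => _ _ [_ [a Aa <-] [v' _ <-]] [_ [h Ah <-] [w' _ <-]].
have Aa' := csa_adj (cs_alg cA1) Aa.
have := step1 v' w' (podles_l cC1 cA1 mg hg Cc1 Aa') (podles_r he Cc2 Ah).
rewrite /F1 /F2 (podles_rep_l cC1 cA1 mg hg ri1 rr1 Cc1 Aa') (podles_rep_r cC2 cA2 me he ri2 rr2 Cc2 Ah).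
have -> : (ampr (r1 (adj a)) \o F1m (g c1)) \o (F2m (e c2) \o ampr (r2 h)) =
  ampr (r1 (adj a)) \o (F1m (g c1) \o F2m (e c2)) \o ampr (r2 h) by [].
rewrite sl_ampr //; [|exact: br1|exact: br2].
have [_ _ _ ->] := rr1.1 => //; rewrite adjK //; exact: br1.
Qed.
(** The Podles condition writes z2 as a limit of combinations of products (1 tensor h) e(c2), and z1
    of products g(c1) (1 tensor a). In between stand the two coaction legs, which commute by [comm];
    this brings the product to the order of [step2]. *)
Let step3 v w z1 z2 : (C1 *T A1) z1 -> (C2 *T A2) z2 -> Y (sl v w (F2 z2 \o F1 z1)).
move=> Tz1 Tz2.
have h1 c1 a : C1 c1 -> A1 a -> Y (sl v w (F2 z2 \o F1 (g c1 \o otens (@id (sp C1)) a))).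
 move=> Cc1 Aa; have T11 := podles_r hg Cc1 Aa.
 suff /(_ _ Tz2)[_ [_ []]] : els (C2 *T A2) `<=` SZl v w (F1 (g c1 \o otens (@id (sp C1)) a)) by [].
 apply: (podles_ind_l cC2 cA2 me he (Zl v w (b1 T11))).
 move=> c2 h Cc2 Ah; have T22 := podles_l cC2 cA2 me he Cc2 Ah; have B2 := b2 T22.
 split=> //; split=> //; split; first exact: (bop_comp B2 (b1 T11)).
 rewrite /F1 /F2 (podles_rep_r cC1 cA1 mg hg ri1 rr1 Cc1 Aa) (podles_rep_l cC2 cA2 me he ri2 rr2 Cc2 Ah).
 have -> : (ampr (r2 h) \o F2m (e c2)) \o (F1m (g c1) \o ampr (r1 a)) =
   ampr (r2 h) \o (F2m (e c2) \o F1m (g c1)) \o ampr (r1 a) by [].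
 rewrite -comm // sl_ampr //; [exact: step2|exact: br2|exact: br1|].
 exact: (bop_comp (bF1 Cc1) (bF2 Cc2)).
suff /(_ _ Tz1)[_ [_ []]] : els (C1 *T A1) `<=` SXr v w (F2 z2) by [].
apply: (podles_ind_r hg (Xr v w (b2 Tz2))).
move=> c1 a Cc1 Aa; have T11 := podles_r hg Cc1 Aa.
by split=> //; split; [exact: b1|split; [exact: (bop_comp (b2 Tz2) (b1 T11))|exact: h1]].
Qed.
(** Commuting coaction legs imply that products in the wrong order lie in the closed span of
    products in the right order: the relation holds after tensoring with the legs r1 and r2 and is
    recovered by slicing them off. *)
Lemma podles_exchange c1 c2 : (exists z : N, z <> 0) -> C1 c1 -> C2 c2 ->
 prodset (i1 @` els C1) (i2 @` els C2) (i2 c2 \o i1 c1).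
move=> [z z0] Cc1 Cc2; rewrite -/Y.
(* Nondegeneracy of r1 and r2 on a nonzero space yields r2 h (r1 a w) nonzero. The slice at this
   vector and w is then a nonzero multiple of i2 c2 \o i1 c1. *)
have [h [a [w [Ah Aa nz]]]] : exists h a w, [/\ A2 h, A1 a & r2 h (r1 a w) <> 0].
 apply: contrapT => no; apply: z0.
 have r20 h : A2 h -> r2 h = 0.
  move=> Ah; apply: (hdense_eq rr1.2) => //; [exact: br2|exact: bop0|].
  move=> _ [_ [a Aa <-] [w _ <-]]; apply: contrapT => nz; apply: no.
  by exists h, a, w.
 apply: (nm_small_eq0 (M := 1)) => eps e0; rewrite mul1r.
 have [y + hy] := rr2.2 z eps e0.
 have y0 : lspan (vecs (r2 @` els A2)) y -> y = 0.
  elim/lspan_ind => // k x y' [_ [h Ah <-] [w _ <-]] ->.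
  by rewrite r20 // scaler0 addr0.
 by move/y0 => y1; rewrite y1 subr0 in hy.
pose v := r2 h (r1 a w).
have := step3 v w (tens_in Cc1 Aa) (tens_in Cc2 Ah).
rewrite /F1 /F2 (jr_local cC1 cA1 ri1 rr1 Cc1 Aa) (jr_local cC2 cA2 ri2 rr2 Cc2 Ah).
rewrite (otens_comp (bi1 Cc1) (br1 Aa) (bi2 Cc2) (br2 Ah)).
rewrite sl_otens; [|bdd|bdd].
rewrite /= -/v ipxx => hY; have := csubZ cY ((nm v ^+ 2)%:C%C)^-1 hY.
rewrite scalerA mulVf ?scale1r //.
apply/eqP => v0; apply: nz; apply: nm_eq0; rewrite -/v.
have : complex.Re ((nm v ^+ 2)%:C%C) = 0 :> R by rewrite v0.
by move=> /= /eqP; rewrite sqrf_eq0 => /eqP.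
Qed.
End Exchange.
End PodlesSlicing.

(** * The universal lift of W and the twisting unitary *)

Section TwistedLegs.
Lemma op_zero_eq H K (s t : op H K) : ~ (exists y : K, y <> 0) -> s = t.
move=> no; apply/funext => x; have z y : y = (0 : K) by apply: contrapT => h; apply: no; exists y.
by rewrite (z (s x)) (z (t x)).
Qed.
Section Universal.
Variables (G : qgroup T) (hG : hq G) (u : udual G) (u' : udual (dual G)) (hU : hu u) (hU' : hu (G := dual G) u').
Local Notation A := (qA G).
Local Notation Ah := (qAd G).
Local Notation W := (qW G).
Local Notation Wh := (dualW G).
Variable Wu : op (sp (uA u *T uA u')) (sp (uA u *T uA u')).
Hypothesis hWu : universal_lift (G := G) (G' := dual G) (u := u) (u' := u') W Wu.
Local Notation L0 := (qL G).
Let hGd : hq (dual G) := hq_dual hG.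
Let cA : cstar A := hq_A hG.
Let cAh : cstar Ah := hq_Ad hG.
Let cU := hu_A hU.
Let cU' := hu_A hU'.
Let mW : mult (Ah *T A) W. by case: (hq_W hG). Qed.
Let mV : mult (uA u *T A) (uV u). by case: (hu_V hU). Qed.
Let mV' : mult (uA u' *T Ah) (uV u'). by case: (hu_V hU'). Qed.
Let mWu : mult (uA u *T uA u') Wu. by case: hWu => [[[]]]. Qed.
Let uWu : unitary Wu. by case: hWu => [[[]]]. Qed.
Let rpi : rep (qpi G) := morphism_Kop (hq_pi hG).
Let rpid : rep (qpid G) := morphism_Kop (hq_pid hG).
Let rpL : rep (@ulam G u) := rep_ulam hG hU.
Let rpL' : rep (@ulam (dual G) u') := rep_ulam hGd hU'.
Let X' := Ad (flip (sp (uA u)) (sp (uA u'))) (adj Wu).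
Let lX : left_bichar (u := u) (D := uA u') Wu.
exact: (bichar_left cU cU' (hu_Delta hU) hWu.1). Qed.
Let lX' : left_bichar (G := dual G) (u := u') (D := uA u) X'.
exact: (bichar_right cU' cU (hu_Delta hU') hWu.1). Qed.
Lemma lg_Wu_Lambda M N Q (al : M ~> Q) (be : N ~> Q)
  (f : sp Ah ~> M) (h : sp A ~> N) : ind2 al be -> rep f -> rep h ->
 lg (al \o (ext f \o uLambda u)) (be \o (ext h \o uLambda u')) Wu = lg (al \o f) (be \o h) W.
move=> i2 rf rh; have j := ind2_jn cAh cA i2 rf rh; rewrite -hWu.2.
rewrite -(lg_mor cU cU' cAh cA (hu_Lambda hU) (hu_Lambda hU') j mWu).
have j' := jn_mor cU cU' cAh cA (hu_Lambda hU) (hu_Lambda hU') j.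
apply: (lg_eq cU cU' j') => // x Hx /=; rewrite ext_namp //.
- exact: ind2_l i2.
- exact: (mor_mult (hu_Lambda hU)).
- exact: ind2_r i2.
- exact: (mor_mult (hu_Lambda hU')).
Qed.
Let lg_X' M (f : sp (uA u) ~> M) (h : sp (uA u') ~> M) : jn f h -> lg h f X' = adj (lg f h Wu).
move=> j; have mWu' : mult (uA u *T uA u') (adj Wu) by exact: (csa_adj (mult_csalg (tens_cs cU cU')) mWu).
by rewrite (lg_flip cU cU' j mWu') (lg_adj cU cU' j mWu).
Qed.
Section Second.
Variables (K2 : hilbert R) (r2 : sp (uA u') ~> K2) (rr2 : rep r2).
(** Once its first leg is reduced, [Wu] is determined by the universal corepresentation of the
    second. Indeed [universal_leg] for the flipped adjoint of [Wu] and [corep_pentagon] for [uV u']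
    express the same conjugate of the adjoint of W. *)
Let Wu_second_loc : lg (@ampl K2 L0 \o @ulam G u) (@ampr L0 K2 \o r2) Wu =
 adj (lg (@ampr L0 K2 \o r2) (@ampl K2 L0 \o qpid G) (uV u')).
pose Q := L0 *t K2; pose l1 := @ampl K2 L0; pose l2 := @ampr L0 K2.
(* The identity is tested in a larger space, which must be nonzero for the amplification to be
   injective; otherwise all operators coincide. *)
have [[q nq]|no] := pselect (exists q : L0 *t Q, q <> 0); last first.
 apply: op_zero_eq => -[y ny]; have [x0 _] := ht_nonzero_l (ex_intro _ y ny).
 by apply: no; apply: ht_nonzero => //; exists y.
pose k := @ampl Q L0; pose r := @ampr L0 Q.
have nr : namp r := namp_r L0 Q.
have i3 : ind3 k (r \o l1) (r \o l2) := ind2_split (ind2_amp L0 Q).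
have i3a : ind3 (r \o l2) k (r \o l1) := ind3_swap12 (ind3_swap23 i3).
have jY := ind2_jn cU cU' (ind2_amp L0 K2) rpL rr2.
have jV := ind2_jn cU' cAh (ind2_sym (ind2_amp L0 K2)) rr2 rpid.
have uV0 := un_lgV hGd hU' jV.
apply: (namp_inj nr (ex_intro _ q nq)); [exact: (lg_bop cU cU' jY mWu)|exact: (bop_adj (un_bop uV0))|].
have e1 := universal_leg hGd hU' rr2 cU lX' i3a rpL.
have e2 := corep_pentagon hGd cU' (hu_X hU') i3a rr2 rpid.
rewrite (lg_X' (jn_namp nr jY)) in e1.
have j20 := ind2_jn cU cU' (ind2_sym (ind3_12 i3)) rpL rpL'.
rewrite (lg_X' j20) in e1.
have e3 := lg_Wu_Lambda (ind2_sym (ind3_12 i3)) rpid rpi.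
have {}e3 : lg ((r \o l1) \o @ulam G u) (k \o @ulam (dual G) u') Wu = lg ((r \o l1) \o qpid G) (k \o qpi G) W := e3.
rewrite e3 in e1.
have j3 := ind2_jn cAh cA (ind2_sym (ind3_12 i3)) rpid rpi.
rewrite (lg_dual hG j3) in e2.
have u24 := un_lgW hG j3.
set w24 := lg ((r \o l1) \o qpid G) _ W in e1 e2 u24.
have j34 := ind2_jn cU' cAh (ind3_12 i3a) rr2 rpid.
have u34 := un_lgV hGd hU' j34.
rewrite -/l1 -/l2 -(lg_namp cU cU' nr jY mWu) (namp_adj nr (un_bop uV0)) -(lg_namp cU' cAh nr jV mV').
set y := lg (r \o (l1 \o _)) _ Wu; set v := lg (r \o (l2 \o r2)) _ (uV u').
have uy : unitary y by apply: (lg_un cU cU' (jn_namp nr jY) mWu uWu).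
set v34 := lg _ (k \o _) (uV u') in e1 e2 u34.
have e4 : adj v34 \o adj w24 \o v34 = adj y \o adj w24 by have := e1; rewrite /Ad adjK //; bdd.
have e5 : adj w24 \o v34 = v34 \o v \o adj w24 by exact: e2.
have e6 : adj y = v.
 apply/funext => x; have := congr1 (fun q => q (w24 x)) e4; rewrite /= unK // => <-.
 by have := congr1 (fun q => q (w24 x)) e5; rewrite /= => ->; rewrite unK // unK.
by rewrite -e6 adjK //; bdd.
Qed.
Lemma Wu_second Q (be : L0 ~> Q) (ga : K2 ~> Q) : ind2 be ga ->
 lg (be \o @ulam G u) (ga \o r2) Wu = adj (lg (ga \o r2) (be \o qpid G) (uV u')).
move=> i2; have [eta ne [h1 h2]] := i2.
pose l1 := @ampl K2 L0; pose l2 := @ampr L0 K2.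
have jY := ind2_jn cU cU' (ind2_amp L0 K2) rpL rr2.
have jV := ind2_jn cU' cAh (ind2_sym (ind2_amp L0 K2)) rr2 rpid.
have uV0 := un_lgV hGd hU' jV.
rewrite (lg_eqb cU cU' ne h1 h2 jY mWu) //.
rewrite (lg_eqb cU' cAh ne h2 h1 jV mV') //.
by rewrite Wu_second_loc (namp_adj ne) //; bdd.
Qed.
End Second.
Section CovariantTwist.
Variables (C1 C2 : opalg R) (g : premor C1 (C1 *T A)) (e : premor C2 (C2 *T Ah)).
Variables (K1 K2 : hilbert R) (phi1 : sp C1 ~> K1) (phi2 : sp C2 ~> K2) (r1 : sp (uA u) ~> K1) (r2 : sp (uA u') ~> K2).
Hypotheses (hc1 : covp (u := u) g phi1 r1) (hc2 : covp (G := dual G) (u := u') e phi2 r2).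
(** Take t = U V with U and V the corepresentations of the two covariant pairs against a common
    middle leg. Then t leaves only U acting on the first algebra, and since the twist reverses the
    order of U and V it leaves only V acting on the second. Covariance turns both results into
    coactions. *)
Lemma covariant_twist Q (al : K1 ~> Q) (be : L0 ~> Q) (ga : K2 ~> Q) :
 ind3 al be ga -> exists2 t : op Q Q, unitary t &
 (forall c, C1 c -> Ad t (al (phi1 c)) = lg (al \o phi1) (be \o qpi G) (g c)) /\
 (forall c, C2 c -> Ad t (Ad (adj (lg (al \o r1) (ga \o r2) Wu)) (ga (phi2 c))) =
   lg (ga \o phi2) (be \o qpid G) (e c)).
move=> i3; have [rp1 rr1 h1] := hc1; have [rp2 rr2 h2] := hc2.
have jU := ind2_jn cU cA (ind3_12 i3) rr1 rpi; have uU := un_lgV hG hU jU.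
have i32 := ind2_sym (ind3_23 i3).
have jV := ind2_jn cU' cAh i32 rr2 rpid; have uV' := un_lgV hGd hU' jV.
have jZ := ind2_jn cU cU' (ind3_13 i3) rr1 rr2.
have uZ := lg_un cU cU' jZ mWu uWu.
have e1 := universal_leg hG hU rr1 cU' lX i3 rr2.
rewrite (Wu_second rr2 (ind3_23 i3)) in e1.
set U := lg (al \o r1) _ (uV u) in uU e1; set V := lg (ga \o r2) _ (uV u') in uV' e1.
set Zs := lg (al \o r1) (ga \o r2) Wu in uZ e1 *.
have bU := un_bop uU; have bV := un_bop uV'; have bZ := un_bop uZ.
exists (U \o V); first exact: un_comp.
split=> c Cc.
 have bc : bop (al (phi1 c)) by apply: (namp_bop (ind2_l (ind3_12 i3))); exact: (rep_bop rp1).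
 rewrite -(Ad_Ad _ bU bV) (h1 _ _ _ _ _ _ (ind3_12 i3) rpi Cc); congr (Ad _ _).
 apply: (Ad_fix uV'); apply/esym/(lg_commute cU' cAh jV bc) => // x Hx.
  by apply: (ind2_comm (ind3_13 i3)); [bdd|bdd].
 by apply: (ind2_comm (ind3_12 i3)); [bdd|bdd].
have bc : bop (ga (phi2 c)) by apply: (namp_bop (ind2_r (ind3_23 i3))); exact: (rep_bop rp2).
rewrite (h2 _ _ _ _ _ _ i32 rpid Cc).
rewrite (Ad_Ad _ (bop_comp bU bV) (bop_adj bZ)).
(* The defining effect of the twist: adj Zs interchanges U and V. It combines [universal_leg] in the
   first leg of [Wu] with [Wu_second] in the other. *)
have -> : (U \o V) \o adj Zs = V \o U.
 have e2 : Zs \o adj V = adj U \o adj V \o U by have := e1; rewrite /Ad adjK.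
 apply/funext => x /=; have := congr1 (fun q => q (V (adj Zs x))) e2.
 by rewrite /= unK // unVK // => e3; rewrite {2}e3 !unVK.
rewrite -(Ad_Ad _ bV bU); congr (Ad _ _); apply: (Ad_fix uU).
apply/esym/(lg_commute cU cA jU bc) => // x Hx.
 by apply/esym/(ind2_comm (ind3_13 i3)); [bdd|bdd].
by apply/esym/(ind2_comm (ind3_23 i3)); [bdd|bdd].
Qed.
End CovariantTwist.
End Universal.
End TwistedLegs.

(** * The images of the two algebras in a common multiplier algebra *)

Section LegImages.
Variables (G : qgroup T) (hG : hq G).
Local Notation A := (qA G).
Local Notation Ah := (qAd G).
Local Notation L0 := (qL G).
Variables (C1 C2 : opalg R) (cC1 : cstar C1) (cC2 : cstar C2) (g : premor C1 (C1 *T A)) (e : premor C2 (C2 *T Ah)).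
Hypotheses (mg : morphism g) (me : morphism e).
Let cA : cstar A := hq_A hG.
Let cAh : cstar Ah := hq_Ad hG.
Let cL := Kop_cstar L0.
(** The middle leg has to carry both A and its dual, which do not commute with each other there;
    hence the compact operators on [qL G]. *)
Definition legalg : opalg R := C1 *T (Kop L0 *T C2).
Definition leg1 c : bo (sp legalg) := leg12 (sp C2) (tapp (idm C1) (qpi G) (g c)).
Definition leg2 c : bo (sp legalg) := leg23 (sp C1) (Ad (flip (sp C2) L0) (tapp (idm C2) (qpid G) (e c))).
Let cKC := tens_cs cL cC2.
Lemma legalg_cstar : cstar legalg. exact: tens_cs. Qed.
Let mt1 c : C1 c -> mult (C1 *T Kop L0) (tapp (idm C1) (qpi G) (g c)).
move=> Cc; apply: (@tapp_mult C1 A C1 (Kop L0)) => //; [exact: idm_morphism|exact: hq_pi|].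
exact: (mor_mult mg).
Qed.
Let mt2 c : C2 c -> mult (C2 *T Kop L0) (tapp (idm C2) (qpid G) (e c)).
move=> Cc; apply: (@tapp_mult C2 Ah C2 (Kop L0)) => //; [exact: idm_morphism|exact: hq_pid|].
exact: (mor_mult me).
Qed.
Lemma mult_leg1 c : C1 c -> mult legalg (leg1 c).
by move=> Cc; apply: (@mult_leg12 C1 (Kop L0) C2) => //; exact: mt1. Qed.
Lemma mult_leg2 c : C2 c -> mult legalg (leg2 c).
move=> Cc; apply: (@mult_leg23 C1 (Kop L0) C2) => //.
by apply: (@mult_flip C2 (Kop L0)) => //; exact: mt2.
Qed.
Variables (K1 K2 : hilbert R) (phi1 : sp C1 ~> K1) (phi2 : sp C2 ~> K2) (rp1 : rep phi1) (rp2 : rep phi2).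
Let P := L0 *t K2.
Let Q := K1 *t P.
Let al : K1 ~> Q := @ampl P K1.
Let nu : P ~> Q := @ampr K1 P.
Let be0 : L0 ~> P := @ampl K2 L0.
Let ga0 : K2 ~> P := @ampr L0 K2.
Let i2 : ind2 al nu := ind2_amp K1 P.
Let i20 : ind2 be0 ga0 := ind2_amp L0 K2.
Definition leg_rep : sp legalg ~> Q := @lg3 C1 (Kop L0) C2 Q (@ampl P K1 \o phi1) (@ampr K1 P \o @ampl K2 L0)
  (@ampr K1 P \o (@ampr L0 K2 \o phi2)).
Let rb0 : rep (A := Kop L0) be0 := rep_Kop (ind2_l i20).
Let jbg : @jn (Kop L0) C2 P be0 (ga0 \o phi2).
exact: (ind2_jn cL cC2 i20 (rep_id cL) rp2). Qed.
Let j3 : @jn3 C1 (Kop L0) C2 Q (al \o phi1) (nu \o be0) (nu \o (ga0 \o phi2)).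
exact: (jn3_group cC1 cL cC2 i2 rp1 jbg). Qed.
Lemma leg_rep_shom : shom (mult legalg) leg_rep.
exact: (lg_shom cC1 cKC j3.2). Qed.
Lemma leg_rep_inj : finj (els C1) phi1 -> finj (els C2) phi2 -> finj (mult legalg) leg_rep.
move=> f1 f2 s t ms mt est.
have eg := lg_group cC1 cL cC2 i2 rp1 jbg.
have := est; rewrite /leg_rep (eg s ms) (eg t mt).
have rF : rep (A := Kop L0 *T C2) (@jr (Kop L0) C2 P be0 (ga0 \o phi2)) := jr_rep jbg.
apply: (lg_inj cC1 cKC rp1 rF f1) => // x y Tx Ty.
rewrite -(lg_in jbg Tx) -(lg_in jbg Ty).
have fid : finj (els (Kop L0)) id by [].
by apply: (lg_inj cL cC2 (rep_id cL) rp2 fid f2); exact: (mult_in cKC).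
Qed.
Lemma leg_rep1 c : C1 c -> leg_rep (leg1 c) = lg (al \o phi1) (nu \o be0 \o qpi G) (g c).
move=> Cc; rewrite /leg_rep (lg3_12 cC1 cL cC2 j3 (mt1 Cc)).
have j12 : @jn C1 (Kop L0) Q (al \o phi1) (nu \o be0) := jn3_12 cC1 cL cC2 j3.
have mi := idm_morphism cC1; have mpi := hq_pi hG.
have mgc : mult (C1 *T A) (g c) by exact: (mor_mult mg).
rewrite -(lg_mor cC1 cA cC1 cL mi mpi j12 mgc).
have j' := jn_mor cC1 cA cC1 cL mi mpi j12.
apply/esym/(lg_eq cC1 cA j' _ _ mgc) => x Hx /=.
 by rewrite (ext_in (jn_l j12)).
rewrite (ext_Kop (al := nu \o be0)) //; first exact: (namp_trans (ind2_l i20) (ind2_r i2)).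
exact: (rep_bop (morphism_Kop mpi)).
Qed.
Lemma leg_rep2 c : C2 c -> leg_rep (leg2 c) = lg (nu \o ga0 \o phi2) (nu \o be0 \o qpid G) (e c).
move=> Cc; have mf : mult (Kop L0 *T C2) (Ad (flip (sp C2) L0) (tapp (idm C2) (qpid G) (e c))).
 by apply: (@mult_flip C2 (Kop L0)) => //; exact: mt2.
rewrite /leg_rep (lg3_23 cC1 cL cC2 j3 mf).
have j23 : @jn C2 (Kop L0) Q (nu \o (ga0 \o phi2)) (nu \o be0) := jn_flip cL cC2 j3.1.
rewrite (lg_flip cC2 cL j23 (mt2 Cc)).
have mi := idm_morphism cC2; have mpi := hq_pid hG.
have mgc : mult (C2 *T Ah) (e c) by exact: (mor_mult me).
rewrite -(lg_mor cC2 cAh cC2 cL mi mpi j23 mgc).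
have j' := jn_mor cC2 cAh cC2 cL mi mpi j23.
apply/esym/(lg_eq cC2 cAh j' _ _ mgc) => x Hx /=.
 by rewrite (ext_in (jn_l j23)).
rewrite (ext_Kop (al := nu \o be0)) //; first exact: (namp_trans (ind2_l i20) (ind2_r i2)).
exact: (rep_bop (morphism_Kop mpi)).
Qed.
End LegImages.

Section WSide.
Variables (G : qgroup T) (hG : hq G) (u : udual G) (u' : udual (dual G)) (hU : hu u) (hU' : hu (G := dual G) u').
Local Notation A := (qA G).
Local Notation Ah := (qAd G).
Local Notation L0 := (qL G).
Variable Wu : op (sp (uA u *T uA u')) (sp (uA u *T uA u')).
Hypothesis hWu : universal_lift (G := G) (G' := dual G) (u := u) (u' := u') (qW G) Wu.
Variables (C1 C2 : opalg R) (cC1 : cstar C1) (cC2 : cstar C2) (g : premor C1 (C1 *T A)) (e : premor C2 (C2 *T Ah)).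
Variables (mg : morphism g) (me : morphism e) (K1 K2 : hilbert R) (phi1 : sp C1 ~> K1) (phi2 : sp C2 ~> K2).
Variables (r1 : sp (uA u) ~> K1) (r2 : sp (uA u') ~> K2).
Hypotheses (hc1 : covp (u := u) g phi1 r1) (hc2 : covp (G := dual G) (u := u') e phi2 r2).
Let cU := hu_A hU.
Let cU' := hu_A hU'.
Let mWu : mult (uA u *T uA u') Wu. by case: hWu => [[[]]]. Qed.
(** The transport is the amplification of K1 and K2 to the outer legs followed by the conjugation of
    [covariant_twist]. Its values are images of [leg1] and [leg2], in which the representations of
    the universal duals no longer occur. *)
Lemma wside_transport : exists2 ka : K1 *t K2 ~> K1 *t (L0 *t K2), namp ka &
 (forall c, C1 c -> ka (@ampl K2 K1 (phi1 c)) = @leg_rep G C1 C2 K1 K2 phi1 phi2 (@leg1 G C1 C2 g c)) /\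
 (forall c, C2 c -> ka (Ad (adj (lg (@ampl K2 K1 \o r1) (@ampr K1 K2 \o r2) Wu))
   (@ampr K1 K2 (phi2 c))) = @leg_rep G C1 C2 K1 K2 phi1 phi2 (@leg2 G C1 C2 e c)).
have [rp1 rr1 _] := hc1; have [rp2 rr2 _] := hc2.
pose P := L0 *t K2; pose Q := K1 *t P.
pose al : K1 ~> Q := @ampl P K1.
pose nu : P ~> Q := @ampr K1 P.
pose be0 : L0 ~> P := @ampl K2 L0.
pose ga0 : K2 ~> P := @ampr L0 K2.
have i3 : ind3 al (nu \o be0) (nu \o ga0) := ind2_split (ind2_amp K1 P).
have [t ut [t1 t2]] := covariant_twist hG hU hU' hWu hc1 hc2 i3.
have [eta ne [h1 h2]] := ind3_13 i3.
exists (Ad t \o eta); first exact: (namp_trans ne (namp_Ad ut)).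
have jZ := ind2_jn cU cU' (ind2_amp K1 K2) rr1 rr2.
have uWu : unitary Wu by case: hWu => [[[]]].
have bZ := un_bop (lg_un cU cU' jZ mWu uWu).
split=> c Cc /=.
 have b1 : bop (phi1 c) by exact: (rep_bop rp1).
 by rewrite -(h1 _ b1) (leg_rep1 hG cC1 cC2 mg rp1 rp2 Cc) -t1.
have b1 : bop (phi2 c) by exact: (rep_bop rp2).
have b2 : bop (@ampr K1 K2 (phi2 c)) by exact: (namp_bop (namp_r K1 K2)).
have ba := bop_adj bZ.
rewrite (namp_conj ne ba b2) (namp_adj ne bZ) -(h2 _ b1) -(lg_namp cU cU' ne jZ mWu) (leg_rep2 hG cC1 cC2 me rp1 rp2 Cc) -(t2 _ Cc).
congr (Ad _ (Ad (adj _) _)); apply/esym/(lg_eq cU cU' (jn_namp ne jZ) _ _ mWu) => x Hx /=.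
 exact: (esym (h1 _ (rep_bop rr1 Hx))).
exact: (esym (h2 _ (rep_bop rr2 Hx))).
Qed.
End WSide.

(** * The codouble: Heisenberg relations for theta and rho *)

Section Codouble.
Variables (G : qgroup T) (d : double_data G) (hG : hq G) (hd : is_double d).
Local Notation A := (qA G).
Local Notation Ah := (qAd G).
Local Notation AA := (A *T Ah).
Local Notation D := (dD d).
Local Notation L := (dL d).
Local Notation W := (qW G).
Local Notation Wh := (dualW G).
Local Notation W' := (codouble_W d).
Local Notation de := (dpid d).
Local Notation p := (dpi d).
Let hC : hq (codouble d) := is_qgroup_hq (db_qgroup hd).
Let hGd : hq (dual G) := hq_dual hG.
Let hCd : hq (dual (codouble d)) := hq_dual hC.
Let cA : cstar A := hq_A hG.
Let cAh : cstar Ah := hq_Ad hG.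
Let cD : cstar D := hq_Ad hC.
Let cAA : cstar AA := hq_A hC.
Let mW : mult (Ah *T A) W. by case: (hq_W hG). Qed.
Let mWh : mult AA Wh. by case: (hq_W hGd). Qed.
Let mW' : mult (D *T AA) W'. by case: (hq_W hC). Qed.
Let mp : morphism p := hq_pi hC.
Let mde : morphism de := hq_pid hC.
Let rp : rep (A := AA) p := morphism_Kop mp.
Let rde : rep de := morphism_Kop mde.
Let mth : morphism (dtheta d) := db_theta hd.
Let mrh : morphism (drho d) := db_rho hd.
(** Four representations on the space of the codouble: theta and rho through the regular
    representation of the double, and the restrictions of the regular representation of the codouble
    to its two tensor factors. *)
Definition thL : sp Ah ~> L := ext de \o dtheta d.
Definition rhL : sp A ~> L := ext de \o drho d.
Definition aL : sp A ~> L := @rep1 A Ah L p.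
Definition bL : sp Ah ~> L := @rep2 A Ah L p.
Lemma rep_thL : rep thL. exact: (rep_comp cD mth rde). Qed.
Lemma rep_rhL : rep rhL. exact: (rep_comp cD mrh rde). Qed.
Lemma jn_abL : jn aL bL. exact: (jn_split cA cAh rp). Qed.
Lemma jr_abL x : AA x -> jr aL bL x = p x. exact: (jr_split cA cAh rp). Qed.
Lemma rep_aL : rep aL. exact: (jn_l jn_abL). Qed.
Lemma rep_bL : rep bL. exact: (jn_r jn_abL). Qed.
Let rth := rep_thL.
Let rrh := rep_rhL.
Let ra := rep_aL.
Let rb := rep_bL.
Lemma un_lgWh Q (f : sp A ~> Q) (g : sp Ah ~> Q) : jn f g -> unitary (lg f g Wh).
by move=> j; exact: (un_lgW hGd j). Qed.
Lemma codouble_lgW Q (al : L ~> Q) (c : sp A ~> Q) (e : sp Ah ~> Q) : namp al -> jn3 (al \o de) c e ->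
 [/\ jn (al \o thL) c, jn (al \o rhL) e & lg3 (al \o de) c e W' = lg (al \o thL) c W \o lg (al \o rhL) e Wh].
move=> na j3; have j12 := jn3_12 cD cA cAh j3; have j13 := jn3_13 cD cA cAh j3.
have [j1 e1] := lg_morl cAh cD cA mth j12 mW.
have [j2 e2] := lg_morl cA cD cAh mrh j13 mWh.
have et s : Ah s -> (ext (al \o de) \o dtheta d) s = (al \o thL) s.
 by move=> As; rewrite /= (ext_namp na) //; exact: (mor_mult mth).
have er s : A s -> (ext (al \o de) \o drho d) s = (al \o rhL) s.
 by move=> As; rewrite /= (ext_namp na) //; exact: (mor_mult mrh).
have [j1' _] := jr_eq cAh cA (g' := c) j1 et (fun _ _ => erefl).
have [j2' _] := jr_eq cA cAh (g' := e) j2 er (fun _ _ => erefl).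
split=> //.
have m1 : mult (D *T A) (tapp (dtheta d) (idm A) W) by apply: (tapp_mult cAh cA cD cA) => //; exact: idm_morphism.
have m2 : mult (D *T Ah) (tapp (drho d) (idm Ah) Wh) by apply: (tapp_mult cA cAh cD cAh) => //; exact: idm_morphism.
rewrite /codouble_W (lg3_comp cD cA cAh j3); [|exact: mult_leg12|exact: mult_leg13].
rewrite (lg3_12 cD cA cAh j3) // (lg3_13 cD cA cAh j3) // -e1 -e2.
by rewrite (lg_eq cAh cA j1 et (fun _ _ => erefl)) // (lg_eq cA cAh j2 er (fun _ _ => erefl)).
Qed.

Lemma codouble_lgW2 M Q (al : L ~> Q) (be : M ~> Q) (c : sp A ~> M) (e : sp Ah ~> M) (q : sp A *t sp Ah ~> M) :
 ind2 al be -> jn c e -> (forall x, AA x -> jr c e x = q x) ->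
 [/\ jn3 (al \o de) (be \o c) (be \o e), jn (al \o thL) (be \o c), jn (al \o rhL) (be \o e) &
 @lg D AA Q (al \o de) (be \o q) W' = lg (al \o thL) (be \o c) W \o lg (al \o rhL) (be \o e) Wh].
move=> i2 j eq; have na := ind2_l i2; have nb := ind2_r i2.
have jbe := jn_namp nb j.
have rq : rep (A := AA) q by exact: (rep_eq (jr_rep j) cAA eq).
have jq := @ind2_jn D AA _ _ _ al be de q cD cAA i2 rde rq.
have e1 x : AA x -> (be \o q) x = jr (be \o c) (be \o e) x by move=> Tx; rewrite (jr_namp cA cAh nb j) //= eq.
have [jq' _] := jr_eq cD cAA jq (fun _ _ => erefl) e1.
have j3 : jn3 (al \o de) (be \o c) (be \o e) by [].
have [j1 j2 e2] := codouble_lgW na j3; split=> //.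
rewrite -e2 /lg3; apply/esym.
exact: (lg_eq cD cAA jq (fun _ _ => erefl) e1 mW').
Qed.
Lemma codouble_lgWp Q (al be : L ~> Q) : ind2 al be ->
 [/\ jn3 (al \o de) (be \o aL) (be \o bL), jn (al \o thL) (be \o aL), jn (al \o rhL) (be \o bL) &
 @lg D AA Q (al \o de) (be \o p) W' = lg (al \o thL) (be \o aL) W \o lg (al \o rhL) (be \o bL) Wh].
by move=> i2; exact: (codouble_lgW2 i2 jn_abL jr_abL). Qed.
Local Notation w02 al be := (@lg D AA _ (be \o de) (al \o p) W').
Lemma jn_w02 Q (al be : L ~> Q) : ind2 al be -> @jn D AA Q (be \o de) (al \o p).
by move=> i2; exact: (@ind2_jn D AA _ _ _ be al de p cD cAA (ind2_sym i2) rde rp).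
Qed.
Lemma un_w02 Q (al be : L ~> Q) : ind2 al be -> unitary (w02 al be).
by move=> i2; exact: (un_lgW hC (jn_w02 i2)). Qed.

Section HopfMorphism.
Variables (E : opalg R) (h : premor E D) (dE : premor E (E *T E)).
Hypotheses (cE : cstar E) (mh : morphism h) (mdE : morphism dE).
Hypothesis hD : forall s, E s -> mext (dDelta d) (h s) = tapp h h (dE s).
Local Notation hL := (ext de \o h).
Let rhh : rep hL. exact: (rep_comp cD mh rde). Qed.
(** A morphism into the double that respects comultiplications inherits the Heisenberg relation of
    the dual of the codouble, implemented by the adjoint of its bicharacter. It serves for rho and
    for theta. *)
Lemma hopf_Heisenberg Q (al be : L ~> Q) s : ind2 al be -> E s ->
 lg (al \o hL) (be \o hL) (dE s) = Ad (adj (w02 al be)) (al (hL s)).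
move=> i2 Es; have na := ind2_l i2; have nb := ind2_r i2.
have jdd := ind2_jn cD cD i2 rde rde.
have mDD : morphism (dDelta d) := hq_Delta hCd.
have uw := un_w02 i2; have nw := namp_Ad (un_adj uw).
have e1 x : D x -> (ext (A := D *T D) (jr (al \o de) (be \o de)) \o dDelta d) x
  = ((Ad (adj (w02 al be)) \o al) \o de) x.
 move=> Dx; apply: etrans (Heisenberg hCd i2 rde Dx) _; rewrite /=.
 congr (Ad _ _); have j := jn_w02 i2.
 exact: (lg_dual hC j).
have cDD := tens_cs cD cD.
have mhs : mult D (h s) by exact: (mor_mult mh).
have rF := rep_comp cDD mDD (jr_rep jdd).
have := shom_eq_ext cD rF e1 mhs.
rewrite (ext_comp cD cDD mDD (jr_rep jdd)) // (ext_namp (namp_trans na nw)) // => e2.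
apply: etrans _ (esym e2); rewrite -(mextE cD cDD mDD mhs) hD // -[RHS]/(lg (al \o de) (be \o de) _).
have mds : mult (E *T E) (dE s) by exact: (mor_mult mdE).
rewrite -(lg_mor cE cE cD cD mh mh jdd mds).
apply: (lg_eq cE cE (jn_mor cE cE cD cD mh mh jdd)) => // x Ex /=.
 by rewrite (ext_namp na) //; exact: (mor_mult mh).
by rewrite (ext_namp nb) //; exact: (mor_mult mh).
Qed.
Variables (F : opalg R) (X : op (sp (E *T F)) (sp (E *T F))) (cF : cstar F) (mX : mult (E *T F) X).
Hypothesis hX : forall M (f g : sp E ~> M) (k : sp F ~> M), jn3 f g k -> jn (fun s => lg f g (dE s)) k /\
 lg (fun s => lg f g (dE s)) k X = lg g k X \o lg f k X.
(** The character property of X in its first leg, with the comultiplication of E written as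
    conjugation by [hopf_Heisenberg]. *)
Lemma hopf_pentagon N Q (al be : L ~> Q) (ga : N ~> Q) (c : sp F ~> N) : ind3 al be ga -> rep c ->
 w02 al be \o (lg (be \o hL) (ga \o c) X \o lg (al \o hL) (ga \o c) X) = lg (al \o hL) (ga \o c) X \o w02 al be.
move=> i3 rc; have i12 := ind3_12 i3; have uw := un_w02 i12.
have j3 := ind3_jn3 cE cE cF i3 rhh rhh rc; have [j e] := hX j3.
have nw := namp_Ad (un_adj uw).
have j13 := ind2_jn cE cF (ind3_13 i3) rhh rc.
apply/(un_AdVP _ _ uw); rewrite -e -(lg_namp cE cF nw j13 mX).
apply/(lg_eq cE cF j) => // x Fx /=; first exact: hopf_Heisenberg.
have bx : bop (c x) by exact: (rep_bop rc).
have bgx : bop (ga (c x)) by exact: (namp_bop (ind2_r (ind3_13 i3))).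
apply/esym/(un_AdVP _ _ uw); apply/esym.
apply: (lg_commute cD cAA (jn_w02 i12) bgx) => // y Dy.
 by apply: (ind2_comm (ind2_sym (ind3_23 i3))) => //; bdd.
by apply: (ind2_comm (ind2_sym (ind3_13 i3))) => //; bdd.
Qed.
End HopfMorphism.
Lemma rho_Heisenberg Q (al be : L ~> Q) s : ind2 al be -> A s ->
 lg (al \o rhL) (be \o rhL) (qDelta G s) = Ad (adj (w02 al be)) (al (rhL s)).
exact: (hopf_Heisenberg cA mrh (hq_Delta hG) (db_rhoDelta hd)). Qed.
Lemma theta_pentagon N Q (al be : L ~> Q) (ga : N ~> Q) (c : sp A ~> N) : ind3 al be ga -> rep c ->
 w02 al be \o (lg (be \o thL) (ga \o c) W \o lg (al \o thL) (ga \o c) W) = lg (al \o thL) (ga \o c) W \o w02 al be.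
exact: (hopf_pentagon cAh mth (hq_Deltad hG) (db_thetaDelta hd) cA mW (hq_Dd hG)).
Qed.
Lemma rho_pentagon N Q (al be : L ~> Q) (ga : N ~> Q) (e : sp Ah ~> N) : ind3 al be ga -> rep e ->
 w02 al be \o (lg (be \o rhL) (ga \o e) Wh \o lg (al \o rhL) (ga \o e) Wh) =
 lg (al \o rhL) (ga \o e) Wh \o w02 al be.
exact: (hopf_pentagon cA mrh (hq_Delta hG) (db_rhoDelta hd) cAh mWh (hq_Dd hGd)).
Qed.
Local Notation th := thL.
Local Notation rh := rhL.
Local Notation a := aL.
Local Notation b := bL.
Lemma mid_W : mid (sp A) (sp Ah) W = Ad (adj (assoc (sp A) (sp Ah) (sp A *t sp Ah))) (leg23 (sp A) (leg12 (sp Ah) W)).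
by rewrite /Ad adjK //; exact/un_bop/assoc_un.
Qed.

Section Comultiplication.
Variables (Q : hilbert R) (c c' : sp A ~> Q) (e e' : sp Ah ~> Q).
Variables (jcc : jn c c') (jee : jn e e') (jce : jn c e) (jce' : jn c' e') (j : @jn AA AA Q (jr c e) (jr c' e')).
Let mD := hq_Delta hG.
Let mDd := hq_Deltad hG.
Let cAA2 := tens_cs cA cA.
Let cAh2 := tens_cs cAh cAh.
Lemma jn_ec : jn e c'.
have j3 := jn3_of_12_3 cA cAh cAA jce j.
by have := jn3_12 cAh cA cAh (conj jce' j3.1).
Qed.
Lemma jn_cc_ee : jn (fun s => lg c c' (qDelta G s)) (fun s => lg e e' (qDeltad G s)).
have [j' _] := jn_quad cA cA cAh cAh jcc jee jce jce' j.
exact: (jn_mor cA cAh cAA2 cAh2 mD mDd j').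
Qed.
(** In sigma^W the flip merely regroups the four legs, which [jn_quad] accounts for, and W becomes
    conjugation by W in the legs e and c'. *)
Lemma codouble_Delta_lg x : AA x -> @lg AA AA Q (jr c e) (jr c' e') (codouble_Delta G x) =
 Ad (lg e c' W) (jr (fun s => lg c c' (qDelta G s)) (fun s => lg e e' (qDeltad G s)) x).
have [j' e1] := jn_quad cA cA cAh cAh jcc jee jce jce' j.
have cDD := tens_cs cAA cAA.
have uw : unitary (lg e c' W) := un_lgW hG jn_ec.
have j3 := jn3_of_12_3 cA cAh cAA jce j.
have mL12 : mult (Ah *T AA) (leg12 (sp Ah) W) by exact: mult_leg12.
have mL : mult (A *T (Ah *T AA)) (leg23 (sp A) (leg12 (sp Ah) W)).
 exact: (mult_leg23 cA cAh cAA).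
have ua := assoc_un (sp A) (sp Ah) (sp A *t sp Ah).
have mm : mult (AA *T AA) (mid (sp A) (sp Ah) W).
 rewrite mid_W; apply: (mult_Ad (B := AA *T AA)) mL => //.
 - by apply: tens_cs => //; exact: tens_cs.
 - exact: un_adj.
 - by move=> y; exact: (assocV_tens).
 - by move=> y; rewrite adjK; [exact: (assoc_tens)|bdd].
have em : @lg AA AA Q (jr c e) (jr c' e') (mid (sp A) (sp Ah) W) = lg e c' W.
 have [_ ->] := jn3_12_3 cA cAh cAA j3; last exact: mm.
 rewrite mid_W AdVK // (lg3_23 cA cAh cAA j3) //.
 exact: (lg3_12 cAh cA cAh (conj jce' j3.1)).
have sL := lg_shom cAA cAA j.
have nw := namp_Ad uw.
have jq := jn_namp nw jn_cc_ee.
move=> Tx; rewrite -(jr_namp cA cAh nw jn_cc_ee Tx).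
have mDl s : A s -> mult (A *T A) (qDelta G s) by exact: (mor_mult mD).
have mDr s : Ah s -> mult (Ah *T Ah) (qDeltad G s) by exact: (mor_mult mDd).
have mcod := hq_Delta hC.
apply: (jr_uniq (F := fun x => @lg AA AA Q (jr c e) (jr c' e') (codouble_Delta G x)) cA cAh jq) => //.
split; first exact: (rep_comp cDD mcod (jr_rep j)).1.
move=> s t As At.
have ma1 := mDl _ As; have ma2 := mDr _ At.
have m1 : mult (A *T A *T (Ah *T Ah)) (otens (qDelta G s) (qDeltad G t)) by exact: (mult_otens).
have m2 := mult_mid_flip cA cA cAh cAh m1.
have um : unitary (mid (sp A) (sp Ah) W) by apply: mid_un; case: (hq_W hG).
have uf := flip_un (sp A) (sp Ah).
have eD : codouble_Delta G (otens s t) = Ad (mid (sp A) (sp Ah) W)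
  (Ad (mid (sp A) (sp Ah) (flip (sp A) (sp Ah))) (otens (qDelta G s) (qDeltad G t))).
 rewrite -[LHS]/(Ad (mid (sp A) (sp Ah) (Wflip G)) (tmor T (qDelta G) (qDeltad G) (otens s t))).
 rewrite (tmorE cA cAh cAA2 cAh2 mD mDd As At) /Wflip mid_comp //; last by case: (hq_W hG).
 by rewrite Ad_Ad //; [exact: un_bop|exact/un_bop/mid_un].
have mc := csa_comp (mult_csalg cDD) mm m2.
have ma := csa_adj (mult_csalg cDD) mm.
rewrite eD [X in lg _ _ X]/Ad (shom_comp sL mc ma) (shom_comp sL mm m2) (shom_adj sL mm) em e1 //.
rewrite -[RHS](Ad_comp _ _ uw); congr (_ \o _ \o _).
exact: (lg_otens cAA2 cAh2 j' ma1 ma2).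
Qed.
End Comultiplication.

Section Exchange.
Variables (M M' Q : hilbert R) (al : L ~> Q) (be : M ~> Q) (ga : M' ~> Q) (c0 : sp A ~> M) (e0 : sp Ah ~> M).
Variables (c1 : sp A ~> M') (e1 : sp Ah ~> M') (i3 : ind3 al be ga) (j0 : jn c0 e0) (j1 : jn c1 e1).
(** The commutation relation of the Drinfeld double, in terms of theta and rho. It is the
    corepresentation identity of the bicharacter of the codouble, written as W in theta times the
    dual bicharacter in rho; the outermost factors commute with w and cancel. *)
Lemma exchange_gen : lg (al \o rh) (be \o e0) Wh \o lg (al \o th) (ga \o c1) W \o lg (be \o e0) (ga \o c1) W =
 lg (be \o e0) (ga \o c1) W \o (lg (al \o th) (ga \o c1) W \o lg (al \o rh) (be \o e0) Wh).
have i12 := ind3_12 i3; have i13 := ind3_13 i3; have i23 := ind3_23 i3.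
have na := ind2_l i12; have nb := ind2_r i12; have ng := ind2_r i13.
have [rc0 [re0 [rc1 re1]]] := (jn_l j0, (jn_r j0, (jn_l j1, jn_r j1))).
pose c := be \o c0; pose e := be \o e0; pose c' := ga \o c1; pose e' := ga \o e1.
have jce : jn c e := jn_namp nb j0.
have jce' : jn c' e' := jn_namp ng j1.
have jcc : jn c c' := ind2_jn cA cA i23 rc0 rc1.
have jee : jn e e' := ind2_jn cAh cAh i23 re0 re1.
have jec : jn e c' := ind2_jn cAh cA i23 re0 rc1.
pose f := al \o de.
have j3 : @jn3 D AA AA Q f (be \o jr c0 e0) (ga \o jr c1 e1).
 exact: (@ind3_jn3 D AA AA _ _ _ _ al be ga de (jr c0 e0) (jr c1 e1) cD cAA cAA i3 rde (jr_rep j0) (jr_rep j1)).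
have eb x : AA x -> (be \o jr c0 e0) x = jr c e x by move=> Tx; rewrite (jr_namp cA cAh nb j0).
have eg x : AA x -> (ga \o jr c1 e1) x = jr c' e' x by move=> Tx; rewrite (jr_namp cA cAh ng j1).
have j3' : @jn3 D AA AA Q f (jr c e) (jr c' e').
 exact: (jn3_eq (B := AA) (C := AA) cD cAA cAA j3 (fun _ _ => erefl) eb eg).
have [jD eD] := hq_D hC j3'.
have [_ jtc jre eL1] := codouble_lgW2 i12 j0 (fun _ _ => erefl).
have [_ jtc' jre' eL2] := codouble_lgW2 i13 j1 (fun _ _ => erefl).
have jf1 := @ind2_jn D AA _ _ _ al be de (jr c0 e0) cD cAA i12 rde (jr_rep j0).
have jf2 := @ind2_jn D AA _ _ _ al ga de (jr c1 e1) cD cAA i13 rde (jr_rep j1).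
have eL1' := lg_eq (B := AA) cD cAA jf1 (fun _ _ => erefl) eb mW'.
have eL2' := lg_eq (B := AA) cD cAA jf2 (fun _ _ => erefl) eg mW'.
have jx := j3'.1.
pose w := lg e c' W; have uw : unitary w := un_lgW hG jec.
have bw := un_bop uw.
have nw := namp_Ad uw; have nw' := namp_Ad (un_adj uw).
pose ch s := lg c c' (qDelta G s); pose eh s := lg e e' (qDeltad G s).
have jh : jn ch eh := jn_cc_ee jcc jee jce jce' jx.
have key x : AA x -> @lg AA AA Q (jr c e) (jr c' e') (codouble_Delta G x) = (Ad w \o jr ch eh) x.
 by move=> Tx; rewrite (codouble_Delta_lg jcc jee jce jce' jx Tx).
have bf x : D x -> bop (f x) by move=> Dx; apply: (namp_bop na); exact: (rep_bop rde).
have ba_ x : Ah x -> bop (e0 x) by exact: (rep_bop re0).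
have cw t : bop t -> al t \o w = w \o al t.
 move=> bt; apply: (lg_commute cAh cA jec (namp_bop na bt)) => // x Hx.
  by apply: (ind2_comm i12) => //; exact: (rep_bop re0).
 by apply: (ind2_comm i13) => //; exact: (rep_bop rc1).
have fw x : D x -> Ad w (f x) = f x by move=> Dx; apply: Ad_fix => //; rewrite cw //; exact: (rep_bop rde).
have jAd : @jn D AA Q f (Ad w \o jr ch eh) by have [] := jr_eq (B := AA) cD cAA jD (fun _ _ => erefl) key.
have jf : @jn D AA Q f (jr ch eh).
 have h1 x : D x -> (Ad (adj w) \o f) x = f x by move=> Dx; rewrite /= -{1}(fw _ Dx) AdK.
 have h2 x : AA x -> (Ad (adj w) \o (Ad w \o jr ch eh)) x = jr ch eh x by move=> _; rewrite /= AdK.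
 by have [] := jr_eq (B := AA) cD cAA (jn_namp nw' jAd) h1 h2.
have jf3 : jn3 f ch eh by [].
have [_ _ e2] := codouble_lgW na jf3.
have e3 : lg (al \o th) ch W = lg (al \o th) c W \o lg (al \o th) c' W.
 exact: (hq_D hG (ind3_jn3 cAh cA cA i3 rth rc0 rc1)).2.
have e4 : lg (al \o rh) eh Wh = lg (al \o rh) e Wh \o lg (al \o rh) e' Wh.
 exact: (hq_D hGd (ind3_jn3 cA cAh cAh i3 rrh re0 re1)).2.
have e5 : Ad w (lg3 f ch eh W') = @lg D AA Q f (jr c e) W' \o @lg D AA Q f (jr c' e') W'.
 rewrite -eD -(lg_namp (B := AA) cD cAA nw jf mW').
 apply/esym/(lg_eq (B := AA) cD cAA (jn_namp nw jf)) => // x Hx.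
 exact: (esym (key _ Hx)).
rewrite eL1' eL2' eL1 eL2 e2 e3 e4 in e5.
have u1 : unitary (lg (al \o th) c W) := un_lgW hG jtc.
have u2 : unitary (lg (al \o rh) e' Wh) := un_lgWh jre'.
have cw1 : w \o lg (al \o th) c W = lg (al \o th) c W \o w.
 apply: (lg_commute cAh cA jtc bw) => // x Hx.
  by apply/esym/cw; exact: (rep_bop rth).
 have bx : bop (c x) by apply: (namp_bop nb); exact: (rep_bop rc0).
 apply/esym; apply: (lg_commute cAh cA jec bx) => // y Hy.
  exact: (jn_comm cA cAh jce).
 exact: (jn_comm cA cA jcc).
have cw2 : w \o lg (al \o rh) e' Wh = lg (al \o rh) e' Wh \o w.
 apply: (lg_commute cA cAh jre' bw) => // x Hx.
  by apply/esym/cw; exact: (rep_bop rrh).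
 have bx : bop (e' x) by apply: (namp_bop ng); exact: (rep_bop re1).
 apply/esym; apply: (lg_commute cAh cA jec bx) => // y Hy.
  by apply/esym; exact: (jn_comm cAh cAh jee).
 by apply/esym; exact: (jn_comm cA cAh jce').
rewrite -/c -/e -/c' -/e' -/w in e5 *.
move: e5; move/(un_AdP _ _ uw) => e5.
apply/funext => x.
have e6 := congr1 (fun q => adj (lg (al \o th) c W) (q (adj (lg (al \o rh) e' Wh) x))) e5.
have c1' y := congr1 (fun q => q y) cw1; have c2' y := congr1 (fun q => q y) cw2.
rewrite /= in e6 c1' c2' *.
rewrite unVK // in e6; rewrite c1' unK // in e6.
by rewrite -c2' unVK // unK // in e6.
Qed.
End Exchange.
(** [exchange_gen] for legs that carry a representation of only one of the two factors. The other
    factor is added and later removed by injectivity of an amplification. *)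
Lemma exchange N N' Q (al : L ~> Q) (be : N ~> Q) (ga : N' ~> Q) (e : sp Ah ~> N) (c : sp A ~> N') :
 ind3 al be ga -> rep e -> rep c ->
 lg (al \o rh) (be \o e) Wh \o lg (al \o th) (ga \o c) W \o lg (be \o e) (ga \o c) W =
 lg (be \o e) (ga \o c) W \o (lg (al \o th) (ga \o c) W \o lg (al \o rh) (be \o e) Wh).
move=> [eta ne [h1 h2 h3]] re rc.
pose k1 := @ampl (N *t N') L; pose r := @ampr L (N *t N').
pose k2 := r \o ampl; pose k3 := r \o ampr.
have i3 : ind3 k1 k2 k3 := ind2_split (ind2_amp L (N *t N')).
have X Q' al' be' ga' (i : @ind3 L N N' Q' al' be' ga') :
  [/\ jn (al' \o rh) (be' \o e), jn (al' \o th) (ga' \o c) & jn (be' \o e) (ga' \o c)].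
 split; [exact: (ind2_jn cA cAh (ind3_12 i))|exact: (ind2_jn cAh cA (ind3_13 i))|exact: (ind2_jn cAh cA (ind3_23 i))].
have tr Q' al' be' ga' Q2 (ze : Q' ~> Q2) al2 be2 ga2 (i : @ind3 L N N' Q' al' be' ga') :
  namp ze -> eqb al2 (ze \o al') -> eqb be2 (ze \o be') -> eqb ga2 (ze \o ga') ->
  [/\ lg (al2 \o rh) (be2 \o e) Wh = ze (lg (al' \o rh) (be' \o e) Wh),
    lg (al2 \o th) (ga2 \o c) W = ze (lg (al' \o th) (ga' \o c) W) &
    lg (be2 \o e) (ga2 \o c) W = ze (lg (be' \o e) (ga' \o c) W)].
 move=> nz f1 f2 f3; have [q1 q2 q3] := X _ _ _ _ i.
 split.
 - by rewrite (lg_eqb cA cAh nz f1 f2 q1 mWh).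
 - by rewrite (lg_eqb cAh cA nz f1 f3 q2 mW).
 - by rewrite (lg_eqb cAh cA nz f2 f3 q3 mW).
have [q1 q2 q3] := X _ _ _ _ i3.
have b1 := lg_bop cA cAh q1 mWh; have b2 := lg_bop cAh cA q2 mW; have b3 := lg_bop cAh cA q3 mW.
suff loc : lg (k1 \o rh) (k2 \o e) Wh \o lg (k1 \o th) (k3 \o c) W \o lg (k2 \o e) (k3 \o c) W =
  lg (k2 \o e) (k3 \o c) W \o (lg (k1 \o th) (k3 \o c) W \o lg (k1 \o rh) (k2 \o e) Wh).
 have [-> -> ->] := tr _ _ _ _ _ eta al be ga i3 ne h1 h2 h3.
 have b12 := bop_comp b1 b2; have b21 := bop_comp b2 b1.
 rewrite -(namp_comp ne b1 b2) -(namp_comp ne b12 b3) loc.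
 by rewrite (namp_comp ne b3 b21) (namp_comp ne b2 b1).
have [z0|z0] := pselect (exists z : L *t (N *t N'), z <> 0); last first.
 by apply/funext => x; apply: contrapT => h; apply: z0; exists (lg (k1 \o rh) (k2 \o e) Wh (lg (k1 \o th) (k3 \o c) W (lg (k2 \o e) (k3 \o c) W x)) -
   lg (k2 \o e) (k3 \o c) W (lg (k1 \o th) (k3 \o c) W (lg (k1 \o rh) (k2 \o e) Wh x))) => /eqP;
  rewrite subr_eq0 => /eqP.
have [zL /ht_nonzero_l[zN zN']] := ht_nonzero_l z0.
have zA := rep_nonzero cA rc zN'; have zAh := rep_nonzero cAh re zN.
(* The missing representations of A and of its dual are the identity representations on an extra
   tensor factor. *)
pose M := sp A *t N; pose M' := N' *t sp Ah.
pose m1 := @ampl (M *t M') L; pose r' := @ampr L (M *t M').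
pose m2 := r' \o ampl; pose m3 := r' \o ampr.
have i3' : ind3 m1 m2 m3 := ind2_split (ind2_amp L (M *t M')).
have jA : jn (ampl) (ampr \o e) := jn_local cA cAh (rep_id cA) re.
have jB : jn (ampl \o c) (ampr) := jn_local cA cAh rc (rep_id cAh).
have gen := exchange_gen i3' jA jB.
have i4 : ind3 m1 m2 (fun t => m3 (ampl t)) := ind3_sub i3'.
have i5 : ind3 m1 (fun t => m2 (ampr t)) (fun t => m3 (ampl t)).
 apply: ind3_swap23.
 have uf := flip_un N (sp A).
 have i6 := ind3_sub (ind3_Ad uf (ind3_swap23 i4)).
 have [eta' ne' [f1 f2 f3]] := i6; exists eta' => //; split=> // t bt.
 by rewrite -f3 // /ampl /ampr Ad_flip_otens //; exact: bop_id.
have [ze nz [g1 g2 g3]] := i5.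
have zQ : exists z : L *t (M *t M'), z <> 0.
 apply: ht_nonzero => //; apply: ht_nonzero; exact: ht_nonzero.
have [t1 t2 t3] := tr _ _ _ _ _ ze m1 (fun t => m2 (ampr t)) (fun t => m3 (ampl t)) i3 nz g1 g2 g3.
have b12 := bop_comp b1 b2; have b21 := bop_comp b2 b1.
apply: (namp_inj nz zQ); [bdd|bdd|].
rewrite (namp_comp nz b12 b3) (namp_comp nz b1 b2) (namp_comp nz b3 b21) (namp_comp nz b2 b1).
by rewrite -t1 -t2 -t3.
Qed.
Let jab : jn a b := jn_abL.
Let mD := hq_Delta hG.
Let mDd := hq_Deltad hG.
Let cA2 := tens_cs cA cA.
Let cAh2 := tens_cs cAh cAh.
Lemma jn3_leg N Q (al : L ~> Q) (ga : N ~> Q) C (f : sp C ~> N) : cstar C -> ind2 al ga -> rep f ->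
 jn3 (al \o a) (al \o b) (ga \o f).
move=> cC i2 rf; have na := ind2_l i2.
apply: jn3_of_12_3 => //; first exact: jn_namp.
have j := @ind2_jn AA C _ _ _ al ga (jr a b) f cAA cC i2 (jr_rep jab) rf.
have e x : AA x -> (al \o jr a b) x = jr (al \o a) (al \o b) x by move=> Tx; rewrite (jr_namp cA cAh na jab).
by have [] := jr_eq cAA cC j e (fun _ _ => erefl).
Qed.
Lemma jn_Da N Q (al : L ~> Q) (ga : N ~> Q) (c : sp A ~> N) : ind2 al ga -> rep c ->
 jn (fun s => lg (al \o a) (ga \o c) (qDelta G s)) (al \o b).
move=> i2 rc; have j3 := jn3_swap23 cA cAh cA (jn3_leg cA i2 rc).
have [j _] := jn3_12_3 cA cA cAh j3.
have j' := jn_flip cA2 cAh j.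
have [j'' _] := lg_morr cAh cA cA2 mD j'.
exact: (jn_flip cAh cA j'').
Qed.
Lemma jn_Db N Q (al : L ~> Q) (ga : N ~> Q) (e : sp Ah ~> N) : ind2 al ga -> rep e ->
 jn (al \o a) (fun s => lg (al \o b) (ga \o e) (qDeltad G s)).
move=> i2 re; have [j1 j2] := jn3_leg cAh i2 re.
by have [] := lg_morr cA cAh cAh2 mDd j2.
Qed.

(** * Conjugating the regular representation of the codouble along theta and rho *)

Section LocalLegs.
Variable N : hilbert R.
Let Q := L *t N.
Let al : L ~> Q := @ampl N L.
Let ga : N ~> Q := @ampr L N.
Let i2 : ind2 al ga := ind2_amp L N.
Let k0 := @ampl Q L.
Let r := @ampr L Q.
Let i3 : ind3 k0 (r \o al) (r \o ga) := ind2_split (ind2_amp L Q).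
Let i3' : ind3 (r \o al) k0 (r \o ga) := ind3_swap12 i3.
Let nr : namp r := namp_r L Q.
Let na : namp al := ind2_l i2.

(* [f] and [g] below agree if their images under [W'] do. *)
Let sep (f g : sp A *t sp Ah ~> Q) : rep (A := AA) f -> rep (A := AA) g ->
 @lg D AA _ (k0 \o de) (r \o f) W' = @lg D AA _ (k0 \o de) (r \o g) W' -> forall x, AA x -> f x = g x.
by move=> rf rg e x Tx; exact: (hq_S hC rf rg e). Qed.
Let jr0 (f : sp A *t sp Ah ~> Q) : rep (A := AA) f -> @jn D AA _ (k0 \o de) (r \o f).
by move=> rf; exact: (@ind2_jn D AA _ _ _ k0 r de f cD cAA (ind2_amp L Q) rde rf). Qed.
Let lgAd (u : op Q Q) f : unitary u -> rep (A := AA) f -> @lg D AA _ (k0 \o de) (r \o (Ad u \o f)) W' =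
 Ad (r u) (@lg D AA _ (k0 \o de) (r \o f) W').
move=> uu rf; have ur := namp_un nr uu; have j := jr0 rf; have bu := un_bop uu.
rewrite -(lg_namp cD cAA (namp_Ad ur) j mW').
apply: (lg_eq cD cAA (jn_namp (namp_Ad ur) j)) => // x Tx.
 have bx : bop (de x) by bdd.
 by apply: Ad_fix => //; rewrite (ind2_comm (ind2_sym (ind2_amp L Q))).
have bx : bop (f x) by bdd.
by rewrite /= -(namp_conj nr).
Qed.
Let lgjr (f : sp A ~> Q) (g : sp Ah ~> Q) : jn f g -> @lg D AA _ (k0 \o de) (r \o jr f g) W' =
 lg (k0 \o th) (r \o f) W \o lg (k0 \o rh) (r \o g) Wh.
move=> j; have [_ _ _ e] := codouble_lgW2 (ind2_amp L Q) j (fun _ _ => erefl); exact: e.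
Qed.
Let w := w02 (r \o al) k0.
Let ew : w = lg (k0 \o th) (r \o al \o a) W \o lg (k0 \o rh) (r \o al \o b) Wh.
by have [_ _ _ e] := codouble_lgWp (ind3_12 i3). Qed.
(** Compare images under the bicharacter w of the codouble. [rho_pentagon] turns the left side into
    w followed by the dual bicharacter in rho and e; the right side gives the same by the
    comultiplication rule for that bicharacter. The factor a is left alone because rho occurs last
    in w. *)
Lemma rho_conj_loc (e : sp Ah ~> N) x : rep e -> AA x -> Ad (lg (al \o rh) (ga \o e) Wh) (al (p x)) =
 jr (al \o a) (fun s => lg (al \o b) (ga \o e) (qDeltad G s)) x.
move=> re; move: x; have jt := ind2_jn cA cAh i2 rrh re.
have uT := un_lgWh jt; have jb := jn_Db i2 re.
have jbe := ind2_jn cAh cAh i2 rb re.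
have rap : rep (al \o p) := rep_namp na rp.
have rf := rep_namp (namp_Ad uT) rap.
apply: (sep rf (jr_rep jb)).
have eT : r (lg (al \o rh) (ga \o e) Wh) = lg (r \o al \o rh) (r \o ga \o e) Wh.
 by rewrite -(lg_namp cA cAh nr jt mWh).
have urT : unitary (lg (r \o al \o rh) (r \o ga \o e) Wh) by rewrite -eT; exact: namp_un.
apply: etrans (lgAd uT rap) _; apply: etrans _ (esym (lgjr jb)); rewrite eT.
have j3 := ind3_jn3 cA cAh cAh i3 rrh rb re.
have [j4 e4] := hq_D hGd j3.
have -> : lg (k0 \o rh) (r \o fun s => lg (al \o b) (ga \o e) (qDeltad G s)) Wh =
  lg (k0 \o rh) (r \o al \o b) Wh \o lg (k0 \o rh) (r \o ga \o e) Wh.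
 rewrite -[RHS]e4; apply: (lg_eq cA cAh j4) => // y Hy.
 by rewrite -[RHS](lg_namp cAh cAh nr jbe) //; exact: (mor_mult mDd).
apply/(un_AdP _ _ urT); have := rho_pentagon i3' re; rewrite -/w => e5.
by apply: etrans (esym e5) _; rewrite ew.
Qed.
(** Here [theta_pentagon] produces W in theta and c behind w, that is, on the wrong side of the rho
    factor. [exchange] moves it past that factor at the price of a conjugation by W in the legs b
    and c. *)
Lemma theta_conj_loc (c : sp A ~> N) x : rep c -> AA x -> Ad (lg (al \o th) (ga \o c) W) (al (p x)) =
 Ad (lg (al \o b) (ga \o c) W) (jr (fun s => lg (al \o a) (ga \o c) (qDelta G s)) (al \o b) x).
move=> rc; move: x; have jt := ind2_jn cAh cA i2 rth rc.
have uT := un_lgW hG jt; have jb := jn_Da i2 rc.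
have jac := ind2_jn cA cA i2 ra rc; have jbc := ind2_jn cAh cA i2 rb rc.
have uB := un_lgW hG jbc.
have rap : rep (al \o p) := rep_namp na rp.
have rf := rep_namp (namp_Ad uT) rap.
have rg := rep_namp (namp_Ad uB) (jr_rep jb).
apply: (sep rf rg).
have eT : r (lg (al \o th) (ga \o c) W) = lg (r \o al \o th) (r \o ga \o c) W by rewrite -(lg_namp cAh cA nr jt mW).
have eB : r (lg (al \o b) (ga \o c) W) = lg (r \o al \o b) (r \o ga \o c) W by rewrite -(lg_namp cAh cA nr jbc mW).
have urT : unitary (lg (r \o al \o th) (r \o ga \o c) W) by rewrite -eT; exact: namp_un.
have urB : unitary (lg (r \o al \o b) (r \o ga \o c) W) by rewrite -eB; exact: namp_un.
apply: etrans (lgAd uT rap) _; apply: etrans _ (esym (lgAd uB (jr_rep jb))); rewrite eT eB.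
rewrite lgjr //.
have j3 := ind3_jn3 cAh cA cA i3 rth ra rc.
have [j4 e4] := hq_D hG j3.
have -> : lg (k0 \o th) (r \o fun s => lg (al \o a) (ga \o c) (qDelta G s)) W =
  lg (k0 \o th) (r \o al \o a) W \o lg (k0 \o th) (r \o ga \o c) W.
 rewrite -[RHS]e4; apply: (lg_eq cAh cA j4) => // y Hy.
 by rewrite -[RHS](lg_namp cA cA nr jac) //; exact: (mor_mult mD).
have e5 := theta_pentagon i3' rc; rewrite -/w in e5.
have e6 := exchange i3 rb rc.
set B := lg (r \o al \o b) _ W in urB e6 *.
have j0a := ind2_jn cAh cA (ind3_12 i3) rth ra.
have jB := ind2_jn cAh cA (ind3_23 i3) rb rc.
have cB : B \o lg (k0 \o th) (r \o al \o a) W = lg (k0 \o th) (r \o al \o a) W \o B.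
 apply: (lg_commute cAh cA j0a (un_bop urB)) => // y Hy.
  have by_ : bop (th y) by bdd.
  have b0 : bop (k0 (th y)) by exact: (namp_bop (ind2_l (ind3_12 i3))).
  apply/esym/(lg_commute cAh cA jB b0) => // z Hz.
   by apply: (ind2_comm (ind3_12 i3)) => //; bdd.
  by apply: (ind2_comm (ind3_13 i3)) => //; bdd.
 have by_ : bop (a y) by bdd.
 have b0 : bop (r (al (a y))) by bdd.
 apply/esym/(lg_commute cAh cA jB b0) => // z Hz.
  by have := jn_comm cA cAh (jn_namp nr (jn_namp na jab)) Hy Hz.
 by apply: (ind2_comm (ind3_23 i3)) => //; bdd.
apply: etrans (_ : w \o lg (k0 \o th) (r \o ga \o c) W = _).
 by apply/(un_AdP _ _ urT); rewrite -[RHS]compA -e5.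
apply/esym/(un_AdP _ _ urB); rewrite ew.
apply/funext => y.
have c1 z := congr1 (fun q => q z) cB; have c2 z := congr1 (fun q => q z) e6.
by rewrite /= in c1 c2 *; rewrite c1 c2.
Qed.
End LocalLegs.

Section AnyLegs.
Variables (N Q : hilbert R) (al : L ~> Q) (ga : N ~> Q) (i2 : ind2 al ga).
Lemma rho_conj (e : sp Ah ~> N) x : rep e -> AA x -> Ad (lg (al \o rh) (ga \o e) Wh) (al (p x)) =
 jr (al \o a) (fun s => lg (al \o b) (ga \o e) (qDeltad G s)) x.
move=> re Tx; have [eta ne [h1 h2]] := i2.
pose l1 := @ampl N L; pose l2 := @ampr L N.
have i0 : ind2 l1 l2 := ind2_amp L N; have n1 := ind2_l i0.
have jt := ind2_jn cA cAh i0 rrh re; have jbe := ind2_jn cAh cAh i0 rb re.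
have jb := jn_Db i0 re.
rewrite (lg_eqb cA cAh ne h1 h2 jt mWh) //.
have bx : bop (p x) by exact: (rep_bop rp).
have uT := un_lgWh jt.
rewrite h1 // -(namp_conj ne); [|bdd|bdd].
rewrite (rho_conj_loc re Tx) -(jr_namp cA cAh ne jb Tx).
have e4 y : A y -> (eta \o (l1 \o a)) y = (al \o a) y by move=> Hy; rewrite /= h1 //; bdd.
have e5 y : Ah y -> (eta \o fun s => lg (l1 \o b) (l2 \o e) (qDeltad G s)) y =
  (fun s => lg (al \o b) (ga \o e) (qDeltad G s)) y.
 move=> Hy; have my : mult (Ah *T Ah) (qDeltad G y) by exact: (mor_mult mDd).
 by rewrite /= (lg_eqb cAh cAh ne h1 h2 jbe my).
by have [_ e6] := jr_eq cA cAh (jn_namp ne jb) e4 e5; rewrite (e6 _ Tx).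
Qed.
Lemma theta_conj (c : sp A ~> N) x : rep c -> AA x -> Ad (lg (al \o th) (ga \o c) W) (al (p x)) =
 Ad (lg (al \o b) (ga \o c) W) (jr (fun s => lg (al \o a) (ga \o c) (qDelta G s)) (al \o b) x).
move=> rc Tx; have [eta ne [h1 h2]] := i2.
pose l1 := @ampl N L; pose l2 := @ampr L N.
have i0 : ind2 l1 l2 := ind2_amp L N; have n1 := ind2_l i0.
have jt := ind2_jn cAh cA i0 rth rc; have jac := ind2_jn cA cA i0 ra rc.
have jbc := ind2_jn cAh cA i0 rb rc.
have jb := jn_Da i0 rc.
have h3 (f : sp Ah ~> L) : rep f -> lg (al \o f) (ga \o c) W = eta (lg (l1 \o f) (l2 \o c) W).
 move=> rf; have j := ind2_jn cAh cA i0 rf rc.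
 by rewrite (lg_eqb cAh cA ne h1 h2 j mW).
have bx : bop (p x) by exact: (rep_bop rp).
have uT := un_lgW hG jt; have uB := un_lgW hG jbc.
rewrite (h3 _ rth) (h3 _ rb) h1 // -(namp_conj ne); [|bdd|bdd].
rewrite (theta_conj_loc rc Tx) (namp_conj ne); [|bdd|exact: (rep_bop (A := AA) (jr_rep jb))].
rewrite -(jr_namp cA cAh ne jb Tx); congr (Ad _ _).
have e4 y : Ah y -> (eta \o (l1 \o b)) y = (al \o b) y by move=> Hy; rewrite /= h1 //; bdd.
have e5 y : A y -> (eta \o fun s => lg (l1 \o a) (l2 \o c) (qDelta G s)) y =
  (fun s => lg (al \o a) (ga \o c) (qDelta G s)) y.
 move=> Hy; have my : mult (A *T A) (qDelta G y) by exact: (mor_mult mD).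
 by rewrite /= (lg_eqb cA cA ne h1 h2 jac my).
by have [_ e6] := jr_eq cA cAh (jn_namp ne jb) e5 e4; rewrite (e6 _ Tx).
Qed.
Lemma rho_fix (e : sp Ah ~> N) s : rep e -> A s -> Ad (lg (al \o rh) (ga \o e) Wh) (al (a s)) = al (a s).
move=> re As; have jt := ind2_jn cA cAh i2 rrh re; have uT := un_lgWh jt.
have na := ind2_l i2; have nT := namp_trans na (namp_Ad uT).
have ms : mult AA (otens s (@id (sp Ah))) by apply: mult_otens => //; [exact: mult_in|exact: mult_id].
have := rep1_eq cA cAh (jn_Db i2 re) (fun x Tx => esym (rho_conj re Tx)) As.
move=> e1; apply: etrans _ e1; rewrite /rep1.
exact: (esym (ext_namp nT cAA rp ms)).
Qed.
End AnyLegs.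

(** * An anti-Heisenberg partner of rho *)

Let rpi := morphism_Kop (hq_pi hG).
Let rpid := morphism_Kop (hq_pid hG).
Let jba : jn b a := jn_flip cA cAh jab.
Let x0 := lg b a W.
Let ux0 : unitary x0 := un_lgW hG jba.
(** Conjugation by W in theta and rho flips the comultiplication along rho, whereas conjugation by W
    in b and rho produces it. Correcting theta by W in the legs b and a combines both effects, see
    [lg_thL'] and [anti_Heisenberg]. *)
Definition thL' : sp Ah ~> L := Ad (lg b a W) \o th.
Lemma rep_thL' : rep thL'.
exact: (rep_namp (namp_Ad ux0) rth). Qed.
Lemma lg_thL' N Q (al : L ~> Q) (ga : N ~> Q) (c : sp A ~> N) : ind2 al ga -> rep c ->
 lg (al \o thL') (ga \o c) W = adj (lg (al \o b) (ga \o c) W) \o lg (al \o th) (ga \o c) W.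
move=> i2 rc; have na := ind2_l i2; have jt := ind2_jn cAh cA i2 rth rc.
have jbc := ind2_jn cAh cA i2 rb rc; have uT := un_lgW hG jt; have uB := un_lgW hG jbc.
have uX := namp_un na ux0.
have -> : lg (al \o thL') (ga \o c) W = Ad (al x0) (lg (al \o th) (ga \o c) W).
 rewrite -(lg_namp cAh cA (namp_Ad uX) jt mW).
 apply: (lg_eq cAh cA (jn_namp (namp_Ad uX) jt)) => // y Hy /=.
  by rewrite -(namp_conj na) //; [bdd|bdd].
 apply: Ad_fix => //; apply: (ind2_comm i2); first bdd.
 bdd.
have j3 := jn3_leg cA i2 rc.
have [_ e1] := hq_D hG (jn3_rot cA cA cAh (jn3_swap23 cA cAh cA j3)).
have e2 : Ad (lg (al \o th) (ga \o c) W) (al x0) = lg (al \o b) (ga \o c) W \o al x0.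
 (* [theta_conj] is applied to W itself: flipped, it is a multiplier of the codouble algebra whose
    image under p is [x0]. *)
 pose z0 := Ad (flip (sp Ah) (sp A)) W.
 have mz : mult AA z0 := mult_flip cAh cA mW.
 have n1 := namp_trans na (namp_Ad uT).
 have jD := jn_Da i2 rc.
 have r1 := rep_namp n1 rp.
 have := shom_eq_ext cAA r1 (fun x Tx => theta_conj i2 rc Tx) mz.
 have -> : ext ((Ad (lg (al \o th) (ga \o c) W) \o al) \o p) z0 = Ad (lg (al \o th) (ga \o c) W) (al x0).
  rewrite (ext_namp n1 cAA rp mz) /=; congr (Ad _ (al _)).
  rewrite (shom_eq_ext cAA (jr_rep jab) (fun x Tx => jr_abL Tx) mz).
  exact: (lg_flip cAh cA jba mW).
 move=> <-.
 have -> : lg (al \o b) (ga \o c) W \o al x0 = Ad (lg (al \o b) (ga \o c) W)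
   (lg (al \o b) (fun s => lg (al \o a) (ga \o c) (qDelta G s)) W).
  rewrite e1 (lg_namp cAh cA na jba mW); apply/esym/un_AdP => //.
 rewrite -(lg_flip cAh cA (jn_flip cA cAh jD) mW).
 exact: (ext_namp (namp_Ad uB) cAA (jr_rep jD) mz).
apply/(un_AdP _ _ uX); have /(un_AdP _ _ uT) e3 := e2.
apply/funext => y /=; have := congr1 (fun q => q y) e3; rewrite /= => ->.
by rewrite unK.
Qed.

Section Local.
Let Q := L *t L.
Let al : L ~> Q := @ampl L L.
Let ga : L ~> Q := @ampr L L.
Let i2 : ind2 al ga := ind2_amp L L.
Let L0 := qL G.
Let k0 := @ampl Q L0.
Let r := @ampr L0 Q.
Let i3 : ind3 k0 (r \o al) (r \o ga) := ind2_split (ind2_amp L0 Q).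
Let i3' : ind3 (r \o al) k0 (r \o ga) := ind3_swap12 i3.
Let nr : namp r := namp_r L0 Q.
Let na : namp al := ind2_l i2.
Let jpr f : rep (A := A) f -> jn (k0 \o qpid G) (r \o f).
by move=> rf; exact: (ind2_jn cAh cA (ind2_amp L0 Q) rpid rf). Qed.
Let lgAd (u : op Q Q) f : unitary u -> rep (A := A) f ->
 lg (k0 \o qpid G) (r \o (Ad u \o f)) W = Ad (r u) (lg (k0 \o qpid G) (r \o f) W).
move=> uu rf; have ur := namp_un nr uu; have j := jpr rf; have bu := un_bop uu.
rewrite -(lg_namp cAh cA (namp_Ad ur) j mW).
apply: (lg_eq cAh cA (jn_namp (namp_Ad ur) j)) => // x Tx.
 have bx : bop (qpid G x) by bdd.
 by apply: Ad_fix => //; rewrite (ind2_comm (ind2_sym (ind2_amp L0 Q))).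
have bx : bop (f x) by bdd.
by rewrite /= -(namp_conj nr).
Qed.
Let ral := rep_namp na rrh.
Let rgl := rep_namp (ind2_r i2) rrh.
Let jta := ind2_jn cAh cA (ind2_sym i2) rth ra.
Let jtr := ind2_jn cAh cA i2 rth rrh.
Let jrr := ind2_jn cA cA i2 rrh rrh.
Let jrr' := ind2_jn cA cA (ind2_sym i2) rrh rrh.
(** By separation rho is replaced by the dual bicharacter in rho and the regular representation.
    This commutes with theta on an independent leg, and with a by [rho_fix]. *)
Let rho_comm s : A s -> Ad (lg (ga \o th) (al \o a) W) (al (rh s)) = al (rh s).
have uX := un_lgW hG jta.
move: s; apply: (hq_S hG (rep_namp (namp_Ad uX) ral) ral); rewrite -/L0 -/k0 -/r.
apply: etrans (lgAd uX ral) _.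
have urX := namp_un nr uX; apply: Ad_fix => //.
have bpi := ind2_jn cAh cA (ind3_12 i3) rpid rrh.
have e0 : lg (k0 \o qpid G) (r \o (al \o rh)) W = adj (lg (r \o al \o rh) (k0 \o qpid G) Wh).
 by rewrite -[Wh]/(qW (dual G)) (lg_dual hG bpi) adjK //; exact: un_bop (un_lgW hG bpi).
have uR := un_lgWh (jn_flip cAh cA bpi).
rewrite e0; set V := lg (r \o al \o rh) (k0 \o qpid G) Wh in uR *.
rewrite -(lg_namp cAh cA nr jta mW).
have bV := un_bop uR; have baV := bop_adj bV.
apply/esym/(lg_commute cAh cA (jn_namp nr jta) baV) => // y Hy /=.
 have b1 : bop (ga (th y)) by apply: (namp_bop (ind2_r i2)); exact: (rep_bop rth).
 have b2 : bop (r (ga (th y))) by bdd.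
 have e1 : r (ga (th y)) \o V = V \o r (ga (th y)).
  apply: (lg_commute cA cAh (jn_flip cAh cA bpi) b2) => // z Hz /=.
   by apply: (ind2_comm (ind2_sym (ind3_23 i3))); [bdd|bdd].
  by apply: (ind2_comm (ind2_sym (ind3_13 i3))); [bdd|bdd].
 by apply: (un_commV uR).
have e1 := rho_fix (ind3_12 i3') rpid Hy.
by apply: (un_commV uR); apply/(un_AdP _ _ uR).
Qed.
(** In [rho_Heisenberg] the implementing unitary has a theta factor and a rho factor. The first
    commutes with the image of rho by [rho_comm], the second is the adjoint of W in b and rho. *)
Let rho_coproduct s : A s -> lg (al \o rh) (ga \o rh) (qDelta G s) = Ad (lg (al \o b) (ga \o rh) W) (al (rh s)).
move=> As.
rewrite (rho_Heisenberg i2 As).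
have [_ _ _ ->] := codouble_lgWp (ind2_sym i2).
have uX := un_lgW hG jta.
have jb := ind2_jn cAh cA i2 rb rrh; have uB := un_lgW hG jb.
have -> : lg (ga \o rh) (al \o b) Wh = adj (lg (al \o b) (ga \o rh) W) by rewrite -(lg_dual hG jb).
rewrite adj_comp; [|bdd|exact: (un_bop (un_adj uB))].
rewrite adjK; last bdd.
rewrite -Ad_Ad; [|bdd|exact: (un_bop (un_adj uX))].
by congr (Ad _ _); rewrite -{1}(rho_comm As) AdK.
Qed.
(** The R-matrix identity on the range of rho. Separation reduces it to [exchange] with the regular
    representation and rho in the outer legs. *)
Let rho_cocommutative s : A s -> Ad (lg (al \o th) (ga \o rh) W) (lg (ga \o rh) (al \o rh) (qDelta G s)) =
 lg (al \o rh) (ga \o rh) (qDelta G s).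
have uX := un_lgW hG jtr.
have j1 := ind3_jn3 cAh cA cA i3 rpid rrh rrh.
have [j1' e1] := hq_D hG j1.
have j2 := ind3_jn3 cAh cA cA (ind3_swap23 i3) rpid rrh rrh.
have [j2' e2] := hq_D hG j2.
have rD (f g : sp A ~> Q) : jn f g -> rep (fun s => lg f g (qDelta G s)).
 by move=> j; exact: (rep_lg_comp cA cA mD j).
move: s; apply: (hq_S hG (rep_namp (namp_Ad uX) (rD _ _ jrr')) (rD _ _ jrr)); rewrite -/L0 -/k0 -/r.
apply: etrans (lgAd uX (rD _ _ jrr')) _.
have urX := namp_un nr uX.
have mD' y : A y -> mult (A *T A) (qDelta G y) by move=> Hy; exact: (mor_mult mD).
have -> : lg (k0 \o qpid G) (r \o fun s => lg (ga \o rh) (al \o rh) (qDelta G s)) W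
  = lg (k0 \o qpid G) (r \o ga \o rh) W \o lg (k0 \o qpid G) (r \o al \o rh) W.
 rewrite -[RHS]e2; apply: (lg_eq cAh cA j2') => // y Hy.
 by rewrite -[RHS](lg_namp cA cA nr jrr') //; exact: mD'.
have -> : lg (k0 \o qpid G) (r \o fun s => lg (al \o rh) (ga \o rh) (qDelta G s)) W
  = lg (k0 \o qpid G) (r \o al \o rh) W \o lg (k0 \o qpid G) (r \o ga \o rh) W.
 rewrite -[RHS]e1; apply: (lg_eq cAh cA j1') => // y Hy.
 by rewrite -[RHS](lg_namp cA cA nr jrr) //; exact: mD'.
apply/(un_AdP _ _ urX).
have e3 := exchange i3' rpid rrh.
rewrite -(lg_namp cAh cA nr jtr mW).
have bpi := ind2_jn cAh cA (ind3_12 i3) rpid rrh.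
rewrite [lg (r \o al \o rh) _ _](lg_dual hG bpi) in e3.
have uB := un_lgW hG bpi.
rewrite -/k0 -/r in e3 *.
set Bq := lg (k0 \o qpid G) (r \o al \o rh) W in e3 uB *.
apply/funext => y; have := congr1 (fun q => Bq (q (Bq y))) e3.
by rewrite /= unVK // unK // => <-.
Qed.
(** By [lg_thL'] the conjugation splits in two: W in b and rho creates the comultiplication by
    [rho_coproduct], and the adjoint of W in theta and rho flips it by [rho_cocommutative]. *)
Lemma anti_Heisenberg_loc s : A s ->
 Ad (adj (lg (al \o thL') (ga \o rh) W)) (al (rh s)) = lg (ga \o rh) (al \o rh) (qDelta G s).
move=> As.
have uX := un_lgW hG jtr.
have jb := ind2_jn cAh cA i2 rb rrh; have uB := un_lgW hG jb.
rewrite (lg_thL' i2 rrh) adj_comp; [|exact: (un_bop (un_adj uB))|bdd].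
rewrite adjK; last bdd.
rewrite -Ad_Ad; [|exact: (un_bop (un_adj uX))|bdd].
by rewrite -(rho_coproduct As) -(rho_cocommutative As) AdK.
Qed.
End Local.
Lemma anti_Heisenberg Q (al ga : L ~> Q) s : ind2 al ga -> A s ->
 Ad (adj (lg (al \o thL') (ga \o rh) W)) (al (rh s)) = lg (ga \o rh) (al \o rh) (qDelta G s).
move=> i2 As; have [eta ne [h1 h2]] := i2.
pose l1 := @ampl L L; pose l2 := @ampr L L.
have i0 : ind2 l1 l2 := ind2_amp L L; have n1 := ind2_l i0.
have bs : bop (rh s) by exact: (rep_bop rrh).
have rt := rep_thL'.
have jt := ind2_jn cAh cA i0 rt rrh; have uT := un_lgW hG jt.
have jrr := ind2_jn cA cA (ind2_sym i0) rrh rrh.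
rewrite (lg_eqb cAh cA ne h1 h2 jt mW) //.
have buT := un_bop uT.
rewrite -(namp_adj ne) // h1 // -(namp_conj ne); [|exact: bop_adj|bdd].
rewrite (anti_Heisenberg_loc As).
have mDs : mult (A *T A) (qDelta G s) by exact: (mor_mult mD).
by rewrite (lg_eqb cA cA ne h2 h1 jrr mDs).
Qed.

(** * Stabilised representations and their coactions *)

Section Stabilisation.
Variables (C : opalg R) (cC : cstar C) (xi : premor C (C *T AA)) (g : premor C (C *T A)) (e : premor C (C *T Ah)).
Hypotheses (hxi : coaction (codouble d) xi) (hyd : yetter_drinfeld (G := G) g e).
Hypothesis hxiE : forall c, C c -> xi c = yd_composite g e c.
Let mxi : morphism xi := co_mor hxi.
Let mg : morphism g := co_mor (yd_g hyd).
Let me : morphism e := co_mor (yd_e hyd).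
Section Legs.
Variables (K N Q : hilbert R) (k : K ~> Q) (nu : L *t N ~> Q) (i2 : ind2 k nu) (phi : sp C ~> K) (rphi : rep phi).
Let al := @ampl N L.
Let ga := @ampr L N.
Let il : ind2 al ga := ind2_amp L N.
Let nn := ind2_r i2.
Let na := ind2_l il.
Let Phi (s : bo (sp C)) : op Q Q := @lg C AA Q (k \o phi) (nu \o (al \o p)) (xi s).
Let mxs s : C s -> mult (C *T AA) (xi s).
by move=> Cs; exact: (mor_mult mxi). Qed.
Let rap : rep (A := AA) (al \o p) := rep_namp (A := AA) na rp.
Let jrn F1 F2 : jn F1 F2 -> @jn C AA Q (k \o phi) (nu \o jr F1 F2).
by move=> j; exact: (ind2_jn cC cAA i2 rphi (jr_rep j)). Qed.
Let jp : @jn C AA Q (k \o phi) (nu \o (al \o p)).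
exact: (ind2_jn cC cAA i2 rphi rap). Qed.
(* Both conjugations below leave [k phi] fixed and turn [p] into a pair. *)
Let Phi_conj (u : bo (L *t N)) F1 F2 (v : bo (L *t N)) s : unitary u -> unitary v ->
 jn F1 F2 -> (forall x, AA x -> Ad u (al (p x)) = Ad v (jr F1 F2 x)) -> C s ->
 Ad (nu u) (Phi s) = Ad (nu v) (lg (fun t => lg (k \o phi) (nu \o F1) (g t)) (nu \o F2) (e s)).
move=> uu uv j hc Cs; have Nu := namp_un nn uu; have Nv := namp_un nn uv.
have j3 := jn3_group cC cA cAh i2 rphi j.
rewrite (yd_split hG cC hyd j3 Cs) -hxiE // (lg_group cC cA cAh i2 rphi j (mxs Cs)).
rewrite -(lg_namp cC cAA (namp_Ad Nu) jp (mxs Cs)).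
rewrite -(lg_namp cC cAA (namp_Ad Nv) (jrn j) (mxs Cs)).
have fix_ w t : unitary w -> bop t -> Ad (nu w) (k t) = k t.
 move=> uw bt; apply: Ad_fix; first exact: (namp_un nn).
 by apply: (ind2_comm (ind2_sym i2)) => //; bdd.
apply: (lg_eq cC cAA (jn_namp (namp_Ad Nv) (jrn j)) _ _ (mxs Cs)) => [t Ct|x Tx] /=.
 by rewrite !fix_ //; bdd.
have b1 : bop (al (p x)) by exact: (rep_bop rap).
have b2 : bop (jr F1 F2 x) by exact: (rep_bop (A := AA) (jr_rep j)).
rewrite -(namp_conj nn) //; [|bdd].
rewrite -(namp_conj nn) //; [|bdd].
by rewrite hc.
Qed.
Lemma stab_split s : C s -> Phi s =
 lg (fun t => lg (k \o phi) (nu \o (al \o a)) (g t)) (nu \o (al \o b)) (e s).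
move=> Cs; have j := jn_namp na jab; have u1 := un_id (L *t N).
have := Phi_conj u1 u1 j _ Cs; rewrite (namp_id nn) !Ad_id'; apply=> x Tx.
by rewrite !Ad_id' (jr_namp cA cAh na jab) // jr_abL.
Qed.
Let f (t : bo (sp C)) : op Q Q := lg (k \o phi) (nu \o (al \o a)) (g t).
Let f_jn3 A1 A2 (c1 : sp A1 ~> L *t N) (c2 : sp A2 ~> L *t N) :
 cstar A1 -> cstar A2 -> jn3 (al \o a) c1 c2 -> jn3 f (nu \o c1) (nu \o c2).
move=> cB1 cB2 j3; have c12 := tens_cs cB1 cB2.
split; first exact: (jn_namp nn j3.1).
have j4 := jn3_group cC cA c12 i2 rphi j3.2.
have j5 := coaction_jn hG cC c12 (yd_g hyd) j4.
apply: (jn_eq cC c12 j5 (fun _ _ => erefl)) => x Tx.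
by rewrite (jr_namp cB1 cB2 nn j3.1).
Qed.
(** Conjugation by the rho unitary applies the dual comultiplication to the leg b by [rho_conj];
    coassociativity of e then moves it to a second application of the coaction. *)
Lemma stab_eps (e' : sp Ah ~> N) s : rep e' -> C s ->
 lg Phi (nu \o (ga \o e')) (e s) = Ad (nu (lg (al \o rh) (ga \o e') Wh)) (Phi s).
move=> re Cs; have jt := ind2_jn cA cAh il rrh re; have uT := un_lgWh jt.
have jb := jn_Db il re.
rewrite (Phi_conj uT (un_id _) jb _ Cs); last first.
 by move=> x Tx; rewrite Ad_id'; exact: rho_conj.
rewrite (namp_id nn) Ad_id' -/f.
have jbe := ind2_jn cAh cAh il rb re.
have j3 := f_jn3 cAh cAh (jn3_leg cAh il re).
have mes : mult (C *T Ah) (e s) by exact: (mor_mult me).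
have [j4 j5 e4] := coaction_lg hGd cC (yd_e hyd) j3 Cs.
have -> : lg f (nu \o fun t => lg (al \o b) (ga \o e') (qDeltad G t)) (e s) =
  lg f (fun t => lg (nu \o (al \o b)) (nu \o (ga \o e')) (qDeltad G t)) (e s).
 apply: (lg_eq cC cAh j4) => // t Ht.
 by rewrite -[RHS](lg_namp cAh cAh nn jbe) //; exact: (mor_mult mDd).
rewrite e4; apply: (lg_eq cC cAh j5) => // t Ct.
by rewrite stab_split.
Qed.
(** [theta_conj] applies the comultiplication to the leg a, up to a conjugation by W in b and c.
    Coassociativity of g handles the former, and the latter is exactly what [yd_exchange] needs to
    interchange g and e. *)
Lemma stab_gamma (c : sp A ~> N) s : rep c -> C s ->
 lg Phi (nu \o (ga \o c)) (g s) = Ad (nu (lg (al \o th) (ga \o c) W)) (Phi s).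
move=> rc Cs; have jt := ind2_jn cAh cA il rth rc; have uT := un_lgW hG jt.
have jbc := ind2_jn cAh cA il rb rc; have uB := un_lgW hG jbc.
have jac := ind2_jn cA cA il ra rc.
have jb := jn_Da il rc.
rewrite (Phi_conj uT uB jb _ Cs); last first.
 by move=> x Tx; exact: theta_conj.
have mes : mult (C *T Ah) (e s) by exact: (mor_mult me).
have mgs t : C t -> mult (C *T A) (g t) by move=> Ct; exact: (mor_mult mg).
have j3 := f_jn3 cA cAh (jn3_swap23 cA cAh cA (jn3_leg cA il rc)).
have j6 := jn3_group cC cA cA i2 rphi jac.
rewrite -(lg_namp cAh cA nn jbc mW).
have jhc := coaction_jn hG cC cAh (yd_g hyd) j3.
have -> : lg (fun t => lg (k \o phi)
   (nu \o fun x => lg (al \o a) (ga \o c) (qDelta G x)) (g t)) (nu \o (al \o b)) (e s) =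
  lg (fun t => lg f (nu \o (ga \o c)) (g t)) (nu \o (al \o b)) (e s).
 apply: (lg_eq cC cAh jhc) => // t Ct.
 have [j4 _ e4] := coaction_lg hG cC (yd_g hyd) j6 Ct.
 rewrite -[LHS]e4; apply/esym/(lg_eq cC cA j4) => //; last exact: mgs.
 by move=> x Hx; rewrite -[RHS](lg_namp cA cA nn jac) //; exact: (mor_mult mD).
rewrite (yd_exchange hG cC hyd j3 Cs).
have [_ j7] := jn3_swap23 cC cA cAh j3.
have j8 := coaction_jn hGd cC cA (yd_e hyd) (jn3_swap23 cC cA cAh j3).
by apply: (lg_eq cC cA j8) => // [t Ct|]; [rewrite stab_split|exact: mgs].
Qed.
End Legs.
End Stabilisation.

(** * Stabilised covariant pairs and commutation of their coaction legs *)

Section Stabilised.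
Local Notation th' := thL'.
Section One.
Variables (C : opalg R) (cC : cstar C) (xi : premor C (C *T AA)) (g : premor C (C *T A)) (e : premor C (C *T Ah)).
Hypotheses (hxi : coaction (codouble d) xi) (hyd : yetter_drinfeld (G := G) g e).
Variables (hxiE : forall c, C c -> xi c = yd_composite g e c) (K : hilbert R) (phi : sp C ~> K) (rphi : rep phi).
Definition stab (s : bo (sp C)) : bo (K *t L) := @lg C AA _ (@ampl L K \o phi) (@ampr K L \o p) (xi s).
Let mxi : morphism xi := co_mor hxi.
Let mxs s : C s -> mult (C *T AA) (xi s).
by move=> Cs; exact: (mor_mult mxi). Qed.
Let j0 : @jn C AA _ (@ampl L K \o phi) (@ampr K L \o p).
exact: (jn_local cC cAA rphi rp). Qed.
Lemma rep_stab : rep stab.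
exact: (rep_lg_comp cC cAA mxi j0). Qed.
Lemma stab_inj : finj (els C) phi -> finj (els C) stab.
move=> fp x y Cx Cy e0; apply: (co_inj hxi Cx Cy).
have pf : finj (els AA) p by exact: (hq_pif hC).
exact: (lg_inj cC cAA rphi rp fp pf (mxs Cx) (mxs Cy) e0).
Qed.
Section Cov.
Variables (N Q : hilbert R) (al : K *t L ~> Q) (ga : N ~> Q) (i2 : ind2 al ga).
Let k : K ~> Q := al \o @ampl L K.
Let l : L ~> Q := al \o @ampr K L.
Lemma stab_legs : ind3 k l ga.
exact: ind3_swap23 (ind3_swap12 (ind2_split (ind2_sym i2))). Qed.
Let na := ind2_l i2.
Let stabE nu s : eqb l (fun t => nu (@ampl N L t)) -> C s ->
 @lg C AA Q (k \o phi) (nu \o (@ampl N L \o p)) (xi s) = al (stab s).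
move=> e1 Cs; rewrite -(lg_namp cC cAA na j0 (mxs Cs)).
apply: (lg_eq cC cAA (jn_namp na j0) (fun _ _ => erefl) _ (mxs Cs)) => x Tx.
by have /= <- := e1 _ (rep_bop rp Tx).
Qed.
Lemma stab_cov (c : sp A ~> N) s : rep c -> C s -> lg (al \o stab) (ga \o c) (g s) =
 Ad (lg (l \o th) (ga \o c) W) (al (stab s)).
move=> rc Cs; have [nu in2 [e1 e2]] := ind3_group stab_legs.
have jt := ind2_jn cAh cA (ind2_amp L N) rth rc.
rewrite -(stabE e1 Cs).
rewrite (lg_eqb cAh cA (ind2_r in2) e1 e2 jt mW) //.
rewrite -(stab_gamma cC hxi hyd hxiE in2 rphi rc Cs).
have mg := co_mor (yd_g hyd).
apply/esym/(lg_eq cC cA (ind2_jn cC cA i2 rep_stab rc)) => [t Ct|x Hx|].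
- by rewrite stabE.
- by rewrite /= -e2 //; bdd.
- exact: (mor_mult mg).
Qed.
Lemma stab_cov_dual (c : sp Ah ~> N) s : rep c -> C s ->
 lg (al \o stab) (ga \o c) (e s) = Ad (lg (l \o rh) (ga \o c) Wh) (al (stab s)).
move=> rc Cs; have [nu in2 [e1 e2]] := ind3_group stab_legs.
have jt := ind2_jn cA cAh (ind2_amp L N) rrh rc.
rewrite -(stabE e1 Cs).
rewrite (lg_eqb cA cAh (ind2_r in2) e1 e2 jt mWh) //.
rewrite -(stab_eps cC hxi hyd hxiE in2 rphi rc Cs).
have me := co_mor (yd_e hyd).
apply/esym/(lg_eq cC cAh (ind2_jn cC cAh i2 rep_stab rc)) => [t Ct|x Hx|].
- by rewrite stabE.
- by rewrite /= -e2 //; bdd.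
- exact: (mor_mult me).
Qed.
End Cov.
(** The representation of the universal dual is theta after the reducing map. Evaluating [Wu] on
    such representations only involves W. *)
Lemma stab_covp (u : udual G) : hu u -> covp (u := u) g stab (@ampr K L \o (ext th \o uLambda u)).
move=> hU; have nr := namp_r K L.
have rl : rep (ext th \o uLambda u) := rep_comp cAh (hu_Lambda hU) rth.
split; [exact: rep_stab|exact: (rep_namp nr rl)|move=> N Q al ga c s i2 rc Cs].
rewrite (stab_cov i2 rc Cs); congr (Ad _ _).
have j := ind2_jn cAh cA (ind3_23 (stab_legs i2)) rth rc.
exact: (esym (lg_Lambda hG hU (ind2_l (ind3_23 (stab_legs i2))) rth j)).
Qed.
Lemma stab_covp_dual (u : udual (dual G)) : hu u ->
 covp (G := dual G) (u := u) e stab (@ampr K L \o (ext rh \o uLambda u)).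
move=> hU; have nr := namp_r K L.
have rl : rep (ext rh \o uLambda u) := rep_comp cA (hu_Lambda hU) rrh.
split; [exact: rep_stab|exact: (rep_namp nr rl)|move=> N Q al ga c s i2 rc Cs].
rewrite (stab_cov_dual i2 rc Cs); congr (Ad _ _).
have j := ind2_jn cA cAh (ind3_23 (stab_legs i2)) rrh rc.
exact: (esym (lg_Lambda hGd hU (ind2_l (ind3_23 (stab_legs i2))) rrh j)).
Qed.
End One.
(** The comultiplication rule of W in its second leg, where the comultiplication along rho is
    implemented by [thL'] through [anti_Heisenberg]. *)
Lemma anti_pentagon Q (x1 x2 x3 : L ~> Q) : ind3 x1 x2 x3 ->
 Ad (adj (lg (x3 \o th') (x2 \o rh) W)) (lg (x1 \o th) (x3 \o rh) W) =
 lg (x1 \o th) (x2 \o rh) W \o lg (x1 \o th) (x3 \o rh) W.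
move=> i3; have rt := rep_thL'.
have j32 := ind2_jn cAh cA (ind2_sym (ind3_23 i3)) rt rrh.
have uV := un_adj (un_lgW hG j32).
have j13 := ind2_jn cAh cA (ind3_13 i3) rth rrh.
have [jD <-] := hq_D hG (ind3_jn3 cAh cA cA i3 rth rrh rrh).
rewrite -(lg_namp cAh cA (namp_Ad uV) j13 mW).
apply/esym; apply: (lg_eq cAh cA (jn_namp (namp_Ad uV) j13)) => // x Hx /=; last first.
 by rewrite anti_Heisenberg //; exact: ind2_sym (ind3_23 i3).
apply: (Ad_fix uV); apply: (un_commV (un_lgW hG j32)).
have bx : bop (th x) by bdd.
have i3r : ind3 x1 x3 x2 := ind3_swap23 i3.
exact: (esym (ind3_lg_comm cAh cA i3r rt rrh bx mW)).
Qed.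

Section Two.
Variables (C1 C2 : opalg R) (cC1 : cstar C1) (cC2 : cstar C2).
Variables (xi1 : premor C1 (C1 *T AA)) (xi2 : premor C2 (C2 *T AA)).
Variables (g1 : premor C1 (C1 *T A)) (e1 : premor C1 (C1 *T Ah)).
Variables (g2 : premor C2 (C2 *T A)) (e2 : premor C2 (C2 *T Ah)).
Hypotheses (hxi1 : coaction (codouble d) xi1) (hyd1 : yetter_drinfeld (G := G) g1 e1).
Hypotheses (hxi2 : coaction (codouble d) xi2) (hyd2 : yetter_drinfeld (G := G) g2 e2).
Hypothesis hxiE1 : forall c, C1 c -> xi1 c = yd_composite g1 e1 c.
Hypothesis hxiE2 : forall c, C2 c -> xi2 c = yd_composite g2 e2 c.
Variables (K1 K2 : hilbert R) (phi1 : sp C1 ~> K1) (phi2 : sp C2 ~> K2) (rphi1 : rep phi1) (rphi2 : rep phi2).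
Let M1 := K1 *t L.
Let M2 := K2 *t L.
Let M := M1 *t M2.
Let q1 : M1 ~> M := @ampl M2 M1.
Let q2 : M2 ~> M := @ampr M1 M2.
(** The twisting unitary for the stabilised representations: [Wu] takes the adjoint value there, and
    so does [Ru] on the two regular legs. *)
Definition stabZ : op M M := adj (lg (q1 \o @ampr K1 L \o th) (q2 \o @ampr K2 L \o rh) W).
Definition stab1 (s : bo (sp C1)) : op M M := q1 (stab xi1 phi1 s).
Definition stab2 (s : bo (sp C2)) : op M M := Ad stabZ (q2 (stab xi2 phi2 s)).
Let m := @ampl L M.
Let n := @ampr M L.
Let imn : ind2 m n := ind2_amp M L.
Let nm_ := ind2_l imn.
Let i3 : ind3 n (m \o q1) (m \o q2) := ind2_split (ind2_sym imn).
Let x1 : L ~> M *t L := m \o q1 \o @ampr K1 L.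
Let x2 : L ~> M *t L := m \o q2 \o @ampr K2 L.
Let ix : ind3 x1 x2 n.
have i4 : ind3 n (m \o q1) x2 := ind3_subr i3.
by have := ind3_subr (ind3_swap23 i4) => i5; exact: ind3_swap23 (ind3_swap12 (ind3_swap23 i5)).
Qed.
Let iM : ind2 (q1 \o @ampr K1 L) (q2 \o @ampr K2 L).
have h := ind3_13 (ind2_split (ind2_amp M1 M2)).
exact: (ind2_sym (ind3_13 (ind2_split (ind2_sym h)))).
Qed.
Let jZ := ind2_jn cAh cA iM rth rrh.
Lemma un_stabZ : unitary stabZ.
exact: un_adj (un_lgW hG jZ). Qed.
(** By covariance the first leg image is p0 conjugated by U, the second is s0 conjugated by V and
    then by the twist. The twist may be replaced by U, so both are conjugates by U of p0 and of Ad V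
    s0; these commute because p0 commutes with V and with s0. *)
Lemma stab_legs_comm c1 c2 : C1 c1 -> C2 c2 ->
 lg (m \o stab1) (n \o rh) (g1 c1) \o lg (m \o stab2) (n \o th') (e2 c2) =
 lg (m \o stab2) (n \o th') (e2 c2) \o lg (m \o stab1) (n \o rh) (g1 c1).
move=> Cc1 Cc2; have rt := rep_thL'; have uZ := un_stabZ.
have i1n : ind2 (m \o q1) n := ind2_sym (ind3_12 i3).
have i2n : ind2 (m \o q2) n := ind2_sym (ind3_13 i3).
have j13 := ind2_jn cAh cA (ind3_13 ix) rth rrh; have uU := un_lgW hG j13.
have j32 := ind2_jn cAh cA (ind2_sym (ind3_23 ix)) rt rrh.
have uB := un_lgW hG j32; have uV := un_adj uB.
have r1 := rep_stab cC1 hxi1 rphi1; have r2 := rep_stab cC2 hxi2 rphi2.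
have bs1 : bop (stab xi1 phi1 c1) by exact: (rep_bop r1).
have bs2 : bop (stab xi2 phi2 c2) by exact: (rep_bop r2).
have me2 := co_mor (yd_e hyd2).
have mes : mult (C2 *T Ah) (e2 c2) by exact: (mor_mult me2).
have eP := stab_cov cC1 hxi1 hyd1 hxiE1 rphi1 i1n rrh Cc1.
have eS0 := stab_cov_dual cC2 hxi2 hyd2 hxiE2 rphi2 i2n rt Cc2.
rewrite -[Wh]/(qW (dual G)) (lg_dual hG j32) in eS0.
have jS0 := ind2_jn cC2 cAh i2n r2 rt.
have umZ := namp_un nm_ uZ.
have eS : lg (m \o stab2) (n \o th') (e2 c2) = Ad (m stabZ) (lg (m \o q2 \o stab xi2 phi2) (n \o th') (e2 c2)).
 rewrite -(lg_namp cC2 cAh (namp_Ad umZ) jS0 mes).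
 apply: (lg_eq cC2 cAh (jn_namp (namp_Ad umZ) jS0) _ _ mes) => x Hx /=.
  have b1 : bop (q2 (stab xi2 phi2 x)) by apply: (namp_bop (namp_r M1 M2)); exact: (rep_bop r2).
  by rewrite /stab2 -(namp_conj nm_) //; bdd.
 apply: (Ad_fix umZ); apply: (ind2_comm imn); first bdd.
 bdd.
rewrite eS eS0 [lg (m \o stab1) _ _]eP.
have emZ : m stabZ = adj (lg (x1 \o th) (x2 \o rh) W).
 by rewrite /stabZ (namp_adj nm_ (un_bop (un_lgW hG jZ))) -(lg_namp cAh cA nm_ jZ mW).
have eA := anti_pentagon ix.
set U := lg (m \o q1 \o ampr \o th) (n \o rh) W in eP *.
rewrite -/U -/x2 in eA *.
set V := adj _ in uV eA *.
(* [anti_pentagon] solved for the twist. As U commutes with s0, conjugating Ad V s0 by the twist or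
   by U gives the same result. *)
have eU : m stabZ \o V = U \o V \o adj U.
 have e3 : V \o U = (lg (x1 \o th) (x2 \o rh) W \o U) \o V by apply/(un_AdP _ _ uV).
 have u12 := un_lgW hG (ind2_jn cAh cA (ind3_12 ix) rth rrh).
 apply/funext => y /=; have := congr1 (fun q => q (adj U y)) e3; rewrite /= unVK // => ->.
 by rewrite emZ unK //.
have buV := un_bop uV; have buU := un_bop uU; have buZ := un_bop umZ.
have buU' := bop_adj buU.
set s0 := (m \o q2) (stab xi2 phi2 c2); set p0 := (m \o q1) (stab xi1 phi1 c1).
have bs0 : bop s0 by exact: (namp_bop (ind2_l i2n)).
have bp0 : bop p0 by exact: (namp_bop (ind2_l i1n)).
have cUs : U \o s0 = s0 \o U.
 apply/esym/(lg_commute cAh cA j13 bs0) => // x Hx.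
  have bx : bop (th x) by bdd.
  apply/esym/(ind2_comm (ind3_23 i3)) => //; exact: (namp_bop (namp_r K1 L)).
 have bx : bop (rh x) by bdd.
 exact: (ind2_comm i2n).
have cBp : lg (n \o th') (x2 \o rh) W \o p0 = p0 \o lg (n \o th') (x2 \o rh) W.
 apply/esym/(lg_commute cAh cA j32 bp0) => // x Hx.
  have bx : bop (th' x) by bdd.
  exact: (ind2_comm i1n).
 have bx : bop (rh x) by bdd.
 apply: (ind2_comm (ind3_23 i3)) => //; exact: (namp_bop (namp_r K2 L)).
have cVp := un_commV uB cBp; rewrite -/V in cVp.
have aVE : adj V = lg (n \o th') (x2 \o rh) W by rewrite /V adjK //; bdd.
have eSU : Ad (m stabZ) (Ad V s0) = Ad U (Ad V s0).
 rewrite (Ad_Ad _ buZ buV) eU /Ad.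
 have -> : adj (U \o V \o adj U) = U \o adj V \o adj U.
  by rewrite (adj_comp (bop_comp buU buV) buU') (adj_comp buU buV) (adjK buU).
 have cUs' := un_commV uU cUs.
 apply/funext => y; have := fun z => congr1 (fun q => q z) cUs'; rewrite /= => h.
 by rewrite h unK // unK.
rewrite eSU -!(Ad_comp _ _ uU); congr (Ad _ _).
have cps : p0 \o s0 = s0 \o p0 by exact: (ind2_comm (ind3_23 i3)).
rewrite /Ad aVE; apply/funext => y.
have h1 := fun z => congr1 (fun q => q z) cVp; have h2 := fun z => congr1 (fun q => q z) cps.
have h3 := fun z => congr1 (fun q => q z) cBp; rewrite /= in h1 h2 h3 *.
by rewrite -h1 h2 h3.
Qed.
End Two.
End Stabilised.

(** * The product twisted by the R-matrix, stabilised *)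

Variables (uD : udual (codouble d)) (hU : hu uD) (Ru : op (sp (uA uD *T uA uD)) (sp (uA uD *T uA uD))).
Hypothesis hRu : universal_lift (u := uD) (u' := uD) (Rmatrix d) Ru.
Let cU := hu_A hU.
Let mRu : mult (uA uD *T uA uD) Ru. by case: hRu => [[[]]]. Qed.
Let uRu : unitary Ru. by case: hRu => [[[]]]. Qed.
Let mV : mult (uA uD *T AA) (uV uD). by case: (hu_V hU). Qed.
Let pL := @ulam (codouble d) uD.
Let rpL : rep pL := rep_ulam hC hU.
Let X' := Ad (flip (sp (uA uD)) (sp (uA uD))) (adj Ru).
Let lX : left_bichar (u := uD) (D := uA uD) Ru.
exact: (bichar_left cU cU (hu_Delta hU) hRu.1). Qed.
Let lX' : left_bichar (u := uD) (D := uA uD) X'.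
exact: (bichar_right cU cU (hu_Delta hU) hRu.1). Qed.
Let lg_X' M (f h : sp (uA uD) ~> M) : jn f h -> lg h f X' = adj (lg f h Ru).
move=> j; have mRu' : mult (uA uD *T uA uD) (adj Ru) by exact: (csa_adj (mult_csalg (tens_cs cU cU)) mRu).
by rewrite (lg_flip cU cU j mRu') (lg_adj cU cU j mRu).
Qed.
Let lg_Ru Q (al be : L ~> Q) : ind2 al be -> lg (al \o pL) (be \o pL) Ru = lg (al \o th) (be \o rh) W.
move=> i2; have j := ind2_jn cD cD i2 rde rde.
have na := ind2_l i2; have nb := ind2_r i2.
have mLam := hu_Lambda hU.
transitivity (lg (al \o de) (be \o de) (Rmatrix d)).
 rewrite -hRu.2 -(lg_mor cU cU cD cD mLam mLam j mRu).
 apply: (lg_eq cU cU (jn_mor cU cU cD cD mLam mLam j) _ _ mRu) => x Hx /=; rewrite ext_namp //;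
  exact: (mor_mult mLam).
rewrite /Rmatrix -(lg_mor cAh cA cD cD mth mrh j mW).
apply/esym/(lg_eq cAh cA (jn_mor cAh cA cD cD mth mrh j) _ _ mW) => x Hx /=; rewrite ext_namp //.
 exact: (mor_mult mth).
exact: (mor_mult mrh).
Qed.
Variables (C1 C2 : opalg R) (xi1 : premor C1 (C1 *T AA)) (xi2 : premor C2 (C2 *T AA)).
Variables (K1 K2 : hilbert R) (phi1 : sp C1 ~> K1) (phi2 : sp C2 ~> K2).
Variables (s1 : sp (uA uD) ~> K1) (s2 : sp (uA uD) ~> K2).
Hypotheses (hc1 : covp (G := codouble d) (u := uD) xi1 phi1 s1) (hc2 : covp (G := codouble d) (u := uD) xi2 phi2 s2).
Let M1 := K1 *t L.
Let M2 := K2 *t L.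
Let M := M1 *t M2.
Let q1 : M1 ~> M := @ampl M2 M1.
Let q2 : M2 ~> M := @ampr M1 M2.
Let k1 : K1 ~> M1 := @ampl L K1.
Let l1 : L ~> M1 := @ampr K1 L.
Let k2 : K2 ~> M2 := @ampl L K2.
Let l2 : L ~> M2 := @ampr K2 L.
Let i12 : ind2 q1 q2 := ind2_amp M1 M2.
Let ia : ind3 (q1 \o k1) (q1 \o l1) (q2 \o k2).
exact: (ind3_sub (ind3_swap23 (ind3_swap12 (ind2_split (ind2_sym i12))))). Qed.
Let ib : ind3 (q2 \o k2) (q2 \o l2) (q1 \o l1).
exact: (ind3_subr (ind3_swap23 (ind3_swap12 (ind2_split i12)))). Qed.
Let n1 := ind2_l i12.
Let n2 := ind2_r i12.
(** X1 and X2 stabilise the two representations. [universal_leg], used once for each leg of [Ru],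
    trades Z for B, whose first leg is reduced, and then B for S, reduced in both legs; S is W in
    theta and rho, the adjoint of [stabZ]. *)
Lemma rside_transport : exists2 ka : K1 *t K2 ~> M, namp ka &
 (forall c, C1 c -> ka (@ampl K2 K1 (phi1 c)) = @stab1 C1 xi1 K1 K2 phi1 c) /\
 (forall c, C2 c -> ka (Ad (adj (lg (@ampl K2 K1 \o s1) (@ampr K1 K2 \o s2) Ru))
   (@ampr K1 K2 (phi2 c))) = @stab2 C2 xi2 K1 K2 phi2 c).
have [rp1 rs1 h1] := hc1; have [rp2 rs2 h2] := hc2.
have jX1 := ind2_jn (B := AA) cU cAA (ind2_amp K1 L) rs1 rp.
have jX2 := ind2_jn (B := AA) cU cAA (ind2_amp K2 L) rs2 rp.
pose X1 := @lg (uA uD) AA M1 (k1 \o s1) (l1 \o p) (uV uD).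
pose X2 := @lg (uA uD) AA M2 (k2 \o s2) (l2 \o p) (uV uD).
have uX1 : unitary X1 := un_lgV hC hU jX1.
have uX2 : unitary X2 := un_lgV hC hU jX2.
have uq1 := namp_un n1 uX1; have uq2 := namp_un n2 uX2.
have bX1 := un_bop uX1; have bX2 := un_bop uX2.
have eX1 : @lg (uA uD) AA M (q1 \o k1 \o s1) (q1 \o l1 \o p) (uV uD) = q1 X1.
 by rewrite -(lg_namp (B := AA) cU cAA n1 jX1 mV).
have eX2 : @lg (uA uD) AA M (q2 \o k2 \o s2) (q2 \o l2 \o p) (uV uD) = q2 X2.
 by rewrite -(lg_namp (B := AA) cU cAA n2 jX2 mV).
have es1 c : C1 c -> bop (@stab C1 xi1 K1 phi1 c).
 move=> Cc; have bc : bop (k1 (phi1 c)) by apply: (namp_bop (namp_l L K1)); exact: (rep_bop rp1).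
 have b1 := bop_Ad uX1 bc.
 have e0 : Ad X1 (k1 (phi1 c)) = @stab C1 xi1 K1 phi1 c := esym (h1 _ _ _ _ _ _ (ind2_amp K1 L) rp Cc).
 by move: b1; rewrite e0.
have st1 c : C1 c -> q1 (stab xi1 phi1 c) = Ad (q1 X1) ((q1 \o k1) (phi1 c)).
 move=> Cc; have bc : bop (k1 (phi1 c)) by apply: (namp_bop (namp_l L K1)); exact: (rep_bop rp1).
 by rewrite -(namp_conj n1 bX1 bc); congr q1; exact: (h1 _ _ _ _ _ _ (ind2_amp K1 L) rp Cc).
have st2 c : C2 c -> q2 (stab xi2 phi2 c) = Ad (q2 X2) ((q2 \o k2) (phi2 c)).
 move=> Cc; have bc : bop (k2 (phi2 c)) by apply: (namp_bop (namp_l L K2)); exact: (rep_bop rp2).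
 by rewrite -(namp_conj n2 bX2 bc); congr q2; exact: (h2 _ _ _ _ _ _ (ind2_amp K2 L) rp Cc).
have jZ := ind2_jn cU cU (ind3_13 ia) rs1 rs2.
have jB := ind2_jn cU cU (ind3_23 ia) rpL rs2.
have e1 := universal_leg hC hU rs1 cU lX ia rs2.
have e2 := universal_leg hC hU rs2 cU lX' ib rpL.
have i24 := ind2_sym (ind3_23 ib).
rewrite (lg_X' jB) (lg_X' (ind2_jn cU cU i24 rpL rpL)) (lg_Ru i24) in e2.
rewrite -/pL in e1.
have {}e1 : Ad (adj (q1 X1)) (lg (q1 \o l1 \o pL) (q2 \o k2 \o s2) Ru) =
  lg (q1 \o k1 \o s1) (q2 \o k2 \o s2) Ru \o lg (q1 \o l1 \o pL) (q2 \o k2 \o s2) Ru.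
 by rewrite -eX1.
have {}e2 : Ad (adj (q2 X2)) (adj (lg (q1 \o l1 \o th) (q2 \o l2 \o rh) W)) =
  adj (lg (q1 \o l1 \o pL) (q2 \o k2 \o s2) Ru) \o adj (lg (q1 \o l1 \o th) (q2 \o l2 \o rh) W).
 by rewrite -eX2.
have uB := lg_un cU cU jB mRu uRu.
have uZ := lg_un cU cU jZ mRu uRu.
have jS := ind2_jn cAh cA i24 rth rrh.
have uS := un_lgW hG jS.
set B := lg _ (q2 \o k2 \o s2) Ru in e1 e2 uB.
set Z := lg _ (q2 \o k2 \o s2) Ru in e1 uZ.
set S := lg _ _ W in e2 uS.
have bB := un_bop uB; have bZ := un_bop uZ; have bS := un_bop uS.
have bq1 := un_bop uq1; have bq2 := un_bop uq2.
have cB c : C1 c -> B \o (q1 \o k1) (phi1 c) = (q1 \o k1) (phi1 c) \o B.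
 move=> Cc; have bc0 : bop (phi1 c) by exact: (rep_bop rp1).
 have bc : bop ((q1 \o k1) (phi1 c)) by exact: (namp_bop (ind2_l (ind3_12 ia))).
 apply/esym/(lg_commute cU cU jB bc) => // x Hx.
  by apply: (ind2_comm (ind3_12 ia)) => //; exact: (rep_bop rpL).
 by apply: (ind2_comm (ind3_13 ia)) => //; exact: (rep_bop rs2).
have cS c : C2 c -> S \o (q2 \o k2) (phi2 c) = (q2 \o k2) (phi2 c) \o S.
 move=> Cc; have bc0 : bop (phi2 c) by exact: (rep_bop rp2).
 have bc : bop ((q2 \o k2) (phi2 c)) by exact: (namp_bop (ind2_l (ind3_12 ib))).
 apply/esym/(lg_commute cAh cA jS bc) => // x Hx.
  by apply: (ind2_comm (ind3_13 ib)) => //; exact: (rep_bop rth).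
 by apply: (ind2_comm (ind3_12 ib)) => //; exact: (rep_bop rrh).
pose Y := q2 X2 \o (q1 X1 \o adj B).
have uY : unitary Y by apply: un_comp => //; apply: un_comp => //; exact: un_adj.
have bY := un_bop uY; have baB := bop_adj bB; have baZ := bop_adj bZ.
have [eta ne [m1 m2]] := ind3_13 ia.
exists (Ad Y \o eta); first exact: (namp_trans ne (namp_Ad uY)).
(* On the second algebra X1 and the inner S act trivially, so only the stabilisation by X2 and the
   twist adj S remain. *)
have eYZ : Y \o adj Z = adj S \o q2 X2 \o S \o q1 X1.
 have f1 x : q1 X1 (adj B (adj Z x)) = adj B (q1 X1 x).
  have := congr1 (fun q => q1 X1 (q (adj B (adj Z x)))) e1.
  by rewrite /Ad (adjK bq1) /= (unVK _ uq1) (unVK _ uB) (unVK _ uZ) => <-; rewrite unK.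
 have f2 x : q2 X2 (adj B x) = adj S (q2 X2 (S x)).
  have := congr1 (fun q => q2 X2 (q (S x))) e2.
  by rewrite /Ad (adjK bq2) /= (unVK _ uq2) (unK _ uS) => ->.
 by apply/funext => x; rewrite /Y /= f1 f2.
split=> c Cc /=.
 have bc0 : bop (phi1 c) by exact: (rep_bop rp1).
 rewrite -(m1 _ bc0) /Y -(Ad_Ad _ bq2 (bop_comp bq1 baB)) -(Ad_Ad _ bq1 baB).
 rewrite (Ad_fix (un_adj uB) (un_commV uB (cB _ Cc))) -(st1 _ Cc).
 apply: (Ad_fix uq2); apply/esym/(ind2_comm i12) => //.
 exact: es1.
have bc0 : bop (phi2 c) by exact: (rep_bop rp2).
have bc1 : bop (@ampr K1 K2 (phi2 c)) by exact: (namp_bop (namp_r K1 K2)).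
have jZ0 := ind2_jn cU cU (ind2_amp K1 K2) rs1 rs2.
have bZ0 := un_bop (lg_un cU cU jZ0 mRu uRu).
have baZ0 := bop_adj bZ0.
rewrite (namp_conj ne baZ0 bc1) (namp_adj ne bZ0) -(m2 _ bc0) -(lg_namp cU cU ne jZ0 mRu).
have -> : lg (eta \o (@ampl K2 K1 \o s1)) (eta \o (@ampr K1 K2 \o s2)) Ru = Z.
 apply/esym/(lg_eq cU cU (jn_namp ne jZ0) _ _ mRu) => x Hx /=.
  exact: (esym (m1 _ (rep_bop rs1 Hx))).
 exact: (esym (m2 _ (rep_bop rs2 Hx))).
rewrite (Ad_Ad _ bY baZ) eYZ.
have b3 : bop (adj S) := bop_adj bS.
have b4 : bop (adj S \o q2 X2) := bop_comp b3 bq2.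
rewrite -(Ad_Ad _ (bop_comp b4 bS) bq1) -(Ad_Ad _ b4 bS) -(Ad_Ad _ b3 bq2).
rewrite (Ad_fix uq1); last first.
 by apply: (ind2_comm i12) => //; exact: (namp_bop (namp_l L K2)).
by rewrite (Ad_fix uS (cS _ Cc)) -(st2 _ Cc).
Qed.
End Codouble.

(** * Twisted products as C*-algebras and correspondences between them *)

Section TwistedPairs.
Lemma namp_isom M Q (al : M ~> Q) t (C : R) : namp al ->
 ((exists x : M, x <> 0) -> exists q : Q, q <> 0) -> bop t -> 0 <= C -> bnd C (al t) -> bnd C t.
move=> na h bt C0 hC; have [ex|no] := pselect (exists x : M, x <> 0); last first.
 by rewrite (op_zero_eq t 0 no) => x; rewrite op0E nm0 mulr_ge0 // nm_ge0.
apply: (shom_isom (bop_csalg M) (namp_shom na)) => // s s' bs bs'.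
exact: (namp_inj na (h ex)).
Qed.
Lemma shom_sub H K (X Y : set (op H H)) (f : H ~> K) : X `<=` Y -> shom Y f -> shom X f.
move=> XY [s1 s2 s3 s4]; split=> [a Xa|c a b Xa Xb|a b Xa Xb|a Xa].
- exact/s1/XY.
- by apply: s2; exact: XY.
- by apply: s3; exact: XY.
- exact/s4/XY.
Qed.
Lemma csub_shom_fix H (X : set (op H H)) (f : H ~> H) : csalg X -> shom X f -> csub [set t | X t /\ f t = t].
move=> cX sf; have -> : [set t | X t /\ f t = t] = [set t | X t /\ [set 0 : op H H] (f t - t)].
 by apply/seteqP; split=> t [Xt e]; split=> //=; [rewrite e subrr|apply: subr0_eq].
apply: (csub_pre (fun t => f t - t) 2) => //; first exact: (csa_sub cX).
- exact: csub_zero.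
- move=> a s t Xs Xt; exists a; rewrite (shom_lin sf) //.
 by rewrite opprD addrACA scalerBr.
- by move=> s t Xs Xt; rewrite (shomB sf) // !opprB addrACA [RHS]addrACA; congr (_ + _); exact: addrC.
- move=> C t C0 Xt hC; rewrite mulr_natl mulr2n; apply: bndD; first exact: (shom_contr cX sf).
 exact: bnd_lin.
Qed.
Section Pair.
Variables (C1 C2 : opalg R) (M : hilbert R) (i1 : sp C1 ~> M) (i2 : sp C2 ~> M).
Hypotheses (cC1 : cstar C1) (cC2 : cstar C2) (r1 : rep i1) (r2 : rep i2).
Definition twalg : opalg R := OpAlg (prodset (i1 @` els C1) (i2 @` els C2)).
Let S := [set x \o y | x in i1 @` els C1 & y in i2 @` els C2].
Let cY : csub (els twalg) := csub_cspan S.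
Let b1 c : C1 c -> bop (i1 c). exact: (rep_bop r1). Qed.
Let b2 c : C2 c -> bop (i2 c). exact: (rep_bop r2). Qed.
Let a1 := cs_alg cC1.
Let a2 := cs_alg cC2.
Lemma twalg_in c d : C1 c -> C2 d -> twalg (i1 c \o i2 d).
by move=> Cc Cd; apply: prodset_in; [exists c|exists d]. Qed.
Lemma twalg_ind (X : set (op M M)) : csub X -> (forall c d, C1 c -> C2 d -> X (i1 c \o i2 d)) -> els twalg `<=` X.
by move=> cX h; apply: prodset_sub => // _ _ [c Cc <-] [d Cd <-]; exact: h. Qed.
Lemma twalg_mull c x : C1 c -> twalg x -> twalg (i1 c \o x).
move=> Cc; suff h : els twalg `<=` [set x | bop x /\ twalg (i1 c \o x)] by move/h=> [].
apply: twalg_ind => [|c' d Cc' Cd]; first exact: (csub_mull cY (b1 Cc)).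
split; first exact: (bop_comp (b1 Cc') (b2 Cd)).
have -> : i1 c \o (i1 c' \o i2 d) = i1 (c \o c') \o i2 d by rewrite (shom_comp r1.1).
exact: (twalg_in (csa_comp a1 Cc Cc')).
Qed.
Lemma twalg_mulr d x : C2 d -> twalg x -> twalg (x \o i2 d).
move=> Cd; suff h : els twalg `<=` [set x | bop x /\ twalg (x \o i2 d)] by move/h=> [].
apply: twalg_ind => [|c d' Cc Cd']; first exact: (csub_mulr cY (b2 Cd)).
split; first exact: (bop_comp (b1 Cc) (b2 Cd')).
have -> : (i1 c \o i2 d') \o i2 d = i1 c \o i2 (d' \o d) by rewrite (shom_comp r2.1).
exact: (twalg_in Cc (csa_comp a2 Cd' Cd)).
Qed.
Hypothesis ex : forall c d, C1 c -> C2 d -> twalg (i2 d \o i1 c).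
Let ad c d : C1 c -> C2 d -> adj (i1 c \o i2 d) = i2 (adj d) \o i1 (adj c).
by move=> Cc Cd; rewrite (adj_comp (b1 Cc) (b2 Cd)) (shom_adj r1.1) // (shom_adj r2.1). Qed.
Lemma twalg_cstar : cstar twalg.
apply: mk_cstar.
 apply: (cspan_csalg (S := S)) => [_ [_ [c Cc <-] [_ [d Cd <-] <-]]|_ _ [_ [c Cc <-] [_ [d Cd <-] <-]] [_ [c' Cc' <-] [_ [d' Cd' <-] <-]]|_ [_ [c Cc <-] [_ [d Cd <-] <-]]].
 - exact: (bop_comp (b1 Cc) (b2 Cd)).
 - exact: (twalg_mull Cc (twalg_mulr Cd' (ex Cc' Cd))).
 - by rewrite ad //; apply: ex; [exact: (csa_adj a1)|exact: (csa_adj a2)].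
apply: (hdense_trans r1.2) => _ e [_ [c Cc <-] [z _ <-]] e0.
have h v : vecs (i2 @` els C2) v -> lspan (vecs (els twalg)) (i1 c v).
 move=> [_ [d Cd <-] [w _ <-]].
 by apply: sub_lspan; exists (i1 c \o i2 d); [exact: twalg_in|exists w].
exact: (lspan_approx z (b1 Cc) r2.2 h e0).
Qed.
Let aT := cs_alg twalg_cstar.
Lemma twalg_mult1 c : C1 c -> mult twalg (i1 c).
move=> Cc; split=> [|x Tx]; first exact: b1.
split; first exact: twalg_mull.
have := csa_adj aT (twalg_mull (csa_adj a1 Cc) (csa_adj aT Tx)).
have bx := csa_bop aT Tx; have bc := b1 Cc.
by rewrite (shom_adj r1.1) // adj_comp ?adjK //; exact: bop_adj.
Qed.
Lemma twalg_mult2 d : C2 d -> mult twalg (i2 d).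
move=> Cc; split=> [|x Tx]; first exact: b2.
split; last exact: twalg_mulr.
have := csa_adj aT (twalg_mulr (csa_adj a2 Cc) (csa_adj aT Tx)).
have bx := csa_bop aT Tx; have bc := b2 Cc.
by rewrite (shom_adj r2.1) // adj_comp ?adjK //; exact: bop_adj.
Qed.
Lemma twalg_morphism1 : morphism (PreMor C1 twalg i1).
apply: (mk_morphism twalg_cstar r1.1 twalg_mult1).
set Y := prodset _ _; have cYY : csub Y by exact: csub_cspan.
apply: twalg_ind => // c d Cc Cd.
suff /(_ c (cstar_prod cC1 Cc))[_ []] : prodset (els C1) (els C1) `<=`
  [set c | C1 c /\ [set t | bop t /\ Y (t \o i2 d)] (i1 c)] by [].
apply: prodset_sub => [|c1 c2 Cc1 Cc2]; first exact: (csub_shom a1 r1.1 (csub_mulr cYY (b2 Cd))).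
split; first exact: (csa_comp a1).
split; first exact: b1 (csa_comp a1 Cc1 Cc2).
rewrite (shom_comp r1.1) //; have -> : (i1 c1 \o i1 c2) \o i2 d = i1 c1 \o (i1 c2 \o i2 d) by [].
by apply: prodset_in; [exists c1|exact: twalg_in].
Qed.
(** Generators i1 c \o i2 d begin with the wrong algebra. Their adjoints do not, and [ex] places the
    remaining products i2 d \o i1 c in the algebra. *)
Lemma twalg_morphism2 : morphism (PreMor C2 twalg i2).
apply: (mk_morphism twalg_cstar r2.1 twalg_mult2).
set Y := prodset _ _; have cYY : csub Y by exact: csub_cspan.
move=> t Tt; have Tt' := csa_adj aT Tt.
suff /(_ _ Tt')[_] : els twalg `<=` [set t | bop t /\ Y (adj t)].
 by rewrite adjK //; exact: (csa_bop aT).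
apply: twalg_ind => [|c d Cc Cd]; first exact: csub_adj.
split; first exact: (bop_comp (b1 Cc) (b2 Cd)).
rewrite ad //; have Cc' := csa_adj a1 Cc; have Cd' := csa_adj a2 Cd.
suff /(_ _ (cstar_prod cC2 Cd'))[_ []] : prodset (els C2) (els C2) `<=`
  [set d | C2 d /\ [set t | bop t /\ Y (t \o i1 (adj c))] (i2 d)] by [].
apply: prodset_sub => [|c1 c2 Cc1 Cc2]; first exact: (csub_shom a2 r2.1 (csub_mulr cYY (b1 Cc'))).
split; first exact: (csa_comp a2).
split; first exact: b2 (csa_comp a2 Cc1 Cc2).
rewrite (shom_comp r2.1) //; have -> : (i2 c1 \o i2 c2) \o i1 (adj c) = i2 c1 \o (i2 c2 \o i1 (adj c)) by [].
by apply: prodset_in; [exists c1|exact: ex].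
Qed.
End Pair.

(* [E] is the graph of an isometric *-isomorphism between dense subalgebras. *)
Section Correspondence.
Variables (C1 C2 : opalg R) (M M' : hilbert R) (i1 : sp C1 ~> M) (i2 : sp C2 ~> M).
Variables (i1' : sp C1 ~> M') (i2' : sp C2 ~> M') (cC1 : cstar C1) (cC2 : cstar C2).
Variables (r1 : rep i1) (r2 : rep i2) (r1' : rep i1') (r2' : rep i2') (E : set (op M M * op M' M')).
Record corresp := Corr {
 corr_bop : forall p, E p -> bop p.1 /\ bop p.2;
 corr0 : E (0, 0);
 corr_lin : forall a p q, E p -> E q -> E (a *: p.1 + q.1, a *: p.2 + q.2);
 corr_comp : forall p q, E p -> E q -> E (p.1 \o q.1, p.2 \o q.2);
 corr_adj : forall p, E p -> E (adj p.1, adj p.2);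
 corr_bnd : forall p (C : R), E p -> 0 <= C -> bnd C p.1 -> bnd C p.2;
 corr_bndV : forall p (C : R), E p -> 0 <= C -> bnd C p.2 -> bnd C p.1;
 corr1 : forall c, C1 c -> E (i1 c, i1' c);
 corr2 : forall c, C2 c -> E (i2 c, i2' c) }.
Hypothesis hE : corresp.
Let N := nclosure [set p.1 | p in E].
Let N_csalg : csalg N.
pose S := [set p.1 | p in E].
have eS : lspan S `<=` S.
 move=> v; elim/lspan_ind => [|a _ _ [p Ep <-] [q Eq <-]]; first by exists (0, 0) => //; exact: corr0.
 by exists (a *: p.1 + q.1, a *: p.2 + q.2) => //; exact: corr_lin.
have -> : N = cspan S.
 apply/seteqP; split=> t ht; apply/nclP => e e0; have /nclP/(_ e e0)[s Ss hs] := ht; exists s => //.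
  exact: sub_lspan.
 exact: eS.
apply: cspan_csalg => [_ [p Ep <-]|_ _ [p Ep <-] [q Eq <-]|_ [p Ep <-]].
- by have [] := corr_bop hE Ep.
- by apply: sub_cspan; exists (p.1 \o q.1, p.2 \o q.2) => //; exact: corr_comp.
- by apply: sub_cspan; exists (adj p.1, adj p.2) => //; exact: corr_adj.
Qed.
Lemma corresp_hom : exists F : M ~> M', [/\ csalg N, shom N F, finj N F,
 (forall p, E p -> N p.1 /\ F p.1 = p.2) & els (twalg i1 i2) `<=` N].
have [F [h1 h2 h3 h4]] := complete_hom (corr_bop hE) (corr0 hE) (corr_lin hE) (corr_comp hE) (corr_adj hE) (corr_bnd hE).
have inN p : E p -> N p.1.
 by move=> Ep; apply/nclP => e e0; exists p.1; [exists p|rewrite subrr => x; rewrite op0E nm0 mulr_ge0 // ?nm_ge0 // ltW].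
exists F; split=> //.
- exact: (h4 (corr_bndV hE)).
- by move=> p Ep; split; [exact: inN|exact: h2].
apply: twalg_ind => [|c d Cc Cd]; first exact: (csa_sub N_csalg).
apply: (csa_comp N_csalg); first exact: (inN _ (corr1 hE Cc)).
exact: (inN _ (corr2 hE Cd)).
Qed.
Lemma corresp_tw F : csalg N -> shom N F -> (forall p, E p -> N p.1 /\ F p.1 = p.2) ->
 els (twalg i1 i2) `<=` N -> forall t, twalg i1 i2 t -> twalg i1' i2' (F t).
move=> cN sF hF sub t Tt.
suff /(_ t Tt)[] : els (twalg i1 i2) `<=` [set t | N t /\ twalg i1' i2' (F t)] by [].
apply: twalg_ind => [|c d Cc Cd]; first exact: (csub_shom cN sF (csub_cspan _)).
have [N1 /= e1] := hF _ (corr1 hE Cc); have [N2 /= e2] := hF _ (corr2 hE Cd).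
split; first exact: (csa_comp cN).
by rewrite (shom_comp sF) // e1 e2; exact: twalg_in.
Qed.
Hypothesis ex : forall c d, C1 c -> C2 d -> twalg i1 i2 (i2 d \o i1 c).
(** The correspondence is isometric, hence maps closed spans of products into closed spans of
    products and carries the exchange relation along. It thus suffices to know that relation for one
    pair. *)
Lemma corresp_exchange c d : C1 c -> C2 d -> twalg i1' i2' (i2' d \o i1' c).
move=> Cc Cd; have [F [cN sF _ hF sub]] := corresp_hom.
have [N1 /= e1] := hF _ (corr1 hE Cc); have [N2 /= e2] := hF _ (corr2 hE Cd).
by rewrite -e1 -e2 -(shom_comp sF) //; apply: corresp_tw => //; exact: ex.
Qed.
End Correspondence.
Lemma corresp_swap C1 C2 M M' (i1 : sp C1 ~> M) (i2 : sp C2 ~> M) (i1' : sp C1 ~> M') (i2' : sp C2 ~> M') E :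
 corresp i1 i2 i1' i2' E -> corresp i1' i2' i1 i2 [set p | E (p.2, p.1)].
case=> h1 h2 h3 h4 h5 h6 h7 h8 h9; split=> //=.
- by move=> p /h1[].
- by move=> a p q Ep Eq; exact: (h3 a _ _ Ep Eq).
- by move=> p q Ep Eq; exact: (h4 _ _ Ep Eq).
- by move=> p Ep; exact: (h5 _ Ep).
- by move=> p C Ep; exact: (h7 _ C Ep).
- by move=> p C Ep; exact: (h6 _ C Ep).
Qed.
Section Isomorphism.
Variables (C1 C2 : opalg R) (M M' : hilbert R) (i1 : sp C1 ~> M) (i2 : sp C2 ~> M).
Variables (i1' : sp C1 ~> M') (i2' : sp C2 ~> M') (cC1 : cstar C1) (cC2 : cstar C2).
Hypotheses (r1 : rep i1) (r2 : rep i2) (r1' : rep i1') (r2' : rep i2').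
Hypothesis ex : forall c d, C1 c -> C2 d -> twalg i1 i2 (i2 d \o i1 c).
Local Notation TW := (twalg i1 i2).
Local Notation TW' := (twalg i1' i2').
(** [corresp_hom] is applied to the graph and to its transpose. The two composites are the identity
    on products of generators, hence everywhere. *)
Lemma corresp_iso E : corresp i1 i2 i1' i2' E -> exists (Phi : premor TW TW') (Psi : premor TW' TW), [/\
  [/\ isomorphism Phi, (forall c, C1 c -> ext Phi (i1 c) = i1' c) & (forall c, C2 c -> ext Phi (i2 c) = i2' c)],
  [/\ morphism Psi, (forall c, C1 c -> ext Psi (i1' c) = i1 c) & (forall c, C2 c -> ext Psi (i2' c) = i2 c)] &
  (forall t, TW t -> TW' (Phi t) /\ Psi (Phi t) = t) /\ (forall t, TW' t -> TW (Psi t) /\ Phi (Psi t) = t)].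
move=> hE; have hE' := corresp_swap hE.
have ex' := corresp_exchange hE ex.
have [F [cN sF fF hF sub]] := corresp_hom hE.
have [F' [cN' sF' fF' hF' sub']] := corresp_hom hE'.
have hT := twalg_cstar cC1 cC2 r1 r2 ex; have hT' := twalg_cstar cC1 cC2 r1' r2' ex'.
have aT := cs_alg hT; have aT' := cs_alg hT'.
have FT := corresp_tw hE cN sF hF sub.
have FT' := corresp_tw hE' cN' sF' hF' sub'.
have e1 c : C1 c -> F (i1 c) = i1' c by move=> Cc; have [_ /= ->] := hF _ (corr1 hE Cc).
have e2 c : C2 c -> F (i2 c) = i2' c by move=> Cc; have [_ /= ->] := hF _ (corr2 hE Cc).
have e1' c : C1 c -> F' (i1' c) = i1 c by move=> Cc; have [_ /= ->] := hF' _ (corr1 hE' Cc).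
have e2' c : C2 c -> F' (i2' c) = i2 c by move=> Cc; have [_ /= ->] := hF' _ (corr2 hE' Cc).
have n1 c : C1 c -> nclosure [set p.1 | p in E] (i1 c) by move=> Cc; have [] := hF _ (corr1 hE Cc).
have n2 c : C2 c -> nclosure [set p.1 | p in E] (i2 c) by move=> Cc; have [] := hF _ (corr2 hE Cc).
have n1' c := fun Cc : C1 c => (hF' _ (corr1 hE' Cc)).1.
have n2' c := fun Cc : C2 c => (hF' _ (corr2 hE' Cc)).1.
have sT := shom_sub sub sF; have sT' := shom_sub sub' sF'.
have K1 t : TW t -> F' (F t) = t.
 move=> Tt; suff /(_ t Tt)[] : els TW `<=` [set t | TW t /\ F' (F t) = t] by [].
 apply: twalg_ind => [|c d Cc Cd]; last first.
  split; first exact: twalg_in.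
  by rewrite (shom_comp sF (n1 _ Cc) (n2 _ Cd)) e1 // e2 // (shom_comp sF') ?e1' ?e2' //; [exact: n1'|exact: n2'].
 apply: (csub_shom_fix aT); split=> [t' Tt'|c a b Ta Tb|a b Ta Tb|a Ta].
 - by have [+ _ _ _] := sT'; apply; exact: FT.
 - by rewrite (shom_lin sT) // (shom_lin sT') //; exact: FT.
 - by rewrite (shom_comp sT) // (shom_comp sT') //; exact: FT.
 - by rewrite (shom_adj sT) // (shom_adj sT') //; exact: FT.
have K2 t : TW' t -> F (F' t) = t.
 move=> Tt; suff /(_ t Tt)[] : els TW' `<=` [set t | TW' t /\ F (F' t) = t] by [].
 apply: twalg_ind => [|c d Cc Cd]; last first.
  split; first exact: twalg_in.
  by rewrite (shom_comp sF' (n1' _ Cc) (n2' _ Cd)) e1' // e2' // (shom_comp sF) ?e1 ?e2 //; [exact: n1|exact: n2].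
 apply: (csub_shom_fix aT'); split=> [t' Tt'|c a b Ta Tb|a b Ta Tb|a Ta].
 - by have [+ _ _ _] := sT; apply; exact: FT'.
 - by rewrite (shom_lin sT') // (shom_lin sT) //; exact: FT'.
 - by rewrite (shom_comp sT') // (shom_comp sT) //; exact: FT'.
 - by rewrite (shom_adj sT') // (shom_adj sT) //; exact: FT'.
have im1 : F @` els TW = els TW'.
 apply/seteqP; split=> [_ [t Tt <-]|t Tt]; first exact: FT.
 by exists (F' t); [exact: FT'|exact: K2].
have im2 : F' @` els TW' = els TW.
 apply/seteqP; split=> [_ [t Tt <-]|t Tt]; first exact: FT'.
 by exists (F t); [exact: FT|exact: K1].
have m1 : morphism (PreMor TW TW' F).
 apply: (mk_morphism hT' sT) => [t Tt|]; first exact: (mult_in hT' (FT _ Tt)).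
 by rewrite im1; exact: cstar_prod.
have m2 : morphism (PreMor TW' TW F').
 apply: (mk_morphism hT sT') => [t Tt|]; first exact: (mult_in hT (FT' _ Tt)).
 by rewrite im2; exact: cstar_prod.
have rF := morph_rep hT' m1; have rF' := morph_rep hT m2.
exists (PreMor TW TW' F), (PreMor TW' TW F'); split.
- split; first by split=> // s t Ts Tt est; rewrite -(K1 _ Ts) -(K1 _ Tt) -[F s]/(PreMor TW TW' F s) est.
 + move=> c Cc; apply: (ext_uniq rF) => [|t Tt]; first exact: (rep_bop r1').
  by rewrite -e1 //; exact: (esym (shom_comp sF (n1 _ Cc) (sub _ Tt))).
 + move=> c Cc; apply: (ext_uniq rF) => [|t Tt]; first exact: (rep_bop r2').
  by rewrite -e2 //; exact: (esym (shom_comp sF (n2 _ Cc) (sub _ Tt))).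
- split=> //.
 + move=> c Cc; apply: (ext_uniq rF') => [|t Tt]; first exact: (rep_bop r1).
  by rewrite -e1' //; exact: (esym (shom_comp sF' (n1' _ Cc) (sub' _ Tt))).
 + move=> c Cc; apply: (ext_uniq rF') => [|t Tt]; first exact: (rep_bop r2).
  by rewrite -e2' //; exact: (esym (shom_comp sF' (n2' _ Cc) (sub' _ Tt))).
- by split=> t Tt /=; split=> //; [exact: FT|exact: K1|exact: FT'|exact: K2].
Qed.
End Isomorphism.
End TwistedPairs.

(** * Transport of a coaction along an isomorphism *)

Section CoactionTransport.
Lemma lg3_local_id (A B C : opalg R) z : cstar A -> cstar B -> cstar C -> mult (A *T (B *T C)) z ->
 @jn3 A B C _ (@ampl (sp B *t sp C) (sp A) \o id) (@ampr (sp A) (sp B *t sp C) \o (@ampl (sp C) (sp B) \o id))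
  (@ampr (sp A) (sp B *t sp C) \o (@ampr (sp B) (sp C) \o id)) /\ @lg3 A B C _ (@ampl (sp B *t sp C) (sp A) \o id)
  (@ampr (sp A) (sp B *t sp C) \o (@ampl (sp C) (sp B) \o id))
  (@ampr (sp A) (sp B *t sp C) \o (@ampr (sp B) (sp C) \o id)) z = z.
move=> cA cB cC mz; have cBC := tens_cs cB cC.
have rA := rep_id cA; have j := jn_local cB cC (rep_id cB) (rep_id cC).
have i2 := ind2_amp (sp A) (sp B *t sp C).
split; first exact: (jn3_group cA cB cC i2 rA j).
rewrite (lg_group cA cB cC i2 rA j mz) -[RHS](lg_local_id (B := B *T C) cA cBC mz).
have jl := jn_local (B := B *T C) cA cBC rA (rep_id cBC).
have jx := ind2_jn (B := B *T C) cA cBC i2 rA (jr_rep j).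
apply/esym/(lg_eq (B := B *T C) cA cBC jx _ _ mz) => // x Tx.
rewrite /= -(lg_in j Tx); congr (ampr _ _).
exact: (lg_local_id cB cC (mult_in cBC Tx)).
Qed.
Variables (G : qgroup T) (hG : hq G).
Local Notation Q0 := (qA G).
Let cQ : cstar Q0 := hq_A hG.
Variables (A B : opalg R) (cA : cstar A) (cB : cstar B).
Let mi := idm_morphism cQ.
Section Comp.
Variables (Phi : premor A B) (mPhi : morphism Phi).
Lemma tapp_comp (C : opalg R) (f : premor C A) (f' : premor C B) z : cstar C -> morphism f ->
 morphism f' -> (forall c, C c -> ext Phi (f c) = f' c) -> mult (C *T Q0) z ->
 tapp Phi (idm Q0) (tapp f (idm Q0) z) = tapp f' (idm Q0) z.
move=> cC mf mf' e mz.
have mz' : mult (A *T Q0) (tapp f (idm Q0) z) by exact: (tapp_mult cC cQ cA cQ mf mi mz).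
rewrite (tapp_lg cA cQ cB cQ mPhi mi mz') (tapp_lg cC cQ cB cQ mf' mi mz).
have jB := jn_local cB cQ (rep_id cB) (rep_id cQ).
have nl := namp_l (sp Q0) (sp B).
have rPhi := morph_rep cB mPhi.
have j : jn (@ampl (sp Q0) (sp B) \o Phi) (@ampr (sp B) (sp Q0) \o idm Q0).
 exact: (jn_local cA cQ rPhi (rep_id cQ)).
rewrite -(lg_mor cC cQ cA cQ mf mi j mz).
apply/esym/(lg_eq cC cQ (jn_mor cC cQ cA cQ mf mi j) _ _ mz) => x Hx /=.
 by rewrite (ext_namp nl cA rPhi (mor_mult mf Hx)) e.
by rewrite (ext_in (jn_r j)).
Qed.
End Comp.
Variables (Phi : premor A B) (Psi : premor B A) (iPhi : isomorphism Phi) (mPsi : morphism Psi).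
Variables (hAB : forall t, A t -> B (Phi t) /\ Psi (Phi t) = t) (hBA : forall t, B t -> A (Psi t) /\ Phi (Psi t) = t).
Let mPhi : morphism Phi. by case: iPhi. Qed.
Let fPhi : finj (els A) Phi. by case: iPhi. Qed.
Let cAQ := tens_cs cA cQ.
Let cBQ := tens_cs cB cQ.
Let mTh : morphism (tmor T Phi (idm Q0)) := (tmorP cA cQ cB cQ mPhi mi).1.
Variables (XR : premor A (A *T Q0)) (hXR : coaction G XR).
Let mXR := co_mor hXR.
Definition transport : premor B (B *T Q0) :=
 PreMor B (B *T Q0) (ext (A := A *T Q0) (tmor T Phi (idm Q0)) \o (ext XR \o Psi)).
Let mXP : morphism (PreMor B (A *T Q0) (ext XR \o Psi)) := morph_comp cB cA cAQ mPsi mXR.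
Lemma transport_morphism : morphism transport.
exact: (morph_comp cB cAQ cBQ mXP mTh). Qed.
Let mX s : A s -> mult (A *T Q0) (XR s). exact: (mor_mult mXR). Qed.
Lemma transportE s : A s -> transport (Phi s) = tapp Phi (idm Q0) (XR s).
move=> As; have [Bs e] := hAB As; rewrite /transport /= e.
by rewrite (ext_in (morph_rep cAQ mXR) As) -(tapp_ext cA cQ cB cQ mPhi mi (mX As)).
Qed.
Let tapp_inj s t : mult (A *T Q0) s -> mult (A *T Q0) t -> tapp Phi (idm Q0) s = tapp Phi (idm Q0) t -> s = t.
move=> ms mt; rewrite !(tapp_lg cA cQ cB cQ mPhi mi) //.
exact: (lg_inj cA cQ (morph_rep cB mPhi) (rep_id cQ) fPhi).
Qed.
(** Both sides are read on the three standard legs. Pulling the first leg back along Phi reduces the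
    claim to coassociativity of [XR] in leg form. *)
Lemma transport_coassoc c : B c ->
 tapp (idm B) (qDelta G) (transport c) = Ad (assoc _ _ _) (tapp transport (idm Q0) (transport c)).
move=> Bc; have [As ec] := hBA Bc; set s := Psi c in As ec.
have mt : mult (B *T Q0) (transport c) := mor_mult transport_morphism Bc.
have cQQ := tens_cs cQ cQ.
have m1 : mult (B *T (Q0 *T Q0)) (tapp (idm B) (qDelta G) (transport c)).
 exact: (tapp_mult (B' := Q0 *T Q0) cB cQ cB cQQ (idm_morphism cB) (hq_Delta hG) mt).
have m2 : mult (B *T (Q0 *T Q0)) (Ad (assoc (sp B) (sp Q0) (sp Q0)) (tapp transport (idm Q0) (transport c))).
 apply: mult_assoc => //.
 exact: (tapp_mult (A' := B *T Q0) cB cQ cBQ cQ transport_morphism mi mt).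
have [j3 e1] := lg3_local_id cB cQ cQ m1; have [_ e2] := lg3_local_id cB cQ cQ m2.
apply: etrans (esym e1) _; apply: etrans _ e2; clear e1.
set f0 := @ampl _ _ \o id in j3 *.
set h1 := _ \o (@ampl _ _ \o id) in j3 *.
set h2 := _ \o (@ampr _ _ \o id) in j3 *.
have [j4 <-] := bichar2_gen cB cQ cQ cQ (hq_Delta hG) j3 mt.
have [j5 <-] := bichar1_gen cB cQ cQ cB transport_morphism j3 mt.
have rPhi := morph_rep cB mPhi.
have rf0 := jn_l j4.
have ef0 x : A x -> (ext f0 \o Phi) x = (f0 \o Phi) x by move=> Ax; rewrite /= (ext_in rf0) //; exact: (hAB Ax).1.
have push M (k : sp B ~> M) (h : sp Q0 ~> M) x : jn k h -> A x ->
  lg k h (tapp Phi (idm Q0) (XR x)) = lg (k \o Phi) h (XR x).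
 move=> j Ax; have [j' <-] := lg_morl cA cB cQ mPhi j (mX Ax).
 apply/esym/(lg_eq cA cQ j') => // [y Ay|]; last exact: mX.
 by rewrite /= (ext_in (jn_l j)) //; exact: (hAB Ay).1.
rewrite -ec transportE // !push //.
have i2 := ind2_amp (sp B) (sp Q0 *t sp Q0).
have jh := jn_local cQ cQ (rep_id cQ) (rep_id cQ).
have jP : jn3 (f0 \o Phi) h1 h2.
 exact: (jn3_group cA cQ cQ i2 rPhi jh).
have [_ j6 ->] := coaction_lg hG cA hXR jP As.
apply/esym/(lg_eq cA cQ j6) => // [x Ax|]; last exact: mX.
by rewrite -[RHS]/(lg f0 h1 (transport (Phi x))) transportE // push //; exact: (jn3_12 cB cQ cQ j3).
Qed.
Lemma transport_coaction : coaction G transport.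
split.
- exact: transport_morphism.
- move=> s t Bs Bt; have [As <-] := hBA Bs; have [At <-] := hBA Bt.
 rewrite !transportE // => /(tapp_inj (mX As) (mX At)) /(co_inj hXR As At) -> //.
- exact: transport_coassoc.
have sTh : shom (els (A *T Q0)) (tmor T Phi (idm Q0)) := morph_shom mTh.
have aAQ := cs_alg cAQ.
have ThE a q : A a -> Q0 q -> tmor T Phi (idm Q0) (otens a q) = otens (Phi a) q.
 by move=> Aa Qq; rewrite (tmorE cA cQ cB cQ mPhi mi Aa Qq).
have Thm z : (A *T Q0) z -> (B *T Q0) (tmor T Phi (idm Q0) z).
 move=> Tz; suff /(_ z Tz)[] : els (A *T Q0) `<=` [set z | (A *T Q0) z /\ (B *T Q0) (tmor T Phi (idm Q0) z)] by [].
 apply: tens_ind => [|a q Aa Qq]; first exact: (csub_shom aAQ sTh (cstar_sub cBQ)).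
 split; first exact: tens_in.
 by rewrite ThE //; apply: tens_in => //; exact: (hAB Aa).1.
have key s q : A s -> Q0 q -> transport (Phi s) \o otens (@id (sp B)) q =
  tmor T Phi (idm Q0) (XR s \o otens (@id (sp A)) q).
 move=> As Qq; have Tsq := podles_r (co_cont hXR) As Qq.
 have m1 : mult (A *T Q0) (otens (@id (sp A)) q) by apply: mult_otens => //; [exact: mult_id|exact: mult_in].
 rewrite transportE // -[RHS](ext_in (morph_rep cBQ mTh) Tsq).
 rewrite (shom_comp (ext_shom cAQ (morph_rep cBQ mTh)) (mX As) m1).
 rewrite -(tapp_ext cA cQ cB cQ mPhi mi (mX As)) -(tapp_ext cA cQ cB cQ mPhi mi m1); congr (_ \o _).
 rewrite (tapp_lg cA cQ cB cQ mPhi mi m1).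
 have j := jn_local cA cQ (morph_rep cB mPhi) (rep_id cQ).
 rewrite (lg_otens cA cQ j (mult_id A) (mult_in cQ Qq)).
 by rewrite ext_id ?(ext_in (jn_r j)) //; exact: (jn_l j).
set Y := prodset _ _; have cY : csub Y by exact: csub_cspan.
apply/seteqP; split.
 apply: prodset_sub => [|_ _ [t Bt <-] [q Qq <-]]; first exact: cstar_sub.
 have [As <-] := hBA Bt; rewrite key //; apply: Thm; exact: (podles_r (co_cont hXR)).
apply: tens_ind => // t q Bt Qq; have [As <-] := hBA Bt; rewrite -ThE //.
have Tz := tens_in As Qq.
suff /(_ _ Tz)[] : els (A *T Q0) `<=` [set z | (A *T Q0) z /\ Y (tmor T Phi (idm Q0) z)] by [].
apply: (podles_ind_r (co_cont hXR)) => [|c a Ac Qa]; first exact: (csub_shom aAQ sTh cY).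
split; first exact: (podles_r (co_cont hXR)).
rewrite -key //; apply: prodset_in; last by exists a.
by exists (Phi c) => //; exact: (hAB Ac).1.
Qed.
Lemma transport_equivariant C (xi : premor C (C *T Q0)) (f : premor C A) (f' : premor C B) :
 cstar C -> coaction G xi -> morphism f -> morphism f' -> (forall c, C c -> ext Phi (f c) = f' c) ->
 (forall c, C c -> ext Psi (f' c) = f c) -> equivariant xi XR f -> equivariant xi transport f'.
move=> cC hxi mf mf' e e' he c Cc.
have mf'c := mor_mult mf' Cc; have mfc := mor_mult mf Cc.
rewrite (mextE cB cBQ transport_morphism mf'c).
rewrite (ext_comp cB cAQ mXP (morph_rep cBQ mTh) mf'c) (ext_comp cB cA mPsi (morph_rep cAQ mXR) mf'c) e' //.
have := he c Cc; rewrite (mextE cA cAQ mXR mfc) => ->.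
have mxc := mor_mult (co_mor hxi) Cc.
rewrite -(tapp_ext cA cQ cB cQ mPhi mi); last exact: (tapp_mult cC cQ cA cQ mf mi mxc).
exact: tapp_comp.
Qed.
End CoactionTransport.

(** * Correspondences from a common algebra, and equivariance on generators *)

Section CommonRefinement.
Lemma ind2_subr M N N' Q (al : M ~> Q) (be : N' *t N ~> Q) : ind2 al be -> ind2 al (be \o @ampr N' N).
by move=> i2; exact: ind3_13 (ind2_split i2). Qed.
Lemma rep_inj_nonzero B M (f : sp B ~> M) : cstar B -> rep f -> finj (els B) f ->
 (exists y : sp B, y <> 0) -> exists x : M, x <> 0.
move=> cB rf ff [y ny]; apply: contrapT => no; apply: ny.
have b0 b : B b -> b = 0.
 move=> Bb; apply: ff => //; first exact: (csub0 (cstar_sub cB)).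
 exact: op_zero_eq.
apply: (nm_small_eq0 (M := 1)) => eps e0; rewrite mul1r.
have [x + hx] := cstar_dense cB y e0.
suff h : lspan (vecs (els B)) x -> x = 0 by move/h => x0; rewrite x0 subr0 in hx.
elim/lspan_ind => // k v x' [b Bb [w _ <-]] ->.
by rewrite (b0 _ Bb) op0E scaler0 addr0.
Qed.
Lemma namp_finj M Q (al : M ~> Q) : namp al ->
 ((exists x : M, x <> 0) -> exists q : Q, q <> 0) -> finj (@bop R M M) al.
move=> na h s t bs bt e; have [ex|no] := pselect (exists x : M, x <> 0); last exact: op_zero_eq.
exact: (namp_inj na (h ex)).
Qed.
(** Two pairs are related when their amplifications are faithful images of the same elements z1 and
    z2. The graph consists of all pairs of operators that come from a common element of [X]; it is
    isometric since F, F', ka and ka' are. *)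
Lemma common_corresp C1 C2 M M' Q Q' S (i1 : sp C1 ~> M) (i2 : sp C2 ~> M) (i1' : sp C1 ~> M') (i2' : sp C2 ~> M')
  (ka : M ~> Q) (ka' : M' ~> Q') (X : set (op S S)) (F : S ~> Q) (F' : S ~> Q') (z1 : sp C1 ~> S) (z2 : sp C2 ~> S) :
 rep i1 -> rep i2 -> rep i1' -> rep i2' -> namp ka -> namp ka' -> ((exists x : M, x <> 0) -> exists q : Q, q <> 0) ->
 ((exists x : M', x <> 0) -> exists q : Q', q <> 0) -> csalg X -> shom X F -> finj X F -> shom X F' -> finj X F' ->
 (forall c, C1 c -> X (z1 c)) -> (forall c, C2 c -> X (z2 c)) ->
 (forall c, C1 c -> ka (i1 c) = F (z1 c)) -> (forall c, C2 c -> ka (i2 c) = F (z2 c)) ->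
 (forall c, C1 c -> ka' (i1' c) = F' (z1 c)) -> (forall c, C2 c -> ka' (i2' c) = F' (z2 c)) ->
 exists E, corresp i1 i2 i1' i2' E.
move=> r1 r2 r1' r2' na na' nz nz' cX sF fF sF' fF' X1 X2 e1 e2 e1' e2'.
pose E := [set p : op M M * op M' M' | (bop p.1 /\ bop p.2) /\ exists z, [/\ X z, ka p.1 = F z & ka' p.2 = F' z]].
have sk := namp_shom na; have sk' := namp_shom na'.
have aM := bop_csalg M; have aM' := bop_csalg M'.
exists E; split.
- by move=> p [].
- split; first by split; exact: bop0.
 exists 0; split; first exact: (csub0 (csa_sub cX)).
  by rewrite (shom0 aM sk) (shom0 cX sF).
 by rewrite (shom0 aM' sk') (shom0 cX sF').
- move=> a p q [[bp bp'] [z [Xz ez ez']]] [[bq bq'] [y [Xy ey ey']]]; split.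
  by split; exact: bop_lincomb.
 exists (a *: z + y); split; first exact: (csub_lincomb (csa_sub cX)).
  by rewrite /= (shom_lin sk) // (shom_lin sF) // ez ey.
 by rewrite /= (shom_lin sk') // (shom_lin sF') // ez' ey'.
- move=> p q [[bp bp'] [z [Xz ez ez']]] [[bq bq'] [y [Xy ey ey']]]; split.
  by split; exact: bop_comp.
 exists (z \o y); split; first exact: (csa_comp cX).
  by rewrite -[LHS]/(ka (p.1 \o q.1)) (shom_comp sk) // (shom_comp sF) // ez ey.
 by rewrite -[LHS]/(ka' (p.2 \o q.2)) (shom_comp sk') // (shom_comp sF') // ez' ey'.
- move=> p [[bp bp'] [z [Xz ez ez']]]; split; first by split; exact: bop_adj.
 exists (adj z); split; first exact: (csa_adj cX).
  by rewrite /= (shom_adj sk) // (shom_adj sF) // ez.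
 by rewrite /= (shom_adj sk') // (shom_adj sF') // ez'.
- move=> p C [[bp bp'] [z [Xz ez ez']]] C0 hC; apply: (namp_isom na' nz' bp' C0); rewrite ez'.
 apply: (shom_contr cX sF') => //; apply: (shom_isom cX sF fF) => //; rewrite -ez.
 exact: (namp_bnd na).
- move=> p C [[bp bp'] [z [Xz ez ez']]] C0 hC; apply: (namp_isom na nz bp C0); rewrite ez.
 apply: (shom_contr cX sF) => //; apply: (shom_isom cX sF' fF') => //; rewrite -ez'.
 exact: (namp_bnd na').
- move=> c Cc; split; first by split; [exact: (rep_bop r1)|exact: (rep_bop r1')].
 by exists (z1 c); split; [exact: X1|exact: e1|exact: e1'].
- move=> c Cc; split; first by split; [exact: (rep_bop r2)|exact: (rep_bop r2')].
 by exists (z2 c); split; [exact: X2|exact: e2|exact: e2'].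
Qed.
Lemma csub_shom_eq H K (X : set (op H H)) (f g : H ~> K) : csalg X -> shom X f -> shom X g ->
 csub [set t | X t /\ f t = g t].
move=> cX sf sg; have -> : [set t | X t /\ f t = g t] = [set t | X t /\ [set 0 : op K K] (f t - g t)].
 by apply/seteqP; split=> t [Xt e]; split=> //=; [rewrite e subrr|apply: subr0_eq].
apply: (csub_pre (fun t => f t - g t) 2) => //; first exact: (csa_sub cX).
- exact: csub_zero.
- move=> a s t Xs Xt; exists a; rewrite (shom_lin sf) // (shom_lin sg) //.
 by rewrite opprD addrACA scalerBr.
- move=> s t Xs Xt; rewrite (shomB sf) // (shomB sg) // !opprB addrACA [RHS]addrACA.
 by congr (_ + _); exact: addrC.
- move=> C t C0 Xt hC; rewrite mulr_natl mulr2n; apply: bndD; first exact: (shom_contr cX sf).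
 by apply: bnd_lin; exact: (shom_contr cX sg).
Qed.
(** Both coactions are determined on products of generators by xi1 and xi2, and Phi matches the
    generators; such products span. *)
Lemma equivariant_unique (G : qgroup T) C1 C2 M (i1 : sp C1 ~> M) (i2 : sp C2 ~> M)
  B (i1' : premor C1 B) (i2' : premor C2 B) (Phi : premor (twalg i1 i2) B)
  (xi1 : premor C1 (C1 *T qA G)) (xi2 : premor C2 (C2 *T qA G))
  (XR : premor (twalg i1 i2) (twalg i1 i2 *T qA G)) (XW : premor B (B *T qA G)) :
 hq G -> cstar C1 -> cstar C2 -> cstar B -> cstar (twalg i1 i2) ->
 morphism (PreMor C1 (twalg i1 i2) i1) -> morphism (PreMor C2 (twalg i1 i2) i2) ->
 morphism i1' -> morphism i2' -> morphism Phi -> (forall t, twalg i1 i2 t -> B (Phi t)) ->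
 (forall c, C1 c -> ext Phi (i1 c) = i1' c) -> (forall c, C2 c -> ext Phi (i2 c) = i2' c) ->
 coaction G xi1 -> coaction G xi2 -> coaction G XR -> coaction G XW ->
 equivariant xi1 XR (PreMor C1 (twalg i1 i2) i1) -> equivariant xi2 XR (PreMor C2 (twalg i1 i2) i2) ->
 equivariant xi1 XW i1' -> equivariant xi2 XW i2' -> equivariant XR XW Phi.
move=> hG cC1 cC2 cB cT m1 m2 m1' m2' mP PB P1 P2 hx1 hx2 hR hW q1 q2 q1' q2' t Tt.
have cQ := hq_A hG; have mi := idm_morphism cQ.
have cTQ := tens_cs cT cQ; have cBQ := tens_cs cB cQ.
have mR := co_mor hR; have mW := co_mor hW.
have mTh := (tmorP cT cQ cB cQ mP mi).1.
have rTh := morph_rep cBQ mTh; have rR := morph_rep cTQ mR; have rW := morph_rep cBQ mW; have rP := morph_rep cB mP.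
rewrite (mext_in cB cBQ mW (PB _ Tt)) (tapp_ext cT cQ cB cQ mP mi (mor_mult mR Tt)).
have aT := cs_alg cT.
suff /(_ t Tt)[] : els (twalg i1 i2) `<=` [set t | twalg i1 i2 t /\ (XW \o Phi) t = (ext (tmor T Phi (idm (qA G))) \o XR) t] by [].
apply: twalg_ind => [|c d Cc Cd].
 apply: (csub_shom_eq aT); last exact: (rep_comp cTQ mR rTh).1.
 have sP := morph_shom mP; have sW := morph_shom mW.
 split=> [s Ts|c s s' Ts Ts'|s s' Ts Ts'|s Ts] /=.
 - exact: (shom_bop sW (PB _ Ts)).
 - by rewrite (shom_lin sP) // (shom_lin sW) //; exact: PB.
 - by rewrite -[X in XW X]/(Phi (s \o s')) (shom_comp sP) // (shom_comp sW) //; exact: PB.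
 - by rewrite (shom_adj sP) // (shom_adj sW) //; exact: PB.
have Tcd : twalg i1 i2 (i1 c \o i2 d) by exact: twalg_in.
split=> //.
have mc := mor_mult m1 Cc; have md := mor_mult m2 Cd.
have mc' := mor_mult m1' Cc; have md' := mor_mult m2' Cd.
rewrite -[LHS]/(XW (Phi (i1 c \o i2 d))) -[RHS]/(ext _ (XR (i1 c \o i2 d))).
have eP : Phi (i1 c \o i2 d) = i1' c \o i2' d.
 by rewrite -(ext_in rP Tcd) (shom_comp (ext_shom cT rP) mc md) P1 // P2.
have Bcd : B (i1' c \o i2' d) by rewrite -eP; exact: PB.
rewrite eP -(ext_in rW Bcd) (shom_comp (ext_shom cB rW) mc' md').
rewrite -(ext_in rR Tcd) (shom_comp (ext_shom cT rR) mc md).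
rewrite -(mextE cB cBQ mW mc') -(mextE cB cBQ mW md') (q1' _ Cc) (q2' _ Cd).
rewrite -(mextE cT cTQ mR mc) -(mextE cT cTQ mR md) (q1 _ Cc) (q2 _ Cd).
have mx1 := mor_mult (co_mor hx1) Cc; have mx2 := mor_mult (co_mor hx2) Cd.
have mt1 := tapp_mult cC1 cQ cT cQ m1 mi mx1; have mt2 := tapp_mult cC2 cQ cT cQ m2 mi mx2.
rewrite (shom_comp (ext_shom cTQ rTh) mt1 mt2).
rewrite -(tapp_ext cT cQ cB cQ mP mi mt1) -(tapp_ext cT cQ cB cQ mP mi mt2).
by rewrite (tapp_comp hG cT cB mP cC1 m1 m1' P1 mx1) (tapp_comp hG cT cB mP cC2 m2 m2' P2 mx2).
Qed.
End CommonRefinement.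
(** The coaction legs of the stabilised pair, taken along rho and [thL'], commute by
    [stab_legs_comm], so slicing applies. On a zero space there is nothing to slice, and that case
    is separate. *)
Lemma stab_exchange (G : qgroup T) (d : double_data G)
  (hG : hq G) (hd : is_double d) (C1 C2 : opalg R) (cC1 : cstar C1) (cC2 : cstar C2)
  (xi1 : premor C1 (tens T C1 (tens T (qA G) (qAd G)))) (xi2 : premor C2 (tens T C2 (tens T (qA G) (qAd G))))
  (g1 : premor C1 (tens T C1 (qA G))) (e1 : premor C1 (tens T C1 (qAd G)))
  (g2 : premor C2 (tens T C2 (qA G))) (e2 : premor C2 (tens T C2 (qAd G)))
  (hxi1 : coaction (codouble d) xi1) (hyd1 : yetter_drinfeld (G := G) g1 e1)
  (hxi2 : coaction (codouble d) xi2) (hyd2 : yetter_drinfeld (G := G) g2 e2)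
  (hxiE1 : forall c, C1 c -> xi1 c = yd_composite g1 e1 c) (hxiE2 : forall c, C2 c -> xi2 c = yd_composite g2 e2 c)
  (K1 K2 : hilbert R) (phi1 : sp C1 ~> K1) (phi2 : sp C2 ~> K2) (r1 : rep phi1) (r2 : rep phi2) :
 [/\ rep (@stab1 G d C1 xi1 K1 K2 phi1), rep (@stab2 G d C2 xi2 K1 K2 phi2) & forall c1 c2, C1 c1 -> C2 c2 ->
 twalg (@stab1 G d C1 xi1 K1 K2 phi1) (@stab2 G d C2 xi2 K1 K2 phi2)
  (@stab2 G d C2 xi2 K1 K2 phi2 c2 \o @stab1 G d C1 xi1 K1 K2 phi1 c1)].
have cA := hq_A hG; have cAh := hq_Ad hG.
have rs1 := rep_stab hd cC1 hxi1 r1; have rs2 := rep_stab hd cC2 hxi2 r2.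
have R1 : rep (@stab1 G d C1 xi1 K1 K2 phi1) := rep_namp (namp_l _ _) rs1.
have R2 : rep (@stab2 G d C2 xi2 K1 K2 phi2).
 exact: (rep_namp (namp_Ad (un_stabZ hG hd K1 K2)) (rep_namp (namp_r _ _) rs2)).
split=> // c1 c2 Cc1 Cc2.
have [nz|no] := pselect (exists z : dL d, z <> 0); last first.
 rewrite (@op_zero_eq _ _ (_ \o _) 0); first exact: (csub0 (csub_cspan _)).
 by move=> [y ny]; apply: no; have [x0 _] := ht_nonzero_l (ex_intro _ y ny); have [] := ht_nonzero_l x0.
apply: (podles_exchange cC1 cC2 cA cAh (co_mor (yd_g hyd1)) (co_mor (yd_e hyd2))
 (co_cont (yd_g hyd1)) (co_cont (yd_e hyd2)) R1 R2 (rep_rhL hd) (rep_thL' hG hd) _ nz Cc1 Cc2) => c c' Cc Cc'.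
exact: (stab_legs_comm hG hd cC1 cC2 hxi1 hyd1 hxi2 hyd2 hxiE1 hxiE2 r1 r2 Cc Cc').
Qed.
Lemma twZ_un (G G' : qgroup T) (u : udual G) (u' : udual G')
  (C D : opalg R) (y : covrep u C) (z : covrep u' D) (X : op (sp (tens T (uA u) (uA u'))) (sp (tens T (uA u) (uA u')))) :
 cstar (uA u) -> cstar (uA u') -> morphism (crho y) -> morphism (crho z) -> umult (tens T (uA u) (uA u')) X ->
 @twZ R T G G' u u' X C D y z = adj (@lg (uA u) (uA u') _ (@ampl (cK z) (cK y) \o crho y)
  (@ampr (cK y) (cK z) \o crho z) X) /\ unitary (@twZ R T G G' u u' X C D y z).
move=> c1 c2 m1 m2 [mX uX].
have e : tapp (crho y) (crho z) X = @lg (uA u) (uA u') _ (@ampl (cK z) (cK y) \o crho y)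
  (@ampr (cK y) (cK z) \o crho z) X.
 exact: (tapp_lg c1 c2 (Kop_cstar _) (Kop_cstar _) m1 m2 mX).
rewrite /twZ e; split=> //; apply: un_adj.
exact: (lg_un c1 c2 (jn_local c1 c2 (morphism_Kop m1) (morphism_Kop m2)) mX uX).
Qed.
End Tensors.

Theorem theorem5p4 (R : realType) (T : hilbert_tensor R)
  (G : qgroup T) (hG : is_qgroup G)
  (d : double_data G) (hd : is_double d)
  (uG : udual G) (huG : is_udual uG)
  (uG' : udual (dual G)) (huG' : is_udual uG')
  (uD : udual (codouble d)) (huD : is_udual uD)
  (Ru : op (sp (tens T (uA uD) (uA uD))) (sp (tens T (uA uD) (uA uD))))
  (hRu : universal_lift (u := uD) (u' := uD) (Rmatrix d) Ru)
  (Wu : op (sp (tens T (uA uG) (uA uG'))) (sp (tens T (uA uG) (uA uG'))))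
  (hWu : universal_lift (u := uG) (u' := uG') (qW G) Wu)
  (C1 C2 : opalg R) (hC1 : is_cstar C1) (hC2 : is_cstar C2)
  (xi1 : premor C1 (tens T C1 (qA (codouble d))))
  (hxi1 : coaction (codouble d) xi1)
  (xi2 : premor C2 (tens T C2 (qA (codouble d))))
  (hxi2 : coaction (codouble d) xi2)
  (g1 : premor C1 (tens T C1 (qA G))) (e1 : premor C1 (tens T C1 (qA (dual G))))
  (hyd1 : yd_of_coaction d xi1 g1 e1)
  (g2 : premor C2 (tens T C2 (qA G))) (e2 : premor C2 (tens T C2 (qA (dual G))))
  (hyd2 : yd_of_coaction d xi2 g2 e2)
  (x1 : covrep uD C1) (hx1 : is_faithful_covrep xi1 x1)
  (x2 : covrep uD C2) (hx2 : is_faithful_covrep xi2 x2)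
  (y1 : covrep uG C1) (hy1 : is_faithful_covrep g1 y1)
  (y2 : covrep uG' C2) (hy2 : is_faithful_covrep e2 y2) :
  exists Phi : premor (twisted Ru x1 x2) (twisted Wu y1 y2),
    [/\ isomorphism Phi,
        (forall c, C1 c -> mext Phi (iota1 Ru x1 x2 c) = iota1 Wu y1 y2 c),
        (forall c, C2 c -> mext Phi (iota2 Ru x1 x2 c) = iota2 Wu y1 y2 c) &
        forall XR : premor (twisted Ru x1 x2)
                           (tens T (twisted Ru x1 x2) (qA (codouble d))),
          coaction (codouble d) XR ->
          equivariant xi1 XR (iota1 Ru x1 x2) ->
          equivariant xi2 XR (iota2 Ru x1 x2) ->
          (exists XW : premor (twisted Wu y1 y2)
                              (tens T (twisted Wu y1 y2) (qA (codouble d))),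
             [/\ coaction (codouble d) XW,
                 equivariant xi1 XW (iota1 Wu y1 y2) &
                 equivariant xi2 XW (iota2 Wu y1 y2)]) /\
          (forall XW : premor (twisted Wu y1 y2)
                              (tens T (twisted Wu y1 y2) (qA (codouble d))),
             coaction (codouble d) XW ->
             equivariant xi1 XW (iota1 Wu y1 y2) ->
             equivariant xi2 XW (iota2 Wu y1 y2) ->
             equivariant XR XW Phi)].
Proof.
have hQ := is_qgroup_hq hG; have hQd := hq_dual hQ; have hQC := is_qgroup_hq (db_qgroup hd).
have hU := is_udual_hu hQ huG; have hU' := is_udual_hu hQd huG'; have hUD := is_udual_hu hQC huD.
have [yd1 xiE1] := hyd1; have [yd2 xiE2] := hyd2.
have cx1 := faithful_covp hQC hUD hC1 hxi1 hx1; have cx2 := faithful_covp hQC hUD hC2 hxi2 hx2.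
have cy1 := faithful_covp hQ hU hC1 (yd_g yd1) hy1.
have cy2 := faithful_covp (G := dual G) hQd hU' hC2 (yd_e yd2) hy2.
have [rx1 rsx1 _] := cx1; have [rx2 rsx2 _] := cx2; have [ry1 rsy1 _] := cy1; have [ry2 rsy2 _] := cy2.
have [rst1 rst2 exst] := stab_exchange hQ hd hC1 hC2 hxi1 yd1 hxi2 yd2 xiE1 xiE2 rx1 rx2.
have [kR nR [kR1 kR2]] := rside_transport hQ hd hUD hRu cx1 cx2.
have cs1 := stab_covp hQ hd hC1 hxi1 yd1 xiE1 rx1 hU.
have cs2 := stab_covp_dual hQ hd hC2 hxi2 yd2 xiE2 rx2 hU'.
have mg1 := co_mor (yd_g yd1); have me2 := co_mor (yd_e yd2).
(* The stabilised representations are covariant for [G] and for its dual separately. They enter the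
   leg description on the same footing as y1 and y2, and this connects the two sides. *)
have [kS nS [kS1 kS2]] := wside_transport hQ hU hU' hWu hC1 hC2 mg1 me2 cs1 cs2.
have [kW nW [kW1 kW2]] := wside_transport hQ hU hU' hWu hC1 hC2 mg1 me2 cy1 cy2.
have cA := hq_A hQ; have cAh := hq_Ad hQ; have cAA := hq_A hQC.
have [eZR uZR] := twZ_un (hu_A hUD) (hu_A hUD) (cr_rho hx1) (cr_rho hx2) (let: conj (And3 m _ _) _ := hRu in m).
have [eZW uZW] := twZ_un (hu_A hU) (hu_A hU') (cr_rho hy1) (cr_rho hy2) (let: conj (And3 m _ _) _ := hWu in m).
have rR1 : rep (iota1 Ru x1 x2) := rep_namp (namp_l T _ _) rx1.
have rR2 : rep (iota2 Ru x1 x2) := rep_namp (namp_Ad uZR) (rep_namp (namp_r T _ _) rx2).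
have rW1 : rep (iota1 Wu y1 y2) := rep_namp (namp_l T _ _) ry1.
have rW2 : rep (iota2 Wu y1 y2) := rep_namp (namp_Ad uZW) (rep_namp (namp_r T _ _) ry2).
(* Nonzero targets are needed for injectivity of the amplifications. If C1 acts on a nonzero space,
   its faithful coactions force the quantum group algebras, and with them their regular
   representations, to live on nonzero spaces. *)
have nzC (B : opalg R) (cB : cstar B) (x : premor C1 (tens T C1 B)) M (f : sp C1 ~> M) :
  morphism x -> faithful x -> rep f -> (exists v : M, v <> 0) -> exists v : sp B, v <> 0.
 move=> mx fx rf /(rep_nonzero hC1 rf) nz; have cT := tens_cs T hC1 cB.
 have nzT := rep_inj_nonzero hC1 (morph_rep cT mx) fx nz.
 by have [] := ht_nonzero_l nzT.
have nzL : (exists v : cK x1, v <> 0) -> exists v : dL d, v <> 0.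
 move/(nzC _ cAA _ _ _ (co_mor hxi1) (co_inj hxi1) rx1).
 exact: (rep_inj_nonzero cAA (morphism_Kop (hq_pi hQC)) (hq_pif hQC)).
have nzL0 M (f : sp C1 ~> M) : rep f -> (exists v : M, v <> 0) -> exists v : qL G, v <> 0.
 move=> rf /(nzC _ cA _ _ _ mg1 (co_inj (yd_g yd1)) rf).
 exact: (rep_inj_nonzero cA (morphism_Kop (hq_pi hQ)) (hq_pif hQ)).
have nzR : (exists v : ht T (cK x1) (cK x2), v <> 0) ->
  exists v : ht T (ht T (cK x1) (dL d)) (ht T (cK x2) (dL d)), v <> 0.
 move=> /ht_nonzero_l[nz1 nz2]; have nz := nzL nz1.
 by apply: ht_nonzero; exact: ht_nonzero.
have nzS : (exists v : ht T (cK x1) (cK x2), v <> 0) ->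
  exists v : ht T (ht T (cK x1) (dL d)) (ht T (qL G) (ht T (cK x2) (dL d))), v <> 0.
 move=> /ht_nonzero_l[nz1 nz2]; have nz := nzL nz1; have nz0 := nzL0 _ _ rx1 nz1.
 by apply: ht_nonzero; [exact: ht_nonzero|apply: ht_nonzero => //; exact: ht_nonzero].
have nzW : (exists v : ht T (cK y1) (cK y2), v <> 0) -> exists v : ht T (cK y1) (ht T (qL G) (cK y2)), v <> 0.
 move=> /ht_nonzero_l[nz1 nz2]; have nz0 := nzL0 _ _ ry1 nz1.
 by apply: ht_nonzero => //; exact: ht_nonzero.
have eR2 c : C2 c -> kR (iota2 Ru x1 x2 c) = @stab2 R T G d C2 xi2 (cK x1) (cK x2) (cphi x2) c.
 by move=> Cc; rewrite -(kR2 _ Cc) -eZR.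
(* The exchange relation is known for the stabilised pair. This correspondence, with the common
   algebra taken to be all bounded operators, carries it back to the original R-matrix product. *)
have [E1 hE1] : exists E, corresp (@stab1 R T G d C1 xi1 (cK x1) (cK x2) (cphi x1))
  (@stab2 R T G d C2 xi2 (cK x1) (cK x2) (cphi x2)) (iota1 Ru x1 x2) (iota2 Ru x1 x2) E.
 apply: (@common_corresp R C1 C2 _ _ _ _ _ _ _ _ _ idfun idfun (@bop R _ _) kR idfun
  (iota1 Ru x1 x2) (iota2 Ru x1 x2)) => //.
 - exact: namp_idf.
 - exact: namp_idf.
 - exact: bop_csalg.
 - exact: namp_shom.
 - exact: namp_finj.
 - by move=> c; exact: (rep_bop rR1).
 - by move=> c; exact: (rep_bop rR2).
 - by move=> c Cc; rewrite -(kR1 _ Cc).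
 - by move=> c Cc; rewrite eR2.
have exR := corresp_exchange hE1 exst.
have hLA := legalg_cstar G hC1 hC2.
have ry1f := cr_inj hy1; have ry2f := cr_inj hy2.
have sf1 := stab_inj hd hC1 hxi1 rx1 (cr_inj hx1); have sf2 := stab_inj hd hC2 hxi2 rx2 (cr_inj hx2).
have rs1 := rep_stab hd hC1 hxi1 rx1; have rs2 := rep_stab hd hC2 hxi2 rx2.
(* On the stabilised representations the universal duals act through the reduced ones, so [Wu]
   evaluates to W in theta and rho and its twist is [stabZ]. *)
have eS2 c : C2 c -> kS (@stab2 R T G d C2 xi2 (cK x1) (cK x2) (cphi x2) c) =
  @leg_rep R T G C1 C2 _ _ (@stab R T G d C1 xi1 _ (cphi x1)) (@stab R T G d C2 xi2 _ (cphi x2)) (@leg2 R T G C1 C2 e2 c).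
 move=> Cc; rewrite -(kS2 _ Cc) /stab2 /stabZ; congr (kS (Ad (adj _) _)).
 have i2 : ind2 T (@ampl R T (ht T (cK x2) (dL d)) (ht T (cK x1) (dL d)) \o @ampr R T (cK x1) (dL d))
   (@ampr R T (ht T (cK x1) (dL d)) (ht T (cK x2) (dL d)) \o @ampr R T (cK x2) (dL d)).
  exact: (ind2_sym (ind2_subr (ind2_sym (ind2_subr (ind2_amp T _ _))))).
 exact: (esym (lg_Wu_Lambda hQ hU hU' hWu i2 (rep_thL hd) (rep_rhL hd))).
pose fS := @leg_rep R T G C1 C2 _ _ (@stab R T G d C1 xi1 _ (cphi x1)) (@stab R T G d C2 xi2 _ (cphi x2)).
pose fW := @leg_rep R T G C1 C2 _ _ (cphi y1) (cphi y2).
have sS : shom (mult (legalg G C1 C2)) fS by exact: leg_rep_shom.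
have sW : shom (mult (legalg G C1 C2)) fW by exact: leg_rep_shom.
have iS : finj (mult (legalg G C1 C2)) fS by exact: (leg_rep_inj hC1 hC2 rs1 rs2 sf1 sf2).
have iW : finj (mult (legalg G C1 C2)) fW by exact: (leg_rep_inj hC1 hC2 ry1 ry2 ry1f ry2f).
have eS1 c : C1 c -> (kS \o kR) (iota1 Ru x1 x2 c) = fS (@leg1 R T G C1 C2 g1 c).
 by move=> Cc; rewrite -[RHS](kS1 _ Cc) /=; congr kS; exact: (kR1 _ Cc).
have eS3 c : C2 c -> (kS \o kR) (iota2 Ru x1 x2 c) = fS (@leg2 R T G C1 C2 e2 c).
 by move=> Cc; rewrite -[LHS]/(kS (kR (iota2 Ru x1 x2 c))) eR2 // eS2.
have eW1 c : C1 c -> kW (iota1 Wu y1 y2 c) = fW (@leg1 R T G C1 C2 g1 c).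
 by move=> Cc; rewrite -[RHS](kW1 _ Cc).
have eW2 c : C2 c -> kW (iota2 Wu y1 y2 c) = fW (@leg2 R T G C1 C2 e2 c).
 by move=> Cc; rewrite -[RHS](kW2 _ Cc) -eZW.
have ml1 c : C1 c -> mult (legalg G C1 C2) (@leg1 R T G C1 C2 g1 c) by move=> Cc; exact: mult_leg1.
have ml2 c : C2 c -> mult (legalg G C1 C2) (@leg2 R T G C1 C2 e2 c) by move=> Cc; exact: mult_leg2.
(* Both products are faithful images of the same multipliers [leg1] and [leg2]: the R-matrix product
   through stabilisation, the other directly. *)
have [E hE] := common_corresp rR1 rR2 rW1 rW2 (namp_trans nR nS) nW nzS nzW
 (mult_csalg hLA) sS iS sW iW ml1 ml2 eS1 eS3 eW1 eW2.
have exW := corresp_exchange hE exR.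
have [Phi [Psi [[iP P1 P2] [mPsi S1 S2] [hAB hBA]]]] := corresp_iso hC1 hC2 rR1 rR2 rW1 rW2 exR hE.
have cR := twalg_cstar hC1 hC2 rR1 rR2 exR; have cW := twalg_cstar hC1 hC2 rW1 rW2 exW.
have mR1 := twalg_morphism1 hC1 hC2 rR1 rR2 exR; have mR2 := twalg_morphism2 hC1 hC2 rR1 rR2 exR.
have mW1 := twalg_morphism1 hC1 hC2 rW1 rW2 exW; have mW2 := twalg_morphism2 hC1 hC2 rW1 rW2 exW.
have mP : morphism Phi by case: iP.
have cRQ := tens_cs T cR cAA; have cWQ := tens_cs T cW cAA.
exists Phi; split=> // [c Cc|c Cc|XR hXR q1 q2].
- rewrite -[RHS](P1 _ Cc); exact: (mextE cR cW mP (mor_mult mR1 Cc)).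
- rewrite -[RHS](P2 _ Cc); exact: (mextE cR cW mP (mor_mult mR2 Cc)).
split=> [|XW hXW q1' q2'].
 exists (transport (G := codouble d) Phi Psi XR); split.
 - exact: (transport_coaction hQC cR cW iP mPsi hAB hBA hXR).
 - exact: (transport_equivariant hQC cR cW iP mPsi hXR hC1 hxi1 mR1 mW1 P1 S1 q1).
 - exact: (transport_equivariant hQC cR cW iP mPsi hXR hC2 hxi2 mR2 mW2 P2 S2 q2).
exact: (equivariant_unique hQC hC1 hC2 cW cR mR1 mR2 mW1 mW2 mP (fun t Tt => (hAB t Tt).1) P1 P2
 hxi1 hxi2 hXR hXW q1 q2 q1' q2').
Qed.
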